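(* Let $(X,L_0,\dots,L_k)$ be a polarized toric manifold of complex dimension $n$, where the curvature of the toric equivariant line bundle $L_i$ is a positive form $\omega_i$, and let $0\le p_i\le n-1$ for $i=1,\dots,k$. Then the $(S^1)^n$-invariant solution $(\omega_{0,\varphi_0},\dots,\omega_{k,\varphi_k})$ of the system $$\begin{cases}\displaystyle\sum_{i=1}^k\frac{\omega_{i,\varphi_i}^{p_i+1}}{(p_i+1)!}\wedge\frac{\omega_{0,\varphi_0}^{n-p_i-1}}{(n-p_i-1)!}-\mathrm{Ric}(\omega_{0,\varphi_0})\wedge\frac{\omega_{0,\varphi_0}^{n-1}}{(n-1)!}-c_0\frac{\omega_{0,\varphi_0}^n}{n!}=0,\\[2mm]\displaystyle\frac{\omega_{0,\varphi_0}^{n-p_j}}{(n-p_j)!}\wedge\frac{\omega_{j,\varphi_j}^{p_j}}{p_j!}-c_j\frac{\omega_{j,\varphi_j}^n}{n!}=0,\qquad j=1,\dots,k,\end{cases}$$ is unique, if it exists.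
   Context: Here $\omega_{i,\varphi_i}$ denotes a Kähler form in the class $[\omega_i]$, i.e. of the form $\omega_i+\sqrt{-1}\partial\bar\partial\varphi_i>0$ with $\varphi_i\in C^\infty(X,\mathbb R)$; an invariant solution is one in which all the $\varphi_i$ are invariant under the compact torus $(S^1)^n$ acting on $X$. $\mathrm{Ric}$ denotes the Ricci form, and $c_0,\dots,c_k$ are the cohomological constants making each left-hand side integrate to zero.
   Formalization: Uniqueness is proved up to pulling back all the forms by one common element of the complex torus (C^* )^n; literal uniqueness fails, e.g. on P^n with all L_i = O(1), where pullbacks of the Fubini–Study solution by real torus elements are different invariant solutions. *)

(* Defs.v *)
From HB Require Import structures.
From mathcomp Require Import all_boot all_order all_algebra all_fingroup.
From mathcomp Require Import complex.
From mathcomp Require Import all_classical all_reals all_analysis.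
Set Implicit Arguments.
Unset Strict Implicit.
Unset Printing Implicit Defensive.
Import Order.TTheory GRing.Theory Num.Theory.
Import numFieldNormedType.Exports.
Local Open Scope classical_set_scope.
Local Open Scope complex_scope.
Local Open Scope ring_scope.

(** ** Calculus on C^n
    A point z = x + iy of C^n is stored as the real row vector (x, y) of length
    n + n, so that the real derivatives and the topology are those of
    ['rV[R]_(n + n)]. *)

Definition cpt (R : realType) (n : nat) : Type := 'rV[R]_(n + n).

Definition zc (R : realType) (n : nat) (z : cpt R n) (j : 'I_n) : R[i] :=
  z 0 (lshift n j) +i* z 0 (rshift n j).

Definition of_zc (R : realType) (n : nat) (w : 'I_n -> R[i]) : cpt R n :=
  row_mx (\row_j complex.Re (w j)) (\row_j complex.Im (w j)).

Definition partial (R : realType) (N : nat) (j : 'I_N) (f : 'rV[R]_N -> R)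
    (z : 'rV[R]_N) : R := 'D_(delta_mx 0 j) f z.

Fixpoint Ck (R : realType) (N m : nat) (f : 'rV[R]_N -> R) : Prop :=
  continuous f /\
  match m with
  | 0 => True
  | m'.+1 => forall j : 'I_N,
      (forall z, derivable f z (delta_mx 0 j)) /\ Ck m' (partial j f)
  end.

Definition smooth (R : realType) (n : nat) (f : cpt R n -> R) : Prop :=
  forall m, Ck m (f : 'rV[R]_(n + n) -> R).

(** A (1,1)-form [i sum_(j,k) a_jk dz_j /\ dzbar_k] at a point is stored as its
    matrix of coefficients a.  [ddbar f] is the form [i d dbar f], with matrix
    d^2 f / dz_j dzbar_k, where
    4 d^2 / dz_j dzbar_k = (d/dx_j - i d/dy_j) (d/dx_k + i d/dy_k). *)
Definition ddbar (R : realType) (n : nat) (f : cpt R n -> R) (z : cpt R n) :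
    'M[R[i]]_n :=
  let dx j := @partial R (n + n) (lshift n j) in
  let dy j := @partial R (n + n) (rshift n j) in
  \matrix_(j, k)
    (((dx j (dx k f) z + dy j (dy k f) z) / 4)
       +i* ((dx j (dy k f) z - dy j (dx k f) z) / 4)).

Definition positive_form (R : realType) (n : nat) (a : 'M[R[i]]_n) : Prop :=
  forall v : 'rV[R[i]]_n, v != 0 ->
    0 < (v *m a *m (map_mx (@conjc R) v)^T) 0 0.

(** The wedge product a_1 /\ ... /\ a_n of the n (1,1)-forms listed in [s], as
    the coefficient of the volume form (i dz_1 /\ dzbar_1) /\ ... /\
    (i dz_n /\ dzbar_n): reordering dz_(u 1) /\ dzbar_(v 1) /\ ... /\
    dz_(u n) /\ dzbar_(v n) costs the sign of u times the sign of v.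
    In particular a /\ ... /\ a has coefficient n! det a. *)
Definition top_wedge (R : realType) (n : nat) (s : seq 'M[R[i]]_n) : R[i] :=
  \sum_(u : 'S_n) \sum_(v : 'S_n)
     (-1) ^+ u * (-1) ^+ v * \prod_(i < n) (nth 0 s i) (u i) (v i).

(** The Ricci form - i d dbar log det (g_jk) of the form with potential f. *)
Definition ricci (R : realType) (n : nat) (f : cpt R n -> R) (z : cpt R n) :
    'M[R[i]]_n :=
  - ddbar (fun y => ln (complex.Re (\det (ddbar f y)))) z.

(** ** Toric manifolds
    A compact toric manifold X of complex dimension n is given by its fan, a
    smooth complete fan in N_R = R^n with lattice N = Z^n.  The maximal cones
    are indexed by [chart]; the rows of [gens s] are the primitive generators
    of the cone s and form a basis of Z^n. *)

Definition cone (R : realType) (n : nat) (B : 'M[int]_n) (v : 'rV[R]_n) : Prop :=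
  exists a : 'rV[R]_n, (forall i, 0 <= a 0 i) /\ v = a *m map_mx intr B.

Definition is_ray (n : nat) (B : 'M[int]_n) (u : 'rV[int]_n) : Prop :=
  exists j, u = row j B.

Record toric_manifold (R : realType) (n : nat) := ToricManifold {
  chart : finType;
  gens : chart -> 'M[int]_n;
  gens_basis : forall s, gens s \in unitmx;
  (* two cones meet along the common face spanned by their common rays *)
  cones_meet : forall s t (v : 'rV[R]_n), cone (gens s) v -> cone (gens t) v ->
    exists a : 'rV[R]_n,
      [/\ forall i, 0 <= a 0 i,
          forall i, a 0 i != 0 -> is_ray (gens t) (row i (gens s))
        & v = a *m map_mx intr (gens s)];
  cones_cover : forall v : 'rV[R]_n, exists s, cone (gens s) v
}.

(** Each maximal cone s gives a chart C^n of X, whose coordinates z_j are the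
    characters of the torus dual to the basis [gens s], that is, the columns of
    [(gens s)^-1].  So the character with exponent m : 'rV[int]_n is, in this
    chart, the Laurent monomial below. *)
Definition character (R : realType) (n : nat) (X : toric_manifold R n)
    (m : 'rV[int]_n) (s : chart X) (z : cpt R n) : R[i] :=
  \prod_(i < n) zc z i ^ ((gens s *m m^T) i 0).

(** The part of the chart s that lies in the chart t, and the coordinate change
    on it.  The coordinates that may vanish there correspond to the common rays,
    and only occur with nonnegative exponents. *)
Definition overlap (R : realType) (n : nat) (X : toric_manifold R n)
    (s t : chart X) (z : cpt R n) : Prop :=
  forall i, ~ is_ray (gens t) (row i (gens s)) -> zc z i != 0.

Definition transition (R : realType) (n : nat) (X : toric_manifold R n)
    (s t : chart X) (z : cpt R n) : cpt R n :=
  of_zc (fun j => character (col j (invmx (gens t)))^T s z).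

(** C^infty(X, R): smooth functions in the charts that agree on overlaps. *)
Record smooth_fun (R : realType) (n : nat) (X : toric_manifold R n) := SmoothFun {
  sf_val :> chart X -> cpt R n -> R;
  sf_smooth : forall s, smooth (sf_val s);
  sf_glue : forall s t z, overlap s t z -> sf_val t (transition s t z) = sf_val s z
}.

(** ** The torus (C^* )^n and its action on X *)

Record torus (R : realType) (n : nat) := Torus {
  torus_val :> 'I_n -> R[i];
  torus_neq0 : forall i, torus_val i != 0
}.

Definition in_compact_torus (R : realType) (n : nat) (g : torus R n) : Prop :=
  forall i, `|g i| = 1.

(** In the chart s, g acts diagonally: z_j is multiplied by the value at g of
    the character z_j. *)
Definition torus_weight (R : realType) (n : nat) (X : toric_manifold R n)
    (g : torus R n) (s : chart X) (j : 'I_n) : R[i] :=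
  \prod_(i < n) g i ^ (invmx (gens s) i j).

Definition torus_act (R : realType) (n : nat) (X : toric_manifold R n)
    (g : torus R n) (s : chart X) (z : cpt R n) : cpt R n :=
  of_zc (fun j => torus_weight g s j * zc z j).

(** g^* a, for a (1,1)-form a on the chart s. *)
Definition torus_pullback (R : realType) (n : nat) (X : toric_manifold R n)
    (g : torus R n) (s : chart X) (a : cpt R n -> 'M[R[i]]_n) (z : cpt R n) :
    'M[R[i]]_n :=
  \matrix_(j, k) (torus_weight g s j * a (torus_act g s z) j k
                    * (torus_weight g s k)^*).

Definition torus_invariant (R : realType) (n : nat) (X : toric_manifold R n)
    (f : chart X -> cpt R n -> R) : Prop :=
  forall g : torus R n, in_compact_torus g ->
    forall s z, f s (torus_act g s z) = f s z.

(** ** Equivariant line bundles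
    Such a bundle is given by its Cartier data: on the chart s it is trivialised
    by the equivariant frame e_s = character (lb_char s), and lb_char s and
    lb_char t agree on the common face of the cones s and t. *)
Record toric_line_bundle (R : realType) (n : nat) (X : toric_manifold R n) :=
  ToricLineBundle {
    lb_char : chart X -> 'rV[int]_n;
    lb_glue : forall s t i, is_ray (gens t) (row i (gens s)) ->
      row i (gens s) *m (lb_char s)^T = row i (gens s) *m (lb_char t)^T
  }.

(** A smooth Hermitian metric, given by its local weights: the function
    |e_s|^2 is exp (- hm_weight s), and
    e_t = character (lb_char t - lb_char s) e_s on overlaps. *)
Record hermitian_metric (R : realType) (n : nat) (X : toric_manifold R n)
    (L : toric_line_bundle X) := HermitianMetric {
  hm_weight :> chart X -> cpt R n -> R;
  hm_smooth : forall s, smooth (hm_weight s);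
  hm_glue : forall s t z, overlap s t z ->
    (expR (- hm_weight t (transition s t z)))%:C =
    `|character (lb_char L t - lb_char L s) s z| ^+ 2
      * (expR (- hm_weight s z))%:C
}.

Definition curvature (R : realType) (n : nat) (X : toric_manifold R n)
    (L : toric_line_bundle X) (h : hermitian_metric L) (s : chart X) :
    cpt R n -> 'M[R[i]]_n :=
  ddbar (h s).

(** A local potential of omega_phi = omega + i d dbar phi, where omega is the
    curvature of h, and omega_phi itself. *)
Definition potential (R : realType) (n : nat) (X : toric_manifold R n)
    (L : toric_line_bundle X) (h : hermitian_metric L) (phi : smooth_fun X)
    (s : chart X) : cpt R n -> R :=
  fun z => h s z + phi s z.

Definition omega (R : realType) (n : nat) (X : toric_manifold R n)
    (L : toric_line_bundle X) (h : hermitian_metric L) (phi : smooth_fun X)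
    (s : chart X) : cpt R n -> 'M[R[i]]_n :=
  ddbar (potential h phi s).

(** The system, for the unknowns phi_0, ..., phi_k; the index i = 1, ..., k of
    a bundle is [lift ord0 i] with i : 'I_k.  No equation has solutions unless
    its constant is the cohomological one, as one sees by integrating over X. *)
Definition scal_equation (R : realType) (n k : nat) (X : toric_manifold R n)
    (L : 'I_k.+1 -> toric_line_bundle X) (h : forall i, hermitian_metric (L i))
    (p : 'I_k -> nat) (c0 : R) (phi : 'I_k.+1 -> smooth_fun X) : Prop :=
  forall (s : chart X) (z : cpt R n),
    let w i := omega (h i) (phi i) s z in
    let ric := ricci (potential (h ord0) (phi ord0) s) z in
    \sum_(i < k)
       top_wedge (nseq (p i).+1 (w (lift ord0 i))
                    ++ nseq (n - p i - 1)%N (w ord0))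
         / ((p i).+1`! * (n - p i - 1)%N`!)%:R
    - top_wedge (ric :: nseq (n - 1)%N (w ord0)) / (n - 1)%N`!%:R
    - c0%:C * (top_wedge (nseq n (w ord0)) / n`!%:R) = 0.

Definition hessian_equation (R : realType) (n k : nat) (X : toric_manifold R n)
    (L : 'I_k.+1 -> toric_line_bundle X) (h : forall i, hermitian_metric (L i))
    (p : 'I_k -> nat) (j : 'I_k) (cj : R) (phi : 'I_k.+1 -> smooth_fun X) : Prop :=
  forall (s : chart X) (z : cpt R n),
    let w i := omega (h i) (phi i) s z in
    top_wedge (nseq (n - p j)%N (w ord0) ++ nseq (p j) (w (lift ord0 j)))
      / ((n - p j)%N`! * (p j)`!)%:R
    - cj%:C * (top_wedge (nseq n (w (lift ord0 j))) / n`!%:R) = 0.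

Record invariant_solution (R : realType) (n k : nat) (X : toric_manifold R n)
    (L : 'I_k.+1 -> toric_line_bundle X) (h : forall i, hermitian_metric (L i))
    (p : 'I_k -> nat) (c : 'I_k.+1 -> R) (phi : 'I_k.+1 -> smooth_fun X) : Prop := {
  sol_kahler : forall i s z, positive_form (omega (h i) (phi i) s z);
  sol_invariant : forall i, torus_invariant (phi i);
  sol_scal : scal_equation h p (c ord0) phi;
  sol_hessian : forall j, hessian_equation h p j (c (lift ord0 j)) phi
}.

(** Uniqueness is modulo the automorphisms of X in (C^* )^n, acting on all the
    forms simultaneously: they preserve the classes, the invariance and the
    system.  For instance, on P^n with all the L_i equal to O(1), taking all the
    omega_i equal to the Fubini-Study form gives an invariant solution, and so
    do its pullbacks by the real points of (C^* )^n, which are different. *)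
Definition same_solution (R : realType) (n k : nat) (X : toric_manifold R n)
    (L : 'I_k.+1 -> toric_line_bundle X) (h : forall i, hermitian_metric (L i))
    (phi psi : 'I_k.+1 -> smooth_fun X) : Prop :=
  exists g : torus R n, forall i s z,
    omega (h i) (psi i) s z = torus_pullback g s (omega (h i) (phi i) s) z.

(* Submission.v *)
From HB Require Import structures.
Require Import Defs.
From mathcomp Require Import all_boot all_order all_algebra all_fingroup.
From mathcomp Require Import complex.
From mathcomp Require Import all_classical all_reals all_analysis.
From mathcomp Require Import ring lra.
Set Implicit Arguments.
Unset Strict Implicit.
Unset Printing Implicit Defensive.
Import Order.TTheory GRing.Theory Num.Theory.
Import numFieldNormedType.Exports.
Local Open Scope classical_set_scope.
Local Open Scope ring_scope.

(** On the real points of the dense torus an invariant form with potential P becomes the Hessian of the convex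
    function u(x) = P(e^x), and the system becomes a system of Hessian equations for u_0, ..., u_k.  Given two
    solutions u_i and u'_i, join u_i to u'_i by the geodesic which interpolates linearly between the Legendre
    transforms: if grad u_i(a) = grad u'_i(b), the point (1-t)a + tb has that momentum at time t and d_i = b - a.
    Along it the velocity potential f_i and the Hessian A_i satisfy
      d_t (f det A) + div (f det A d) = 0
    and, after polarisation in A_0 + m A_j and for the entropy of det A_0, similar conservation laws with a
    nonnegative right-hand side.  The equations at t = 0 and t = 1 make the densities of a suitable combination
    of these laws vanish there.  Since the Hessians decay exponentially at infinity, the fluxes do not contribute,
    so integrating over space-time shows that the right-hand side vanishes: d_0 is constant and d_j = d_0 for all
    j, that is, u'_i(x + d) = u_i(x) up to constants, with the same d for all i.  Such a translation is the action
    of a real point of the torus.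

    Completeness of the fan gives the estimates at infinity: every x lies, in the logarithmic coordinates of some
    chart, in the negative orthant, where e^x stays in a polydisc. *)

(** * Differential calculus in coordinates *)

(** The geodesics are explicit, so no theory of degenerate equations is needed: the displacement is
    a critical point of a coercive function, and the interpolated Hessian is a weighted harmonic
    mean of two Hessians. The coupling of the forms rests on one algebraic fact: for a sum phi_0 + m
    phi_j the defect in the Monge-Ampere equation, times a determinant, is a polynomial in m with
    nonnegative coefficients, and each coefficient of degree 1, ..., n vanishes only if d_0 = d_j.
    Since 1 <= p_j + 1 <= n, the single coefficient that the system sees is enough. The Hessian of
    log det A_0 has no sign, but its contributions to the entropy and to the scalar equation cancel
    exactly. No integral is taken: the divergence theorem is an inequality between Riemann sums on
    large boxes, and it only has to give information at time 1/2. The analytic obstacle is infinity,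
    that is, the toric divisors: a uniform bound on b - a in logarithmic coordinates amounts to a
    division by the coordinate z_j, which is possible because the invariance makes the relevant
    terms vanish with z_j. *)

Section Derivatives.
Context {R : realType} {V : normedModType R}.
Implicit Types (f g : V -> R) (x v : V).

Lemma is_derive_eqfun (W : normedModType R) (f g : V -> W) x v df dg :
  f =1 g -> df = dg -> is_derive x v f df -> is_derive x v g dg.
Proof. by move=> /funext -> ->. Qed.

Lemma is_deriveDp f g x v df dg : is_derive x v f df -> is_derive x v g dg ->
  is_derive x v (fun y => f y + g y) (df + dg).
Proof. exact: is_deriveD. Qed.

Lemma is_deriveNp f x v df : is_derive x v f df ->
  is_derive x v (fun y => - f y) (- df).
Proof. exact: is_deriveN. Qed.

Lemma is_deriveBp f g x v df dg : is_derive x v f df -> is_derive x v g dg ->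
  is_derive x v (fun y => f y - g y) (df - dg).
Proof. exact: is_deriveB. Qed.

Lemma is_deriveMp f g x v df dg : is_derive x v f df -> is_derive x v g dg ->
  is_derive x v (fun y => f y * g y) (df * g x + f x * dg).
Proof.
move=> hf hg; have := is_deriveM hf hg.
by apply: is_derive_eqfun => //; rewrite /GRing.scale /= addrC mulrC.
Qed.

Lemma is_derive_suml (I : eqType) (r : seq I) (P : pred I) (F : I -> V -> R)
    (dF : I -> R) x v :
  (forall i, P i -> is_derive x v (F i) (dF i)) ->
  is_derive x v (fun y => \sum_(i <- r | P i) F i y) (\sum_(i <- r | P i) dF i).
Proof.
move=> h; elim: r => [|a r IH].
  by apply: is_derive_eqfun (is_derive_cst (0 : R) x v) => [y|]; rewrite big_nil.
case Pa: (P a).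
  apply: is_derive_eqfun (is_deriveDp (h a Pa) IH) => [y|];
  by rewrite big_cons Pa.
by apply: is_derive_eqfun IH => [y|]; rewrite big_cons Pa.
Qed.

Lemma is_derive_prodl (n : nat) (F : 'I_n -> V -> R) (dF : 'I_n -> R) x v :
  (forall i, is_derive x v (F i) (dF i)) ->
  is_derive x v (fun y => \prod_(i < n) F i y)
    (\sum_(k < n) \prod_(i < n) (if i == k then dF i else F i x)).
Proof.
elim: n F dF => [|n IH] F dF h.
  by apply: is_derive_eqfun (is_derive_cst (1 : R) x v) => [y|]; rewrite ?big_ord0.
have := is_deriveMp (h ord0) (IH _ _ (fun i => h (lift ord0 i))).
apply: is_derive_eqfun => [y|]; first by rewrite big_ord_recl.
rewrite big_ord_recl big_ord_recl eqxx; congr (_ * _ + _).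
rewrite mulr_sumr; apply: eq_bigr => k _; rewrite big_ord_recl /=.
by congr (_ * _).
Qed.

End Derivatives.

Section MatrixDerivatives.
Context {R : realType} {V : normedModType R}.

Lemma is_derive_mxP m n (M : V -> 'M[R]_(m, n)) x v dM :
  is_derive x v M dM <-> forall i j, is_derive x v (fun y => M y i j) (dM i j).
Proof.
split.
  case=> hM <- i j; split; first exact: (derivable_mxP M x v).1 hM i j.
  by rewrite derive_mx // mxE.
move=> h; have hM : derivable M x v by apply/derivable_mxP => i j; case: (h i j).
split=> //; rewrite derive_mx //; apply/matrixP => i j; rewrite mxE.
by case: (h i j).
Qed.

Lemma is_derive_mulmx m n p (A : V -> 'M[R]_(m, n)) (B : V -> 'M[R]_(n, p)) x v dA dB :
  is_derive x v A dA -> is_derive x v B dB ->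
  is_derive x v (fun y => A y *m B y) (dA *m B x + A x *m dB).
Proof.
move=> /is_derive_mxP hA /is_derive_mxP hB; apply/is_derive_mxP => i j.
have : is_derive x v (fun y => \sum_k A y i k * B y k j)
   (\sum_k (dA i k * B x k j + A x i k * dB k j)).
  by apply: is_derive_suml => k _; apply: is_deriveMp.
apply: is_derive_eqfun => [y|]; first by rewrite mxE.
by rewrite !mxE big_split.
Qed.

Lemma is_derive_trmx m n (A : V -> 'M[R]_(m, n)) x v dA :
  is_derive x v A dA -> is_derive x v (fun y => (A y)^T) dA^T.
Proof.
move=> /is_derive_mxP hA; apply/is_derive_mxP => i j.
by apply: is_derive_eqfun (hA j i) => [y|]; rewrite mxE.
Qed.

(** Jacobi's formula in adjugate form, valid at singular matrices too: the Leibniz sum is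
    differentiated one row at a time, and the determinant with row k replaced is expanded along that
    row. *)
Lemma is_derive_det_adj n (A : V -> 'M[R]_n) x v dA :
  is_derive x v A dA -> is_derive x v (fun y => \det (A y)) (\tr (\adj (A x) *m dA)).
Proof.
move=> /is_derive_mxP hA.
have h : is_derive x v (fun y => \det (A y))
   (\sum_(s : 'S_n) (-1) ^+ s * \sum_(k < n) \prod_(i < n)
        (if i == k then dA i (s i) else A x i (s i))).
  apply: is_derive_suml => s _.
  have := is_deriveMp (is_derive_cst ((-1) ^+ s : R) x v)
     (is_derive_prodl (fun i => hA i (s i))).
  by apply: is_derive_eqfun => //; rewrite mul0r add0r.
apply: is_derive_eqfun h => //.
transitivity (\sum_(k < n) \det (\matrix_(i, j) (if i == k then dA i j else A x i j))).
  rewrite /determinant exchange_big /=; apply: eq_bigr => s _.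
  rewrite -mulr_sumr; congr (_ * _); apply: eq_bigr => k _.
  by apply: eq_bigr => i _; rewrite mxE.
rewrite mxtrace_mulC /mxtrace; apply: eq_bigr => k _.
rewrite (expand_det_row _ k) mxE; apply: eq_bigr => j _.
rewrite !mxE eqxx; congr (_ * _); rewrite /cofactor; congr (_ * \det _).
by apply/matrixP => a b; rewrite !mxE eq_sym (negbTE (neq_lift _ _)).
Qed.

Lemma is_derive_det n (A : V -> 'M[R]_n) x v dA : A x \in unitmx ->
  is_derive x v A dA ->
  is_derive x v (fun y => \det (A y)) (\det (A x) * \tr (invmx (A x) *m dA)).
Proof.
move=> uA /is_derive_det_adj; apply: is_derive_eqfun => //.
rewrite /invmx uA -scalemxAl mxtraceZ mulrA divff ?mul1r //.
by move: uA; rewrite unitmxE unitfE.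
Qed.

End MatrixDerivatives.

Section MatrixLimits.
Context {R : realType} {T : Type} (F : set_system T) {FF : Filter F}.

Lemma cvg_mxP m n (M : T -> 'M[R]_(m, n)) (L : 'M[R]_(m, n)) :
  M @ F --> L <-> forall i j, (fun t => M t i j) @ F --> L i j.
Proof.
split=> [h i j|h].
  apply: (@cvg_comp _ _ _ M (fun N : 'M[R]_(m, n) => N i j) F (nbhs L)) => //.
  exact: coord_continuous.
apply/cvgrPdist_le => e e0; near=> t.
rewrite /Num.Def.normr /= mx_normrE; apply: bigmax_le; first exact: ltW.
move=> i _; rewrite !mxE; move: i; near: t; apply: filter_forall => i.
by move: (h i.1 i.2) => /cvgrPdist_le /(_ _ e0).
Unshelve. all: by end_near. Qed.

Lemma cvg_suml (I : Type) (r : seq I) (P : pred I) (G : I -> T -> R) (l : I -> R) :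
  (forall i, P i -> G i @ F --> l i) ->
  (fun t => \sum_(i <- r | P i) G i t) @ F --> \sum_(i <- r | P i) l i.
Proof.
move=> h; elim: r => [|a r IH].
  under [X in X @ _]funext do rewrite big_nil; rewrite big_nil; exact: cvg_cst.
under [X in X @ _]funext do rewrite big_cons; rewrite big_cons.
by case Pa: (P a) => //; apply: cvgD => //; apply: h.
Qed.

Lemma cvg_prodl (I : Type) (r : seq I) (P : pred I) (G : I -> T -> R) (l : I -> R) :
  (forall i, P i -> G i @ F --> l i) ->
  (fun t => \prod_(i <- r | P i) G i t) @ F --> \prod_(i <- r | P i) l i.
Proof.
move=> h; elim: r => [|a r IH].
  under [X in X @ _]funext do rewrite big_nil; rewrite big_nil; exact: cvg_cst.
under [X in X @ _]funext do rewrite big_cons; rewrite big_cons.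
by case Pa: (P a) => //; apply: cvgM => //; apply: h.
Qed.

Lemma cvg_mulmx m n p (A : T -> 'M[R]_(m, n)) (B : T -> 'M[R]_(n, p))
    (a : 'M[R]_(m, n)) (b : 'M[R]_(n, p)) :
  A @ F --> a -> B @ F --> b -> (fun t => A t *m B t) @ F --> a *m b.
Proof.
move=> /cvg_mxP hA /cvg_mxP hB; apply/cvg_mxP => i j.
under [X in X @ _]funext do rewrite mxE; rewrite mxE.
by apply: cvg_suml => k _; apply: cvgM.
Qed.

Lemma cvg_trmx m n (A : T -> 'M[R]_(m, n)) (a : 'M[R]_(m, n)) :
  A @ F --> a -> (fun t => (A t)^T) @ F --> a^T.
Proof.
move=> /cvg_mxP hA; apply/cvg_mxP => i j.
under [X in X @ _]funext do rewrite mxE; rewrite mxE; exact: hA.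
Qed.

Lemma cvg_det n (A : T -> 'M[R]_n) (a : 'M[R]_n) :
  A @ F --> a -> (fun t => \det (A t)) @ F --> \det a.
Proof.
move=> /cvg_mxP hA; apply: cvg_suml => s _; apply: cvgM; first exact: cvg_cst.
by apply: cvg_prodl => i _; exact: hA.
Qed.

Lemma cvg_adj n (A : T -> 'M[R]_n) (a : 'M[R]_n) :
  A @ F --> a -> (fun t => \adj (A t)) @ F --> \adj a.
Proof.
move=> /cvg_mxP hA; apply/cvg_mxP => i j.
under [X in X @ _]funext do rewrite mxE; rewrite mxE.
apply: cvgM; first exact: cvg_cst.
apply: cvg_det; apply/cvg_mxP => k l.
under [X in X @ _]funext do rewrite !mxE; rewrite !mxE; exact: hA.
Qed.

Lemma cvg_invmx n (A : T -> 'M[R]_n) (a : 'M[R]_n) : a \in unitmx ->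
  A @ F --> a -> (fun t => invmx (A t)) @ F --> invmx a.
Proof.
move=> ua hA.
have da : \det a != 0 by rewrite -unitfE -unitmxE.
have hd := cvg_det hA.
have : (fun t => (\det (A t))^-1 *: \adj (A t)) @ F --> (\det a)^-1 *: \adj a.
  by apply: cvgZ; [exact: cvgV|exact: cvg_adj].
rewrite [invmx a]/invmx ua; apply: cvg_trans; apply: near_eq_cvg.
have : \forall t \near F, \det (A t) != 0.
  have /cvgr_neq0 := hd; exact.
apply: filterS => t ht; rewrite /invmx unitmxE unitfE ht //.
Qed.

Lemma cvg_mxtrace n (A : T -> 'M[R]_n) (a : 'M[R]_n) :
  A @ F --> a -> (fun t => \tr (A t)) @ F --> \tr a.
Proof. by move=> /cvg_mxP hA; apply: cvg_suml => i _; exact: hA. Qed.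

End MatrixLimits.

Section InverseDerivative.
Context {R : realType} {V : normedModType R}.

Lemma derivable_line (f : V -> R) x v : derivable f x v ->
  (fun h : R => f (h *: v + x)) @ 0 --> f x.
Proof.
move=> /derivable1P/derivable1_diffP/differentiable_continuous.
by rewrite /prop_for /continuous_at scale0r add0r.
Qed.

End InverseDerivative.

Section LineMVT.
Context {R : realType} {V : normedModType R}.

Lemma is_derive_line (f : V -> R) x v (h : R) l :
  is_derive (h *: v + x) v f l -> is_derive h 1 (fun t : R => f (t *: v + x)) l.
Proof.
have E : (fun t : R => t^-1 *: (f (t *: v + (h *: v + x)) - f (h *: v + x))) =
         (fun t : R => t^-1 *: (f ((t *: 1 + h) *: v + x) - f (h *: v + x))).
  by apply/funext => t; rewrite scalerDl addrA [t *: 1]mulr1.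
by case=> d e; split; [move: d|move: e]; rewrite /derivable /derive /= E.
Qed.

(** Composition with t |-> c t treats c = 0 on the same footing, where rescaling the difference
    quotient would divide by zero. *)
Lemma is_derive_scale (f : V -> R) x v c l :
  is_derive x v f l -> is_derive x (c *: v) f (c * l).
Proof.
move=> hf; have h0 : is_derive (c * 0) 1 (fun t : R => f (t *: v + x)) l.
  by apply: is_derive_line; rewrite mulr0 scale0r add0r.
have hc : is_derive (0 : R) 1 (fun t : R => c * t) c.
  have := is_deriveMp (is_derive_cst c (0 : R) 1) (is_derive_id (0 : R) 1).
  by apply: is_derive_eqfun => //; rewrite mul0r add0r mulr1.
have [d e] := is_derive1_comp h0 hc.
have E : (fun t : R => t^-1 *: (f (t *: (c *: v) + x) - f x)) =
  (fun t : R => t^-1 *: (f ((c * (t *: 1 + 0)) *: v + x) - f ((c * 0) *: v + x))).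
  by apply/funext => t; rewrite scalerA addr0 [t *: 1]mulr1 mulr0 scale0r add0r mulrC.
split; [move: d|move: e]; rewrite /derivable /derive /= E // => ->.
by rewrite /GRing.scale /= mulrC.
Qed.

Lemma line_MVT (f : V -> R) (df : R -> R) x v :
  (forall t : R, 0 <= t <= 1 -> is_derive (t *: v + x) v f (df t)) ->
  exists2 t, 0 <= t <= 1 & f (v + x) - f x = df t.
Proof.
move=> h.
have hd (t : R) : 0 <= t <= 1 -> is_derive t 1 (fun s : R => f (s *: v + x)) (df t).
  by move=> /h; exact: is_derive_line.
have [||t] := @MVT_segment R (fun s : R => f (s *: v + x)) df 0 1 ler01.
- move=> t; rewrite in_itv /= => /andP[t0 t1]; apply: hd; rewrite !ltW //.
- apply: derivable_within_continuous => t; rewrite in_itv /= => ht.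
  by case: (hd t ht).
rewrite in_itv /= => ht; rewrite scale1r scale0r add0r subr0 mulr1 => e.
by exists t.
Qed.

End LineMVT.

Section C1.
Context {R : realType} {N : nat}.
Implicit Types (D : set 'rV[R]_N) (f g : 'rV[R]_N -> R) (x w : 'rV[R]_N).

Definition C1on D f := forall x, D x -> {for x, continuous f} /\
  forall j, derivable f x (delta_mx 0 j) /\ {for x, continuous (partial j f)}.

Lemma row_norm_le (w : 'rV[R]_N) (e : R) : 0 <= e ->
  `|w| <= e <-> forall j, `|w 0 j| <= e.
Proof.
move=> e0; rewrite /Num.Def.normr /= mx_normrE; split.
  move=> h j; apply: le_trans h; exact: (le_bigmax _ (fun ij : 'I_1 * 'I_N => `|w ij.1 ij.2|) (0, j)).
by move=> h; apply: bigmax_le => // -[i j] _ /=; rewrite ord1; exact: h.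
Qed.

Lemma coord_le_norm (w : 'rV[R]_N) j : `|w 0 j| <= `|w|.
Proof. by have := (row_norm_le w (normr_ge0 w)).1 (lexx _). Qed.

Lemma partialP f x j : derivable f x (delta_mx 0 j) ->
  is_derive x (delta_mx 0 j) f (partial j f x).
Proof. exact: derivableP. Qed.

Lemma partial_val f x j l : is_derive x (delta_mx 0 j) f l -> partial j f x = l.
Proof. by case. Qed.

(** The coordinates of w are switched on one at a time, with the mean value theorem at each step.
    The intermediate points stay within [|w|] of x because the norm is the sup norm. *)
Lemma hadamard D f x w : (forall y, `|y - x| <= `|w| -> D y) -> C1on D f ->
  exists xi : 'I_N -> 'rV[R]_N, (forall k, `|xi k - x| <= `|w|) /\
    f (w + x) - f x = \sum_k w 0 k * partial k f (xi k).
Proof.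
move=> wD fD.
pose T (k : nat) : 'rV[R]_N := \row_j (if (j < k)%N then w 0 j else 0).
have TS (k : 'I_N) : T k.+1 = w 0 k *: delta_mx 0 k + T k.
  apply/rowP => j; rewrite !mxE eqxx /= ltnS leq_eqVlt val_eqE.
  by have [->|jk] := eqVneq j k; rewrite ?ltnn ?mulr1 ?addr0 // mulr0 add0r.
have st (k : 'I_N) : exists xi, `|xi - x| <= `|w| /\
    f (T k.+1 + x) - f (T k + x) = w 0 k * partial k f xi.
  have B (t : R) : 0 <= t <= 1 ->
     `|t *: (w 0 k *: delta_mx 0 k) + (T k + x) - x| <= `|w|.
    move=> /andP[t0 t1]; rewrite addrA addrK; apply/row_norm_le => // j.
    rewrite !mxE eqxx /=.
    have [->|jk] := eqVneq j k.
      rewrite ltnn addr0 mulr1 normrM (ger0_norm t0).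
      by apply: le_trans (coord_le_norm w k); rewrite ler_piMl.
    rewrite !mulr0 add0r; case: ifP => _; [exact: coord_le_norm|by rewrite normr0].
  have [|t ht e] := @line_MVT R _ f (fun t => w 0 k * partial k f (t *: (w 0 k *: delta_mx 0 k) + (T k + x)))
     (T k + x) (w 0 k *: delta_mx 0 k).
    move=> t ht; apply: is_derive_scale; apply: partialP.
    by have [_ /(_ k)[]] := fD _ (wD _ (B t ht)).
  exists (t *: (w 0 k *: delta_mx 0 k) + (T k + x)); split; first exact: B.
  by rewrite -e addrA TS.
have [xi hxi] := choice st; exists xi; split; first by move=> k; case: (hxi k).
rewrite (eq_bigr (fun k : 'I_N => f (T k.+1 + x) - f (T k + x))); last first.
  by move=> k _; case: (hxi k) => _ ->.
have -> : w = T N by apply/rowP => j; rewrite !mxE ltn_ord.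
have T0 : T 0 + x = x.
  by rewrite -[RHS]add0r; congr (_ + _); apply/rowP => j; rewrite !mxE.
rewrite -(big_mkord xpredT (fun k => f (T k.+1 + x) - f (T k + x))).
by rewrite (@telescope_sumr _ 0 N (fun k => f (T k + x))) // T0.
Qed.

End C1.

(** * The chain rule for C^1 functions *)

Section C1chain.
Context {R : realType} {N : nat} {V : normedModType R}.

(** Only the derivative of [phi] in the single direction v is used. [hadamard] expresses the
    increment of f by partial derivatives at points squeezed towards [phi x], and their continuity
    gives the limit. *)
Lemma C1_chain (D : set 'rV[R]_N) (f : 'rV[R]_N -> R) (phi : V -> 'rV[R]_N) x v dphi :
  open D -> C1on D f -> D (phi x) -> is_derive x v phi dphi ->
  is_derive x v (fun y => f (phi y)) (\sum_j dphi 0 j * partial j f (phi x)).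
Proof.
move=> oD fD Dx hphi.
have [e /= e0 eD] : exists2 e, 0 < e & forall y, `|y - phi x| <= e -> D y.
  have /nbhs_closedballP[M MD] : nbhs (phi x) D by exact: open_nbhs_nbhs.
  exists M%:num => // y hy; apply: MD.
  by rewrite closed_ballE // /closed_ball_ /= distrC.
pose W (h : R) := phi (h *: v + x) - phi x.
have W0 : W h @[h --> 0^'] --> (0 : 'rV[R]_N).
  have [d _] := hphi.
  have : (fun h : R => phi (h *: v + x)) @ 0 --> phi x.
    apply/cvg_mxP => i j.
    apply: (@derivable_line R V (fun y => phi y i j)).
    by have /derivable_mxP := d.
  move=> h; rewrite -(subrr (phi x)); apply: cvgB; last exact: cvg_cst.
  by apply: cvg_trans h; apply: cvg_app; exact: nbhs_dnbhs.
have /choice[xi hxi] : forall h : R, exists xi : 'I_N -> 'rV[R]_N, 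
   (forall k, `|xi k - phi x| <= `|W h|) /\ (`|W h| <= e ->
    f (phi (h *: v + x)) - f (phi x) = \sum_k W h 0 k * partial k f (xi k)).
  (* For increments that may leave D the points are given the default value [phi x]; this does not
     happen for h close to 0. *)
  move=> h; have [We|We] := leP `|W h| e; last first.
    exists (fun => phi x); split; first by move=> k; rewrite subrr normr0.
    by [].
  have [|xi [h1 h2]] := @hadamard R N D f (phi x) (W h) _ fD.
    by move=> y hy; apply: eD; apply: le_trans hy We.
  by exists xi; split=> // _; rewrite -h2 /W subrK.
have xi0 k : (fun h => xi h k) @ 0^' --> phi x.
  apply/cvgrPdist_le => r r0.
  have : \forall h \near 0^', `|W h| <= r.
    by move/cvgrPdist_le : W0 => /(_ _ r0); apply: filterS => h; rewrite sub0r normrN.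
  by apply: filterS => h hr; rewrite distrC; apply: le_trans hr; case: (hxi h).
have key : (fun h => h^-1 *: (f (phi (h *: v + x)) - f (phi x))) @ 0^' -->
    \sum_j dphi 0 j * partial j f (phi x).
  have : (fun h => \sum_k (h^-1 *: W h) 0 k * partial k f (xi h k)) @ 0^' -->
     \sum_j dphi 0 j * partial j f (phi x).
    apply: cvg_suml => k _; apply: cvgM.
      have : (fun h => h^-1 *: W h) @ 0^' --> dphi.
        by have [d <-] := hphi; exact: d.
      by move=> /cvg_mxP /(_ 0 k).
    have [_ /(_ k)[_ c]] := fD _ Dx.
    exact: (@cvg_comp _ _ _ (fun h => xi h k) (partial k f) _ _ _ (xi0 k) c).
  apply: cvg_trans; apply: near_eq_cvg.
  have : \forall h \near 0^', `|W h| <= e.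
    by move/cvgrPdist_le : W0 => /(_ _ e0); apply: filterS => h; rewrite sub0r normrN.
  apply: filterS => h he; case: (hxi h) => _ /(_ he) ->.
  rewrite scaler_sumr; apply: eq_bigr => k _; rewrite mxE /GRing.scale /=.
  by rewrite mulrA.
split; first by apply/cvg_ex; eexists; exact: key.
exact: cvg_lim key.
Qed.

End C1chain.

Local Opaque partial.

(** * Symmetry of second derivatives *)

Section Schwarz.
Context {R : realType} {N : nat}.
Implicit Types (D : set 'rV[R]_N) (f g : 'rV[R]_N -> R) (x w : 'rV[R]_N).

Lemma is_derive_shiftV (V : normedModType R) (f : V -> R) (c x v : V) l :
  is_derive (c + x) v f l -> is_derive x v (fun y => f (c + y)) l.
Proof.
have E : (fun t : R => t^-1 *: (f (t *: v + (c + x)) - f (c + x))) =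
         (fun t : R => t^-1 *: (f (c + (t *: v + x)) - f (c + x))).
  by apply/funext => t; rewrite [in RHS]addrCA.
by case=> d e; split; [move: d|move: e]; rewrite /derivable /derive /= E.
Qed.

Lemma norm_delta_le (i : 'I_N) (c : R) : `|c *: (delta_mx 0 i : 'rV[R]_N)| <= `|c|.
Proof.
apply/row_norm_le => // j; rewrite !mxE eqxx /=.
by case: (j == i); rewrite ?mulr1 ?mulr0 ?normr0.
Qed.

Lemma second_difference D f i j x (h : R) : 0 < h ->
  (forall y, `|y - x| <= 2 * h -> D y) -> C1on D f -> C1on D (partial i f) ->
  exists2 xi, `|xi - x| <= 2 * h &
  f (h *: delta_mx 0 j + (h *: delta_mx 0 i + x)) - f (h *: delta_mx 0 i + x)
   - (f (h *: delta_mx 0 j + x) - f x) = h * (h * partial j (partial i f) xi).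
Proof.
move=> h0 hD fD fiD.
have B (s t : R) : 0 <= s <= 1 -> 0 <= t <= 1 ->
    `|s *: (h *: delta_mx 0 j) + (t *: (h *: delta_mx 0 i) + x) - x| <= 2 * h.
  move=> /andP[s0 s1] /andP[t0 t1]; rewrite addrA addrK.
  apply: le_trans (ler_normD _ _) _; rewrite mulrDl mul1r lerD // scalerA.
    apply: le_trans (norm_delta_le _ _) _.
    by rewrite ger0_norm ?mulr_ge0 ?(ltW h0) // ler_piMl // ltW.
  apply: le_trans (norm_delta_le _ _) _.
  by rewrite ger0_norm ?mulr_ge0 ?(ltW h0) // ler_piMl // ltW.
have B1 (t : R) : 0 <= t <= 1 -> D (h *: delta_mx 0 j + (t *: (h *: delta_mx 0 i) + x)).
  by move=> ht; apply: hD; have := B 1 t; rewrite scale1r; apply=> //; rewrite ler01 lexx.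
have B0 (t : R) : 0 <= t <= 1 -> D (t *: (h *: delta_mx 0 i) + x).
  by move=> ht; apply: hD; have := B 0 t; rewrite scale0r add0r; apply=> //; rewrite ler01 lexx.
have [t ht e] := @line_MVT R _ (fun y => f (h *: delta_mx 0 j + y) - f y)
  (fun t => h * (partial i f (h *: delta_mx 0 j + (t *: (h *: delta_mx 0 i) + x)) -
     partial i f (t *: (h *: delta_mx 0 i) + x))) x (h *: delta_mx 0 i)
  (fun t ht => is_derive_scale h (is_deriveBp
     (is_derive_shiftV (partialP ((fD _ (B1 t ht)).2 i).1))
      (partialP ((fD _ (B0 t ht)).2 i).1))).
have [s hs e'] := @line_MVT R _ (partial i f)
  (fun s => h * partial j (partial i f) (s *: (h *: delta_mx 0 j) + (t *: (h *: delta_mx 0 i) + x)))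
  (t *: (h *: delta_mx 0 i) + x) (h *: delta_mx 0 j)
  (fun s hs => is_derive_scale h (partialP ((fiD _ (hD _ (B s t hs ht))).2 j).1)).
exists (s *: (h *: delta_mx 0 j) + (t *: (h *: delta_mx 0 i) + x)); first exact: B.
by rewrite e e'.
Qed.

(** The second difference is symmetric in i and j. By [second_difference] it equals h^2 times either
    mixed derivative at some nearby point, so the two derivatives agree at two points close to x,
    and continuity at x concludes. *)
Lemma schwarz D f i j x : open D -> D x -> C1on D f ->
  C1on D (partial i f) -> C1on D (partial j f) ->
  partial i (partial j f) x = partial j (partial i f) x.
Proof.
move=> oD Dx fD fiD fjD; apply/eqP; rewrite -subr_eq0 -normr_le0.
apply/ler_addgt0Pr => e e0; rewrite add0r.
have [_ /(_ j)[_ cij]] := fiD _ Dx; have [_ /(_ i)[_ cji]] := fjD _ Dx.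
have e2 : 0 < e / 2 by rewrite divr_gt0.
have : \forall y \near x, [/\ D y, `|partial j (partial i f) x - partial j (partial i f) y| <= e / 2
   & `|partial i (partial j f) x - partial i (partial j f) y| <= e / 2].
  have n0 : \forall y \near x, D y by exact: open_nbhs_nbhs.
  move/cvgrPdist_le : cij => /(_ _ e2) n1; move/cvgrPdist_le : cji => /(_ _ e2) n2.
  by apply: filterS3 n0 n1 n2 => y h0 h1 h2; exact: And3 h0 h1 h2.
move=> /nbhs_closedballP[M MD].
have h0 : 0 < M%:num / 2 by rewrite divr_gt0.
have {}MD y : `|y - x| <= 2 * (M%:num / 2) -> [/\ D y, `|partial j (partial i f) x - partial j (partial i f) y| <= e / 2
   & `|partial i (partial j f) x - partial i (partial j f) y| <= e / 2].
  rewrite mulrC divfK // => hy; apply: MD.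
  by rewrite closed_ballE // /closed_ball_ /= distrC.
have [xi hxi e1] := @second_difference D f i j x _ h0 (fun y hy => let: And3 a _ _ := MD y hy in a) fD fiD.
have [xi' hxi' e1'] := @second_difference D f j i x _ h0 (fun y hy => let: And3 a _ _ := MD y hy in a) fD fjD.
have hn : M%:num / 2 != 0 by rewrite gt_eqF.
have E : partial j (partial i f) xi = partial i (partial j f) xi'.
  have e3 (a b c d : R) : a - b - (c - d) = a - c - (b - d) by ring.
  rewrite (addrCA (_ *: delta_mx 0 i)) e3 e1 in e1'.
  exact: (mulfI hn (mulfI hn e1')).
have [_ h1 _] := MD _ hxi; have [_ _ h2] := MD _ hxi'.
rewrite -(subrKA (partial i (partial j f) xi')) -{2}E.
apply: le_trans (ler_normD _ _) _; rewrite (splitr e); apply: lerD; first exact: h2.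
by rewrite distrC; exact: h1.
Qed.

End Schwarz.

Section C1closure.
Context {R : realType} {N : nat}.
Implicit Types (D : set 'rV[R]_N) (f g : 'rV[R]_N -> R) (x w : 'rV[R]_N).

Lemma for_continuous_near (T U : topologicalType) (f g : T -> U) (x : T) :
  (\forall y \near x, f y = g y) -> {for x, continuous f} -> {for x, continuous g}.
Proof.
move=> h; rewrite /prop_for /continuous_at (nbhs_singleton h) => c.
by apply: cvg_trans c; apply: near_eq_cvg.
Qed.

Lemma for_continuous_mx (T : topologicalType) m n (A : T -> 'M[R]_(m, n)) (x : T) :
  (forall i j, {for x, continuous (fun y => A y i j)}) -> {for x, continuous A}.
Proof. by move=> h; apply/cvg_mxP => i j; exact: h. Qed.

Lemma for_continuous_sum (T : topologicalType) (I : Type) (r : seq I) (P : pred I)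
    (G : I -> T -> R) (x : T) :
  (forall i, P i -> {for x, continuous (G i)}) ->
  {for x, continuous (fun y => \sum_(i <- r | P i) G i y)}.
Proof. exact: cvg_suml. Qed.

Lemma for_continuous_comp (T U W : topologicalType) (phi : T -> U) (f : U -> W) (x : T) :
  {for x, continuous phi} -> {for phi x, continuous f} ->
  {for x, continuous (fun y => f (phi y))}.
Proof. exact: continuous_comp. Qed.

Lemma C1onI D f (df : 'I_N -> 'rV[R]_N -> R) : open D ->
  (forall x, D x -> {for x, continuous f}) ->
  (forall x j, D x -> is_derive x (delta_mx 0 j) f (df j x)) ->
  (forall x j, D x -> {for x, continuous (df j)}) -> C1on D f.
Proof.
move=> oD cf hf cdf x Dx; split; first exact: cf.
move=> j; split; first by have [] := hf x j Dx.
have E : \forall y \near x, df j y = partial j f y.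
  have : \forall y \near x, D y by exact: open_nbhs_nbhs.
  by apply: filterS => y Dy; rewrite (partial_val (hf y j Dy)).
exact: for_continuous_near E (cdf x j Dx).
Qed.

Lemma C1on_partial D f x j : C1on D f -> D x ->
  is_derive x (delta_mx 0 j) f (partial j f x).
Proof. by move=> fD Dx; apply: partialP; have [_ /(_ j)[]] := fD _ Dx. Qed.

Lemma C1on_eq D f g : open D -> (forall x, D x -> f x = g x) -> C1on D f -> C1on D g.
Proof.
move=> oD fg fD.
have nD x : D x -> \forall y \near x, f y = g y.
  move=> Dx; have : \forall y \near x, D y by exact: open_nbhs_nbhs.
  by apply: filterS.
apply: (@C1onI _ _ (fun j => partial j f)) => // [x Dx|x j Dx|x j Dx].
- by have [c _] := fD _ Dx; apply: for_continuous_near c; exact: nD.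
- by apply: near_eq_is_derive (C1on_partial j fD Dx); exact: nD.
- by have [_ /(_ j)[]] := fD _ Dx.
Qed.

Lemma C1on_sub D D' f : D' `<=` D -> C1on D f -> C1on D' f.
Proof. by move=> s fD x /s /fD. Qed.

Lemma C1on_cst D (c : R) : open D -> C1on D (fun=> c).
Proof.
move=> oD; apply: (@C1onI _ _ (fun _ _ => 0)) => // [x _|x j _].
- exact: cst_continuous.
- exact: cst_continuous.
Qed.

Lemma C1on_coord D k : open D -> C1on D (fun x => x 0 k).
Proof.
move=> oD; apply: (@C1onI _ _ (fun j _ => (k == j)%:R)) => // [x _|x j _|x j _].
- exact: coord_continuous.
- have /is_derive_mxP/(_ 0 k) := is_derive_id x (delta_mx 0 j).
  by rewrite mxE.
- exact: cst_continuous.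
Qed.

Lemma C1on_add D f g : open D -> C1on D f -> C1on D g -> C1on D (fun x => f x + g x).
Proof.
move=> oD fD gD; apply: (@C1onI _ _ (fun j x => partial j f x + partial j g x)) => // [x Dx|x j Dx|x j Dx].
- by apply: continuousD; [case: (fD _ Dx)|case: (gD _ Dx)].
- exact: is_deriveDp (C1on_partial j fD Dx) (C1on_partial j gD Dx).
- by apply: continuousD; [case: (fD _ Dx) => _ /(_ j)[]|case: (gD _ Dx) => _ /(_ j)[]].
Qed.

Lemma C1on_mul D f g : open D -> C1on D f -> C1on D g -> C1on D (fun x => f x * g x).
Proof.
move=> oD fD gD; apply: (@C1onI _ _ (fun j x => partial j f x * g x + f x * partial j g x)) => // [x Dx|x j Dx|x j Dx].
- by apply: continuousM; [case: (fD _ Dx)|case: (gD _ Dx)].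
- exact: is_deriveMp (C1on_partial j fD Dx) (C1on_partial j gD Dx).
- have [cf /(_ j)[_ cdf]] := fD _ Dx; have [cg /(_ j)[_ cdg]] := gD _ Dx.
  exact: continuousD (continuousM cdf cg) (continuousM cf cdg).
Qed.

Lemma C1on_opp D f : open D -> C1on D f -> C1on D (fun x => - f x).
Proof.
move=> oD fD; apply: (C1on_eq oD _ (C1on_mul oD (C1on_cst (-1) oD) fD)) => x _.
by rewrite mulN1r.
Qed.

Lemma C1on_sum D (I : Type) (r : seq I) (P : pred I) (F : I -> 'rV[R]_N -> R) :
  open D -> (forall i, P i -> C1on D (F i)) ->
  C1on D (fun x => \sum_(i <- r | P i) F i x).
Proof.
move=> oD h; elim: r => [|a r IH].
  by apply: (C1on_eq oD _ (C1on_cst 0 oD)) => x _; rewrite big_nil.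
case Pa: (P a).
  by apply: (C1on_eq oD _ (C1on_add oD (h _ Pa) IH)) => x _; rewrite big_cons Pa.
by apply: (C1on_eq oD _ IH) => x _; rewrite big_cons Pa.
Qed.

Lemma C1on_prod D (I : Type) (r : seq I) (P : pred I) (F : I -> 'rV[R]_N -> R) :
  open D -> (forall i, P i -> C1on D (F i)) ->
  C1on D (fun x => \prod_(i <- r | P i) F i x).
Proof.
move=> oD h; elim: r => [|a r IH].
  by apply: (C1on_eq oD _ (C1on_cst 1 oD)) => x _; rewrite big_nil.
case Pa: (P a).
  by apply: (C1on_eq oD _ (C1on_mul oD (h _ Pa) IH)) => x _; rewrite big_cons Pa.
by apply: (C1on_eq oD _ IH) => x _; rewrite big_cons Pa.
Qed.

Lemma C1on_inv D f : open D -> (forall x, D x -> f x != 0) -> C1on D f ->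
  C1on D (fun x => (f x)^-1).
Proof.
move=> oD f0 fD; apply: (@C1onI _ _ (fun j x => - (f x) ^- 2 * partial j f x)) => // [x Dx|x j Dx|x j Dx].
- by apply: continuousV; [exact: f0|case: (fD _ Dx)].
- have [_ /(_ j)[d _]] := fD _ Dx.
  split; first by apply: derivableV => //; exact: f0.
  by rewrite deriveV //; exact: f0.
- have [cf /(_ j)[_ cdf]] := fD _ Dx.
  have c2 : {for x, continuous (fun x => f x ^+ 2)} := continuousM cf cf.
  have h : {for x, continuous (fun x => (f x ^+ 2)^-1)}.
    by apply: continuousV; [rewrite expf_neq0 // f0|exact: c2].
  exact: continuousM (continuousN h) cdf.
Qed.

Definition C1mx m n D (M : 'rV[R]_N -> 'M[R]_(m, n)) := forall i j, C1on D (fun x => M x i j).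

Lemma C1mx_cst m n D (c : 'M[R]_(m, n)) : open D -> C1mx D (fun=> c).
Proof. by move=> oD i j; exact: C1on_cst. Qed.

Lemma C1mx_eq m n D (A B : 'rV[R]_N -> 'M[R]_(m, n)) : open D ->
  (forall x, D x -> A x = B x) -> C1mx D A -> C1mx D B.
Proof. by move=> oD AB hA i j; apply: C1on_eq (hA i j) => // x /AB ->. Qed.

Lemma C1mx_add m n D (A B : 'rV[R]_N -> 'M[R]_(m, n)) : open D ->
  C1mx D A -> C1mx D B -> C1mx D (fun x => A x + B x).
Proof.
move=> oD hA hB i j.
by apply: (C1on_eq oD _ (C1on_add oD (hA i j) (hB i j))) => x _; rewrite mxE.
Qed.

Lemma C1mx_opp m n D (A : 'rV[R]_N -> 'M[R]_(m, n)) : open D ->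
  C1mx D A -> C1mx D (fun x => - A x).
Proof.
by move=> oD hA i j; apply: (C1on_eq oD _ (C1on_opp oD (hA i j))) => x _; rewrite mxE.
Qed.

Lemma C1mx_scale m n D (c : 'rV[R]_N -> R) (A : 'rV[R]_N -> 'M[R]_(m, n)) : open D ->
  C1on D c -> C1mx D A -> C1mx D (fun x => c x *: A x).
Proof.
by move=> oD hc hA i j; apply: (C1on_eq oD _ (C1on_mul oD hc (hA i j))) => x _; rewrite mxE.
Qed.

Lemma C1mx_mul m n p D (A : 'rV[R]_N -> 'M[R]_(m, n)) (B : 'rV[R]_N -> 'M[R]_(n, p)) : open D ->
  C1mx D A -> C1mx D B -> C1mx D (fun x => A x *m B x).
Proof.
move=> oD hA hB i j.
apply: (@C1on_eq D (fun x => \sum_k A x i k * B x k j)) => // [x _|]; first by rewrite mxE.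
by apply: C1on_sum => // k _; apply: C1on_mul.
Qed.

Lemma C1mx_tr m n D (A : 'rV[R]_N -> 'M[R]_(m, n)) : open D ->
  C1mx D A -> C1mx D (fun x => (A x)^T).
Proof. by move=> oD hA i j; apply: (C1on_eq oD _ (hA j i)) => x _; rewrite mxE. Qed.

Lemma C1on_det n D (A : 'rV[R]_N -> 'M[R]_n) : open D -> C1mx D A -> C1on D (fun x => \det (A x)).
Proof.
move=> oD hA; apply: C1on_sum => // s _; apply: C1on_mul => //; first exact: C1on_cst.
by apply: C1on_prod => // i _; exact: hA.
Qed.

Lemma C1on_mxtrace n D (A : 'rV[R]_N -> 'M[R]_n) : open D -> C1mx D A -> C1on D (fun x => \tr (A x)).
Proof. by move=> oD hA; apply: C1on_sum => // i _; exact: hA. Qed.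

Lemma C1mx_inv n D (A : 'rV[R]_N -> 'M[R]_n) : open D -> (forall x, D x -> A x \in unitmx) ->
  C1mx D A -> C1mx D (fun x => invmx (A x)).
Proof.
move=> oD uA hA.
have cd : C1on D (fun x => (\det (A x))^-1).
  by apply: C1on_inv (C1on_det oD hA) => // x /uA; rewrite unitmxE unitfE.
have ca : C1mx D (fun x => \adj (A x)).
  move=> i j; have hs : C1mx D (fun x => row' j (col' i (A x))).
    by move=> k l; apply: (C1on_eq oD _ (hA (lift j k) (lift i l))) => x _; rewrite !mxE.
  have cc := C1on_mul oD (C1on_cst ((-1) ^+ (j + i)) oD) (C1on_det oD hs).
  by apply: (C1on_eq oD _ cc) => x _; rewrite [RHS]mxE.
apply: (C1mx_eq oD _ (C1mx_scale oD cd ca)) => x Dx.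
by rewrite /invmx uA.
Qed.

Lemma C1mx_cvg m n D (A : 'rV[R]_N -> 'M[R]_(m, n)) x : C1mx D A -> D x ->
  {for x, continuous A}.
Proof. by move=> hA Dx; apply: for_continuous_mx => i j; case: (hA i j x Dx). Qed.

Definition partial_mx m n k (A : 'rV[R]_N -> 'M[R]_(m, n)) x : 'M[R]_(m, n) :=
  \matrix_(i, j) partial k (fun y => A y i j) x.

Lemma C1mx_is_derive m n D (A : 'rV[R]_N -> 'M[R]_(m, n)) x k : C1mx D A -> D x ->
  is_derive x (delta_mx 0 k) A (partial_mx k A x).
Proof. by move=> hA Dx; apply/is_derive_mxP => i j; rewrite mxE; apply: C1on_partial Dx. Qed.

End C1closure.

Section C1composition.
Context {R : realType} {M N : nat}.

Lemma C1on_comp (D : set 'rV[R]_M) (D' : set 'rV[R]_N) (f : 'rV[R]_N -> R)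
    (phi : 'rV[R]_M -> 'rV[R]_N) :
  open D -> open D' -> (forall x, D x -> D' (phi x)) -> C1on D' f -> C1mx D phi ->
  C1on D (fun x => f (phi x)).
Proof.
move=> oD oD' DD fD hphi.
apply: (@C1onI _ _ _ _ (fun k x => \sum_j partial_mx k phi x 0 j * partial j f (phi x))) => // [x Dx|x k Dx|x k Dx].
- have [c _] := fD _ (DD _ Dx).
  exact: for_continuous_comp (C1mx_cvg hphi Dx) c.
- by apply: (C1_chain oD' fD (DD _ Dx)); exact: C1mx_is_derive Dx.
- apply: for_continuous_sum => j _; apply: continuousM.
    have -> : (fun y => partial_mx k phi y 0 j) = partial k (fun y => phi y 0 j).
      by apply/funext => y; rewrite mxE.
    by have [_ /(_ k)[]] := hphi 0 j x Dx.
  have [_ /(_ j)[_ c]] := fD _ (DD _ Dx).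
  exact: for_continuous_comp (C1mx_cvg hphi Dx) c.
Qed.

End C1composition.

Section InverseMatrixDerivative.
Context {R : realType} {V : normedModType R}.

Lemma is_derive1P (W : normedModType R) (F : V -> W) x v l :
  is_derive (0 : R) 1 (fun h : R => F (h *: v + x)) l <-> is_derive x v F l.
Proof.
have E : (fun t : R => t^-1 *: (F ((t *: 1 + 0) *: v + x) - F (0 *: v + x))) =
         (fun t : R => t^-1 *: (F (t *: v + x) - F x)).
  by apply/funext => t; rewrite addr0 [t *: 1]mulr1 scale0r add0r.
by split; case=> d e; split; [move: d|move: e|move: d|move: e];
  rewrite /derivable /derive /= E.
Qed.

(** Cramer's formula shows that the inverse is derivable; the value of the derivative is then forced
    by differentiating the product of the matrix and its inverse, which is constant near x. *)
Lemma is_derive_invmx n (A : V -> 'M[R]_n) x v dA : A x \in unitmx ->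
  is_derive x v A dA ->
  is_derive x v (fun y => invmx (A y)) (- (invmx (A x) *m dA *m invmx (A x))).
Proof.
move=> uA hA; pose g (h : R) := A (h *: v + x).
have g0 : g 0 = A x by rewrite /g scale0r add0r.
have hg : is_derive (0 : R) 1 g dA by apply/is_derive1P.
have cg : g h @[h --> 0] --> A x.
  rewrite -g0; apply: differentiable_continuous.
  by apply/derivable1_diffP; case: hg.
have near0 : \forall h \near (0 : R), g h \in unitmx.
  have : \forall h \near (0 : R), \det (g h) != 0.
    by apply: (cvgr_neq0 _ (cvg_det cg)); rewrite -unitfE -unitmxE.
  by apply: filterS => h; rewrite unitmxE unitfE.
have der : derivable (fun h => invmx (g h)) 0 1.
  apply/derivable_mxP => i j.
  apply: (@near_eq_derivable _ _ _ (fun h => (\det (g h))^-1 * (\adj (g h)) i j)).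
    by move: near0; apply: filterS => h hh /=; rewrite [invmx _]/invmx hh [RHS]mxE.
  apply: derivableM; first (apply: derivableV).
  - by rewrite g0 -unitfE -unitmxE.
  - by have [] := is_derive_det_adj hg.
  - have : is_derive (0 : R) 1 (fun h => row' j (col' i (g h))) (row' j (col' i dA)).
      apply/is_derive_mxP => k l.
      apply: is_derive_eqfun (((is_derive_mxP _ _ _ _).1 hg) (lift j k) (lift i l)) => [h|];
      by rewrite !mxE.
    move=> /is_derive_det_adj [d _].
    have -> : (fun h => \adj (g h) i j) = (fun h => (-1) ^+ (j + i) * \det (row' j (col' i (g h)))).
      by apply/funext => h; rewrite mxE.
    exact: (derivableM (derivable_cst _ _ _) d).
apply/is_derive1P; rewrite -/g -g0.
split=> //; set D := LHS.
have hi : is_derive (0 : R) 1 (fun h => invmx (g h)) D by split.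
have hm := is_derive_mulmx hg hi.
have h1 : is_derive (0 : R) 1 (fun h => g h *m invmx (g h)) 0.
  apply: (@near_eq_is_derive _ _ _ (fun=> 1%:M)).
  by move: near0; apply: filterS => h hh; rewrite mulmxV.
have : dA *m invmx (g 0) + g 0 *m D = 0.
  by case: hm => _ <-; case: h1.
move=> /(congr1 (mulmx (invmx (g 0)))).
rewrite mulmx0 mulmxDr mulKmx ?g0 // mulmxA => /eqP.
by rewrite addrC addr_eq0 => /eqP.
Qed.

End InverseMatrixDerivative.

(** * The divergence theorem on a box *)

Section Grid.
Context {R : realType} {N : nat}.
Implicit Types (D : set 'rV[R]_N) (f g : 'rV[R]_N -> R) (x w : 'rV[R]_N).

Definition box (c l : 'rV[R]_N) : set 'rV[R]_N := [set x | forall j, `|x 0 j - c 0 j| <= l 0 j].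

Lemma box_compact c l : compact (box c l).
Proof.
have -> : box c l = [set v : 'rV[R]_N | forall i, `[c 0 i - l 0 i, c 0 i + l 0 i]%classic (v ord0 i)].
  apply/seteqP; split=> x h j; have := h j; rewrite /= in_itv /= ler_distl //.
apply: (@rV_compact _ _ (fun i => `[c 0 i - l 0 i, c 0 i + l 0 i]%classic)) => i.
exact: segment_compact.
Qed.

(** Uniform continuity in a form where y may leave K. If it failed at every scale 1/(n+1), the
    points of K where it fails would have a cluster point, and continuity there gives a
    contradiction. *)
Lemma compact_uniform (K : set 'rV[R]_N) f (e : R) : 0 < e -> compact K ->
  (forall x, K x -> {for x, continuous f}) ->
  exists2 d, 0 < d & forall x y, K x -> `|y - x| <= d -> `|f y - f x| <= e.
Proof.
move=> e0 cK cf; apply: contrapT => /forall2NP H.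
have /choice[F HF] : forall n : nat, exists xy : 'rV[R]_N * 'rV[R]_N,
    [/\ K xy.1, `|xy.2 - xy.1| <= n.+1%:R^-1 & e < `|f xy.2 - f xy.1|].
  move=> n; have [h0|] := H n.+1%:R^-1; first by case: h0; rewrite invr_gt0 ltr0n.
  move=> /existsNP[x /existsNP[y /not_implyP[Kx /not_implyP[xy /negP]]]].
  by rewrite -ltNge => ?; exists (x, y).
pose u n := (F n).1.
have [|x [Kx clx]] := cK (u @ \oo) _.
  by exists 0%N => // n _; case: (HF n).
have e2 : 0 < e / 2 by rewrite divr_gt0.
have /cf /cvgrPdist_le /(_ _ e2) /nbhs_ballP[r /= r0 hr] := Kx.
have r2 : 0 < r / 2 by rewrite divr_gt0.
have [m hm] : exists m : nat, forall n, (m <= n)%N -> n.+1%:R^-1 < r / 2.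
  exists (Num.truncn (r / 2)^-1) => n mn; rewrite invf_plt ?posrE ?ltr0n //.
  apply: lt_le_trans (truncnS_gt _) _; by rewrite ler_nat.
have [_ [[n mn <-] /= hn]] := clx [set y | exists2 n, (m <= n)%N & u n = y] (ball x (r / 2))
   (ex_intro2 _ _ m I (fun n mn => ex_intro2 _ _ n mn erefl)) (nbhsx_ballx _ _ r2).
have [_ h1 h2] := HF n.
have b1 : ball x r (u n) by apply: le_ball hn; lra.
have b2 : ball x r (F n).2.
  rewrite [r]splitr; apply: ball_triangle hn _.
  rewrite -ball_normE /ball_ /= distrC; apply: le_lt_trans h1 _; exact: hm.
have l1 := hr _ b1; have l2 := hr _ b2.
have : `|f (F n).2 - f (F n).1| <= e.
  rewrite -(subrKA (f x)); apply: le_trans (ler_normD _ _) _.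
  by rewrite (splitr e) lerD // distrC.
by rewrite leNgt h2.
Qed.

Lemma card_slice (m : nat) (i : 'I_N) (a : 'I_m) :
  (0 < N)%N -> #|[pred k : {ffun 'I_N -> 'I_m} | k i == a]| = (m ^ N.-1)%N.
Proof.
move=> N0; pose P (j : 'I_N) := [pred b : 'I_m | (j == i) ==> (b == a)].
transitivity #|(family P : simpl_pred {ffun 'I_N -> 'I_m})|.
  apply: eq_card => k; rewrite !inE; apply/eqP/familyP => [ka j|/(_ i)]; rewrite !inE.
    by apply/implyP => /eqP ->; rewrite ka.
  by rewrite eqxx /= => /eqP.
rewrite card_family foldrE big_image /=.
rewrite (bigD1 i) //= -[in RHS](card_ord N) -(cardC1 i).
rewrite (eq_bigr (fun => m)); last first.
  by move=> j ji; rewrite (eq_card (B := predT)) ?card_ord // => b; rewrite !inE (negbTE ji).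
rewrite (eq_card (B := pred1 a)); last by move=> b; rewrite !inE eqxx.
by rewrite card1 mul1n prod_nat_const; congr (_ ^ _)%N; apply: eq_card => j; rewrite !inE.
Qed.

(** Each axis consists of 2M + 1 blocks of q cells, and the indices counted are those of the middle
    block. *)
Lemma card_central (q M m : nat) (hm : m = ((2 * M + 1) * q)%N) :
  (q ^ N <= #|[pred k : {ffun 'I_N -> 'I_m} | [forall j, M * q <= k j < M * q + q]]|)%N.
Proof.
have lt (a : 'I_q) : (M * q + a < m)%N.
  rewrite hm mulnDl mul1n mul2n -addnn mulnDl -addnA ltn_add2l.
  by apply: leq_trans (ltn_ord a) _; rewrite leq_addl.
pose F (k : {ffun 'I_N -> 'I_q}) : {ffun 'I_N -> 'I_m} := [ffun j => Ordinal (lt (k j))].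
have Finj : injective F.
  move=> k l /ffunP E; apply/ffunP => j; have /(congr1 val) := E j; rewrite !ffunE /=.
  by move=> /addnI /val_inj.
have -> : (q ^ N)%N = #|{ffun 'I_N -> 'I_q}| by rewrite card_ffun !card_ord.
rewrite -(card_codom Finj).
apply: subset_leq_card.
apply/fintype.subsetP => _ /codomP[k ->].
by rewrite !inE; apply/forallP => j; rewrite ffunE /= leq_addr ltn_add2l ltn_ord.
Qed.

(** A divergence theorem without integrals. The Riemann sum of the divergence over a grid telescopes
    along each axis and leaves the values on the two opposite faces, which [b] bounds. The ratio L
    of the boxes is odd so that the small box is exactly the middle block of cells of the large
    one. *)
Lemma grid_divergence D (W : 'I_N -> 'rV[R]_N -> R) (c s : 'rV[R]_N) (M : nat)
    (b : 'I_N -> R) (kappa : R) :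
  let L := (2 * M + 1)%:R : R in
  let T x := \sum_i partial i (W i) x in
  open D -> box c (L *: s) `<=` D -> (0 < N)%N ->
  (forall j, 0 < s 0 j) -> (forall i, C1on D (W i)) ->
  (forall x, box c (L *: s) x -> 0 <= T x) ->
  (forall x, box c s x -> kappa <= T x) -> 0 <= kappa ->
  (forall i x, box c (L *: s) x -> `|x 0 i - c 0 i| = L * s 0 i -> `|W i x| <= b i) ->
  kappa * \prod_j (2 * s 0 j) <= \sum_i 2 * b i * \prod_(j | j != i) (2 * (L * s 0 j)).
Proof.
move=> L T oD BD N0 s0 hW T0 Tk k0 hb.
have L0 : 0 < L by rewrite ltr0n addn1.
set V := \prod_j (2 * (L * s 0 j)).
have V0 : 0 < V by apply: prodr_gt0 => j _; rewrite !mulr_gt0.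
apply/ler_addgt0Pr => e e0.
(* Each of the N axes will produce an error of V times [eps], so the total error is e. *)
pose eps := e / (N%:R * V).
have eps0 : 0 < eps by rewrite divr_gt0 // mulr_gt0 // ltr0n.
have /choice[eta heta] : forall i, exists d, 0 < d /\ forall x y, box c (L *: s) x -> `|y - x| <= d ->
     `|partial i (W i) y - partial i (W i) x| <= eps.
  move=> i; have [|d d0 hd] := @compact_uniform (box c (L *: s)) (partial i (W i)) eps eps0 (@box_compact c (L *: s)).
    by move=> x /BD Dx; have [_ /(_ i)[]] := hW i x Dx.
  by exists d.
(* q cells per axis in the small box, enough for every edge to be shorter than the modulus of
   continuity [eta i]. *)
have [q q0 hq] : exists2 q : nat, (0 < q)%N & forall i, 2 * s 0 i / q%:R <= eta i.
  have : exists q : nat, forall i, 2 * s 0 i / eta i <= q%:R.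
    exists (\max_i (Num.truncn (2 * s 0 i / eta i)%R).+1)%N => i.
    apply: le_trans (ltW (truncnS_gt _)) _; rewrite ler_nat.
    exact: (@leq_bigmax _ (fun i => (Num.truncn (2 * s 0 i / eta i)).+1)).
  move=> [q hq]; exists q.+1 => // i; have [ei _] := heta i.
  rewrite ler_pdivrMr ?ltr0n // -ler_pdivrMl // mulrC.
  by apply: le_trans (hq i) _; rewrite ler_nat.
pose m := ((2 * M + 1) * q)%N.
have m0 : (0 < m)%N by rewrite muln_gt0 addn1 q0.
have mR : m%:R = L * q%:R :> R by rewrite natrM.
have q0R : 0 < q%:R :> R by rewrite ltr0n.
pose h (j : 'I_N) : R := 2 * s 0 j / q%:R.
have h0 j : 0 < h j by rewrite divr_gt0 // mulr_gt0.
have mh j : m%:R * h j = 2 * (L * s 0 j).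
  by rewrite mR /h; field; rewrite gt_eqF.
pose X (k : {ffun 'I_N -> 'I_m}) : 'rV[R]_N := \row_j (c 0 j - L * s 0 j + (k j)%:R * h j).
have Xbox k (i : 'I_N) (t : R) : 0 <= t <= 1 -> box c (L *: s) (t *: (h i *: delta_mx 0 i) + X k).
  move=> /andP[t0 t1] j; rewrite !mxE eqxx /=.
  set u := t * _ + _; have -> : u - c 0 j = ((k j)%:R + t * (j == i)%:R) * h j - L * s 0 j.
    by rewrite /u; have [->|_] := eqVneq j i; rewrite ?mulr1 ?mulr0; ring.
  rewrite ler_norml; have hj := mh j; have kj : 0 <= ((k j)%:R : R) <= m%:R - 1.
    rewrite ler0n /= lerBrDr natr1 ler_nat; exact: ltn_ord.
  have tj : 0 <= t * (j == i)%:R <= 1.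
    by case: (j == i); rewrite ?mulr1 ?mulr0 ?t0 ?lexx ?ler01.
  have : 0 <= ((k j)%:R + t * (j == i)%:R) * h j <= m%:R * h j.
    by rewrite mulr_ge0 ?ler_pM2r ?(ltW (h0 j)) //=; lra.
  by lra.
pose VH := \prod_j h j.
have VH0 : 0 < VH by apply: prodr_gt0.
have VHm : VH * (m ^ N)%:R = V.
  rewrite natrX -[X in m%:R ^+ X]card_ord -prodr_const -big_split /=.
  by apply: eq_bigr => j _; rewrite mulrC mh.
(* The cells of the middle block give the lower bound; all other cells are dropped because the
   divergence is nonnegative there. *)
have low : kappa * \prod_j (2 * s 0 j) <= VH * \sum_k T (X k).
  rewrite (bigID (fun k : {ffun 'I_N -> 'I_m} => [forall j, M * q <= k j < M * q + q]))%N /=.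
  apply: (@le_trans _ _ (VH * (\sum_(k : {ffun 'I_N -> 'I_m} | [forall j, (M * q <= k j < M * q + q)%N]) kappa))).
    have -> : \prod_j (2 * s 0 j) = VH * (q ^ N)%:R.
      rewrite natrX -[X in q%:R ^+ X]card_ord -prodr_const -big_split /=.
      by apply: eq_bigr => j _; rewrite /h divfK // gt_eqF.
    rewrite sumr_const -[X in _ <= _ * X]mulr_natr mulrCA; apply: ler_wpM2l; first exact: ltW.
    apply: ler_wpM2l; first exact: k0.
    by rewrite ler_nat; exact: card_central.
  rewrite ler_pM2l //; apply: ler_wpDr.
    by apply: sumr_ge0 => k _; apply: T0; have := Xbox k (Ordinal N0) 0; rewrite scale0r add0r lexx ler01; apply.
  apply: ler_sum => k /forallP hk; apply: Tk => j; rewrite mxE.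
  have /andP[h1 h2] := hk j.
  have {}h1 : M%:R * q%:R <= (k j)%:R :> R by rewrite -natrM ler_nat.
  have {}h2 : (k j)%:R <= M%:R * q%:R + q%:R :> R by rewrite -natrM -natrD ler_nat ltnW.
  have -> : c 0 j - L * s 0 j + (k j)%:R * h j - c 0 j = ((k j)%:R - L * q%:R / 2) * h j.
    by rewrite /h; field; rewrite gt_eqF.
  rewrite normrM (ger0_norm (ltW (h0 j))) /h !mulrA ler_pdivrMr // -mulrA [s 0 j * _]mulrC mulrA.
  rewrite ler_pM2r //; suff : `|(k j)%:R - L * q%:R / 2| <= q%:R / 2 by lra.
  by rewrite ler_norml /L natrD natrM mulr1n; lra.
apply: le_trans low _; rewrite /T exchange_big /= mulr_sumr.
apply: (@le_trans _ _ (\sum_(i < N) (2 * b i * \prod_(j | j != i) (2 * (L * s 0 j)) + V * eps))); last first.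
  rewrite big_split /= lerD2l sumr_const card_ord -mulr_natl /eps mulrA.
  by rewrite mulrC divfK // mulf_neq0 // ?gt_eqF // ltr0n.
apply: ler_sum => i _.
(* The derivative at the lower corner differs by at most [eps] from its mean value along the edge,
   which is the difference of W between the end points. *)
have cell k : h i * partial i (W i) (X k) <= W i (h i *: delta_mx 0 i + X k) - W i (X k) + h i * eps.
  have [|t ht e'] := @line_MVT R _ (W i) (fun t => h i * partial i (W i) (t *: (h i *: delta_mx 0 i) + X k)) (X k) (h i *: delta_mx 0 i).
    move=> t ht; apply: is_derive_scale; apply: partialP.
    by have [_ /(_ i)[]] := hW i _ (BD _ (Xbox k i t ht)).
  rewrite e' -mulrDr ler_pM2l // -lerBlDl.
  have [_ hd] := heta i.
  apply: le_trans (ler_norm _) _; rewrite distrC; apply: hd.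
    by have := Xbox k i 0; rewrite scale0r add0r lexx ler01; apply.
  rewrite addrK scalerA; apply: le_trans (norm_delta_le _ _) _.
  have /andP[t0 t1] := ht.
  rewrite (ger0_norm (mulr_ge0 t0 (ltW (h0 i)))).
  by apply: le_trans (hq i); rewrite -/(h i) ler_piMl // ltW.
pose Vi := \prod_(j | j != i) h j.
have VHi : VH = h i * Vi by rewrite /VH (bigD1 i).
have Vi0 : 0 < Vi by apply: prodr_gt0.
have sumle : \sum_k h i * partial i (W i) (X k) <=
    \sum_k (W i (h i *: delta_mx 0 i + X k) - W i (X k)) + (m ^ N)%:R * (h i * eps).
  apply: (@le_trans _ _ (\sum_k (W i (h i *: delta_mx 0 i + X k) - W i (X k) + h i * eps))).
    by apply: ler_sum => k _; exact: cell.
  rewrite big_split /= lerD2l sumr_const.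
  by rewrite card_ffun !card_ord mulr_natl.
(* The cyclic shift along axis i. After reindexing the subtracted values by it, all cells cancel
   except those in the last layer, where the shift wraps around to the first; these carry the values
   on the two faces. *)
pose sh (k : {ffun 'I_N -> 'I_m}) : {ffun 'I_N -> 'I_m} :=
  [ffun j => if j == i then ordS (k j) else k j].
have shinj : injective sh.
  move=> k l /ffunP E; apply/ffunP => j; have := E j; rewrite !ffunE.
  by case: (j == i) => // /(bij_inj (ordS_bij m)).
pose last := Ordinal (etrans (congr1 (leq^~ m) (prednK m0)) (leqnn m)) : 'I_m.
have telescope : \sum_k (W i (h i *: delta_mx 0 i + X k) - W i (X k)) <= (m ^ N.-1)%:R * (2 * b i).
  rewrite sumrB [X in _ - X](reindex_inj shinj) /= -sumrB.
  rewrite (bigID (fun k : {ffun 'I_N -> 'I_m} => k i == last)) /=.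
  rewrite [X in _ + X]big1 ?addr0; last first.
    move=> k kl; apply/eqP; rewrite subr_eq0; apply/eqP; congr (W i _).
    apply/rowP => j; rewrite !mxE eqxx ffunE /=.
    have [->|ji] := eqVneq j i; last by rewrite mulr0 add0r.
    have km : ((k i).+1 < m)%N.
      rewrite ltn_neqAle ltn_ord andbT; apply: contra kl => /eqP E.
      by apply/eqP/val_inj/succn_inj; rewrite /= prednK.
    by rewrite /ordS /= modn_small // -natr1; ring.
  have cardE : #|[pred k : {ffun 'I_N -> 'I_m} | k i == last]| = (m ^ N.-1)%N by exact: card_slice.
  rewrite -cardE mulr_natl -sumr_const; apply: ler_sum => k /eqP ki.
  have B1 : `|W i (h i *: delta_mx 0 i + X k)| <= b i.
    apply: hb; first by have := Xbox k i 1; rewrite scale1r; apply; rewrite lexx ler01.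
    rewrite !mxE !eqxx ki /=.
    have -> : h i * (true && true)%:R + (c 0 i - L * s 0 i + m.-1%:R * h i) - c 0 i = L * s 0 i.
      have := mh i; rewrite -[X in X%:R](prednK m0) -natr1 /=; lra.
    by rewrite ger0_norm // mulr_ge0 // ltW.
  have B2 : `|W i (X (sh k))| <= b i.
    apply: hb; first by have := Xbox (sh k) i 0; rewrite scale0r add0r; apply; rewrite lexx ler01.
    rewrite !mxE ffunE eqxx ki /ordS /= prednK // modnn mul0r addr0 addrAC subrr add0r normrN.
    by rewrite ger0_norm // mulr_ge0 // ltW.
  apply: le_trans (ler_norm _) _; apply: le_trans (ler_normB _ _) _.
  by rewrite mulrDl mul1r lerD.
have -> : VH * \sum_k partial i (W i) (X k) = Vi * \sum_k h i * partial i (W i) (X k).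
  by rewrite VHi -mulr_sumr; ring.
apply: le_trans (ler_wpM2l (ltW Vi0) sumle) _.
have -> : V * eps = Vi * ((m ^ N)%:R * (h i * eps)) by rewrite -VHm VHi; ring.
rewrite mulrDr lerD2r; apply: le_trans (ler_wpM2l (ltW Vi0) telescope) _.
have -> : \prod_(j | j != i) (2 * (L * s 0 j)) = Vi * (m ^ N.-1)%:R.
  have -> : N.-1 = #|predC1 i| by rewrite cardC1 card_ord.
  rewrite natrX -prodr_const /Vi.
  rewrite [X in _ * X](eq_bigl (fun j => j != i)); last by move=> j; rewrite !inE.
  by rewrite -big_split /=; apply: eq_bigr => j _; rewrite -mh mulrC.
by rewrite le_eqVlt; apply/orP; left; apply/eqP; ring.
Qed.

End Grid.

(** * Positive definite matrices *)

Section SimultaneousDiagonalisation.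
Local Open Scope sesquilinear_scope.
Variable C : numClosedFieldType.

Lemma hermconj n (A : 'M[C]_n) : A \is hermsymmx <-> A = A ^t*.
Proof.
split=> [/is_hermitianmxP|h]; first by rewrite expr0 scale1r.
by apply/is_hermitianmxP; rewrite expr0 scale1r.
Qed.

Lemma herm_congr n (A S : 'M[C]_n) : A \is hermsymmx -> S *m A *m S ^t* \is hermsymmx.
Proof.
move=> /hermconj h; apply/hermconj.
by rewrite !trmx_mul !map_mxM trmxCK -h mulmxA.
Qed.

(** The spectral theorem is applied twice: the eigenvectors of A, rescaled by the square roots of
    the eigenvalues, turn A into the identity; a unitary diagonalisation of the transformed B then
    leaves that identity untouched. *)
Lemma simultaneous_diag n (A B : 'M[C]_n) : A \is hermsymmx -> B \is hermsymmx ->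
  (forall v : 'rV[C]_n, v != 0 -> 0 < (v *m A *m v ^t*) 0 0) ->
  exists S (l : 'rV[C]_n), [/\ S \in unitmx, S *m A *m S ^t* = 1%:M,
     S *m B *m S ^t* = diag_mx l & l \is a realmx].
Proof.
move=> hA hB pA.
pose P := spectralmx A; pose d := spectral_diag A.
have uP : P \is unitarymx by exact: spectral_unitarymx.
have eA : A = P ^t* *m diag_mx d *m P.
  by rewrite -invmx_unitary //; apply/orthomx_spectralP; exact: hermitian_normalmx.
have PP : P *m P ^t* = 1%:M by apply/unitarymxP.
have dA : P *m A *m P ^t* = diag_mx d.
  by rewrite eA !mulmxA PP mul1mx -mulmxA PP mulmx1.
have d0 i : 0 < d 0 i.
  have rP : row i P != 0.
    apply/eqP => r0; have /matrixP/(_ i i) := PP.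
    rewrite !mxE eqxx big1 => [/eqP|j _]; first by rewrite eq_sym oner_eq0.
    by have /rowP/(_ j) := r0; rewrite !mxE => ->; rewrite mul0r.
  have := pA _ rP; have -> : row i P *m A *m (row i P) ^t* = (row i (P *m A *m P ^t*)) *m (delta_mx i 0).
    rewrite !row_mul -!mulmxA; congr (_ *m (_ *m _)).
    by rewrite -colE; apply/matrixP => a b; rewrite !mxE.
  by rewrite dA -colE !mxE eqxx mulr1n.
pose s := diag_mx (\row_i (sqrtC (d 0 i))^-1).
have sq0 i : sqrtC (d 0 i) != 0 by rewrite sqrtC_eq0 gt_eqF.
have sreal : s ^t* = s.
  rewrite tr_diag_mx map_diag_mx; congr diag_mx; apply/rowP => i; rewrite !mxE.
  by apply/CrealP; rewrite rpredV ger0_real // sqrtC_ge0 ltW.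
have us : s \in unitmx.
  rewrite unitmxE det_diag unitfE; apply/prodf_neq0 => i _.
  by rewrite !mxE invr_neq0.
pose S1 := s *m P.
have uS1 : S1 \in unitmx by rewrite unitmx_mul us unitarymx_unit.
have S1A : S1 *m A *m S1 ^t* = 1%:M.
  rewrite trmx_mul map_mxM sreal /S1 !mulmxA -(mulmxA s P) -(mulmxA s (P *m A)) dA.
  rewrite /s -mulmxA !mulmx_diag -diag_const_mx; congr diag_mx; apply/rowP => i; rewrite !mxE.
  by rewrite -{2}(sqrtCK (d 0 i)) expr2 mulfK // mulVf.
clearbody S1.
have hB1 := herm_congr S1 hB.
set B1 := _ *m _ in hB1.
pose Q := spectralmx B1; pose l := spectral_diag B1.
have uQ : Q \is unitarymx by exact: spectral_unitarymx.
have QQ : Q *m Q ^t* = 1%:M by apply/unitarymxP.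
have eB : B1 = Q ^t* *m diag_mx l *m Q.
  by rewrite -invmx_unitary //; apply/orthomx_spectralP; exact: hermitian_normalmx.
exists (Q *m S1), l; split.
- by rewrite unitmx_mul uS1 unitarymx_unit.
- rewrite trmx_mul map_mxM !mulmxA -(mulmxA Q S1) -(mulmxA Q (S1 *m A)) S1A.
  by rewrite mulmx1 QQ.
- rewrite trmx_mul map_mxM !mulmxA -(mulmxA Q S1) -(mulmxA Q (S1 *m B)) -/B1 eB.
  by rewrite !mulmxA QQ mul1mx -mulmxA QQ mulmx1.
- exact: hermitian_spectral_diag_real.
Qed.

End SimultaneousDiagonalisation.

Section PositiveDefinite.
Context {R : realType}.
Local Notation C := (R[i]).
Local Notation toC := (map_mx (real_complex R)).

Definition qf n (A : 'M[R]_n) (v : 'rV[R]_n) : R := (v *m A *m v^T) 0 0.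
Definition posdef n (A : 'M[R]_n) := A^T = A /\ forall v, v != 0 -> 0 < qf A v.

Lemma posdef_sym n (A : 'M[R]_n) : posdef A -> A^T = A.
Proof. by case. Qed.

Lemma posdef_ge0 n (A : 'M[R]_n) v : posdef A -> 0 <= qf A v.
Proof.
move=> [_ pA]; have [->|v0] := eqVneq v 0; last exact/ltW/pA.
by rewrite /qf !mul0mx mxE.
Qed.

Lemma qfD n (A B : 'M[R]_n) v : qf (A + B) v = qf A v + qf B v.
Proof. by rewrite /qf mulmxDr mulmxDl mxE. Qed.

Lemma qfZ n (A : 'M[R]_n) c v : qf (c *: A) v = c * qf A v.
Proof. by rewrite /qf -scalemxAr -scalemxAl mxE. Qed.

Lemma posdef_unit n (A : 'M[R]_n) : posdef A -> A \in unitmx.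
Proof.
move=> pA; rewrite -row_free_unit; apply/row_freeP; apply: contrapT => h.
have : kermx A != 0.
  rewrite kermx_eq0; apply/negP => /row_freeP; exact: h.
move=> /rowV0Pn[v /sub_kermxP vA v0]; have := pA.2 _ v0.
by rewrite /qf vA mul0mx mxE ltxx.
Qed.

Lemma posdefD n (A B : 'M[R]_n) : posdef A -> posdef B -> posdef (A + B).
Proof.
move=> pA pB; split; first by rewrite linearD /= pA.1 pB.1.
by move=> v v0; rewrite qfD addr_gt0 ?pA.2 ?pB.2.
Qed.

Lemma posdefZ n (A : 'M[R]_n) c : 0 < c -> posdef A -> posdef (c *: A).
Proof.
move=> c0 pA; split; first by rewrite linearZ /= pA.1.
by move=> v v0; rewrite qfZ mulr_gt0 ?pA.2.
Qed.

Lemma posdefDZ n (A B : 'M[R]_n) m : 0 <= m -> posdef A -> posdef B -> posdef (A + m *: B).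
Proof.
rewrite le_eqVlt => /orP[/eqP <-|m0] pA pB; first by rewrite scale0r addr0.
by apply: posdefD => //; exact: posdefZ.
Qed.

Lemma e00D (K : zmodType) (X Y : 'M[K]_1) : (X + Y) 0 0 = X 0 0 + Y 0 0.
Proof. by rewrite mxE. Qed.

Lemma e00N (K : zmodType) (X : 'M[K]_1) : (- X) 0 0 = - X 0 0.
Proof. by rewrite mxE. Qed.

Lemma e00Z (K : pzRingType) c (X : 'M[K]_1) : (c *: X) 0 0 = c * X 0 0.
Proof. by rewrite mxE. Qed.

Lemma trmx11 (K : Type) (X : 'M[K]_1) : X^T = X.
Proof. by apply/matrixP => i j; rewrite mxE !ord1. Qed.

Lemma conjC_real (r : R) : Num.conj (r%:C%C : C) = r%:C%C.
Proof. exact: conjc_real. Qed.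

Lemma toC_det n (A : 'M[R]_n) : \det (toC A) = (\det A)%:C%C.
Proof. exact: det_map_mx. Qed.

Lemma toC_sym_herm n (A : 'M[R]_n) : A^T = A -> toC A \is hermsymmx.
Proof.
move=> h; apply/hermconj; apply/matrixP => i j; rewrite !mxE conjC_real.
by rewrite -[in LHS]h mxE.
Qed.

(** For a symmetric real matrix the cross terms between the real and imaginary parts cancel. *)
Lemma toC_qf n (A : 'M[R]_n) (x y : 'rV[R]_n) : A^T = A ->
  let v := toC x + 'i%C *: toC y in
  (v *m toC A *m (map_mx Num.conj v^T)) 0 0 = (qf A x + qf A y)%:C%C.
Proof.
move=> sA v.
have ci : Num.conj ('i%C : C) = - 'i%C.
  by apply/eqP; rewrite eq_complex /= oppr0 !eqxx.
have cv : map_mx Num.conj v^T = toC x^T - 'i%C *: toC y^T.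
  apply/matrixP => i j; rewrite !mxE rmorphD rmorphM /=.
  by rewrite ci !conjC_real mulNr.
have xy : y *m A *m x^T = x *m A *m y^T.
  by rewrite -[LHS]trmx11 !trmx_mul trmxK sA mulmxA.
rewrite cv /v mulmxDl mulmxBr mulmxDl -!scalemxAl -!scalemxAr mulmxDl -!scalemxAl.
rewrite -!map_mxM xy !(e00D, e00N, e00Z) /qf rmorphD /=.
rewrite [X in _ = X + _](_ : _ = toC (x *m A *m x^T) 0 0); last by rewrite [RHS]mxE.
rewrite [X in _ = _ + X](_ : _ = toC (y *m A *m y^T) 0 0); last by rewrite [RHS]mxE.
move: (toC _ 0 0) (toC (x *m A *m y^T) 0 0) (toC (y *m A *m y^T) 0 0) => b a c.
have i2 : ('i%C : C) * 'i%C = -1 by have := sqr_i R; rewrite expr2.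
transitivity (b - ('i%C * 'i%C) * c : C); first by move: ('i%C : C) => ii; ring.
by rewrite i2; ring.
Qed.

Lemma toC_posdef n (A : 'M[R]_n) : posdef A ->
  forall v : 'rV[C]_n, v != 0 -> 0 < (v *m toC A *m (map_mx Num.conj v^T)) 0 0.
Proof.
move=> pA v v0.
pose x := map_mx (@complex.Re R) v; pose y := map_mx (@complex.Im R) v.
have ev : v = toC x + 'i%C *: toC y.
  by apply/matrixP => i j; rewrite !mxE [LHS]complexE.
rewrite ev (toC_qf _ _ pA.1) ltcR.
have [x0|x0] := eqVneq x 0; last by rewrite ltr_wpDr ?posdef_ge0 // pA.2.
have y0 : y != 0 by apply: contra v0 => /eqP y0; rewrite ev x0 y0 !map_mx0 scaler0 addr0.
by rewrite ltr_wpDl ?posdef_ge0 // pA.2.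
Qed.

(** Real symmetric matrices are diagonalised as Hermitian ones over [R[i]]. The change of basis
    stays complex; only the relative eigenvalues, which are all that later arguments use, are
    brought back to [R]. *)
Lemma simultaneous_diag_real n (A B : 'M[R]_n) : posdef A -> B^T = B ->
  exists (S : 'M[C]_n) (l : 'rV[R]_n), [/\ S \in unitmx,
    S *m toC A *m (map_mx Num.conj S^T) = 1%:M &
    S *m toC B *m (map_mx Num.conj S^T) = diag_mx (toC l)].
Proof.
move=> pA sB.
have [S [l [uS SA SB lr]]] := simultaneous_diag (toC_sym_herm pA.1) (toC_sym_herm sB) (toC_posdef pA).
exists S, (map_mx (@complex.Re R) l); split=> //; rewrite SB; congr diag_mx.
apply/matrixP => i j; rewrite !mxE; apply/esym/RRe_real.
by have /mxOverP := lr.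
Qed.

Lemma posdef_det n (A : 'M[R]_n) : posdef A -> 0 < \det A.
Proof.
move=> pA; have [S [l [uS SA _]]] := simultaneous_diag_real pA pA.1.
have /(congr1 determinant) := SA.
rewrite !det_mulmx det1 det_map_mx det_map_mx det_tr => E.
have s0 : \det S != 0 by rewrite -unitfE -unitmxE.
have : 0 < \det S * Num.conj (\det S) by rewrite mul_conjC_gt0.
rewrite mulrAC in E => sp.
have : (0 : C) < (\det A)%:C%C.
  by rewrite -(pmulr_rgt0 _ sp) E ltr01.
by rewrite ltcR.
Qed.

(** K^-1 N is not symmetric, but it is similar to a real diagonal matrix, so the trace of its square
    is a sum of squares. This is the sign of the dissipation of the entropy. *)
Lemma trace_square n (K N : 'M[R]_n) : posdef K -> N^T = N ->
  0 <= \tr (invmx K *m N *m (invmx K *m N)) /\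
  (\tr (invmx K *m N *m (invmx K *m N)) = 0 -> N = 0).
Proof.
move=> pK sN; have [S [l [uS SK SN]]] := simultaneous_diag_real pK sN.
set S' := map_mx Num.conj S^T in SK SN.
have uK := posdef_unit pK.
have uS' : S' \in unitmx.
  by rewrite /S' map_unitmx unitmx_tr.
have iK : invmx (toC K) = S' *m S.
  have eK : toC K = invmx S *m invmx S'.
    have := SK; rewrite -mulmxA => /(congr1 (mulmx (invmx S))).
    by rewrite mulKmx // mulmx1 => /(congr1 (mulmx^~ (invmx S'))); rewrite mulmxK.
  have KS : toC K *m (S' *m S) = 1%:M.
    by rewrite eK -!mulmxA (mulmxA _ S') mulVmx // mul1mx mulVmx.
  have uKC : toC K \in unitmx by rewrite map_unitmx.
  by rewrite -[RHS](mulKmx uKC) KS mulmx1.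
have eT : (\tr (invmx K *m N *m (invmx K *m N)))%:C%C = (\sum_i l 0 i ^+ 2)%:C%C.
  rewrite -trace_map_mx !map_mxM map_invmx iK -!mulmxA mxtrace_mulC !mulmxA SN.
  rewrite -(mulmxA _ S) -(mulmxA _ (S *m _)) SN mulmx_diag mxtrace_diag rmorph_sum.
  by apply: eq_bigr => i _; rewrite !mxE rmorphXn /= expr2.
move/complexI : eT => ->; split; first by apply: sumr_ge0 => i _; rewrite sqr_ge0.
move=> h.
have l0 : l = 0.
  apply/rowP => i; rewrite mxE; apply/eqP.
  have /allP/(_ i) : all (fun i => l 0 i ^+ 2 == 0) (index_enum 'I_n).
    have := h; move/eqP; rewrite psumr_eq0 // => i' _; exact: sqr_ge0.
  by rewrite mem_index_enum sqrf_eq0; apply.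
move: SN; rewrite l0 map_mx0 linear0 => SN.
have : toC N = 0.
  have := SN; rewrite -mulmxA => /(congr1 (mulmx (invmx S))).
  by rewrite mulKmx // mulmx0 => /(congr1 (mulmx^~ (invmx S'))); rewrite mulmxK // mul0mx.
move=> /matrixP N0; apply/matrixP => i j; have := N0 i j; rewrite !mxE.
by move=> /(@complexI R) ->.
Qed.

(** Each of two potentials may satisfy the homogeneous Monge-Ampere equation while their sum does
    not. The left side is the defect for phi_0 + m phi_1 with displacements a and b; completing the
    square shows that it depends on a - b only, through the parallel sum of A and B. *)
Lemma mixed_schur n (A B : 'M[R]_n) (a b : 'rV[R]_n) (m : R) :
  A^T = A -> B^T = B -> A + m *: B \in unitmx ->
  let g := a *m A + m *: (b *m B) in
  qf A a + m * qf B b - (g *m invmx (A + m *: B) *m g^T) 0 0 =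
  m * ((a - b) *m B *m invmx (A + m *: B) *m A *m (a - b)^T) 0 0.
Proof.
move=> sA sB uM g; set M := A + m *: B in uM *.
pose d := a - b.
have sM : M^T = M by rewrite linearD linearZ /= sA sB.
(* g is expanded once around a and once around b, so that M cancels against its inverse on either
   side of the quadratic form. *)
have g1 : g = a *m M - m *: (d *m B).
  rewrite /g /M mulmxDr -scalemxAr /d mulmxBl.
  by move: (a *m A) (a *m B) (b *m B) => p q r; apply/rowP => i; rewrite !mxE; ring.
have g2 : g = b *m M + d *m A.
  rewrite /g /M mulmxDr -scalemxAr /d mulmxBl.
  by move: (a *m A) (b *m A) (b *m B) => p q r; apply/rowP => i; rewrite !mxE; ring.
have gT : g^T = M *m b^T + A *m d^T by rewrite g2 linearD /= !trmx_mul sM sA.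
have gi : g *m invmx M = a - m *: (d *m B *m invmx M).
  by rewrite g1 mulmxBl mulmxK // -scalemxAl.
rewrite gi gT mulmxBl !mulmxDr -!scalemxAl -!mulmxA (mulmxA (invmx M)) mulVmx // mul1mx.
have e1 : a *m (M *m b^T) = a *m (A *m b^T) + m *: (a *m (B *m b^T)).
  by rewrite /M mulmxDl mulmxDr -scalemxAl -scalemxAr.
rewrite e1 /qf !mulmxA.
have -> : d *m B *m b^T = a *m B *m b^T - b *m B *m b^T by rewrite /d !mulmxBl.
have -> : a *m A *m d^T = a *m A *m a^T - a *m A *m b^T by rewrite /d linearB /= mulmxBr.
rewrite !(e00D, e00N, e00Z).
by rewrite -/d; ring.
Qed.

(** The coefficients are the elementary symmetric functions of the numbers in s. *)
Lemma prod_lin_coef (s : seq R) : (forall x, x \in s -> 0 < x) ->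
  let p := \prod_(x <- s) (1 + x *: 'X) in
  (size p <= (size s).+1)%N /\ forall i, 0 <= p`_i /\ ((i <= size s)%N -> 0 < p`_i).
Proof.
elim: s => [_|x s IH h] /=.
  rewrite big_nil size_poly1; split=> // i; rewrite coef1.
  by case: i => [|i] //=.
have [y ys|sz hc] := IH; first by apply: h; rewrite in_cons ys orbT.
have x0 : 0 < x by apply: h; rewrite in_cons eqxx.
rewrite big_cons; set p := \prod_(y <- s) _ in sz hc *.
have E i : ((1 + x *: 'X) * p)`_i = p`_i + x * (if i == 0%N then 0 else p`_i.-1).
  by rewrite mulrDl mul1r -scalerAl coefD coefZ coefXM.
split.
  apply: leq_trans (size_polyMleq _ _) _.
  have s2 : (size (1 + x *: 'X : {poly R})%R <= 2)%N.
    apply: leq_trans (size_polyD _ _) _; rewrite geq_max size_poly1 /=.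
    by apply: leq_trans (size_scale_leq _ _) _; rewrite size_polyX.
  by rewrite -subn1 leq_subLR (leq_trans (leq_add s2 sz)).
move=> i; rewrite E; case: i => [|i] /=.
  by rewrite mulr0 addr0; split=> [|_]; case: (hc 0%N) => // _; apply.
split; first by rewrite addr_ge0 ?mulr_ge0 ?(ltW x0) //; case: (hc i.+1); case: (hc i).
rewrite ltnS => hi; rewrite ltr_wpDl ?mulr_gt0 //; first by case: (hc i.+1).
by case: (hc i) => _; apply.
Qed.

(** In a common eigenbasis with relative eigenvalues l_i, and with c_i the squared moduli of the
    coordinates of d, the product is det A times m times the sum of c_i l_i prod_(k <> i) (1 + m
    l_k): the denominators 1 + m l_i of the inverse are absorbed by the determinant. The
    coefficients are thus positive combinations of elementary symmetric functions, and each separate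
    coefficient controls d. *)
Lemma mixed_poly n (A B : 'M[R]_n) (d : 'rV[R]_n) : posdef A -> posdef B ->
  exists P : {poly R}, [/\ (size P <= n.+1)%N,
    (forall m, 0 <= m -> P.[m] = \det (A + m *: B) *
        (m * (d *m B *m invmx (A + m *: B) *m A *m d^T) 0 0)),
    (forall q, 0 <= P`_q),
    (forall q, (1 <= q <= n)%N -> P`_q = 0 -> d = 0) &
    P`_1 = \det A * qf B d].
Proof.
move=> pA pB; have [S [l [uS SA SB]]] := simultaneous_diag_real pA pB.1.
set S' := map_mx Num.conj S^T in SA SB.
have uS' : S' \in unitmx by rewrite /S' map_unitmx unitmx_tr.
have l0 i : 0 < l 0 i.
  have rS : row i S != 0.
    apply/eqP => r0; have := mulmxV uS => /(congr1 (row i)).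
    rewrite row_mul r0 mul0mx => /rowP/(_ i); rewrite !mxE eqxx => /eqP.
    by rewrite eq_sym oner_eq0.
  have := toC_posdef pB rS.
  have -> : row i S *m toC B *m map_mx Num.conj (row i S)^T = row i (S *m toC B *m S') *m delta_mx i 0.
    rewrite !row_mul -!mulmxA; congr (_ *m (_ *m _)).
    by rewrite -colE; apply/matrixP => a b; rewrite !mxE.
  by rewrite SB -colE !mxE eqxx mulr1n ltcR.
have KD (X : 'M[R]_n) (D : 'M[C]_n) : S *m toC X *m S' = D -> toC X = invmx S *m D *m invmx S'.
  by move=> <-; rewrite -!mulmxA mulKmx // mulmxV // mulmx1.
have [w ew] : {w | toC d *m invmx S = w} by eexists.
have ws : invmx S' *m toC d^T = map_mx Num.conj w^T.
  rewrite -ew trmx_mul map_mxM /= /S' -map_invmx trmx_inv; congr (_ *m _).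
  by apply/matrixP => i j; rewrite !mxE conjC_real.
pose c i := complex.Re (w 0 i * Num.conj (w 0 i)).
have cE i : (c i)%:C%C = w 0 i * Num.conj (w 0 i).
  by apply: RRe_real; rewrite ger0_real // mul_conjC_ge0.
have c0 i : 0 <= c i by rewrite -lecR cE mul_conjC_ge0.
pose Q i := \prod_(k < n | k != i) (1 + l 0 k *: 'X : {poly R}).
have QE i : Q i = \prod_(x <- [seq l 0 k | k <- [seq k <- index_enum 'I_n | k != i]]) (1 + x *: 'X).
  by rewrite big_map big_filter.
have szi i : size [seq l 0 k | k <- [seq k <- index_enum 'I_n | k != i]] = n.-1.
  rewrite size_map size_filter -[in RHS](card_ord n) -(cardC1 i) -sum1_count -sum1_card.
  by apply: eq_bigl => k; rewrite inE.
have hl i x : x \in [seq l 0 k | k <- [seq k <- index_enum 'I_n | k != i]] -> 0 < x.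
  by move=> /mapP[k _ ->].
have hQ i := prod_lin_coef (hl i).
have detA0 := posdef_det pA.
have mixE : qf B d = \sum_i c i * l 0 i.
  apply: (@complexI R); rewrite rmorph_sum /=.
  have -> : (qf B d)%:C%C = (toC (d *m B *m d^T)) 0 0 by rewrite [RHS]mxE.
  rewrite !map_mxM (KD _ _ SB) !mulmxA ew -mulmxA ws !mxE.
  apply: eq_bigr => i _; rewrite mul_mx_diag !mxE rmorphM /= cE.
  by rewrite mulrAC.
have n0 (i : 'I_n) : (0 < n)%N by exact: leq_ltn_trans (ltn_ord i).
exists (\det A *: ('X * \sum_i (c i * l 0 i) *: Q i)); split.
- apply: leq_trans (size_scale_leq _ _) _.
  have hs : (size (\sum_i (c i * l 0 i) *: Q i)%R <= n)%N.
    apply: leq_trans (size_sum _ _ _) _; apply/bigmax_leqP => i _.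
    apply: leq_trans (size_scale_leq _ _) _.
    by have [+ _] := hQ i; rewrite -QE szi prednK // (n0 i).
  apply: leq_trans (size_polyMleq _ _) _; rewrite size_polyX -subn1 leq_subLR.
  exact: leq_add (leqnn 2) hs.
- move=> m m0.
  have lm i : 0 < 1 + m * l 0 i by rewrite ltr_wpDr ?mulr_ge0 // ltW.
  pose D := diag_mx (\row_i ((1 + m * l 0 i)%:C%C : C)).
  have SM : S *m toC (A + m *: B) *m S' = D.
    rewrite map_mxD map_mxZ mulmxDr mulmxDl SA -scalemxAr -scalemxAl SB.
    apply/matrixP => i j; rewrite !mxE rmorphD rmorphM rmorph1 /=.
    by case: eqP => _; rewrite ?mulr1n // !mulr0n mulr0 addr0.
  have uM : A + m *: B \in unitmx by apply/posdef_unit/posdefDZ.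
  pose Di := diag_mx (\row_i ((1 + m * l 0 i)^-1%:C%C : C)).
  have DDi : D *m Di = 1%:M.
    rewrite mulmx_diag -diag_const_mx; congr diag_mx; apply/rowP => i; rewrite !mxE.
    by rewrite -rmorphM /= divff ?rmorph1 // gt_eqF.
  have iM : toC (invmx (A + m *: B)) = S' *m Di *m S.
    have : toC (A + m *: B) *m (S' *m Di *m S) = 1%:M.
      rewrite (KD _ _ SM) !mulmxA -(mulmxA _ (invmx S')) mulVmx // mulmx1.
      by rewrite -(mulmxA _ D) DDi mulmx1 mulVmx.
    move=> E; rewrite map_invmx -[RHS](@mulKmx _ _ _ (toC (A + m *: B))) ?map_unitmx //.
    by rewrite E mulmx1.
  have detM : \det (A + m *: B) = \det A * \prod_i (1 + m * l 0 i).
    have h1 := congr1 determinant SA; have h2 := congr1 determinant SM.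
    rewrite !det_mulmx det1 in h1; rewrite !det_mulmx det_diag in h2.
    apply: (@complexI R); rewrite rmorphM rmorph_prod /=.
    have eP : \prod_i ((1 + m * l 0 i)%:C%C : C) = \prod_i (\row_i ((1 + m * l 0 i)%:C%C : C)) 0 i.
      by apply: eq_bigr => i _; rewrite mxE.
    have h1' : \det S * (\det A)%:C%C * \det S' = 1 :> C by rewrite -[RHS]h1 toC_det.
    have h2' : \det S * (\det (A + m *: B))%:C%C * \det S' = \prod_i (\row_i ((1 + m * l 0 i)%:C%C : C)) 0 i :> C.
      by rewrite -[RHS]h2 toC_det.
    rewrite eP -h2' -[LHS]mul1r -h1'.
    move: ((\det A)%:C%C : C) ((\det (A + m *: B))%:C%C : C) (\det S) (\det S') => dA dM dS dS'.
    by ring.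
  have mE : (d *m B *m invmx (A + m *: B) *m A *m d^T) 0 0 =
      \sum_i c i * l 0 i / (1 + m * l 0 i).
    apply: (@complexI R); rewrite rmorph_sum /=.
    set X := d *m B *m _ *m A *m d^T.
    have -> : (X 0 0)%:C%C = (toC X) 0 0 by rewrite [RHS]mxE.
    rewrite /X !map_mxM iM (KD _ _ SB) (KD _ _ SA) mulmx1 !mulmxA ew.
    rewrite -(mulmxA _ (invmx S') S') mulVmx // mulmx1 -(mulmxA _ S (invmx S)) mulmxV // mulmx1.
    rewrite -mulmxA ws !mxE; apply: eq_bigr => i _; rewrite !mul_mx_diag !mxE !rmorphM /= cE.
    by ring.
  rewrite hornerZ hornerM hornerX horner_sum mE detM -mulrA; congr (_ * _).
  rewrite mulrCA; congr (_ * _); rewrite mulr_sumr; apply: eq_bigr => i _.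
  rewrite hornerZ /Q horner_prod [in RHS](bigD1 i) //=.
  have -> : \prod_(k < n | k != i) (1 + l 0 k *: 'X).[m] = \prod_(k < n | k != i) (1 + m * l 0 k).
    by apply: eq_bigr => k _; rewrite !hornerE mulrC.
  by field; rewrite gt_eqF.
- move=> q; rewrite coefZ coefXM; case: eqP => _; first by rewrite mulr0.
  rewrite mulr_ge0 ?(ltW detA0) // coef_sum sumr_ge0 // => i _.
  by rewrite coefZ mulr_ge0 ?mulr_ge0 ?(ltW (l0 i)) // QE; case: (hQ i) => _ /(_ q.-1)[].
- move=> q /andP[q1 qn]; rewrite coefZ coefXM gtn_eqF // => /eqP.
  rewrite mulf_eq0 gt_eqF //= coef_sum => /eqP h.
  (* [Q i] has degree n - 1 and positive coefficients in all degrees up to n - 1; the factor 'X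
     shifts this range to 1 <= q <= n. *)
  have hi i : 0 < (Q i)`_q.-1.
    by have [_ /(_ q.-1)[_ ]] := hQ i; rewrite -QE szi; apply; rewrite -ltnS !prednK // (n0 i).
  have w0 : w = 0.
    apply/rowP => i; rewrite mxE.
    have /allP/(_ i) : all (fun i => xpredT i ==> (((c i * l 0 i) *: Q i)`_q.-1 == 0)) (index_enum 'I_n).
      move/eqP: h; rewrite psumr_eq0 // => j _; rewrite coefZ mulr_ge0 ?mulr_ge0 ?(ltW (l0 j)) //.
      exact: ltW.
    rewrite mem_index_enum coefZ => /(_ isT) /=.
    rewrite !mulf_eq0 !(gt_eqF (l0 i)) (gt_eqF (hi i)) !orbF => /eqP ci.
    by have /esym/eqP := cE i; rewrite ci rmorph0 mul_conjC_eq0 => /eqP.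
  have : toC d = 0 by rewrite -[LHS](mulmxKV uS) ew w0 mul0mx.
  move=> /rowP d0; apply/rowP => i; have := d0 i; rewrite !mxE.
  by move=> /(@complexI R) ->.
- rewrite coefZ coefXM /= coef_sum mixE; congr (_ * _); apply: eq_bigr => i _.
  rewrite coefZ -[RHS]mulr1; congr (_ * _); rewrite -horner_coef0 /Q horner_prod big1 // => k _.
  by rewrite !hornerE.
Qed.

End PositiveDefinite.

(** * Coefficients of a polynomial from its values *)

Section Interpolation.
Context {R : realType}.

(* The inverse Vandermonde matrix recovers the coefficients of a polynomial of degree < d from its values at
   0, ..., d - 1. *)
Definition interp_weight (d q : nat) (k : 'I_d) : R :=
  if insub q is Some q' then (invmx (Vandermonde d (\row_(j < d) (j%:R : R)))) k q' else 0.

Lemma coef_interp d q (p : {poly R}) : (size p <= d)%N -> (q < d)%N ->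
  \sum_(k < d) interp_weight q k * p.[k%:R] = p`_q.
Proof.
move=> sp qd; rewrite /interp_weight insubT /=.
set V := Vandermonde d _.
have uV : V \in unitmx.
  rewrite unitmxE det_Vandermonde unitfE; apply/prodf_neq0 => i _; apply/prodf_neq0 => j ij.
  by rewrite !mxE subr_eq0 eqr_nat gtn_eqF.
pose c : 'rV[R]_d := \row_i p`_i.
have E : c = (\row_k p.[k%:R]) *m invmx V.
  rewrite -[LHS](mulmxK uV); congr (_ *m _); apply/rowP => k; rewrite !mxE.
  rewrite (horner_coef_wide _ sp); apply: eq_bigr => i _; rewrite !mxE //.
have /rowP/(_ (Ordinal qd)) := E; rewrite [in LHS]mxE /= => ->.
by rewrite mxE; apply: eq_bigr => k _; rewrite mxE mulrC.
Qed.

Lemma size_prod_lin n (F : 'I_n -> {poly R}) :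
  (forall i, (size (F i) <= 2)%N) -> (size (\prod_i F i)%R <= n.+1)%N.
Proof.
elim: n F => [F _|n IH F h]; first by rewrite big_ord0 size_poly1.
rewrite big_ord_recl; apply: leq_trans (size_polyMleq _ _) _.
rewrite -subn1 leq_subLR; apply: leq_add (h _) (IH _ _) => i; exact: h.
Qed.

Lemma size_det_lin n (A B : 'M[R]_n) :
  (size (\det (map_mx polyC A + 'X *: map_mx polyC B)) <= n.+1)%N.
Proof.
rewrite /determinant; apply: leq_trans (size_sum _ _ _) _; apply/bigmax_leqP => s _.
rewrite -signr_odd; case: (odd _); rewrite ?expr0 ?expr1 ?mulN1r ?mul1r ?size_polyN;
  apply: size_prod_lin => i; rewrite !mxE; apply: leq_trans (size_polyD _ _) _;
  rewrite geq_max (leq_trans (size_polyC_leq1 _)) //=;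
  apply: leq_trans (size_polyMleq _ _) _; rewrite size_polyX -subn1 leq_subLR;
  exact: leq_add (leqnn 2) (size_polyC_leq1 _).
Qed.

Lemma horner_det_lin n (A B : 'M[R]_n) m :
  (\det (map_mx polyC A + 'X *: map_mx polyC B)).[m] = \det (A + m *: B).
Proof.
rewrite -horner_evalE -det_map_mx; congr (\det _); apply/matrixP => i j.
by rewrite !mxE /= horner_evalE !hornerE.
Qed.

End Interpolation.

(** * Divergence identities in space-time *)

Section SpaceTime.
Context {R : realType} {n : nat}.
Implicit Types (D : set 'rV[R]_(1 + n)) (x : 'rV[R]_(1 + n)).

Definition tix : 'I_(1 + n) := lshift n ord0.
Definition xix (i : 'I_n) : 'I_(1 + n) := rshift 1 i.
Definition dt (f : 'rV[R]_(1 + n) -> R) x : R := partial tix f x.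
Definition dx i (f : 'rV[R]_(1 + n) -> R) x : R := partial (xix i) f x.

Definition spacetime_div (W0 : 'rV[R]_(1 + n) -> R) (W : 'I_n -> 'rV[R]_(1 + n) -> R) x : R :=
  dt W0 x + \sum_i dx i (W i) x.

Lemma trace_entries m p (A : 'M[R]_(m, p)) (B : 'M[R]_(p, m)) :
  \tr (A *m B) = \sum_i \sum_j A i j * B j i.
Proof. by apply: eq_bigr => i _; rewrite mxE. Qed.

Lemma dot_entries (g h : 'rV[R]_n) : \sum_i g 0 i * h 0 i = (h *m g^T) 0 0.
Proof. by rewrite mxE; apply: eq_bigr => i _; rewrite mxE mulrC. Qed.

(** T stands for the array of third derivatives of a potential, and [hT] exchanges the direction of
    differentiation with the row index. *)
Lemma symmetric3_trace (h : 'rV[R]_n) (B : 'M[R]_n) (T : 'I_n -> 'M[R]_n) :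
  (forall k i j, T k i j = T i k j) ->
  \sum_i \tr (B *m T i) * h 0 i = \sum_i (h *m T i *m B) 0 i.
Proof.
move=> hT.
transitivity (\sum_i \sum_k \sum_l h 0 i * (T i k l * B l k)).
  apply: eq_bigr => i _; rewrite mulrC mxtrace_mulC trace_entries mulr_sumr.
  by apply: eq_bigr => k _; rewrite mulr_sumr.
rewrite exchange_big /=.
transitivity (\sum_k \sum_l \sum_i h 0 i * (T i k l * B l k)).
  by apply: eq_bigr => k _; rewrite exchange_big.
apply: eq_bigr => k _; rewrite mxE; apply: eq_bigr => l _.
rewrite mxE mulr_suml; apply: eq_bigr => i _.
by rewrite hT mulrA.
Qed.

(** Think of M as the Hessian of phi and of g as the gradient of phi_t. Then det M and - det M g
    M^-1 are cofactors in one row of the space-time Hessian, and cofactors of a Hessian are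
    divergence-free (Piola's identity). Hence only the derivatives of F survive; phi_tt never
    occurs. *)
Lemma cofactor_divergence D F M (g : 'rV[R]_(1 + n) -> 'rV[R]_n) x :
  open D -> C1on D F -> C1mx D M -> C1mx D g -> D x ->
  M x \in unitmx ->
  (forall i j, dt (fun y => M y i j) x = dx i (fun y => g y 0 j) x) ->
  (forall k i j, dx k (fun y => M y i j) x = dx i (fun y => M y k j) x) ->
  spacetime_div (fun y => F y * \det (M y))
     (fun i y => - (F y * \det (M y) * (g y *m invmx (M y)) 0 i)) x
  = \det (M x) * (dt F x - \sum_i dx i F x * (g x *m invmx (M x)) 0 i).
Proof.
move=> oD cF cM cg Dx uM hMt hT.
have dM k := C1mx_is_derive k cM Dx.
have dg k := C1mx_is_derive k cg Dx.
have dF k := C1on_partial k cF Dx.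
have ddet k := is_derive_det uM (dM k).
have dinv k := is_derive_invmx uM (dM k).
set Mi := invmx (M x) in ddet dinv *.
set h := g x *m Mi; set J := \det (M x) in ddet *.
have dW0 : dt (fun y => F y * \det (M y)) x = dt F x * J + F x * (J * \tr (Mi *m partial_mx tix M x)).
  by apply: partial_val; apply: is_deriveMp (dF tix) (ddet tix).
have dWi i : dx i (fun y => - (F y * \det (M y) * (g y *m invmx (M y)) 0 i)) x =
  - ((dx i F x * J + F x * (J * \tr (Mi *m partial_mx (xix i) M x))) * h 0 i +
     F x * J * ((partial_mx (xix i) g x *m Mi) 0 i - (h *m partial_mx (xix i) M x *m Mi) 0 i)).
  apply: partial_val; apply: is_deriveNp; apply: is_deriveMp.
    by apply: is_deriveMp (dF _) (ddet _).
  have /is_derive_mxP/(_ 0 i) := is_derive_mulmx (dg (xix i)) (dinv (xix i)).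
  by rewrite mulmxN !mulmxA -/h [X in is_derive _ _ _ X]mxE [X in is_derive _ _ _ (_ + X)]mxE.
rewrite /spacetime_div dW0 (eq_bigr _ (fun i _ => dWi i)).
have S2 : \sum_i (partial_mx (xix i) g x *m Mi) 0 i = \tr (Mi *m partial_mx tix M x).
  rewrite trace_entries exchange_big /=; apply: eq_bigr => i _; rewrite mxE.
  by apply: eq_bigr => j _; rewrite !mxE -/(dt _ x) hMt mulrC.
have S3 : \sum_i \tr (Mi *m partial_mx (xix i) M x) * h 0 i =
          \sum_i (h *m partial_mx (xix i) M x *m Mi) 0 i.
  by apply: symmetric3_trace => k i j; rewrite !mxE; exact: hT.
clearbody J h.
transitivity (dt F x * J + F x * (J * \tr (Mi *m partial_mx tix M x))
   - (J * (\sum_i dx i F x * h 0 i) + F x * J * (\sum_i \tr (Mi *m partial_mx (xix i) M x) * h 0 i)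
   + F x * J * (\sum_i (partial_mx (xix i) g x *m Mi) 0 i - \sum_i (h *m partial_mx (xix i) M x *m Mi) 0 i))).
  congr (_ + _); rewrite -sumrB !mulr_sumr -!big_split -sumrN /=.
  by apply: eq_bigr => i _; ring.
by rewrite S2 S3; ring.
Qed.

(** The case where F plays the role of phi_t, so that its gradient is g: the right side is the
    determinant of the space-time Hessian of phi, written with a Schur complement, where e stands
    for phi_tt. *)
Lemma spacetime_divergence D F M (g : 'rV[R]_(1 + n) -> 'rV[R]_n) e x :
  open D -> C1on D F -> C1mx D M -> C1mx D g -> D x ->
  M x \in unitmx -> dt F x = e -> (forall i, dx i F x = g x 0 i) ->
  (forall i j, dt (fun y => M y i j) x = dx i (fun y => g y 0 j) x) ->
  (forall k i j, dx k (fun y => M y i j) x = dx i (fun y => M y k j) x) ->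
  spacetime_div (fun y => F y * \det (M y))
     (fun i y => - (F y * \det (M y) * (g y *m invmx (M y)) 0 i)) x
  = \det (M x) * (e - (g x *m invmx (M x) *m (g x)^T) 0 0).
Proof.
move=> oD cF cM cg Dx uM hFt hFx hMt hT; rewrite (cofactor_divergence oD) // hFt -dot_entries.
by under eq_bigr do rewrite hFx.
Qed.

(* f = phi_t, A = Hess phi and A d = - grad phi_t for a solution phi of the homogeneous Monge-Ampere equation
   phi_tt = <A^-1 grad phi_t, grad phi_t>; phi itself is not needed. *)
Record hma D (f : 'rV[R]_(1 + n) -> R) (A : 'rV[R]_(1 + n) -> 'M[R]_n)
    (d : 'rV[R]_(1 + n) -> 'rV[R]_n) : Prop := Hma {
  hma_f : C1on D f; hma_A : C1mx D A; hma_d : C1mx D d;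
  hma_pd : forall x, D x -> posdef (A x);
  hma_ft : forall x, D x -> dt f x = qf (A x) (d x);
  hma_fx : forall i x, D x -> dx i f x = - (d x *m A x) 0 i;
  hma_T : forall k i j x, D x -> dx k (fun y => A y i j) x = dx i (fun y => A y k j) x;
  hma_At : forall i j x, D x -> dt (fun y => A y i j) x = - dx i (fun y => (d y *m A y) 0 j) x
}.

(** Density and, below, flux of [spacetime_divergence] for phi_0 + m phi_1. The flux has a plus sign
    because grad f = - A d. *)
Definition mixed0 (f0 f1 : 'rV[R]_(1 + n) -> R) (A0 A1 : 'rV[R]_(1 + n) -> 'M[R]_n) (m : R) x : R :=
  (f0 x + m * f1 x) * \det (A0 x + m *: A1 x).

Definition mixedi (f0 f1 : 'rV[R]_(1 + n) -> R) (A0 A1 : 'rV[R]_(1 + n) -> 'M[R]_n)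
    (d0 d1 : 'rV[R]_(1 + n) -> 'rV[R]_n) (m : R) i x : R :=
  mixed0 f0 f1 A0 A1 m x *
    ((d0 x *m A0 x + m *: (d1 x *m A1 x)) *m invmx (A0 x + m *: A1 x)) 0 i.

Lemma C1_mixed0 D f0 f1 A0 A1 d0 d1 m : open D -> hma D f0 A0 d0 -> hma D f1 A1 d1 ->
  C1on D (mixed0 f0 f1 A0 A1 m).
Proof.
move=> oD h0 h1; apply: C1on_mul => //.
  by apply: C1on_add (hma_f h0) _ => //; apply: C1on_mul (hma_f h1) => //; exact: C1on_cst.
apply: C1on_det => //; apply: C1mx_add (hma_A h0) _ => //.
by apply: C1mx_scale (hma_A h1) => //; exact: C1on_cst.
Qed.

Lemma C1_mixedi D f0 f1 A0 A1 d0 d1 m i : open D -> 0 <= m -> hma D f0 A0 d0 -> hma D f1 A1 d1 ->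
  C1on D (mixedi f0 f1 A0 A1 d0 d1 m i).
Proof.
move=> oD m0 h0 h1; apply: C1on_mul => //; first exact: C1_mixed0 h0 h1.
have cA : C1mx D (fun x => A0 x + m *: A1 x).
  apply: C1mx_add (hma_A h0) _ => //.
  exact: C1mx_scale oD (C1on_cst m oD) (hma_A h1).
have uA x : D x -> A0 x + m *: A1 x \in unitmx.
  by move=> Dx; exact: posdef_unit (posdefDZ m0 (hma_pd h0 Dx) (hma_pd h1 Dx)).
have cg0 := C1mx_mul oD (hma_d h0) (hma_A h0).
have cg1 := C1mx_mul oD (hma_d h1) (hma_A h1).
have := C1mx_mul oD (C1mx_add oD cg0 (C1mx_scale oD (C1on_cst m oD) cg1)) (C1mx_inv oD uA cA).
by move/(_ 0 i).
Qed.

(** Each potential solves the homogeneous equation, so the space-time determinant of phi_0 + m phi_1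
    is exactly the defect computed in [mixed_schur]. *)
Lemma mixed_divergence D f0 f1 A0 A1 d0 d1 m x : open D -> 0 <= m ->
  hma D f0 A0 d0 -> hma D f1 A1 d1 -> D x ->
  spacetime_div (mixed0 f0 f1 A0 A1 m) (mixedi f0 f1 A0 A1 d0 d1 m) x =
  \det (A0 x + m *: A1 x) *
    (m * ((d0 x - d1 x) *m A1 x *m invmx (A0 x + m *: A1 x) *m A0 x *m (d0 x - d1 x)^T) 0 0).
Proof.
move=> oD m0 h0 h1 Dx.
pose F y := f0 y + m * f1 y; pose M y := A0 y + m *: A1 y.
pose g y := - (d0 y *m A0 y + m *: (d1 y *m A1 y)).
have cmul (f : 'rV[R]_(1 + n) -> R) : C1on D f -> C1on D (fun y => m * f y).
  by move=> cf; apply: C1on_mul cf => //; exact: C1on_cst.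
have cF : C1on D F by apply: C1on_add (hma_f h0) _ => //; exact: cmul (hma_f h1).
have cM : C1mx D M := C1mx_add oD (hma_A h0) (C1mx_scale oD (C1on_cst m oD) (hma_A h1)).
have cg0 := C1mx_mul oD (hma_d h0) (hma_A h0).
have cg1 := C1mx_mul oD (hma_d h1) (hma_A h1).
have cg : C1mx D g := C1mx_opp oD (C1mx_add oD cg0 (C1mx_scale oD (C1on_cst m oD) cg1)).
have pM : posdef (M x).
  by apply: posdefDZ => //; [exact: hma_pd h0 _ Dx|exact: hma_pd h1 _ Dx].
have lin (k : 'I_(1 + n)) (a b : 'rV[R]_(1 + n) -> R) : C1on D a -> C1on D b ->
    partial k (fun y => a y + m * b y) x = partial k a x + m * partial k b x.
  move=> ca cb; apply: partial_val; apply: is_deriveDp; first exact: C1on_partial Dx.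
  apply: is_derive_eqfun (is_deriveMp (is_derive_cst m x _) (C1on_partial k cb Dx)) => //.
  by rewrite mul0r add0r.
have := @spacetime_divergence D F M g (qf (A0 x) (d0 x) + m * qf (A1 x) (d1 x)) x oD cF cM cg Dx (posdef_unit pM).
set S1 := spacetime_div _ _ x; set S2 := spacetime_div _ _ x.
have -> : S2 = S1.
  rewrite /S1 /S2; congr (spacetime_div _ _ x).
  apply/funext => i; apply/funext => y.
  by rewrite /mixedi /mixed0 /g mulNmx [X in - (_ * X)]mxE mulrN opprK.
move=> ->.
- congr (_ * _); have := @mixed_schur R n (A0 x) (A1 x) (d0 x) (d1 x) m.
  move=> /(_ (posdef_sym (hma_pd h0 Dx)) (posdef_sym (hma_pd h1 Dx)) (posdef_unit pM)) /= <-.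
  by rewrite /g mulNmx linearN /= mulmxN mulNmx opprK.
- rewrite -(hma_ft h0 Dx) -(hma_ft h1 Dx) /dt; exact: lin (hma_f h0) (hma_f h1).
- move=> i; rewrite /dx (lin _ _ _ (hma_f h0) (hma_f h1)) -!/(dx i _ x).
  rewrite (hma_fx h0 i Dx) (hma_fx h1 i Dx) /g [RHS]mxE [in RHS]mxE [X in - (_ + X)]mxE.
  by ring.
- move=> i j.
  have -> : (fun y => M y i j) = (fun y => A0 y i j + m * A1 y i j) by apply/funext => y; rewrite !mxE.
  rewrite /dt lin; [|exact: (hma_A h0)|exact: (hma_A h1)].
  rewrite -!/(dt _ x) (hma_At h0) // (hma_At h1) //.
  have -> : (fun y => g y 0 j) = (fun y => - ((d0 y *m A0 y) 0 j + m * (d1 y *m A1 y) 0 j)).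
    by apply/funext => y; rewrite /g 2!mxE [X in - (_ + X)]mxE.
  rewrite [RHS](partial_val (is_deriveNp (partialP _))); last first.
    by have [_ /(_ (xix i))[]] := C1on_add oD (cg0 0 j) (cmul _ (cg1 0 j)) Dx.
  by rewrite lin; [rewrite /dx; ring|exact: cg0|exact: cg1].
- move=> k i j.
  have E a b : (fun y => M y a b) = (fun y => A0 y a b + m * A1 y a b) by apply/funext => y; rewrite !mxE.
  rewrite !E /dx !lin; try exact: (hma_A h0); try exact: (hma_A h1).
  by rewrite -!/(dx _ _ x) (hma_T h0 k) // (hma_T h1 k).
Qed.

(** The determinant of A is transported by d as a mass density, so the divergence reduces to the
    material derivative of s. *)
Lemma mass_transport D f A d (s : 'rV[R]_(1 + n) -> R) x : open D -> hma D f A d ->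
  C1on D s -> D x ->
  spacetime_div (fun y => \det (A y) * s y) (fun i y => \det (A y) * d y 0 i * s y) x
  = \det (A x) * (dt s x + \sum_i d x 0 i * dx i s x).
Proof.
move=> oD h cs Dx.
have uA := posdef_unit (hma_pd h Dx).
have dA k := C1mx_is_derive k (hma_A h) Dx.
have dd k := C1mx_is_derive k (hma_d h) Dx.
have ddet k := is_derive_det uA (dA k).
have ds k := C1on_partial k cs Dx.
set J := \det (A x) in ddet *; set Ai := invmx (A x) in ddet *.
have E0 : dt (fun y => \det (A y) * s y) x = J * \tr (Ai *m partial_mx tix A x) * s x + J * dt s x.
  by apply: partial_val; exact: is_deriveMp (ddet tix) (ds tix).
pose E : 'M[R]_n := \matrix_(i, l) dx i (fun y => d y 0 l) x.
have Ei i : dx i (fun y => \det (A y) * d y 0 i * s y) x =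
  (J * \tr (Ai *m partial_mx (xix i) A x) * d x 0 i + J * E i i) * s x
   + J * d x 0 i * dx i s x.
  rewrite [E i i]mxE; apply: partial_val.
  exact: is_deriveMp (is_deriveMp (ddet _) (C1on_partial (xix i) (hma_d h 0 i) Dx)) (ds _).
rewrite /spacetime_div E0 (eq_bigr _ (fun i _ => Ei i)).
(* The evolution equation of A, with the derivatives of A rearranged by the symmetry of third
   derivatives. Its trace against A^-1 is the continuity equation for the determinant. *)
have At : partial_mx tix A x = - (E *m A x + \sum_l d x 0 l *: partial_mx (xix l) A x).
  apply/matrixP => i j; rewrite mxE -/(dt _ x) (hma_At h i j Dx) [RHS]mxE; congr (- _).
  have dg := is_derive_mulmx (dd (xix i)) (dA (xix i)).
  rewrite /dx (partial_val ((is_derive_mxP _ _ _ _).1 dg 0 j)) [LHS]mxE [RHS]mxE.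
  congr (_ + _); first by rewrite !mxE; apply: eq_bigr => l _; rewrite !mxE.
  rewrite mxE summxE; apply: eq_bigr => l _; rewrite !mxE; congr (_ * _).
  exact: hma_T h i l j _ Dx.
have key : \tr (Ai *m partial_mx tix A x) = - (\tr E + \sum_l d x 0 l * \tr (Ai *m partial_mx (xix l) A x)).
  rewrite At mulmxN raddfN mulmxDr raddfD /= mulmxA mxtrace_mulC mulmxA mulmxV // mul1mx.
  congr (- (_ + _)); rewrite mulmx_sumr raddf_sum; apply: eq_bigr => l _ /=.
  by rewrite -scalemxAr mxtraceZ.
rewrite key; clearbody J Ai E.
transitivity (J * dt s x + (\sum_i (- (J * (E i i
   + d x 0 i * \tr (Ai *m partial_mx (xix i) A x)) * s x) +
   ((J * \tr (Ai *m partial_mx (xix i) A x) * d x 0 i + J * E i i) * s x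
   + J * d x 0 i * dx i s x)))).
  rewrite [in RHS]big_split /=.
  rewrite [X in _ = _ + (X + _)](_ : _ = - (J * (\tr E + \sum_l d x 0 l * \tr (Ai *m partial_mx (xix l) A x)) * s x)).
    by ring.
  by rewrite sumrN -mulr_suml -mulr_sumr big_split.
rewrite mulrDr mulr_sumr; congr (_ + _); apply: eq_bigr => i _; ring.
Qed.

End SpaceTime.

(** * Convex functions *)

Section Convex.
Context {R : realType} {n : nat}.
Implicit Types (u : 'rV[R]_n -> R) (x y v w : 'rV[R]_n).

Definition grad u x : 'rV[R]_n := \row_i partial i u x.
Definition hess u x : 'M[R]_n := \matrix_(i, j) partial i (partial j u) x.
Definition dot (v w : 'rV[R]_n) : R := (v *m w^T) 0 0.

Lemma dotE v w : dot v w = \sum_i v 0 i * w 0 i.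
Proof. by rewrite /dot mxE; apply: eq_bigr => i _; rewrite mxE. Qed.

Lemma dotC v w : dot v w = dot w v.
Proof. by rewrite !dotE; apply: eq_bigr => i _; rewrite mulrC. Qed.

Lemma dotDl v w z : dot (v + w) z = dot v z + dot w z.
Proof. by rewrite /dot mulmxDl mxE. Qed.

Lemma dotNl v z : dot (- v) z = - dot v z.
Proof. by rewrite /dot mulNmx mxE. Qed.

Lemma dotZl c v z : dot (c *: v) z = c * dot v z.
Proof. by rewrite /dot -scalemxAl mxE. Qed.

Lemma dotBl v w z : dot (v - w) z = dot v z - dot w z.
Proof. by rewrite dotDl dotNl. Qed.

Lemma dotDr v w z : dot z (v + w) = dot z v + dot z w.
Proof. by rewrite dotC dotDl !(dotC z). Qed.

Lemma dotNr v z : dot z (- v) = - dot z v.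
Proof. by rewrite dotC dotNl (dotC z). Qed.

Lemma dotZr c v z : dot z (c *: v) = c * dot z v.
Proof. by rewrite dotC dotZl (dotC z). Qed.

Lemma dotBr v w z : dot z (v - w) = dot z v - dot z w.
Proof. by rewrite dotDr dotNr. Qed.

Lemma dot_ge0 v : 0 <= dot v v.
Proof. by rewrite dotE; apply: sumr_ge0 => i _; rewrite -expr2 sqr_ge0. Qed.

Lemma dot_delta v i : dot v (delta_mx 0 i) = v 0 i.
Proof.
rewrite dotE (bigD1 i) //= mxE !eqxx mulr1 big1 ?addr0 // => j ji.
by rewrite mxE eqxx (negbTE ji) mulr0.
Qed.

Lemma dot_norm_le v w : `|dot v w| <= n%:R * (`|v| * `|w|).
Proof.
rewrite dotE; apply: le_trans (ler_norm_sum _ _ _) _.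
rewrite mulr_natl -[X in _ *+ X]card_ord -sumr_const; apply: ler_sum => i _.
by rewrite normrM ler_pM // coord_le_norm.
Qed.

Lemma norm_sq_le_dot v : `|v| ^+ 2 <= dot v v.
Proof.
have h j : v 0 j ^+ 2 <= dot v v.
  rewrite dotE (bigD1 j) //= -expr2 lerDl sumr_ge0 // => i _.
  by rewrite -expr2 sqr_ge0.
have H : `|v| <= Num.sqrt (dot v v).
  by apply: (row_norm_le v (sqrtr_ge0 _)).2 => j; rewrite -sqrtr_sqr ler_sqrt ?dot_ge0.
by rewrite -(sqr_sqrtr (dot_ge0 v)) ler_pXn2r ?nnegrE // sqrtr_ge0.
Qed.

Lemma Ck_weak m (f : 'rV[R]_n -> R) : Ck m.+1 f -> Ck m f.
Proof.
elim: m f => [|m IH] f [cf h]; split=> // j; have [d k] := h j.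
by split=> //; exact: IH.
Qed.

Lemma Ck_le m k (f : 'rV[R]_n -> R) : (m <= k)%N -> Ck k f -> Ck m f.
Proof.
by move=> /subnK <-; elim: (k - m)%N => // l IH; rewrite addSn => /Ck_weak.
Qed.

Lemma Ck_partial m j (f : 'rV[R]_n -> R) : Ck m.+1 f -> Ck m (partial j f).
Proof. by case=> _ /(_ j)[]. Qed.

Lemma Ck_C1on m (f : 'rV[R]_n -> R) : Ck m.+1 f -> C1on setT f.
Proof.
move=> [cf h] x _; split; first exact: cf.
by move=> j; have [d k] := h j; split=> //; case: m k {h} => [|m] [c _]; exact: c.
Qed.

Lemma Ck_is_derive m (f : 'rV[R]_n -> R) x j : Ck m.+1 f ->
  is_derive x (delta_mx 0 j) f (partial j f x).
Proof. by move=> /Ck_C1on h; exact: C1on_partial h I. Qed.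

Lemma hess_sym u x : Ck 2 u -> (hess u x)^T = hess u x.
Proof.
move=> cu; apply/matrixP => i j; rewrite !mxE.
apply: (@schwarz _ _ setT) => //; first exact: openT.
- exact: Ck_C1on cu.
- exact: Ck_C1on (Ck_partial j cu).
- exact: Ck_C1on (Ck_partial i cu).
Qed.

Lemma grad_is_derive u x v : Ck 1 u -> is_derive x v u (dot v (grad u x)).
Proof.
move=> cu; have := C1_chain openT (Ck_C1on cu) I (is_derive_id x v).
by apply: is_derive_eqfun => //; rewrite dotE; apply: eq_bigr => i _; rewrite mxE.
Qed.

Lemma grad_dot_is_derive u x v w : Ck 2 u ->
  is_derive x v (fun y => dot w (grad u y)) ((v *m hess u x *m w^T) 0 0).
Proof.
move=> cu.
have h : is_derive x v (fun y => \sum_i w 0 i * partial i u y)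
    (\sum_i w 0 i * (\sum_j v 0 j * partial j (partial i u) x)).
  apply: is_derive_suml => i _.
  have := is_deriveMp (is_derive_cst (w 0 i) x v) (C1_chain openT (Ck_C1on (Ck_partial i cu)) I (is_derive_id x v)).
  by apply: is_derive_eqfun => //; rewrite mul0r add0r.
apply: is_derive_eqfun h => [y|]; first by rewrite dotE; apply: eq_bigr => i _; rewrite mxE.
rewrite mxE; apply: eq_bigr => i _; rewrite mxE [w^T _ _]mxE mulrC; congr (_ * _).
by apply: eq_bigr => j _; rewrite mxE.
Qed.

Lemma grad_MVT u x v w : Ck 2 u ->
  exists2 t, 0 <= t <= 1 & dot w (grad u (v + x)) - dot w (grad u x) =
     (v *m hess u (t *: v + x) *m w^T) 0 0.
Proof.
move=> cu.
exact: (@line_MVT R _ (fun y => dot w (grad u y)) (fun t => (v *m hess u (t *: v + x) *m w^T) 0 0) x v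
  (fun t _ => grad_dot_is_derive _ v w cu)).
Qed.

Definition strictly_convex u := Ck 2 u /\ forall x, posdef (hess u x).

Lemma grad_monotone u x y : strictly_convex u -> y != x -> 0 < dot (y - x) (grad u y - grad u x).
Proof.
move=> [cu pu] yx; rewrite dotBr.
have [t _] := grad_MVT x (y - x) (y - x) cu; rewrite subrK => ->.
by apply: (pu _).2; rewrite subr_eq0.
Qed.

Lemma grad_monotone_le u x y : strictly_convex u -> 0 <= dot (y - x) (grad u y - grad u x).
Proof.
move=> su; have [->|yx] := eqVneq y x; first by rewrite !subrr dotE big1 // => i _; rewrite mxE mul0r.
exact/ltW/grad_monotone.
Qed.

Lemma grad_inj u x y : strictly_convex u -> grad u x = grad u y -> x = y.
Proof.
move=> su e; apply/eqP; apply: contraT => xy; have := grad_monotone su xy.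
by rewrite e subrr dotE big1 ?ltxx // => i _; rewrite [X in _ * X]mxE mulr0.
Qed.

Lemma convex_tangent u x y : strictly_convex u -> u x + dot (y - x) (grad u x) <= u y.
Proof.
move=> su; have [cu _] := su; have c1 := Ck_weak cu.
have [t /andP[t0 t1]] := @line_MVT R _ u (fun t => dot (y - x) (grad u (t *: (y - x) + x))) x (y - x)
  (fun t _ => grad_is_derive _ _ c1).
rewrite subrK => e; rewrite addrC -lerBrDr e -subr_ge0 -dotBr.
have [->|tn0] := eqVneq t 0; first by rewrite scale0r add0r subrr dotC dotE big1 // => i _; rewrite mxE mul0r.
have := grad_monotone_le x (t *: (y - x) + x) su; rewrite addrK dotZl pmulr_rge0 //.
by rewrite lt_neqAle eq_sym tn0.
Qed.

Lemma Ck_grad_cont u (x : 'rV[R]_n) : Ck 1 u -> {for x, continuous (grad u)}.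
Proof.
move=> [_ h]; apply: for_continuous_mx => i j.
have -> : (fun y => grad u y i j) = partial j u by apply/funext => y; rewrite mxE.
by have [_ [c _]] := h j; exact: c.
Qed.

Lemma Ck_hess_cont u (x : 'rV[R]_n) : Ck 2 u -> {for x, continuous (hess u)}.
Proof.
move=> [_ h]; apply: for_continuous_mx => i j.
have -> : (fun y => hess u y i j) = partial i (partial j u) by apply/funext => y; rewrite mxE.
by have [_ [_ /(_ i)[_ [c _]]]] := h j; exact: c.
Qed.

Lemma for_continuous_id (T : topologicalType) (x : T) : {for x, continuous (fun y : T => y)}.
Proof. exact: cvg_id. Qed.

Lemma for_continuous_cst (T U : topologicalType) (c : U) (x : T) :
  {for x, continuous (fun _ : T => c)}.
Proof. exact: cvg_cst. Qed.

Lemma for_continuous_coord (T : topologicalType) m p (f : T -> 'M[R]_(m, p)) i j (x : T) :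
  {for x, continuous f} -> {for x, continuous (fun y : T => f y i j)}.
Proof.
move=> cf.
exact: (@for_continuous_comp _ _ _ f (fun M : 'M[R]_(m, p) => M i j) x cf (@coord_continuous _ _ _ i j _)).
Qed.

Lemma norm_continuous_dot (T : topologicalType) (f g : T -> 'rV[R]_n) (x : T) :
  {for x, continuous f} -> {for x, continuous g} -> {for x, continuous (fun y : T => dot (f y) (g y))}.
Proof.
move=> cf cg.
have -> : (fun y : T => dot (f y) (g y)) = (fun y : T => \sum_i f y 0 i * g y 0 i).
  by apply/funext => y; rewrite dotE.
apply: for_continuous_sum => i _; apply: continuousM.
  exact: for_continuous_coord cf.
exact: for_continuous_coord cg.
Qed.

Lemma ball_row_compact (x : 'rV[R]_n) (r : R) : compact [set y : 'rV[R]_n | `|y - x| <= r].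
Proof.
apply: bounded_closed_compact.
  exists (`|x| + r); split; first by rewrite num_real.
  move=> M hM y /= hy; apply: le_trans (ltW hM); rewrite -(subrK x y) addrC.
  by apply: le_trans (ler_normD _ _) _; rewrite lerD2l.
have -> : [set y : 'rV[R]_n | `|y - x| <= r] = (fun y => `|y - x|) @^-1` [set z : R | z <= r] by [].
apply: preimage_closed; last exact: closed_le.
move=> y _; apply: (@for_continuous_comp _ _ _ (fun y => y - x) Num.norm); last exact: norm_continuous.
by apply: continuousB; [exact: for_continuous_id|exact: for_continuous_cst].
Qed.

(** On the compact unit sphere around x the radial increase of the gradient has a positive minimum
    k. Outside the unit ball two tangent inequalities are chained, from x to the sphere and from the
    sphere to w + x; inside it k |w| - k is negative and one tangent inequality is enough. *)
Lemma linear_growth u x : (0 < n)%N -> strictly_convex u ->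
  exists2 k, 0 < k & forall w, u x + dot w (grad u x) + k * `|w| - k <= u (w + x).
Proof.
move=> n0 su; have [cu pu] := su; have c1 := Ck_weak cu.
pose Sp := [set v : 'rV[R]_n | `|v| = 1].
have cS : compact Sp.
  apply: bounded_closed_compact.
    by exists 1; split; [rewrite num_real|move=> M /ltW hM y /= ->].
  have -> : Sp = (fun y => `|y|) @^-1` [set z : R | z = 1] by [].
  by apply: preimage_closed; [move=> y _; exact: norm_continuous|exact: closed_eq].
have nS : Sp !=set0.
  exists (delta_mx 0 (Ordinal n0)); rewrite /Sp /=; apply/eqP; rewrite eq_le; apply/andP; split.
    apply/row_norm_le => // j; rewrite mxE eqxx /=; case: (_ == _) => /=; rewrite ?normr1 ?normr0 //.
  by apply: le_trans (coord_le_norm _ (Ordinal n0)); rewrite mxE !eqxx normr1.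
pose g v := dot v (grad u (v + x) - grad u x).
have cg : continuous g.
  move=> v; apply: (@norm_continuous_dot _ (fun v => v) (fun v => grad u (v + x) - grad u x)).
    exact: for_continuous_id.
  apply: continuousB; last exact: for_continuous_cst.
  apply: (@for_continuous_comp _ _ _ (fun v => v + x) (grad u)); last exact: Ck_grad_cont.
  by apply: continuousD; [exact: for_continuous_id|exact: for_continuous_cst].
have [v0] := @EVT_min_rV R n g Sp nS cS (continuous_subspaceT cg).
rewrite inE => Sv0 hmin.
have gpos v : Sp v -> 0 < g v.
  move=> Sv; have := @grad_monotone u x (v + x) su; rewrite addrK; apply.
  by rewrite -subr_eq0 addrK -normr_eq0 Sv oner_eq0.
exists (g v0); first exact: gpos.
move=> w; have [w1|w1] := leP 1 `|w|; last first.
  apply: le_trans (_ : u x + dot w (grad u x) <= _); last first.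
    by have := convex_tangent x (w + x) su; rewrite addrK.
  by rewrite -addrA gerDl -{2}[g v0]mulr1 -mulrBr pmulr_rle0 ?gpos // subr_le0 ltW.
have w0 : `|w| != 0 by rewrite gt_eqF // (lt_le_trans ltr01).
pose v := `|w|^-1 *: w.
have Sv : Sp v by rewrite /Sp /= normrZ ger0_norm ?invr_ge0 // mulVf.
have ew : w = `|w| *: v by rewrite scalerA divff // scale1r.
have h1 := convex_tangent x (v + x) su; rewrite addrK in h1.
have h2 := convex_tangent (v + x) (w + x) su.
have e2 : w + x - (v + x) = (`|w| - 1) *: v by rewrite opprD addrACA subrr addr0 {1}ew scalerBl scale1r.
have h3 : g v0 <= g v by apply: hmin; rewrite inE.
rewrite e2 dotZl in h2; rewrite {2}/g dotBr in h3.
have -> : dot w (grad u x) = `|w| * dot v (grad u x) by rewrite {1}ew dotZl.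
have r0 : 0 <= `|w| - 1 by rewrite subr_ge0.
have h4 : (`|w| - 1) * (g v0 + dot v (grad u x)) <= (`|w| - 1) * dot v (grad u (v + x)).
  by apply: ler_wpM2l => //; rewrite -lerBrDr.
move: h1 h2 h4; move: (g v0) (dot v _) (dot v _) `|w| (u (v + x)) (u (w + x)) (u x).
move=> a b c e f1 f2 f3 h1 h2 h4; lra.
Qed.

Lemma coercive_critical (F : 'rV[R]_n -> R) (k C : R) : 0 < k -> Ck 1 F ->
  (forall d, k * `|d| - C <= F d) -> exists d, grad F d = 0.
Proof.
move=> k0 cF hF.
(* Beyond this radius the lower bound exceeds F 0, so the minimum over the ball is global. *)
pose r := (`|F 0| + `|C| + 1) / k.
have [||d] := @EVT_min_rV R n F [set y | `|y - 0| <= r] _ (@ball_row_compact 0 r).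
- exists 0; rewrite /= subrr normr0 divr_ge0 ?(ltW k0) // !addr_ge0 //.
- by apply: continuous_subspaceT; case: cF.
rewrite inE /= subr0 => dr hmin.
have glob y : F d <= F y.
  have [yr|yr] := leP `|y| r; first by apply: hmin; rewrite inE /= subr0.
  have F0 : F d <= F 0.
    apply: hmin; rewrite inE /= subrr normr0 divr_ge0 ?(ltW k0) // !addr_ge0 //.
  apply: le_trans F0 _; apply: le_trans (hF y).
  have : `|F 0| + `|C| + 1 < k * `|y| by rewrite -ltr_pdivrMl // mulrC.
  have := ler_norm (F 0); have := ler_norm C; lra.
exists d; apply/rowP => i; rewrite !mxE.
have hd : is_derive (0 : R) 1 (fun s : R => F (s *: delta_mx 0 i + d)) (partial i F d).
  by apply: is_derive_line; rewrite scale0r add0r; exact: Ck_is_derive cF.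
have := @derive1_at_min R (fun s : R => F (s *: delta_mx 0 i + d)) (-1) 1 0.
case.
- lra.
- move=> s _; have : is_derive s 1 (fun s : R => F (s *: delta_mx 0 i + d)) (partial i F (s *: delta_mx 0 i + d)).
    by apply: is_derive_line; exact: Ck_is_derive cF.
  by case.
- by rewrite in_itv /=; lra.
- by move=> s _; rewrite scale0r add0r.
by move=> _ <-; case: hd.
Qed.

(** Increments of the gradient become matrix products with a factor continuous at y0. Implicit
    equations between gradients can then be differentiated by linear algebra alone. The factor
    collects the points given by [hadamard] for each partial derivative. *)
Lemma caratheodory u y0 : Ck 2 u -> exists H : 'rV[R]_n -> 'M[R]_n,
  (forall y, grad u y - grad u y0 = (y - y0) *m H y) /\ H @ y0 --> hess u y0.
Proof.
move=> cu.
have /choice[X hX] : forall yj : 'rV[R]_n * 'I_n, exists xi : 'I_n -> 'rV[R]_n,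
    (forall k, `|xi k - y0| <= `|yj.1 - y0|) /\
    partial yj.2 u yj.1 - partial yj.2 u y0 = \sum_k (yj.1 - y0) 0 k * partial k (partial yj.2 u) (xi k).
  move=> [y j] /=.
  have [xi [h1 h2]] := @hadamard R n setT (partial j u) y0 (y - y0) (fun _ _ => I) (Ck_C1on (Ck_partial j cu)).
  by exists xi; split=> //; rewrite -h2 subrK.
exists (fun y => \matrix_(k, j) partial k (partial j u) (X (y, j) k)); split.
  move=> y; apply/rowP => j; rewrite !mxE; have [_ /= ->] := hX (y, j).
  by apply: eq_bigr => k _; rewrite !mxE.
apply: (@cvg_mxP R _ (nbhs y0) (nbhs_filter y0) n n _ _).2 => k j.
have -> : (fun t => (\matrix_(k, j) partial k (partial j u) (X (t, j) k)) k j) =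
   (fun t => partial k (partial j u) (X (t, j) k)) by apply/funext => t; rewrite mxE.
rewrite mxE.
have c : {for y0, continuous (partial k (partial j u))}.
  by have [_ [c _]] := (Ck_partial j cu).2 k; exact: c.
apply: (@cvg_comp _ _ _ (fun t => X (t, j) k) (partial k (partial j u)) _ (nbhs y0)); last exact: c.
apply/cvgrPdist_le => e e0.
have : \forall t \near y0, `|y0 - t| <= e.
  by have /cvgrPdist_le /(_ _ e0) := (@cvg_id _ (nbhs y0)).
apply: filterS => t ht; have [/(_ k) h _] := hX (t, j).
by rewrite distrC; apply: le_trans h _; rewrite distrC.
Qed.

End Convex.

Section ConvexMore.
Context {R : realType} {n : nat}.
Implicit Types (u : 'rV[R]_n -> R) (x y v w : 'rV[R]_n).

(** The form A is nonnegative at v - s v A^-1; with s = 1/(n M) the expansion bounds A from below by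
    the size of the entries of its inverse. *)
Lemma posdef_lower (A : 'M[R]_n) (M : R) v : posdef A -> 0 < M ->
  (forall i j, `|invmx A i j| <= M) -> dot v v <= n%:R * M * qf A v.
Proof.
move=> pA M0 hM; have uA := posdef_unit pA.
case: (posnP n) => [n0|n0].
  by subst n; rewrite dotE big_ord0 !mul0r.
pose k := n%:R * M; have k0 : 0 < k by rewrite mulr_gt0 // ltr0n.
pose s := k^-1; have s0 : 0 < s by rewrite invr_gt0.
have := posdef_ge0 (v - s *: (v *m invmx A)) pA.
have iAT : (invmx A)^T = invmx A by rewrite trmx_inv (posdef_sym pA).
have -> : qf A (v - s *: (v *m invmx A)) = qf A v - 2 * s * dot v v + s ^+ 2 * qf (invmx A) v.
  have eT : (v - s *: (v *m invmx A))^T = v^T - s *: (invmx A *m v^T).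
    by rewrite raddfB /= linearZ /= trmx_mul iAT.
  rewrite /qf /dot eT.
  rewrite mulmxBl -scalemxAl mulmxKV // !mulmxBr !mulmxBl -!scalemxAr -!scalemxAl.
  rewrite !mulmxA -(mulmxA v A (invmx A)) mulmxV // mulmx1.
  by rewrite !(e00D, e00N, e00Z); ring.
have : qf (invmx A) v <= k * dot v v.
  apply: le_trans (ler_norm _) _; rewrite /qf -mulmxA mxE.
  apply: le_trans (ler_norm_sum _ _ _) _.
  apply: (@le_trans _ _ (\sum_i \sum_j M * (`|v 0 i| * `|v 0 j|))).
    apply: ler_sum => i _; rewrite mxE mulr_sumr; apply: le_trans (ler_norm_sum _ _ _) _.
    apply: ler_sum => j _; rewrite !normrM [v^T _ _]mxE mulrCA.
    by rewrite ler_wpM2r ?mulr_ge0.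
  apply: (@le_trans _ _ (\sum_i \sum_j M / 2 * (v 0 i ^+ 2 + v 0 j ^+ 2))).
    apply: ler_sum => i _; apply: ler_sum => j _; rewrite -mulrA ler_wpM2l ?(ltW M0) //.
    by have := sqr_ge0 (`|v 0 i| - `|v 0 j|); rewrite sqrrB !real_normK ?num_real //; lra.
  rewrite le_eqVlt; apply/orP; left; apply/eqP.
  have e : \sum_i v 0 i ^+ 2 = dot v v by rewrite dotE; apply: eq_bigr => i _; rewrite expr2.
  transitivity (\sum_(i < n) (M / 2 * (n%:R * v 0 i ^+ 2 + dot v v))).
    apply: eq_bigr => i _; rewrite -mulr_sumr big_split /= e sumr_const card_ord.
    by rewrite mulr_natl.
  rewrite -mulr_sumr big_split /= -mulr_sumr e sumr_const card_ord -mulr_natl /k.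
  by field.
move=> h1 h2.
have {h1}h2 : 0 <= qf A v - 2 * s * dot v v + s ^+ 2 * (k * dot v v).
  by apply: le_trans h2 _; rewrite lerD2l ler_wpM2l // sqr_ge0.
have e1 : s ^+ 2 * (k * dot v v) = s * dot v v by rewrite /s; field; rewrite gt_eqF.
rewrite e1 in h2.
have : s * dot v v <= qf A v by lra.
by rewrite -/k /s ler_pdivrMl.
Qed.

Lemma for_continuous_invmx (T : topologicalType) m (A : T -> 'M[R]_m) (x : T) :
  A x \in unitmx -> {for x, continuous A} -> {for x, continuous (fun y : T => invmx (A y))}.
Proof. exact: cvg_invmx. Qed.

Lemma hess_lower u x (r : R) : strictly_convex u -> 0 <= r ->
  exists2 c, 0 < c & forall y v, `|y - x| <= r -> c * dot v v <= qf (hess u y) v.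
Proof.
move=> [cu pu] r0.
have ch : continuous (fun y => `|invmx (hess u y)|).
  move=> y; apply: (@for_continuous_comp _ _ _ (fun y => invmx (hess u y)) Num.norm); last exact: norm_continuous.
  have cH : {for y, continuous (hess u)} by exact: Ck_hess_cont cu.
  exact: (@for_continuous_invmx _ _ (hess u) y (posdef_unit (pu y)) cH).
have [|y0 _ hmax] := @EVT_max_rV R n _ [set y | `|y - x| <= r] _ (@ball_row_compact _ _ x r) (continuous_subspaceT ch).
  by exists x; rewrite /= subrr normr0.
pose M := `|invmx (hess u y0)| + 1.
have M0 : 0 < M by rewrite ltr_wpDl.
exists (n.+1%:R * M)^-1; first by rewrite invr_gt0 mulr_gt0.
move=> y v hy; rewrite ler_pdivrMl ?mulr_gt0 //.
have := @posdef_lower (hess u y) M v (pu y) M0.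
have -> : (forall i j, `|invmx (hess u y) i j| <= M) = true :> Prop.
  apply/propext; split=> // _ i j.
  apply: le_trans (_ : `|invmx (hess u y)| <= _).
    rewrite [leRHS]/Num.Def.normr /= mx_normrE.
    exact: (le_bigmax _ (fun ij : 'I_n * 'I_n => `|invmx (hess u y) ij.1 ij.2|) (i, j)).
  by apply: le_trans (_ : `|invmx (hess u y0)| <= _); [apply: hmax; rewrite inE|rewrite lerDl].
move=> /(_ isT) h; apply: le_trans h _.
by rewrite ler_wpM2r ?posdef_ge0 // ler_wpM2r ?(ltW M0) // ler_nat.
Qed.

Lemma C1on_Ck1 (f : 'rV[R]_n -> R) : C1on setT f -> Ck 1 f.
Proof.
move=> h; split; first by move=> x; have [] := h x I.
move=> j; split; first by move=> x; have [_ /(_ j)[]] := h x I.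
by split=> // x; have [_ /(_ j)[]] := h x I.
Qed.

Lemma grad_val u x (g : 'rV[R]_n) : (forall j, is_derive x (delta_mx 0 j) u (g 0 j)) -> grad u x = g.
Proof. by move=> h; apply/rowP => j; rewrite mxE (partial_val (h j)). Qed.

Lemma affine_comp u x c : Ck 1 u -> C1on setT (fun d => u (x + c *: d)) /\
  forall d, grad (fun d => u (x + c *: d)) d = c *: grad u (x + c *: d).
Proof.
move=> cu; split.
  apply: (@C1on_comp _ _ _ setT setT) => //; try exact: openT; first exact: Ck_C1on cu.
  apply: C1mx_add; [exact: openT|exact: C1mx_cst openT|].
  apply: C1mx_scale; [exact: openT|exact: C1on_cst openT|].
  move=> i j; apply: (C1on_eq openT _ (C1on_coord j openT)) => y _.
  by rewrite ord1.
move=> d; apply: grad_val => j.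
have hphi : is_derive d (delta_mx 0 j) (fun d => x + c *: d) (c *: delta_mx 0 j).
  have := is_deriveD (is_derive_cst x d (delta_mx 0 j)) (is_deriveZ c (is_derive_id d (delta_mx 0 j))).
  by rewrite add0r.
have := C1_chain openT (Ck_C1on cu) I hphi; apply: is_derive_eqfun => //.
rewrite [RHS]mxE mxE (bigD1 j) //= !mxE !eqxx mulr1 big1 ?addr0 // => k kj.
by rewrite !mxE eqxx (negbTE kj) mulr0 mul0r.
Qed.

(** The equation says that d is critical for u'(x + (1-t) d)/(1-t) + u(x - t d)/t. This function is
    coercive: the second term is bounded below by a constant minus d . grad u(x), and the linear
    growth of u at x, inherited by u' within C0, beats that linear term. *)
Lemma geo_exists_lt u u' (C0 t : R) x : (0 < n)%N -> strictly_convex u -> strictly_convex u' ->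
  (forall y, `|u' y - u y| <= C0) -> 0 <= t < 1 ->
  exists d, grad u' (x + (1 - t) *: d) = grad u (x - t *: d).
Proof.
move=> n0 su su' hC /andP[t0 t1].
pose s := 1 - t; have s0 : 0 < s by rewrite subr_gt0.
have c1 := Ck_weak su.1; have c1' := Ck_weak su'.1.
pose g := grad u x.
(* [E] is the second term of the functional; at t = 0 it is replaced by its limit - d . grad u(x),
   after removal of the constant u(x)/t. *)
have [E [cE [C lE] gE]] : exists E, [/\ C1on setT E, exists C, forall d, C - dot d g <= E d
    & forall d, grad E d = - grad u (x - t *: d)].
  have [tz|tn] := eqVneq t 0.
    exists (fun d => - \sum_i d 0 i * g 0 i); split.
    - apply: C1on_opp; first exact: openT.
      apply: C1on_sum; first exact: openT.
      move=> i _; apply: C1on_mul; [exact: openT|exact: C1on_coord openT|exact: C1on_cst openT].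
    - by exists 0 => d; rewrite dotE sub0r.
    - move=> d; apply: grad_val => j; rewrite mxE tz scale0r subr0.
      apply: is_deriveNp.
      have := @is_derive_suml R _ _ (index_enum 'I_n) xpredT _ _ d (delta_mx 0 j) (fun i _ => is_deriveMp
         ((is_derive_mxP _ _ _ _).1 (is_derive_id d (delta_mx 0 j)) 0 i) (is_derive_cst (g 0 i) d (delta_mx 0 j))).
      apply: is_derive_eqfun => //.
      rewrite (bigD1 j) //= !mxE !eqxx mul1r mulr0 addr0 big1 ?addr0 /g ?mxE // => i ij.
      by rewrite !mxE eqxx (negbTE ij) mul0r mulr0 addr0.
  have tp : 0 < t by rewrite lt_neqAle eq_sym tn.
  have [cA gA] := affine_comp x (- t) c1.
  exists (fun d => t^-1 * u (x + - t *: d)); split.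
  - exact: C1on_mul openT (C1on_cst t^-1 openT) cA.
  - exists (t^-1 * u x) => d; rewrite -/(t^-1) ler_pdivlMl // mulrBr mulrA divff // mul1r.
    have := convex_tangent x (x + - t *: d) su; rewrite addrAC subrr add0r dotZl.
    by rewrite mulNr.
  - move=> d; apply: grad_val => j.
    have h : is_derive d (delta_mx 0 j) (fun d => u (x + - t *: d)) ((- t *: grad u (x + - t *: d)) 0 j).
      by rewrite -gA mxE; exact: C1on_partial cA I.
    have := is_deriveMp (is_derive_cst t^-1 d (delta_mx 0 j)) h.
    apply: is_derive_eqfun => //.
    by rewrite mul0r add0r mxE [RHS]mxE mulrA mulrN mulVf // mulN1r scaleNr.
have [cB gB] := affine_comp x s c1'.
pose F d := s^-1 * u' (x + s *: d) + E d.
have cF : Ck 1 F.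
  exact: C1on_Ck1 (C1on_add openT (C1on_mul openT (C1on_cst s^-1 openT) cB) cE).
have [k k0 hk] := linear_growth x n0 su.
have [|d hd] := @coercive_critical R n F k (- (C + s^-1 * (u x - k - C0))) k0 cF.
  move=> d; have := hk (s *: d); rewrite [s *: d + x]addrC dotZl normrZ (gtr0_norm s0) -/g.
  have := hC (x + s *: d); rewrite ler_distl => /andP[h1 _] h2.
  have h3 := lE d.
  have h4 : s * (dot d g + k * `|d|) + (u x - k - C0) <= u' (x + s *: d).
    move: h1 h2; rewrite mulrDr mulrCA.
    by move: (u' _) (u _) (u x) => a b c; lra.
  rewrite opprK /F.
  have h5 : dot d g + k * `|d| + s^-1 * (u x - k - C0) <= s^-1 * u' (x + s *: d).
    rewrite ler_pdivlMl // mulrDr; apply: le_trans h4.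
    by rewrite [s * (s^-1 * _)]mulrA divff ?mul1r // gt_eqF.
  lra.
exists d; apply/eqP; rewrite -subr_eq0 -hd; apply/eqP/esym/grad_val => j.
rewrite mxE [X in is_derive _ _ _ (_ + X)]mxE.
have h1 : is_derive d (delta_mx 0 j) (fun d => u' (x + s *: d)) ((s *: grad u' (x + s *: d)) 0 j).
  by rewrite -gB mxE; exact: C1on_partial cB I.
have h2 : is_derive d (delta_mx 0 j) E (- (grad u (x - t *: d)) 0 j).
  by have := C1on_partial j cE (x := d) I; have /rowP/(_ j) := gE d; rewrite !mxE => ->.
have := is_deriveDp (is_deriveMp (is_derive_cst s^-1 d (delta_mx 0 j)) h1) h2.
apply: is_derive_eqfun => //; congr (_ + _).
by rewrite mul0r add0r mxE mulrA mulVf ?mul1r // gt_eqF.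
Qed.

(** The remaining time t = 1 is the case t = 0 with u and u' exchanged and d replaced by - d. *)
Lemma geo_exists u u' (C0 t : R) x : (0 < n)%N -> strictly_convex u -> strictly_convex u' ->
  (forall y, `|u' y - u y| <= C0) -> 0 <= t <= 1 ->
  exists d, grad u' (x + (1 - t) *: d) = grad u (x - t *: d).
Proof.
move=> n0 su su' hC /andP[t0]; rewrite le_eqVlt => /orP[/eqP ->|t1]; last first.
  by apply: (geo_exists_lt x n0 su su' hC); rewrite t0.
have [||d hd] := @geo_exists_lt u' u C0 0 x n0 su' su _.
- by move=> y; rewrite distrC.
- by rewrite lexx ltr01.
exists (- d); rewrite subrr scale0r addr0 scale1r opprK.
by move: hd; rewrite subr0 scale1r scale0r subr0 => ->.
Qed.

End ConvexMore.

(** * Geodesics between convex functions *)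

Section RowAlgebra.
Context {R : realType} {n : nat}.
Implicit Types (x d g : 'rV[R]_n).

Lemma row_segment_diff x d (t : R) : x + (1 - t) *: d - (x - t *: d) = d.
Proof. by apply/rowP => i; rewrite !mxE; ring. Qed.

Lemma row_axpy_diff x d g (c : R) : c *: (d - g) + (x + c *: g) = x + c *: d.
Proof. by apply/rowP => i; rewrite !mxE; ring. Qed.

Lemma row_segment_shift x y d g (s c : R) :
  s *: (c *: (d - g)) + (x + c *: g) - y = (x - y) + c *: (s *: d + (1 - s) *: g).
Proof. by apply/rowP => i; rewrite !mxE; ring. Qed.

Lemma norm_convex d g (s C : R) : 0 <= s <= 1 -> `|d| <= C -> `|g| <= C ->
  `|s *: d + (1 - s) *: g| <= C.
Proof.
move=> /andP[s0 s1] hd hg; have s1' : 0 <= 1 - s by rewrite subr_ge0.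
apply: le_trans (ler_normD _ _) _; rewrite !normrZ (ger0_norm s0) (ger0_norm s1').
have h1 := ler_wpM2l s0 hd; have h2 := ler_wpM2l s1' hg.
by apply: le_trans (lerD h1 h2) _; rewrite -mulrDl addrC subrK mul1r.
Qed.

Lemma for_continuous_dist (T : topologicalType) (V : normedModType R) (f : T -> V) (x : T) :
  (forall e, 0 < e -> \forall y \near x, `|f y - f x| <= e) -> {for x, continuous f}.
Proof.
move=> h; apply/cvgrPdist_le => e e0; have := h _ e0.
by apply: filterS => y; rewrite distrC.
Qed.

Lemma geo_gap (t a a' b c q q' m : R) : a' = a -> a' - b = (1 - t) * q' -> a - c = - t * q ->
  (1 - t) * m <= (1 - t) * q' -> t * m <= t * q -> m <= - (b - c).
Proof. by move=> -> e1 e2 h1 h2; lra. Qed.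

Lemma for_continuous_axpy (T : topologicalType) (f g : T -> 'rV[R]_n) (c : T -> R) (x : T) :
  {for x, continuous f} -> {for x, continuous c} -> {for x, continuous g} ->
  {for x, continuous (fun y : T => f y + c y *: g y)}.
Proof. move=> cf cc cg; exact: (continuousD cf (continuousZ cc cg)). Qed.

Lemma for_continuous_mulmx (T : topologicalType) a b c (A : T -> 'M[R]_(a, b)) (B : T -> 'M[R]_(b, c)) (x : T) :
  {for x, continuous A} -> {for x, continuous B} -> {for x, continuous (fun y : T => A y *m B y)}.
Proof. exact: cvg_mulmx. Qed.

Lemma Ck_cont m (f : 'rV[R]_n -> R) : Ck m f -> continuous f.
Proof. by case: m => [|m] []. Qed.

End RowAlgebra.

(** * Weighted harmonic means of positive definite matrices *)

Section InterpolatedMatrix.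
Context {R : realType} {n : nat}.
Implicit Types (A B X : 'M[R]_n) (t : R).

(** The weights are in this order because the derivative with respect to d of grad u'(x + (1-t) d) -
    grad u(x - t d) is (1-t) B + t A, with B the Hessian of u' and A that of u. *)
Definition mid t A B : 'M[R]_n := (1 - t) *: B + t *: A.

Lemma mid_posdef t A B : 0 <= t <= 1 -> posdef A -> posdef B -> posdef (mid t A B).
Proof.
move=> /andP[t0]; rewrite /mid le_eqVlt => /orP[/eqP ->|t1] pA pB.
  by rewrite subrr scale0r add0r scale1r.
have s0 : 0 < 1 - t by rewrite subr_gt0.
exact: (posdefDZ t0 (posdefZ s0 pB) pA).
Qed.

Lemma posdef_inv X : posdef X -> posdef (invmx X).
Proof.
move=> pX; have uX := posdef_unit pX; split; first by rewrite trmx_inv (posdef_sym pX).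
move=> y y0; have : y *m invmx X != 0.
  by apply: contra y0 => /eqP h; rewrite -(mulmxKV uX y) h mul0mx.
move=> /(pX.2 _); rewrite /qf trmx_mul trmx_inv (posdef_sym pX) mulmxKV //.
by rewrite mulmxA.
Qed.

Section Fixed.
Variables (t : R) (A B : 'M[R]_n).
Hypotheses (t01 : 0 <= t <= 1) (pA : posdef A) (pB : posdef B).
Let K := mid t A B.
Let uA := posdef_unit pA.
Let uB := posdef_unit pB.
Let uK : K \in unitmx := posdef_unit (mid_posdef t01 pA pB).

(** Legendre transforms interpolate linearly, hence so do their Hessians, which are the inverses of
    the Hessians of the functions. This is why the left side is the Hessian of the interpolated
    function. *)
Lemma mid_harmonic : B *m invmx K *m A = invmx (t *: invmx B + (1 - t) *: invmx A).
Proof.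
have e : (t *: invmx B + (1 - t) *: invmx A) *m (B *m invmx K *m A) = 1%:M.
  rewrite mulmxDl -!scalemxAl !mulmxA mulVmx // mul1mx.
  have -> : invmx A *m B *m invmx K *m A = invmx A *m (B *m invmx K *m A) by rewrite !mulmxA.
  have h : t *: A + (1 - t) *: B = K by rewrite addrC.
  have -> : t *: (invmx K *m A) = invmx A *m (t *: A *m invmx K *m A).
    by rewrite -!scalemxAl -scalemxAr !mulmxA mulVmx // mul1mx.
  by rewrite scalemxAr -mulmxDr !scalemxAl -!mulmxDl h mulmxV // mul1mx mulVmx.
by rewrite -[RHS]mulmx1 -e mulmxA mulVmx ?mul1mx //; case/mulmx1_unit: e.
Qed.

Lemma mid_harmonic_posdef : posdef (B *m invmx K *m A).
Proof.
rewrite mid_harmonic; apply: posdef_inv; rewrite addrC.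
have := mid_posdef t01 (posdef_inv pB) (posdef_inv pA).
by rewrite /mid.
Qed.

Lemma mid_sub_l : 1%:M - t *: ((A - B) *m invmx K) = B *m invmx K.
Proof.
rewrite -[1%:M](mulmxV uK) scalemxAl -mulmxBl; congr (_ *m _).
by rewrite /K /mid; apply/matrixP => i j; rewrite !mxE; ring.
Qed.

Lemma mid_sub_r : 1%:M + (1 - t) *: ((A - B) *m invmx K) = A *m invmx K.
Proof.
have -> : 1%:M + (1 - t) *: ((A - B) *m invmx K) = (1%:M - t *: ((A - B) *m invmx K)) + (A - B) *m invmx K.
  by rewrite scalerBl scale1r addrA addrAC.
by rewrite mid_sub_l -mulmxDl addrC subrK.
Qed.

End Fixed.
End InterpolatedMatrix.

Record geodesic_pair {R : realType} {n : nat} (u u' : 'rV[R]_n -> R) (C0 C1 : R) : Prop := GeodesicPair {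
  gp_n : (0 < n)%N; gp_l : Ck 3 u; gp_r : Ck 3 u';
  gp_pl : forall x, posdef (hess u x); gp_pr : forall x, posdef (hess u' x);
  gp_bound : forall x, `|u' x - u x| <= C0;
  gp_disp : forall a b, grad u a = grad u' b -> `|b - a| <= C1
}.

Section Geodesic.
Context {R : realType} {n : nat}.
Variables (u u' : 'rV[R]_n -> R) (C0 C1 : R).
Hypothesis gp : geodesic_pair u u' C0 C1.
Let n0 := gp_n gp.
Let cu := gp_l gp.
Let cu' := gp_r gp.
Let pu := gp_pl gp.
Let pu' := gp_pr gp.
Let bd := gp_bound gp.
Let disp := gp_disp gp.

Local Notation N := (1 + n)%N.

Definition tm (z : 'rV[R]_N) : R := z 0 tix.
Definition sp (z : 'rV[R]_N) : 'rV[R]_n := \row_i z 0 (xix i).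
(** With time clamped to [0, 1] the geodesic is defined and continuous on all of space-time,
    including neighbourhoods of the end slices. *)
Definition clamp (t : R) : R := Num.max 0 (Num.min t 1).

Lemma clamp_itv t : 0 <= clamp t <= 1.
Proof. by rewrite /clamp le_max lexx /= ge_max ler01 ge_min lexx orbT. Qed.

Lemma clamp_id t : 0 <= t <= 1 -> clamp t = t.
Proof. by move=> /andP[t0 t1]; rewrite /clamp (min_idPl t1) (max_idPr t0). Qed.

Lemma clamp_continuous : continuous clamp.
Proof.
have lip t s : `|clamp t - clamp s| <= `|t - s|.
  wlog ts : t s / s <= t => [W|].
    by have [|/ltW h] := leP s t; [exact: W|rewrite distrC [leRHS]distrC; exact: W].
  have t1 : Num.min s 1 <= Num.min t 1 by rewrite le_min !ge_min ts lexx orbT.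
  rewrite !ger0_norm ?subr_ge0 //; first last.
    by rewrite /clamp ge_max le_max lexx /= le_max t1 orbT.
  rewrite /clamp; case: (leP t 1) => h1; case: (leP s 1) => h2;
    rewrite ?(min_idPl h1) ?(min_idPl h2);
    repeat match goal with |- context [Num.max 0 ?a] => case: (leP 0 a) => ? end; lra.
move=> t; apply/cvgrPdist_le => e e0.
have /cvgrPdist_le /(_ _ e0) : (fun s : R => s) @ t --> t by exact: cvg_id.
by apply: filterS => s; exact: le_trans (lip _ _).
Qed.

Let su : strictly_convex u := conj (Ck_weak cu) pu.
Let su' : strictly_convex u' := conj (Ck_weak cu') pu'.

(* If grad u' b = grad u a then x = (1 - t) a + t b is reached at time t with displacement b - a. *)
Definition geo (t : R) (x : 'rV[R]_n) : 'rV[R]_n :=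
  xget 0 [set d | grad u' (x + (1 - t) *: d) = grad u (x - t *: d)].

Lemma geoP t x : 0 <= t <= 1 -> grad u' (x + (1 - t) *: geo t x) = grad u (x - t *: geo t x).
Proof.
move=> ht; have [d hd] := geo_exists x n0 su su' bd ht.
by rewrite /geo; case: xgetP => [d' _ hd'|/(_ d)] //.
Qed.

Lemma geo_bound t x : 0 <= t <= 1 -> `|geo t x| <= C1.
Proof.
by move=> ht; have := disp (esym (geoP x ht)); rewrite row_segment_diff.
Qed.

Definition gd z := geo (clamp (tm z)) (sp z).
Definition apt z := sp z - clamp (tm z) *: gd z.
Definition bpt z := sp z + (1 - clamp (tm z)) *: gd z.
Definition gA z := hess u (apt z).
Definition gB z := hess u' (bpt z).
Definition gK z := mid (clamp (tm z)) (gA z) (gB z).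
Definition gE z := (gA z - gB z) *m invmx (gK z).
Definition gpm z := grad u (apt z).
Definition gM z := gB z *m invmx (gK z) *m gA z.
(** The velocity of the geodesic at a fixed point x: the Legendre transform of u minus that of u',
    both taken at the common momentum. *)
Definition gf z := u' (bpt z) - u (apt z) - dot (gpm z) (gd z).

Lemma gdP z : grad u' (bpt z) = grad u (apt z).
Proof. exact: geoP (clamp_itv _). Qed.

Lemma gd_bound z : `|gd z| <= C1.
Proof. exact: geo_bound (clamp_itv _). Qed.

Lemma gA_posdef z : posdef (gA z). Proof. exact: pu. Qed.

Lemma gB_posdef z : posdef (gB z). Proof. exact: pu'. Qed.

Lemma gK_posdef z : posdef (gK z).
Proof. exact: mid_posdef (clamp_itv _) (gA_posdef z) (gB_posdef z). Qed.

Lemma gM_posdef z : posdef (gM z).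
Proof. exact: mid_harmonic_posdef (clamp_itv _) (gA_posdef z) (gB_posdef z). Qed.

Local Opaque geo clamp gd apt bpt gA gB gK tm sp hess grad.

Lemma tm_continuous : continuous tm.
Proof. by move=> z; exact: coord_continuous. Qed.

Lemma sp_continuous : continuous sp.
Proof.
move=> z; apply: for_continuous_mx => i j.
have -> : (fun y : 'rV[R]_N => sp y i j) = (fun y : 'rV[R]_N => y 0 (xix j)) by apply/funext => y; rewrite mxE.
exact: coord_continuous.
Qed.

Lemma clamp_tm_continuous : continuous (fun z => clamp (tm z)).
Proof.
by move=> z; exact: (@for_continuous_comp _ _ _ tm clamp z (tm_continuous (x := z)) (clamp_continuous (x := _))).
Qed.

(** With d0 frozen, [G z] measures by how much d0 fails to solve the equation at z. Uniform
    convexity turns this into a bound on the distance from d0 to the true solution, and [G] is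
    continuous and zero at z0. The a priori bound C1 keeps all points in one ball, where the
    Hessians are bounded below. *)
Lemma gd_continuous : continuous gd.
Proof.
move=> z0; set d0 := gd z0.
have C1_ge0 : 0 <= C1 by apply: le_trans (gd_bound z0).
have [c c0 hc] := @hess_lower R n u (sp z0) (1 + C1) su (addr_ge0 ler01 C1_ge0).
have [c' c0' hc'] := @hess_lower R n u' (sp z0) (1 + C1) su' (addr_ge0 ler01 C1_ge0).
pose m := Num.min c c'; have m0 : 0 < m by rewrite lt_min c0.
pose G z := grad u' (sp z + (1 - clamp (tm z)) *: d0) - grad u (sp z + - clamp (tm z) *: d0).
have G0 : G z0 = 0.
  by rewrite /G scaleNr -[X in grad u X]/(apt z0) -[X in grad u' X]/(bpt z0) gdP subrr.
have cG : {for z0, continuous G}.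
  apply: continuousB.
    apply: (@for_continuous_comp _ _ _ (fun z => sp z + (1 - clamp (tm z)) *: d0) (grad u')).
      apply: for_continuous_axpy; [exact: sp_continuous| |exact: for_continuous_cst].
      by apply: continuousB; [exact: for_continuous_cst|exact: clamp_tm_continuous].
    exact: Ck_grad_cont (Ck_weak (Ck_weak cu')).
  apply: (@for_continuous_comp _ _ _ (fun z => sp z + - clamp (tm z) *: d0) (grad u)).
    apply: for_continuous_axpy; [exact: sp_continuous| |exact: for_continuous_cst].
    by apply: continuousN; exact: clamp_tm_continuous.
  exact: Ck_grad_cont (Ck_weak (Ck_weak cu)).
have key z : `|sp z - sp z0| <= 1 -> `|gd z - d0| <= n%:R / m * `|G z|.
  move=> hz; set d := gd z; set t := clamp (tm z).
  have /andP[t0 t1] := clamp_itv (tm z).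
  have s0 : 0 <= 1 - t by rewrite subr_ge0.
  pose de := d - d0.
  have seg (s c1 : R) : 0 <= s <= 1 -> `|c1| <= 1 -> `|s *: (c1 *: de) + (sp z + c1 *: d0) - sp z0| <= 1 + C1.
    move=> /andP[s1 s2] hc1.
    rewrite row_segment_shift; apply: le_trans (ler_normD _ _) (lerD hz _).
    rewrite normrZ -[leRHS]mul1r; apply: (ler_pM (normr_ge0 _) (normr_ge0 _) hc1).
    by apply: norm_convex (gd_bound _) (gd_bound _); rewrite s1.
  have [s1 hs1 e1] := grad_MVT (sp z + (1 - t) *: d0) ((1 - t) *: de) de (Ck_weak cu').
  have [s2 hs2 e2] := grad_MVT (sp z + - t *: d0) (- t *: de) de (Ck_weak cu).
  have E1 : (1 - t) *: de + (sp z + (1 - t) *: d0) = bpt z.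
    exact: row_axpy_diff.
  have E2 : - t *: de + (sp z + - t *: d0) = apt z.
    by rewrite row_axpy_diff scaleNr.
  rewrite E1 -scalemxAl -scalemxAl e00Z in e1; rewrite E2 -scalemxAl -scalemxAl e00Z in e2.
  have q1 : m * dot de de <= qf (hess u' (s1 *: ((1 - t) *: de) + (sp z + (1 - t) *: d0))) de.
    apply: le_trans (hc' _ _ _); first by rewrite ler_wpM2r ?dot_ge0 // ge_min lexx orbT.
    by apply: seg hs1 _; rewrite (ger0_norm s0) gerBl.
  have q2 : m * dot de de <= qf (hess u (s2 *: (- t *: de) + (sp z + - t *: d0))) de.
    apply: le_trans (hc _ _ _); first by rewrite ler_wpM2r ?dot_ge0 // ge_min lexx.
    by apply: seg hs2 _; rewrite normrN (ger0_norm t0).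
  (* The two mean value formulas enter with weights 1 - t and t; the terms at the solution cancel
     because the momenta agree there. *)
  have tot : m * dot de de <= - dot de (G z).
    rewrite /G dotBr -/t.
    have h1 := ler_wpM2l s0 q1; have h2 := ler_wpM2l t0 q2.
    have eP : dot de (grad u' (bpt z)) = dot de (grad u (apt z)) by rewrite gdP.
    exact: geo_gap eP e1 e2 h1 h2.
  rewrite -/de; have [->|dn] := eqVneq de 0.
    by rewrite normr0 (mulr_ge0 (divr_ge0 (ler0n _ _) (ltW m0)) (normr_ge0 _)).
  have dp : 0 < `|de| by rewrite normr_gt0.
  have := norm_sq_le_dot de; rewrite -(ler_pM2l m0) => h1.
  have h2 : m * `|de| ^+ 2 <= n%:R * (`|de| * `|G z|).
    apply: le_trans h1 _; apply: le_trans tot _; apply: le_trans (ler_norm _) _.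
    by rewrite normrN; exact: dot_norm_le.
  have h3 : m * `|de| <= n%:R * `|G z|.
    by move: h2; rewrite expr2 mulrCA [n%:R * _]mulrCA ler_pM2l.
  by rewrite mulrAC ler_pdivlMr // mulrC.
apply: for_continuous_dist => e e0.
pose e' := e / (n%:R / m + 1).
have k0 : 0 < n%:R / m + 1 by rewrite ltr_wpDl // divr_ge0 // ltW.
have e0' : 0 < e' by rewrite divr_gt0.
have n1 : \forall z \near z0, `|sp z0 - sp z| <= 1.
  by have /cvgrPdist_le /(_ _ ltr01) := sp_continuous (x := z0).
have n2 : \forall z \near z0, `|G z0 - G z| <= e'.
  by have /cvgrPdist_le /(_ _ e0') := cG.
apply: filterS2 n1 n2 => z h1 h2.
apply: le_trans (key z _) _; first by rewrite distrC.
rewrite G0 sub0r normrN in h2.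
apply: (@le_trans _ _ (n%:R / m * e')).
  by rewrite ler_wpM2l // divr_ge0 // ltW.
rewrite /e' mulrCA ler_piMr ?(ltW e0) // ler_pdivrMr // mul1r lerDl ler01 //.
Qed.

Lemma apt_continuous : continuous apt.
Proof.
move=> z; apply: continuousB; first exact: sp_continuous.
by apply: continuousZ; [exact: clamp_tm_continuous|exact: gd_continuous].
Qed.

Lemma bpt_continuous : continuous bpt.
Proof.
move=> z; apply: continuousD; first exact: sp_continuous.
apply: continuousZ; last exact: gd_continuous.
by apply: continuousB; [exact: for_continuous_cst|exact: clamp_tm_continuous].
Qed.

Lemma gA_continuous : continuous gA.
Proof.
move=> z; apply: (@for_continuous_comp _ _ _ apt (hess u)); first exact: apt_continuous.
exact: Ck_hess_cont (Ck_weak cu).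
Qed.

Lemma gB_continuous : continuous gB.
Proof.
move=> z; apply: (@for_continuous_comp _ _ _ bpt (hess u')); first exact: bpt_continuous.
exact: Ck_hess_cont (Ck_weak cu').
Qed.

Lemma gK_continuous : continuous gK.
Proof.
move=> z; have c1 : {for z, continuous (fun y => 1 - clamp (tm y))}.
  by apply: continuousB; [exact: for_continuous_cst|exact: clamp_tm_continuous].
exact: (continuousD (continuousZ c1 (gB_continuous (x := z)))
  (continuousZ (clamp_tm_continuous (x := z)) (gA_continuous (x := z)))).
Qed.

Lemma gKi_continuous : continuous (fun z => invmx (gK z)).
Proof.
move=> z; have c : {for z, continuous gK} by exact: gK_continuous.
exact: (@for_continuous_invmx R _ _ gK z (posdef_unit (gK_posdef z)) c).
Qed.

Lemma gE_continuous : continuous gE.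
Proof.
move=> z; exact: (for_continuous_mulmx (continuousB (gA_continuous (x := z)) (gB_continuous (x := z)))
  (gKi_continuous (x := z))).
Qed.

Lemma gM_continuous : continuous gM.
Proof.
move=> z; exact: (for_continuous_mulmx (for_continuous_mulmx (gB_continuous (x := z))
  (gKi_continuous (x := z))) (gA_continuous (x := z))).
Qed.

Lemma gpm_continuous : continuous gpm.
Proof.
move=> z; apply: (@for_continuous_comp _ _ _ apt (grad u)); first exact: apt_continuous.
exact: Ck_grad_cont (Ck_weak (Ck_weak cu)).
Qed.

Lemma gf_continuous : continuous gf.
Proof.
move=> z.
have c1 : {for z, continuous (fun y => u' (bpt y))}.
  apply: (@for_continuous_comp _ _ _ bpt u'); first exact: bpt_continuous.
  exact: (Ck_cont cu' (x := bpt z)).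
have c2 : {for z, continuous (fun y => u (apt y))}.
  apply: (@for_continuous_comp _ _ _ apt u); first exact: apt_continuous.
  exact: (Ck_cont cu (x := apt z)).
have c3 := norm_continuous_dot (gpm_continuous (x := z)) (gd_continuous (x := z)).
exact: (continuousB (continuousB c1 c2) c3).
Qed.

End Geodesic.

Lemma is_derive_affine (R : realType) (V W : normedModType R) (f : V -> W) x v l :
  (\forall h \near (0 : R), f (h *: v + x) = h *: l + f x) -> is_derive x v f l.
Proof.
move=> hl.
have key : (fun h => h^-1 *: (f (h *: v + x) - f x)) @ 0^' --> l.
  have c : (fun _ : R => l) @ (0 : R)^' --> l by exact: cvg_cst.
  apply: cvg_trans c; apply: near_eq_cvg.
  have n1 : \forall h \near (0 : R)^', h != 0 by exact: nbhs_dnbhs_neq.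
  have n2 := @nbhs_dnbhs _ (0 : R) _ hl.
  by apply: filterS2 n1 n2 => h h0 ->; rewrite addrK scalerA mulVf // scale1r.
split; first by apply/cvg_ex; eexists; exact: key.
exact: cvg_lim key.
Qed.

Lemma cvg_comp_at (T U W : topologicalType) (l : T -> U) (f : U -> W) (x : T) (y : U) (z : W) :
  l @ x --> y -> f @ y --> z -> (fun t => f (l t)) @ x --> z.
Proof. exact: cvg_comp. Qed.

Section QuotientLimit.
Context {R : realType} {n : nat} {T : Type} {F : set_system T} {FF : Filter F}.
Variables (XA XB : T -> 'M[R]_n) (th : T -> R) (A B : 'M[R]_n) (t : R).
Hypotheses (hA : XA x @[x --> F] --> A) (hB : XB x @[x --> F] --> B)
  (ht : th x @[x --> F] --> t).

Lemma cvg_mid : mid (th x) (XA x) (XB x) @[x --> F] --> mid t A B.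
Proof.
have h1 : (1 - th x) @[x --> F] --> 1 - t by apply: cvgB ht; exact: cvg_cst.
exact: cvgD (cvgZ h1 hB) (cvgZ ht hA).
Qed.

Lemma near_mid_unit : mid t A B \in unitmx -> \forall x \near F, mid (th x) (XA x) (XB x) \in unitmx.
Proof.
move=> uK.
have : \forall x \near F, \det (mid (th x) (XA x) (XB x)) != 0.
  by apply: (cvgr_neq0 _ (cvg_det cvg_mid)); rewrite -unitfE -unitmxE.
by apply: filterS => h; rewrite unitmxE unitfE.
Qed.

Lemma cvg_mid_quotient m (w : 'M[R]_(m, n)) : mid t A B \in unitmx ->
  (w *m (XA x - XB x) *m invmx (mid (th x) (XA x) (XB x))) @[x --> F]
    --> w *m ((A - B) *m invmx (mid t A B)).
Proof.
move=> uK; rewrite mulmxA.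
have h1 : (w *m (XA x - XB x)) @[x --> F] --> w *m (A - B).
  by apply: cvg_mulmx; [exact: cvg_cst|exact: cvgB].
by apply: cvg_mulmx h1 _; exact: cvg_invmx cvg_mid.
Qed.

End QuotientLimit.

(** * Differentiating the geodesic *)

Section GeodesicDerivative.
Context {R : realType} {n : nat}.
Variables (u u' : 'rV[R]_n -> R) (C0 C1 : R).
Hypothesis gp : geodesic_pair u u' C0 C1.
Local Notation N := (1 + n)%N.
Local Notation gd := (gd u u').
Local Notation apt := (apt u u').
Local Notation bpt := (bpt u u').
Local Notation gA := (gA u u').
Local Notation gB := (gB u u').
Local Notation gK := (gK u u').
Local Notation gE := (gE u u').
Local Notation gM := (gM u u').
Local Notation gf := (gf u u').
Local Notation gpm := (gpm u u').

Lemma tmD (x y : 'rV[R]_N) : tm (x + y) = tm x + tm y. Proof. by rewrite /tm mxE. Qed.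
Lemma tmZ c (x : 'rV[R]_N) : tm (c *: x) = c * tm x. Proof. by rewrite /tm mxE. Qed.
Lemma spD (x y : 'rV[R]_N) : sp (x + y) = sp x + sp y.
Proof. by apply/rowP => i; rewrite !mxE. Qed.
Lemma spZ c (x : 'rV[R]_N) : sp (c *: x) = c *: sp x.
Proof. by apply/rowP => i; rewrite !mxE. Qed.

(** Holds for every direction at interior times and for spatial directions at all times; so spatial
    derivatives are available on the end slices too. *)
Definition clamp_linear (z v : 'rV[R]_N) : Prop :=
  \forall h \near (0 : R), clamp (tm (h *: v + z)) = clamp (tm z) + h * tm v.

Lemma clamp_linear_slice z v : tm v = 0 -> clamp_linear z v.
Proof. move=> v0; rewrite /clamp_linear; near=> h; by rewrite tmD tmZ v0 !mulr0 add0r addr0.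
Unshelve. all: by end_near. Qed.

Lemma clamp_linear_interior z v : 0 < tm z < 1 -> clamp_linear z v.
Proof.
move=> /andP[z0 z1].
have c : {for 0, continuous (fun h : R => h * tm v + tm z)}.
  apply: continuousD; last exact: for_continuous_cst.
  by apply: continuousM; [exact: for_continuous_id|exact: for_continuous_cst].
have n1 : \forall h \near (0 : R), 0 < h * tm v + tm z.
  by apply: (cvgr_gt _ c); rewrite mul0r add0r.
have n2 : \forall h \near (0 : R), h * tm v + tm z < 1.
  by apply: (cvgr_lt _ c); rewrite mul0r add0r.
apply: filterS2 n1 n2 => h h1 h2; rewrite tmD tmZ !clamp_id ?(ltW z0) ?(ltW z1) ?(ltW h1) ?(ltW h2) //.
exact: addrC.
Qed.

Lemma row_shift_apt (s d w : 'rV[R]_n) (t h c : R) (e : 'rV[R]_n) :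
  (h *: w + s) - (t + h * c) *: e - (s - t *: d) = h *: (w - c *: d) - (t + h * c) *: (e - d).
Proof. by apply/rowP => i; rewrite !mxE; ring. Qed.

Lemma row_shift_bpt (s d w : 'rV[R]_n) (t h c : R) (e : 'rV[R]_n) :
  (h *: w + s) + (1 - (t + h * c)) *: e - (s + (1 - t) *: d)
   = h *: (w - c *: d) + (1 - (t + h * c)) *: (e - d).
Proof. by apply/rowP => i; rewrite !mxE; ring. Qed.

Lemma implicit_step (w de : 'rV[R]_n) (X Y : 'M[R]_n) (h t : R) :
  (h *: w - t *: de) *m X = (h *: w + (1 - t) *: de) *m Y ->
  de *m mid t X Y = h *: (w *m (X - Y)).
Proof.
move=> e; rewrite /mid mulmxDr mulmxBr scalerBr !scalemxAr.
move: e; rewrite mulmxBl mulmxDl -!scalemxAl -!scalemxAr.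
move: (h *: (w *m X)) (h *: (w *m Y)) (t *: _) ((1 - t) *: _) => a b c d e.
have -> : a = b + d + c by rewrite -e subrK.
by rewrite -addrA [b + d]addrC -addrA [b + _]addrC subrK.
Qed.

Lemma for_continuous_scalel (V : normedModType R) (v : V) (x : R) : {for x, continuous (fun h : R => h *: v)}.
Proof. move: (@scalel_continuous R V v x); exact. Qed.

(** The implicit function theorem by hand: the Caratheodory form of the two gradients turns the
    difference of the defining equations into a linear system for the increment of the displacement,
    and the continuity of [gd] already proved lets its coefficients converge. *)
Lemma gd_is_derive z v : clamp_linear z v ->
  is_derive z v gd ((sp v - tm v *: gd z) *m gE z).
Proof.
move=> hl; set w := sp v - tm v *: gd z.
have cu := Ck_weak (gp_l gp); have cu' := Ck_weak (gp_r gp).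
have [HA [eA cA]] := caratheodory (apt z) cu.
have [HB [eB cB]] := caratheodory (bpt z) cu'.
pose l (h : R) := h *: v + z.
have l0 : l 0 = z by rewrite /l scale0r add0r.
have cl : l h @[h --> 0] --> z.
  have c : {for 0, continuous l}.
    by apply: continuousD; [apply: for_continuous_scalel|exact: for_continuous_cst].
  by rewrite -[X in _ --> X]l0; exact: c.
pose XA h := HA (apt (l h)); pose XB h := HB (bpt (l h)).
have cXA : XA h @[h --> 0] --> gA z.
  exact: (cvg_comp_at cl (cvg_comp_at (apt_continuous gp (x := z)) cA)).
have cXB : XB h @[h --> 0] --> gB z.
  exact: (cvg_comp_at cl (cvg_comp_at (bpt_continuous gp (x := z)) cB)).
pose th (h : R) := clamp (tm z) + h * tm v.
have cth : th h @[h --> 0] --> clamp (tm z).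
  have c : {for 0, continuous th}.
    apply: continuousD; first exact: for_continuous_cst.
    by apply: continuousM; [exact: for_continuous_id|exact: for_continuous_cst].
  by have := c; rewrite /prop_for /continuous_at {2}/th mul0r addr0.
pose XK h := mid (th h) (XA h) (XB h).
have uK := posdef_unit (gK_posdef gp z).
have nK : \forall h \near (0 : R), XK h \in unitmx by exact: near_mid_unit cXA cXB cth uK.
have cq := cvg_mid_quotient cXA cXB cth (w := w) uK.
have eq1 : \forall h \near (0 : R), gd (l h) - gd z = h *: (w *m (XA h - XB h) *m invmx (XK h)).
  apply: filterS2 hl nK => h ht hu.
  have aptE : apt (l h) - apt z = h *: w - th h *: (gd (l h) - gd z).
    by rewrite /Submission.apt ht spD spZ; exact: row_shift_apt.
  have bptE : bpt (l h) - bpt z = h *: w + (1 - th h) *: (gd (l h) - gd z).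
    by rewrite /Submission.bpt ht spD spZ; exact: row_shift_bpt.
  have e1 := eA (apt (l h)); have e2 := eB (bpt (l h)).
  rewrite -[HA _]/(XA h) aptE in e1; rewrite -[HB _]/(XB h) bptE in e2.
  have e : (h *: w - th h *: (gd (l h) - gd z)) *m XA h = (h *: w + (1 - th h) *: (gd (l h) - gd z)) *m XB h.
    exact: etrans (esym e1) (etrans (esym (congr2 (fun a b => a - b) (gdP gp (l h)) (gdP gp z))) e2).
  have {}e := implicit_step e.
  by rewrite -(mulmxK hu (gd (l h) - gd z)) e -scalemxAl.
have key : (fun h => h^-1 *: (gd (h *: v + z) - gd z)) @ 0^' --> w *m gE z.
  have cq' := cvg_trans (cvg_app _ (@nbhs_dnbhs _ (0 : R))) (cq (nbhs_filter _)).
  apply: cvg_trans cq'; apply: near_eq_cvg.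
  have n1 : \forall h \near (0:R)^', h != 0 by exact: nbhs_dnbhs_neq.
  have n2 := @nbhs_dnbhs _ (0 : R) _ eq1.
  apply: filterS2 n1 n2 => h h0 ->.
  by rewrite scalerA mulVf // scale1r.
have key' : (fun h => h^-1 *: (gd (h *: v + z) - gd z)) @ 0^' --> w *m gE z := key.
split; first by apply/cvg_ex; eexists; exact: key'.
exact: cvg_lim key'.
Qed.

Lemma tm_is_derive z v : clamp_linear z v -> is_derive z v (fun y => clamp (tm y)) (tm v).
Proof.
move=> hl; apply: is_derive_affine; apply: filterS hl => h ->; exact: addrC.
Qed.

Lemma sp_is_derive z v : is_derive z v (@sp R n) (sp v).
Proof. by apply: is_derive_affine; near=> h; rewrite spD spZ.
Unshelve. all: by end_near. Qed.

Lemma is_deriveZp (V : normedModType R) m p (c : V -> R) (A : V -> 'M[R]_(m, p)) x v dc dA :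
  is_derive x v c dc -> is_derive x v A dA ->
  is_derive x v (fun y => c y *: A y) (dc *: A x + c x *: dA).
Proof.
move=> hc /is_derive_mxP hA; apply/is_derive_mxP => i j.
apply: is_derive_eqfun (is_deriveMp hc (hA i j)) => [y|]; first by rewrite mxE.
by rewrite !mxE.
Qed.

Local Transparent partial.
Lemma partial_near_eq (D : set 'rV[R]_N) (f g : 'rV[R]_N -> R) k z : open D -> D z ->
  (forall y, D y -> f y = g y) -> partial k f z = partial k g z.
Proof.
move=> oD Dz e; rewrite /partial; apply: near_eq_derive.
have : \forall y \near z, D y by exact: open_nbhs_nbhs.
by apply: filterS.
Qed.
Local Opaque partial.

Lemma apt_is_derive z v : clamp_linear z v ->
  is_derive z v apt ((sp v - tm v *: gd z) *m (gB z *m invmx (gK z))).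
Proof.
move=> hl; set w := sp v - tm v *: gd z.
have h1 := is_deriveB (sp_is_derive z v) (is_deriveZp (tm_is_derive hl) (gd_is_derive hl)).
apply: is_derive_eqfun h1 => //; rewrite -/w.
have e := mid_sub_l (clamp_itv (tm z)) (gA_posdef gp z) (gB_posdef gp z).
have -> : gB z *m invmx (gK z) = 1%:M - clamp (tm z) *: gE z by rewrite -e.
by rewrite mulmxBr mulmx1 -scalemxAr opprD addrA /w.
Qed.

Lemma bpt_is_derive z v : clamp_linear z v ->
  is_derive z v bpt ((sp v - tm v *: gd z) *m (gA z *m invmx (gK z))).
Proof.
move=> hl; set w := sp v - tm v *: gd z.
have h0 := is_deriveBp (is_derive_cst (1 : R) z v) (tm_is_derive hl).
have h1 := is_deriveD (sp_is_derive z v) (is_deriveZp h0 (gd_is_derive hl)).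
apply: is_derive_eqfun h1 => //; rewrite -/w.
have e := mid_sub_r (clamp_itv (tm z)) (gA_posdef gp z) (gB_posdef gp z).
have -> : gA z *m invmx (gK z) = 1%:M + (1 - clamp (tm z)) *: gE z by rewrite -e.
by rewrite mulmxDr mulmx1 -scalemxAr sub0r scaleNr addrA /w.
Qed.

Lemma gpm_is_derive z v : clamp_linear z v ->
  is_derive z v gpm ((sp v - tm v *: gd z) *m gM z).
Proof.
move=> hl; apply/is_derive_mxP => i j; rewrite ord1.
have := C1_chain openT (Ck_C1on (Ck_partial j (gp_l gp))) I (apt_is_derive hl).
apply: is_derive_eqfun => [y|]; first by rewrite mxE.
have -> : (sp v - tm v *: gd z) *m gM z = (sp v - tm v *: gd z) *m (gB z *m invmx (gK z)) *m gA z.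
  by rewrite /Submission.gM !mulmxA.
rewrite [RHS]mxE; apply: eq_bigr => k _.
by rewrite /Submission.gA [hess _ _ _ _]mxE.
Qed.

(** An envelope argument: the variations of the end points contribute the momentum times the
    variation of b - a, which cancels against the variation of d, and only the variation of the
    momentum is left. *)
Lemma gf_is_derive z v : clamp_linear z v ->
  is_derive z v gf (- dot ((sp v - tm v *: gd z) *m gM z) (gd z)).
Proof.
move=> hl; set w := sp v - tm v *: gd z.
have hb := C1_chain openT (Ck_C1on (gp_r gp)) I (bpt_is_derive hl).
have ha := C1_chain openT (Ck_C1on (gp_l gp)) I (apt_is_derive hl).
rewrite -/w in ha hb.
have hd : is_derive z v (fun y => dot (gpm y) (gd y)) (dot (w *m gM z) (gd z) + dot (gpm z) (w *m gE z)).
  have := is_derive_mulmx (gpm_is_derive hl) (is_derive_trmx (gd_is_derive hl)).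
  by move/is_derive_mxP/(_ 0 0); rewrite e00D.
have h := is_deriveBp (is_deriveBp hb ha) hd.
apply: is_derive_eqfun h => //.
have -> : \sum_j (w *m (gA z *m invmx (gK z))) 0 j * partial j u' (bpt z) =
  dot (w *m (gA z *m invmx (gK z))) (gpm z).
  by rewrite /Submission.gpm -(gdP gp) dotE; apply: eq_bigr => j _; rewrite [grad _ _ _ _]mxE.
have -> : \sum_j (w *m (gB z *m invmx (gK z))) 0 j * partial j u (apt z) =
  dot (w *m (gB z *m invmx (gK z))) (gpm z).
  by rewrite /Submission.gpm dotE; apply: eq_bigr => j _; rewrite [grad _ _ _ _]mxE.
rewrite -dotBl -mulmxBr -mulmxBl [X in _ - (_ + X)]dotC -/(gE z).
by rewrite opprD addrCA subrr addr0.
Qed.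

Local Notation D := [set z : 'rV[R]_N | 0 < tm z < 1].

Lemma open_slab : open D.
Proof.
have -> : D = (@tm R n) @^-1` `]0, 1[%classic by apply/seteqP; split => z /=; rewrite in_itv.
by apply: open_comp => [z _|]; [exact: tm_continuous|exact: interval_open].
Qed.

Lemma tm_delta_x i : tm (delta_mx 0 (xix i) : 'rV[R]_N) = 0.
Proof. by rewrite /tm mxE eq_lrshift andbF. Qed.
Lemma tm_delta_t : tm (delta_mx 0 (tix : 'I_N) : 'rV[R]_N) = 1.
Proof. by rewrite /tm mxE !eqxx. Qed.
Lemma sp_delta_x i : sp (delta_mx 0 (xix i) : 'rV[R]_N) = delta_mx 0 i.
Proof. by apply/rowP => j; rewrite !mxE eq_rshift. Qed.
Lemma sp_delta_t : sp (delta_mx 0 (tix : 'I_N) : 'rV[R]_N) = 0.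
Proof. by apply/rowP => j; rewrite !mxE eq_rlshift andbF. Qed.

Lemma C1on_tm : C1on D (@tm R n). Proof. exact: C1on_coord open_slab. Qed.

Lemma C1mx_sp : C1mx D (@sp R n).
Proof.
move=> i j; apply: (@C1on_eq _ _ D (fun z => z 0 (xix j))) => [|z _|]; [exact: open_slab|by rewrite mxE|].
exact: C1on_coord open_slab.
Qed.

Lemma C1on_clamp : C1on D (fun z => clamp (tm z)).
Proof.
apply: (C1on_eq open_slab _ C1on_tm) => z /andP[z0 z1].
by rewrite clamp_id // !ltW.
Qed.

Lemma C1mx_gd : C1mx D gd.
Proof.
move=> i j; apply: (@C1onI _ _ D _ (fun k z =>
   ((sp (delta_mx 0 k) - tm (delta_mx 0 k : 'rV[R]_N) *: gd z) *m gE z) i j) open_slab) => [z Dz|z k Dz|z k Dz].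
- exact: for_continuous_coord (gd_continuous gp (x := z)).
- exact: (is_derive_mxP _ _ _ _).1 (gd_is_derive (clamp_linear_interior _ Dz)) i j.
- apply: for_continuous_coord; apply: for_continuous_mulmx; last exact: (gE_continuous gp (x := z)).
  have -> : (fun y => sp (delta_mx 0 k : 'rV[R]_N) - tm (delta_mx 0 k : 'rV[R]_N) *: gd y) =
    (fun y => sp (delta_mx 0 k) + - tm (delta_mx 0 k : 'rV[R]_N) *: gd y) by apply/funext => y; rewrite scaleNr.
  apply: (@for_continuous_axpy R n _ (fun=> sp (delta_mx 0 k)) gd (fun=> - tm (delta_mx 0 k : 'rV[R]_N)) z).
  - exact: for_continuous_cst.
  - exact: for_continuous_cst.
  - exact: (gd_continuous gp (x := z)).
Qed.

Lemma C1mx_hess_comp (f : 'rV[R]_n -> R) (phi : 'rV[R]_N -> 'rV[R]_n) (D' : set 'rV[R]_N) : open D' -> Ck 3 f ->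
  C1mx D' phi -> C1mx D' (fun z => hess f (phi z)).
Proof.
move=> oD cf cphi i j.
apply: (@C1on_eq _ _ D' (fun z => partial i (partial j f) (phi z)) _ oD) => [z _|]; first by rewrite mxE.
apply: (@C1on_comp _ _ _ D' setT) => //; first exact: openT.
exact: Ck_C1on (Ck_partial i (Ck_partial j cf)).
Qed.

Section Along.
Variables (D' : set 'rV[R]_N) (phi : 'rV[R]_N -> 'rV[R]_N).
Hypotheses (oD : open D') (cs : C1mx D' (fun z => sp (phi z)))
  (ct : C1on D' (fun z => clamp (tm (phi z)))) (cd : C1mx D' (fun z => gd (phi z))).

(** The map [phi] allows one argument to be used twice: for the identity on the open slab and for
    [at_time c] on all of space-time. *)
Lemma C1mx_apt_along : C1mx D' (fun z => apt (phi z)).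
Proof. exact: (C1mx_add oD cs (C1mx_opp oD (C1mx_scale oD ct cd))). Qed.

Lemma C1mx_bpt_along : C1mx D' (fun z => bpt (phi z)).
Proof.
have h := C1on_add oD (C1on_cst 1 oD) (C1on_opp oD ct).
exact: (C1mx_add oD cs (C1mx_scale oD h cd)).
Qed.

Lemma C1mx_gA_along : C1mx D' (fun z => gA (phi z)).
Proof. exact: C1mx_hess_comp oD (gp_l gp) C1mx_apt_along. Qed.

Lemma C1mx_gB_along : C1mx D' (fun z => gB (phi z)).
Proof. exact: C1mx_hess_comp oD (gp_r gp) C1mx_bpt_along. Qed.

Lemma C1mx_gKi_along : C1mx D' (fun z => invmx (gK (phi z))).
Proof.
apply: (C1mx_inv oD) => [z _|]; first exact: posdef_unit (gK_posdef gp (phi z)).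
have h := C1on_add oD (C1on_cst 1 oD) (C1on_opp oD ct).
exact: (C1mx_add oD (C1mx_scale oD h C1mx_gB_along) (C1mx_scale oD ct C1mx_gA_along)).
Qed.

Lemma C1mx_gE_along : C1mx D' (fun z => gE (phi z)).
Proof.
exact: (C1mx_mul oD (C1mx_add oD C1mx_gA_along (C1mx_opp oD C1mx_gB_along)) C1mx_gKi_along).
Qed.

Lemma C1mx_gM_along : C1mx D' (fun z => gM (phi z)).
Proof. exact: (C1mx_mul oD (C1mx_mul oD C1mx_gB_along C1mx_gKi_along) C1mx_gA_along). Qed.

Lemma C1on_gf_along : C1on D' (fun z => gf (phi z)).
Proof.
have h1 : C1on D' (fun z => u' (bpt (phi z))).
  exact: (@C1on_comp _ _ _ D' setT u' _ oD openT (fun _ _ => I) (Ck_C1on (gp_r gp)) C1mx_bpt_along).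
have h2 : C1on D' (fun z => u (apt (phi z))).
  exact: (@C1on_comp _ _ _ D' setT u _ oD openT (fun _ _ => I) (Ck_C1on (gp_l gp)) C1mx_apt_along).
have h3 : C1mx D' (fun z => gpm (phi z)).
  move=> i j; apply: (C1on_eq oD _
    (@C1on_comp _ _ _ D' setT (partial j u) _ oD openT (fun _ _ => I) (Ck_C1on (Ck_partial j (gp_l gp))) C1mx_apt_along)).
  by move=> z _; rewrite mxE.
have h4 := C1mx_mul oD h3 (C1mx_tr oD cd).
exact: (C1on_add oD (C1on_add oD h1 (C1on_opp oD h2)) (C1on_opp oD (h4 0 0))).
Qed.

End Along.

Lemma C1mx_gE : C1mx D gE.
Proof. exact: (C1mx_gE_along open_slab C1mx_sp C1on_clamp C1mx_gd). Qed.

Lemma C1mx_gM : C1mx D gM.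
Proof. exact: (C1mx_gM_along open_slab C1mx_sp C1on_clamp C1mx_gd). Qed.

Definition at_time (c : R) (z : 'rV[R]_N) : 'rV[R]_N := row_mx (const_mx c) (sp z).

Lemma tm_at c z : tm (at_time c z) = c.
Proof. by rewrite /tm /at_time /tix row_mxEl mxE. Qed.

Lemma sp_at c z : sp (at_time c z) = sp z.
Proof. by apply/rowP => i; rewrite [LHS]mxE /at_time /xix row_mxEr. Qed.

Lemma at_timeK z : at_time (tm z) z = z.
Proof.
apply/rowP => k; rewrite -(splitK k); case: (fintype.split k) => j /=.
  by rewrite row_mxEl mxE ord1 /tm.
by rewrite row_mxEr mxE.
Qed.

Lemma at_time_line c h v z : at_time c (h *: v + z) = h *: at_time 0 v + at_time c z.
Proof.
rewrite /at_time spD spZ scale_row_mx add_row_mx; congr row_mx.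
by apply/rowP => i; rewrite !mxE mulr0 add0r.
Qed.

Lemma at_time_is_derive (V : normedModType R) (F : 'rV[R]_N -> V) c z v l :
  is_derive (at_time c z) (at_time 0 v) F l -> is_derive z v (fun y => F (at_time c y)) l.
Proof.
move=> /is_derive1P h; apply/is_derive1P.
by have -> : (fun t : R => F (at_time c (t *: v + z))) = (fun t : R => F (t *: at_time 0 v + at_time c z))
  by apply/funext => t; rewrite at_time_line.
Qed.

Lemma at_time_delta i : at_time 0 (delta_mx 0 (xix i)) = delta_mx 0 (xix i).
Proof. by rewrite -(tm_delta_x i) at_timeK. Qed.

Lemma at_time_continuous c : continuous (at_time c).
Proof.
move=> z; apply: for_continuous_mx => i j; rewrite ord1.
rewrite -(splitK j); case: (fintype.split j) => k /=.
  have -> : (fun y => at_time c y 0 (lshift n k)) = (fun=> c) by apply/funext => y; rewrite row_mxEl mxE.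
  exact: for_continuous_cst.
have -> : (fun y => at_time c y 0 (rshift 1 k)) = (fun y => y 0 (xix k)) by apply/funext => y; rewrite row_mxEr mxE.
exact: coord_continuous.
Qed.

Section Slice.
Variable c : R.
Hypothesis c01 : 0 <= c <= 1.

Lemma C1mx_gd_slice : C1mx setT (fun z => gd (at_time c z)).
Proof.
move=> i j; apply: (@C1onI _ _ setT _ (fun k z =>
   (sp (delta_mx 0 k : 'rV[R]_N) *m gE (at_time c z)) i j) openT) => [z _|z k _|z k _].
- apply: for_continuous_coord.
  exact: (for_continuous_comp (at_time_continuous (x := z)) (gd_continuous gp (x := at_time c z))).
- apply: (is_derive_mxP _ _ _ _).1; apply: at_time_is_derive.
  have t0 : tm (at_time 0 (delta_mx 0 k : 'rV[R]_N)) = 0 by rewrite tm_at.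
  have := gd_is_derive (clamp_linear_slice (at_time c z) t0).
  by rewrite t0 scale0r subr0 sp_at.
- apply: for_continuous_coord; apply: for_continuous_mulmx; first exact: for_continuous_cst.
  exact: (for_continuous_comp (at_time_continuous (x := z)) (gE_continuous gp (x := at_time c z))).
Qed.

Lemma C1mx_sp_slice : C1mx setT (fun z => sp (at_time c z)).
Proof.
have -> : (fun z => sp (at_time c z)) = @sp R n by apply/funext => z; rewrite sp_at.
move=> i j; apply: (@C1on_eq _ _ setT (fun z => z 0 (xix j))) => [|z _|]; [exact: openT|by rewrite mxE|].
exact: C1on_coord openT.
Qed.

Lemma C1on_clamp_slice : C1on setT (fun z => clamp (tm (at_time c z))).
Proof.
have -> : (fun z => clamp (tm (at_time c z))) = (fun=> c) by apply/funext => z; rewrite tm_at clamp_id.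
exact: C1on_cst openT.
Qed.

Lemma C1mx_gE_slice : C1mx setT (fun z => gE (at_time c z)).
Proof. exact: (C1mx_gE_along openT C1mx_sp_slice C1on_clamp_slice C1mx_gd_slice). Qed.

Lemma C1on_gf_slice : C1on setT (fun z => gf (at_time c z)).
Proof. exact: (C1on_gf_along openT C1mx_sp_slice C1on_clamp_slice C1mx_gd_slice). Qed.

End Slice.

Lemma gd_dx z i j : dx i (fun y => gd y 0 j) z = gE z i j.
Proof.
have := gd_is_derive (clamp_linear_slice z (tm_delta_x i)).
move/is_derive_mxP/(_ 0 j)/partial_val => e.
by rewrite /dx e sp_delta_x tm_delta_x scale0r subr0 -rowE mxE.
Qed.

Lemma gd_dt z j : D z -> dt (fun y => gd y 0 j) z = - (gd z *m gE z) 0 j.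
Proof.
move=> Dz; have := gd_is_derive (clamp_linear_interior (delta_mx 0 tix) Dz).
move/is_derive_mxP/(_ 0 j)/partial_val => e.
by rewrite /dt e sp_delta_t tm_delta_t scale1r sub0r mulNmx mxE.
Qed.

Lemma gf_dx z i : dx i gf z = - (gd z *m gM z) 0 i.
Proof.
have := partial_val (gf_is_derive (clamp_linear_slice z (tm_delta_x i))).
rewrite /dx => ->; rewrite sp_delta_x tm_delta_x scale0r subr0 /dot.
rewrite -mulmxA -rowE mxE -(posdef_sym (gM_posdef gp z)) -trmx_mul [X in - X = _]mxE.
by rewrite (posdef_sym (gM_posdef gp z)).
Qed.

Lemma gf_dt z : D z -> dt gf z = qf (gM z) (gd z).
Proof.
move=> Dz; have := partial_val (gf_is_derive (clamp_linear_interior (delta_mx 0 tix) Dz)).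
rewrite /dt => ->; rewrite sp_delta_t tm_delta_t scale1r sub0r.
by rewrite mulNmx dotNl opprK.
Qed.

Lemma gpm_dx z i j : dx i (fun y => gpm y 0 j) z = gM z i j.
Proof.
have := gpm_is_derive (clamp_linear_slice z (tm_delta_x i)).
move/is_derive_mxP/(_ 0 j)/partial_val => e.
by rewrite /dx e sp_delta_x tm_delta_x scale0r subr0 -rowE mxE.
Qed.

Lemma gpm_dt z j : D z -> dt (fun y => gpm y 0 j) z = - (gd z *m gM z) 0 j.
Proof.
move=> Dz; have := gpm_is_derive (clamp_linear_interior (delta_mx 0 tix) Dz).
move/is_derive_mxP/(_ 0 j)/partial_val => e.
by rewrite /dt e sp_delta_t tm_delta_t scale1r sub0r mulNmx mxE.
Qed.

Lemma C1on_gf : C1on D gf.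
Proof. exact: (C1on_gf_along open_slab C1mx_sp C1on_clamp C1mx_gd). Qed.

Lemma C1mx_gpm : C1mx D gpm.
Proof.
move=> i j; apply: (C1on_eq open_slab _
  (@C1on_comp _ _ _ D setT (partial j u) apt open_slab openT (fun _ _ => I) (Ck_C1on (Ck_partial j (gp_l gp)))
    (C1mx_apt_along open_slab C1mx_sp C1on_clamp C1mx_gd))).
by move=> z _; rewrite mxE.
Qed.

(** The matrix field is the Jacobian of the momentum, so the symmetry of third derivatives and the
    evolution of the matrix both follow from [schwarz] applied to the momentum. *)
Lemma geodesic_hma : hma D gf gM gd.
Proof.
have cdM := C1mx_mul open_slab C1mx_gd C1mx_gM.
have pxE i j : dx i (fun y => gpm y 0 j) = (fun z => gM z i j).
  by apply/funext => z; exact: gpm_dx.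
split; [exact: C1on_gf|exact: C1mx_gM|exact: C1mx_gd|by move=> z _; exact: gM_posdef gp z|by move=> z; exact: gf_dt
  |by move=> i z _; exact: gf_dx| |].
- move=> k i j z Dz; rewrite -!pxE.
  apply: (schwarz open_slab Dz); first exact: C1mx_gpm.
    by rewrite -[partial _ _]/(dx k _) pxE; exact: C1mx_gM.
  by rewrite -[partial _ _]/(dx i _) pxE; exact: C1mx_gM.
- move=> i j z Dz; rewrite -pxE.
  have ptE y : D y -> dt (fun y => gpm y 0 j) y = - (gd y *m gM y) 0 j by exact: gpm_dt.
  have c : C1on D (dt (fun y => gpm y 0 j)).
    by apply: (C1on_eq open_slab _ (C1on_opp open_slab (cdM 0 j))) => y Dy; rewrite ptE.
  rewrite /dt /dx (schwarz open_slab Dz (C1mx_gpm 0 j) c); last first.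
    by rewrite -[partial _ _]/(dx i _) pxE; exact: C1mx_gM.
  rewrite -(partial_val (is_deriveNp (C1on_partial (xix i) (cdM 0 j) Dz))).
  exact: partial_near_eq open_slab Dz ptE.
Qed.

(** The displacement satisfies Burgers' equation d_t + (d . grad) d = 0, since it is constant along
    straight segments. Taking the spatial divergence gives the transport equation for the trace. *)
Lemma trace_transport z : D z ->
  dt (fun y => \tr (gE y)) z + \sum_l gd z 0 l * dx l (fun y => \tr (gE y)) z = - \tr (gE z *m gE z).
Proof.
move=> Dz.
have dxE i j : dx i (fun y => gd y 0 j) = (fun z => gE z i j) by apply/funext => y; exact: gd_dx.
have cE i j : C1on D (dx i (fun y => gd y 0 j)) by rewrite dxE; exact: C1mx_gE.
have tr k : partial k (fun y => \tr (gE y)) z = \sum_i partial k (fun y => gE y i i) z.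
  by apply: partial_val; apply: is_derive_suml => i _; exact: C1on_partial (C1mx_gE i i) Dz.
(* The components of Burgers' equation; they vanish on the whole open slab, so they may be
   differentiated once more. *)
pose Q j := fun y => dt (fun y => gd y 0 j) y + \sum_l gd y 0 l * dx l (fun y => gd y 0 j) y.
have Q0 j y : D y -> Q j y = 0.
  move=> Dy; rewrite /Q (gd_dt _ Dy) mxE addrC; apply/eqP; rewrite subr_eq0; apply/eqP.
  by apply: eq_bigr => l _; rewrite dxE.
have cdt j : C1on D (dt (fun y => gd y 0 j)).
  apply: (C1on_eq open_slab _ (C1on_opp open_slab (C1mx_mul open_slab C1mx_gd C1mx_gE 0 j))) => y Dy.
  by rewrite gd_dt.
have sw i k l : partial l (dx k (fun y => gd y 0 i)) z = dx k (partial l (fun y => gd y 0 i)) z ->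
   partial l (fun y => gE y k i) z = dx k (partial l (fun y => gd y 0 i)) z by rewrite dxE.
have dQ i : dx i (Q i) z = dt (fun y => gE y i i) z + \sum_l (gE z i l * gE z l i + gd z 0 l * dx l (fun y => gE y i i) z).
  apply: partial_val; rewrite /Q; apply: is_deriveDp.
    rewrite /dt (sw i i tix); first exact: C1on_partial (cdt i) Dz.
    exact: schwarz open_slab Dz (C1mx_gd 0 i) (cdt i) (cE i i).
  apply: is_derive_suml => l _.
  apply: is_derive_eqfun (is_deriveMp (C1on_partial (xix i) (C1mx_gd 0 l) Dz) (C1on_partial (xix i) (cE l i) Dz)) => //.
  rewrite -/(dx i _ z) gd_dx -/(dx l _ _) gd_dx; congr (_ * _ + _ * _).
  rewrite [RHS]/dx (sw i i (xix l) (schwarz open_slab Dz (C1mx_gd 0 i) (cE l i) (cE i i))).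
  by [].
have S0 : \sum_i dx i (Q i) z = 0.
  apply: big1 => i _; rewrite /dx; have c0 : partial (xix i) (fun=> 0 : R) z = 0.
    exact: partial_val (is_derive_cst (0 : R) z _).
  by rewrite -c0; apply: partial_near_eq open_slab Dz _ => y Dy; exact: Q0.
move: S0; rewrite (eq_bigr _ (fun i _ => dQ i)) big_split /= /dt tr => S0.
apply/eqP; rewrite -subr_eq0 opprK; apply/eqP; rewrite -[RHS]S0 -addrA; congr (_ + _).
rewrite addrC trace_entries.
rewrite [RHS](eq_bigr (fun i => \sum_l gE z i l * gE z l i + \sum_l gd z 0 l * dx l (fun y => gE y i i) z)); last first.
  by move=> i _; rewrite big_split.
rewrite [RHS]big_split /=; congr (_ + _).
rewrite [RHS]exchange_big /=; apply: eq_bigr => l _.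
by rewrite /dx tr mulr_sumr.
Qed.

Lemma gd_dx_slice c z i j : dx i (fun y => gd (at_time c y) 0 j) z = gE (at_time c z) i j.
Proof.
rewrite -gd_dx; apply: partial_val; rewrite /dx.
have h := (is_derive_mxP _ _ _ _).1 (gd_is_derive (clamp_linear_slice (at_time c z) (tm_delta_x i))) 0 j.
rewrite (partial_val h); apply: (@at_time_is_derive _ (fun y => gd y 0 j)).
by rewrite at_time_delta.
Qed.

Lemma gf_dx_slice c z i : dx i (fun y => gf (at_time c y)) z = - (gd (at_time c z) *m gM (at_time c z)) 0 i.
Proof.
rewrite -gf_dx; apply: partial_val; rewrite /dx.
have h := gf_is_derive (clamp_linear_slice (at_time c z) (tm_delta_x i)).
rewrite (partial_val h); apply: at_time_is_derive.
by rewrite at_time_delta.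
Qed.

End GeodesicDerivative.

(** * Conservation laws with exponentially decaying flux *)

Section ConservationLaws.
Context {R : realType} {n : nat}.
Local Notation N := (1 + n)%N.
Local Notation D := [set z : 'rV[R]_N | 0 < tm z < 1].
Implicit Types (w T : 'rV[R]_N -> R) (W : 'I_n -> 'rV[R]_N -> R).

(** Density w, flux W and source T. The equation holds in the open slab, while w and T are
    continuous on all of space-time, so that values of w at times 0 and 1 can be exploited. The flux
    bound is uniform in time. *)
Record claw (c : R) w W T : Prop := CLaw {
  claw_0 : C1on D w; claw_i : forall i, C1on D (W i);
  claw_div : forall z, D z -> spacetime_div w W z = T z;
  claw_cont : continuous w;
  claw_contT : continuous T;
  claw_flux : exists C, forall i z, D z -> `|W i z| <= C * expR (- (c * `|sp z|))
}.

(** Raise 1 + y <= exp y, with y = a L / (k+1), to the power k + 1. The extra power of L is needed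
    because the bound must still decay like 1/L. *)
Lemma expR_beats_power (a : R) k (L : R) : 0 < a -> 0 < L ->
  L ^+ k * expR (- (a * L)) <= (k.+1%:R / a) ^+ k.+1 / L.
Proof.
move=> a0 L0; set m : R := k.+1%:R; have m0 : 0 < m by rewrite ltr0n.
have y0 : 0 < a * L / m by rewrite divr_gt0 // mulr_gt0.
have h : (a * L / m) ^+ k.+1 <= expR (a * L).
  have -> : expR (a * L) = expR (a * L / m) ^+ k.+1.
    by rewrite -expRM_natl -/m mulrCA divff ?mulr1 ?lt0r_neq0.
  rewrite lerXn2r ?nnegrE ?expR_ge0 ?(ltW y0) //.
  by apply: le_trans (expR_ge1Dx _); rewrite lerDr.
rewrite expRN ler_pdivrMr ?expR_gt0 // mulrAC ler_pdivlMr // -exprSr.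
apply: (@le_trans _ _ ((m / a) ^+ k.+1 * (a * L / m) ^+ k.+1)); last first.
  by rewrite ler_wpM2l // exprn_ge0 // divr_ge0 // ltW.
have e : m / a * (a * L / m) = L by field; rewrite !lt0r_neq0.
by rewrite -exprMn e.
Qed.

Definition stW w W (k : 'I_N) : 'rV[R]_N -> R := match fintype.split k with inl _ => w | inr i => W i end.

Lemma stW_t w W : stW w W tix = w.
Proof. by rewrite /stW /tix; case: splitP => // j /= /eqP; rewrite add0n. Qed.

Lemma stW_x w W i : stW w W (xix i) = W i.
Proof.
rewrite /stW /xix; case: splitP => [j /= e|k /= /eqP].
  by have := ltn_ord j; rewrite -e.
by rewrite eqn_add2l => /eqP e; congr W; apply: val_inj.
Qed.

Lemma row_sum (S : zmodType) (F : 'I_N -> S) : \sum_k F k = F tix + \sum_i F (xix i).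
Proof. by rewrite big_split_ord /= big_ord1. Qed.

Lemma row_prod (F : 'I_N -> R) : \prod_k F k = F tix * \prod_i F (xix i).
Proof. by rewrite big_split_ord /= big_ord1. Qed.

Lemma tix_or_xix (P : 'I_N -> Prop) : P tix -> (forall i, P (xix i)) -> forall k, P k.
Proof.
move=> Pt Px k; rewrite -(splitK k); case: (fintype.split k) => [j|j] /=; last exact: Px.
by rewrite ord1; exact: Pt.
Qed.

(** If T were positive near z0, the source in a small box would exceed the flux out of a large one,
    of spatial half-width L r and covering almost all of [0, 1] in time. The small box lasts only a
    fraction 1/L of that time, so its source is of order 1/L; the time faces and the sides must both
    be made smaller than that. *)
Lemma claw_vanish c w W T (z0 : 'rV[R]_N) : 0 < c -> claw c w W T ->
  (forall z, tm z = 0 \/ tm z = 1 -> w z = 0) -> (forall z, D z -> 0 <= T z) ->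
  tm z0 = 1 / 2 -> T z0 = 0.
Proof.
move=> c0 h W00 T0 tz0.
have Dz0 : D z0 by rewrite /= tz0; lra.
apply/eqP; rewrite eq_le T0 // andbT leNgt; apply/negP => Tp.
pose kappa := T z0 / 2; have k0 : 0 < kappa by rewrite divr_gt0.
have [r0 r00 hr0] : exists2 r, 0 < r & forall z, `|z - z0| <= r -> kappa <= T z.
  have [|d d0 hd] := @compact_uniform _ _ [set z0] T kappa k0 (@compact_set1 _ z0).
    by move=> x _; exact: claw_contT h x.
  exists d => // z hz; have := hd z0 z erefl hz; rewrite ler_distl => /andP[+ _].
  by rewrite /kappa; lra.
have [C hC] := claw_flux h.
have C0 : 0 <= `|C| by [].
pose r := r0; pose xs := `|sp z0|.
pose K0 := kappa * (2 * r) ^+ n.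
have K00 : 0 < K0 by rewrite mulr_gt0 // exprn_gt0 // mulr_gt0.
(* These constants are chosen so that, after [expR_beats_power], the sides contribute at most K2 /
   (2 L^2). *)
pose K1 := 4 * (`|C| * expR (c * xs)) * n%:R * (2 * r) ^+ n / (2 * r).
have K10 : 0 <= K1.
  have r2 : 0 <= 2 * r by rewrite mulr_ge0 // ltW.
  rewrite /K1; apply: divr_ge0 => //; apply: mulr_ge0; last exact: exprn_ge0.
  by rewrite !mulr_ge0 ?expR_ge0.
pose K2 := K1 * (n.+1%:R / (c * r)) ^+ n.+1.
have K20 : 0 <= K2.
  apply: mulr_ge0 K10 _; apply: exprn_ge0; apply: divr_ge0 => //.
  by apply: mulr_ge0; exact: ltW.
have Q0 : 0 <= K2 / K0 by rewrite divr_ge0 // ltW.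
have ir0 : 0 <= 1 / r by rewrite divr_ge0 // ltW.
(* L > 1/r makes the small box shorter in time than r, so that it lies where T >= kappa; L > 4 K2 /
   K0 makes the sides negligible against the source. *)
pose M := Num.truncn (1 / r + 4 * (K2 / K0)).
pose L : R := (2 * M + 1)%:R.
have LM : 1 / r + 4 * (K2 / K0) < L.
  have q0 : 0 <= 1 / r + 4 * (K2 / K0) by apply: addr_ge0 ir0 _; apply: mulr_ge0.
  have /andP[_ h1] := truncn_itv q0.
  apply: lt_le_trans h1 _; rewrite -/M ler_nat addn1 ltnS.
  by rewrite mul2n -addnn leq_addr.
have L0 : 0 < L by apply: le_lt_trans LM; apply: addr_ge0 ir0 _; apply: mulr_ge0.
have Lr : 1 < L * r.
  rewrite -ltr_pdivrMr //; apply: le_lt_trans LM; by rewrite -div1r lerDl mulr_ge0.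
have LK : K2 / L < K0 / 4.
  have h1 : 4 * (K2 / K0) < L by apply: le_lt_trans LM; rewrite lerDr.
  rewrite ltr_pdivrMr // mulrAC ltr_pdivlMr //.
  by move: h1; rewrite mulrA ltr_pdivrMr // mulrC [K0 * L]mulrC.
pose V : R := (2 * (L * r)) ^+ n.
have V0 : 0 < V by rewrite exprn_gt0 // !mulr_gt0.
(* V is the area of a time face, so the two time faces together contribute at most K0 / (4 L). *)
pose e' := K0 / (8 * L * V).
have e0 : 0 < e' by rewrite divr_gt0 // !mulr_gt0.
pose big : 'rV[R]_N := row_mx (const_mx (1 / 2)) (const_mx (L * r)).
have bigt : big 0 tix = 1 / 2 by rewrite /big /tix row_mxEl mxE.
have bigx i : big 0 (xix i) = L * r by rewrite /big /xix row_mxEr mxE.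
have [|d d0 hd] := @compact_uniform _ _ (box z0 big) w e' e0 (@box_compact R N z0 big).
  by move=> x _; exact: claw_cont h x.
pose eps := Num.min d (1 / 4).
have ep0 : 0 < eps by rewrite lt_min d0 divr_gt0.
have ep1 : eps <= 1 / 4 by rewrite ge_min lexx orbT.
have epd : eps <= d by rewrite ge_min lexx.
pose st := (1 / 2 - eps) / L.
have st0 : 0 < st by rewrite divr_gt0 // subr_gt0; lra.
have Lst : L * st = 1 / 2 - eps by rewrite mulrC divfK // lt0r_neq0.
pose s : 'rV[R]_N := row_mx (const_mx st) (const_mx r).
have st_ : s 0 tix = st by rewrite /s /tix row_mxEl mxE.
have sx i : s 0 (xix i) = r by rewrite /s /xix row_mxEr mxE.
have boxD : box z0 (L *: s) `<=` D.
  move=> z /(_ tix); rewrite mxE st_ Lst -[z 0 tix]/(tm z) -[z0 0 tix]/(tm z0) tz0 ler_distl /= => /andP[h1 h2].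
  by apply/andP; split; lra.
have boxbig : box z0 (L *: s) `<=` box z0 big.
  move=> z hz; apply: tix_or_xix => [|i].
    have := hz tix; rewrite mxE st_ Lst bigt => h1; apply: le_trans h1 _; lra.
  by have := hz (xix i); rewrite mxE sx bigx.
pose b (k : 'I_N) := match fintype.split k with inl _ => e' | inr _ => `|C| * expR (c * xs) * expR (- (c * (L * r))) end.
have bt : b tix = e'.
  by rewrite /b /tix; case: splitP => // j /= /eqP; rewrite add0n.
have bx i : b (xix i) = `|C| * expR (c * xs) * expR (- (c * (L * r))).
  rewrite /b /xix; case: splitP => // j /= e; by have := ltn_ord j; rewrite -e.
have TE z : D z -> \sum_k partial k (stW w W k) z = T z.
  move=> Dz; rewrite row_sum stW_t -(claw_div h Dz) /spacetime_div; congr (_ + _).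
  by apply: eq_bigr => i _; rewrite stW_x.
have := @grid_divergence R N D (stW w W) z0 s M b kappa (@open_slab R n) boxD isT _ _ _ _ (ltW k0) _.
rewrite -/L.
have -> : \prod_j (2 * s 0 j) = 2 * st * (2 * r) ^+ n.
  rewrite row_prod st_; congr (_ * _); under eq_bigr do rewrite sx.
  by rewrite prodr_const card_ord.
have VE : \prod_j (2 * (L * s 0 j)) = 2 * (L * st) * V.
  rewrite row_prod st_; congr (_ * _); under eq_bigr do rewrite sx.
  by rewrite prodr_const card_ord.
have Vi i : \prod_(j | j != i) (2 * (L * s 0 j)) = 2 * (L * st) * V / (2 * (L * s 0 i)).
  have si : 2 * (L * s 0 i) != 0.
    apply: mulf_neq0 => //; apply: mulf_neq0; first exact: lt0r_neq0.
    by move: i; apply: tix_or_xix => [|i]; rewrite ?st_ ?sx lt0r_neq0.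
  by rewrite -VE [in RHS](bigD1 i) //= [X in _ = X / _]mulrC mulfK.
rewrite row_sum Vi bt st_.
under eq_bigr => i _ do rewrite Vi bx sx.
rewrite sumr_const card_ord => main.
have {}main : kappa * (2 * st * (2 * r) ^+ n) <= 2 * e' * (2 * (L * st) * V / (2 * (L * st))) +
   (2 * (`|C| * expR (c * xs) * expR (- (c * (L * r)))) * (2 * (L * st) * V / (2 * (L * r)))) *+ n.
  apply: main.
  - by apply: tix_or_xix => [|i]; rewrite ?st_ ?sx.
  - by apply: tix_or_xix => [|i]; rewrite ?stW_t ?stW_x; [exact: claw_0 h|exact: claw_i h i].
  - by move=> z /boxD Dz; rewrite TE // T0.
  - move=> z hz; have hz' : `|z - z0| <= r.
      apply/(row_norm_le _ (ltW r00)); apply: tix_or_xix => [|i]; rewrite !mxE.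
        have := hz tix; rewrite st_ => h1; apply: le_trans h1 _.
        rewrite /st ler_pdivrMr // [r0 * L]mulrC; move: Lr ep0; rewrite /r; move: (L * r0) => q; lra.
      by have := hz (xix i); rewrite sx.
    rewrite TE; first exact: hr0.
    apply: boxD => k; rewrite mxE; apply: le_trans (hz k) _.
    have L1 : 1 <= L by rewrite /L ler1n addn1.
    rewrite ler_peMl //; move: k {hz}; apply: tix_or_xix => [|i]; rewrite ?st_ ?sx; exact: ltW.
  - apply: tix_or_xix => [z hz|i z hz].
      rewrite st_ Lst stW_t bt -[z 0 tix]/(tm z) -[z0 0 tix]/(tm z0) tz0 => hf.
      (* The time faces lie at t = eps and t = 1 - eps, within the modulus d of an end slice, where
         w vanishes. *)
      have [z' [hz' h0]] : exists z', `|z' - z| <= d /\ (tm z' = 0 \/ tm z' = 1).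
        have [neg|pos] := leP (tm z) (1 / 2).
          exists (z - eps *: delta_mx 0 tix); split.
            rewrite addrAC subrr add0r normrN; apply: le_trans (norm_delta_le _ _) _.
            by rewrite gtr0_norm.
          left; rewrite -scaleNr tmD tmZ tm_delta_t mulr1.
          by move: hf; rewrite ler0_norm; lra.
        exists (eps *: delta_mx 0 tix + z); split.
          rewrite addrK; apply: le_trans (norm_delta_le _ _) _.
          by rewrite gtr0_norm.
        right; rewrite tmD tmZ tm_delta_t mulr1.
        by move: hf; rewrite gtr0_norm; lra.
      by have := hd z z' (boxbig _ hz) hz'; rewrite (W00 _ h0) sub0r normrN.
    rewrite sx stW_x bx => hf; apply: le_trans (hC i z (boxD _ hz)) _.
    apply: (@le_trans _ _ (`|C| * expR (- (c * `|sp z|)))).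
      by rewrite ler_wpM2r ?expR_ge0 // ler_norm.
    rewrite -mulrA ler_wpM2l // -expRD ler_expR.
    rewrite -mulrBr -mulrN ler_pM2l // lerNl opprB lerBlDr -hf.
    apply: (@le_trans _ _ `|sp z - sp z0|).
      have -> : z 0 (xix i) - z0 0 (xix i) = (sp z - sp z0) 0 i by rewrite !mxE.
      exact: coord_le_norm.
    exact: ler_normB.
move: main; have u1 : 2 * (L * st) != 0 by apply: mulf_neq0 => //; apply: mulf_neq0; exact: lt0r_neq0.
have -> : 2 * (L * st) * V / (2 * (L * st)) = V by rewrite mulrAC divff // mul1r.
rewrite Lst => main.
have E1 : 2 * e' * V = K0 / (4 * L) by rewrite /e'; field; rewrite !lt0r_neq0.
have V' : V = L ^+ n * (2 * r) ^+ n by rewrite /V mulrCA exprMn.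
have E2 := @expR_beats_power (c * r) n L (mulr_gt0 c0 r00) L0.
have B1 : (2 * (`|C| * expR (c * xs) * expR (- (c * (L * r)))) * (2 * (1 / 2 - eps) * V / (2 * (L * r)))) *+ n
   <= K2 / L / (2 * L).
  have -> : K2 / L / (2 * L) = K1 * ((n.+1%:R / (c * r)) ^+ n.+1 / L) / (2 * L) by rewrite /K2 mulrA.
  apply: (@le_trans _ _ (K1 * (L ^+ n * expR (- (c * r * L))) / (2 * L))); last first.
    by rewrite ler_wpM2r ?invr_ge0 ?mulr_ge0 ?(ltW L0) // ler_wpM2l.
  have -> : c * (L * r) = c * r * L by ring.
  rewrite V' -mulr_natr /K1.
  have -> : 2 * (`|C| * expR (c * xs) * expR (- (c * r * L))) * (2 * (1 / 2 - eps) * (L ^+ n * (2 * r) ^+ n) / (2 * (L * r))) * n%:R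
    = (1 - 2 * eps) * (4 * (`|C| * expR (c * xs)) * n%:R * (2 * r) ^+ n / (2 * r) * (L ^+ n * expR (- (c * r * L))) / (2 * L)).
    by field; rewrite !lt0r_neq0.
  apply: ler_piMl; last by rewrite gerBl mulr_ge0 // ltW.
  apply: divr_ge0; last by rewrite mulr_ge0 // ltW.
  apply: mulr_ge0; first exact: K10.
  by apply: mulr_ge0; [apply: exprn_ge0; exact: ltW|exact: expR_ge0].
have B2 : K0 / (2 * L) <= kappa * (2 * st * (2 * r) ^+ n).
  have -> : kappa * (2 * st * (2 * r) ^+ n) = K0 * (2 * (1 / 2 - eps)) / L by rewrite /K0 /st; field; rewrite lt0r_neq0.
  rewrite invfM mulrA ler_wpM2r ?invr_ge0 ?(ltW L0) // ler_wpM2l ?(ltW K00) //; lra.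
have := le_trans B2 (le_trans main (lerD (lexx _) B1)); rewrite E1.
have -> : K0 / (2 * L) = K0 / 2 / L by field; rewrite lt0r_neq0.
have -> : K0 / (4 * L) + K2 / L / (2 * L) = (K0 / 4 + K2 / L / 2) / L by field; rewrite lt0r_neq0.
rewrite ler_pM2r ?invr_gt0 //.
by move: LK; move: (K2 / L) => q; lra.
Qed.

Lemma claw_add c w W T w' W' T' : claw c w W T -> claw c w' W' T' ->
  claw c (fun z => w z + w' z) (fun i z => W i z + W' i z) (fun z => T z + T' z).
Proof.
move=> h h'; have oD := @open_slab R n; split.
- exact: C1on_add oD (claw_0 h) (claw_0 h').
- by move=> i; exact: C1on_add oD (claw_i h i) (claw_i h' i).
- move=> z Dz; rewrite -(claw_div h Dz) -(claw_div h' Dz) /spacetime_div addrACA; congr (_ + _).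
    by apply: partial_val; apply: is_deriveDp; [exact: C1on_partial (claw_0 h) Dz|exact: C1on_partial (claw_0 h') Dz].
  rewrite -big_split; apply: eq_bigr => i _.
  by apply: partial_val; apply: is_deriveDp; [exact: C1on_partial (claw_i h i) Dz|exact: C1on_partial (claw_i h' i) Dz].
- by move=> z; exact: (continuousD (claw_cont h (x := z)) (claw_cont h' (x := z))).
- by move=> z; exact: (continuousD (claw_contT h (x := z)) (claw_contT h' (x := z))).
- have [C hC] := claw_flux h; have [C' hC'] := claw_flux h'.
  exists (C + C') => i z Dz; apply: le_trans (ler_normD _ _) _.
  by rewrite mulrDl; apply: lerD; [exact: hC|exact: hC'].
Qed.

Lemma claw_scale c a w W T : claw c w W T ->
  claw c (fun z => a * w z) (fun i z => a * W i z) (fun z => a * T z).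
Proof.
move=> h; have oD := @open_slab R n; have ca := C1on_cst a oD.
have ds (f : 'rV[R]_N -> R) k z : C1on D f -> D z -> partial k (fun y => a * f y) z = a * partial k f z.
  move=> cf Dz; apply: partial_val.
  apply: is_derive_eqfun (is_deriveMp (is_derive_cst a z _) (C1on_partial k cf Dz)) => //.
  by rewrite mul0r add0r.
split.
- exact: C1on_mul oD ca (claw_0 h).
- by move=> i; exact: C1on_mul oD ca (claw_i h i).
- move=> z Dz; rewrite -(claw_div h Dz) /spacetime_div mulrDr mulr_sumr /dt ds //; last exact: claw_0 h.
  by congr (_ + _); apply: eq_bigr => i _; rewrite /dx ds //; exact: claw_i h i.
- by move=> z; apply: continuousM; [exact: for_continuous_cst|exact: (claw_cont h (x := z))].
- by move=> z; apply: continuousM; [exact: for_continuous_cst|exact: (claw_contT h (x := z))].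
- have [C hC] := claw_flux h; exists (`|a| * C) => i z Dz.
  by rewrite normrM -mulrA ler_wpM2l //; exact: hC.
Qed.

Lemma claw_zero c : claw c (fun=> 0) (fun _ _ => 0) (fun=> 0).
Proof.
have oD := @open_slab R n; split.
- exact: C1on_cst.
- by move=> i; exact: C1on_cst.
- move=> z _; rewrite /spacetime_div /dt (partial_val (is_derive_cst (0 : R) z _)) add0r.
  by apply: big1 => i _; rewrite /dx (partial_val (is_derive_cst (0 : R) z _)).
- by move=> z; exact: for_continuous_cst.
- by move=> z; exact: for_continuous_cst.
- by exists 0 => i z _; rewrite normr0 mul0r.
Qed.

Lemma claw_sum c (I : finType) (w T : I -> 'rV[R]_N -> R) (W : I -> 'I_n -> 'rV[R]_N -> R) :
  (forall k, claw c (w k) (W k) (T k)) ->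
  claw c (fun z => \sum_k w k z) (fun i z => \sum_k W k i z) (fun z => \sum_k T k z).
Proof.
move=> h; rewrite /index_enum; elim: (Finite.enum I) => [|k s IH].
  have := claw_zero c; congr claw; try apply/funext => ?; try apply/funext => ?; by rewrite big_nil.
have := claw_add (h k) IH.
by congr claw; try apply/funext => ?; try apply/funext => ?; rewrite big_cons.
Qed.

End ConservationLaws.

(** * Bounds for determinants and mixed discriminants *)

Section MatrixEstimates.
Context {R : realType} {n : nat}.
Implicit Types (A B X Y M : 'M[R]_n) (v w : 'rV[R]_n).
Local Notation C := R[i].
Local Notation toC := (map_mx (real_complex R)).

Lemma symmetric_form M v w : M^T = M -> w *m M *m v^T = v *m M *m w^T.
Proof. by move=> sM; rewrite -[LHS]trmx11 !trmx_mul trmxK sM mulmxA. Qed.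

Definition detp A B : {poly R} := \det (map_mx polyC A + 'X *: map_mx polyC B).

(** Both sides are the derivative of det (A + m B) at m = 0. The right side is linear in B, which
    allows an indefinite B to be split into a difference. *)
Lemma detp_coef1 A B : (detp A B)`_1 = \tr (\adj A *m B).
Proof.
have h1 := is_derive_poly (detp A B) 0.
have h2 : is_derive (0 : R) 1 (fun m : R => \det (A + m *: B)) (\tr (\adj A *m B)).
  have hB : is_derive (0 : R) 1 (fun m : R => A + m *: B) B.
    by apply: is_derive_affine; near=> h; rewrite scale0r !addr0 addrC; congr (_ *: _ + _); exact: mulr1.
  by have := is_derive_det_adj hB; rewrite scale0r addr0.
have E : horner (detp A B) = (fun m : R => \det (A + m *: B)) by apply/funext => m; exact: horner_det_lin.
rewrite -E in h2; case: h1 => _ h1; case: h2 => _; rewrite h1 => <-.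
by rewrite horner_coef0 coef_deriv.
Unshelve. all: by end_near.
Qed.

Lemma detp_coef1B A B X : (detp A (B - X))`_1 = (detp A B)`_1 - (detp A X)`_1.
Proof. by rewrite !detp_coef1 mulmxBr raddfB. Qed.

Lemma posdef_cauchy M v w : posdef M -> dot (v *m M) w ^+ 2 <= qf M v * qf M w.
Proof.
move=> pM; have [->|w0] := eqVneq w 0.
  by rewrite /dot linear0 mulmx0 mxE expr0n mulr_ge0 ?posdef_ge0 // /qf linear0 mulmx0 mxE.
have qw := pM.2 _ w0; have sM := posdef_sym pM.
pose c := dot (v *m M) w / qf M w.
have : 0 <= qf M (v - c *: w) by exact: posdef_ge0.
have sw : (w *m M *m v^T) 0 0 = dot (v *m M) w.
  by rewrite symmetric_form.
have -> : qf M (v - c *: w) = qf M v - c * dot (v *m M) w.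
  rewrite /qf mulmxBl linearB linearZ /= mulmxBr !mulmxBl -!scalemxAl -!scalemxAr.
  rewrite !(e00D, e00N, e00Z) sw -/(qf M w) -/(dot (v *m M) w) -/(qf M v).
  have cq : c * qf M w = dot (v *m M) w by rewrite /c divfK // lt0r_neq0.
  by rewrite cq subrr subr0.
by rewrite subr_ge0 /c mulrAC -expr2 ler_pdivrMr.
Qed.

Lemma relative_eigenvalues X Y (a b : R) : posdef Y -> X^T = X ->
  (forall v, a * qf Y v <= qf X v <= b * qf Y v) ->
  exists l : 'I_n -> R, [/\ forall i, a <= l i <= b, \det X = (\prod_i l i) * \det Y
    & \tr (X *m invmx Y) = \sum_i l i].
Proof.
move=> pY sX hab; have [S [l [uS SY SX]]] := simultaneous_diag_real pY sX.
set S' := map_mx Num.conj S^T in SY SX.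
exists (fun i => l 0 i).
have diagE (Z : 'M[R]_n) i (p q : 'rV[R]_n) : Z^T = Z -> row i S = toC p + 'i%C *: toC q ->
    (S *m toC Z *m S') i i = (qf Z p + qf Z q)%:C%C.
  move=> sZ e; rewrite -(toC_qf p q sZ) /= -e.
  have -> : (S *m toC Z *m S') i i = (row i (S *m toC Z *m S')) 0 i by rewrite [RHS]mxE.
  rewrite !row_mul [LHS]mxE [RHS]mxE; apply: eq_bigr => k _.
  by rewrite !mxE.
have ends i : a <= l 0 i <= b.
  pose p := map_mx (@complex.Re R) (row i S); pose q := map_mx (@complex.Im R) (row i S).
  have ev : row i S = toC p + 'i%C *: toC q.
    by apply/matrixP => k j; rewrite !mxE [LHS]complexE.
  have := diagE Y i p q (posdef_sym pY) ev; rewrite SY mxE eqxx => /complexI e1.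
  have := diagE X i p q sX ev; rewrite SX !mxE eqxx mulr1n => /complexI ->.
  have /andP[h1 h2] := hab p; have /andP[h3 h4] := hab q.
  move: h1 h2 h3 h4 e1; move: (qf Y p) (qf Y q) (qf X p) (qf X q) => y1 y2 x1 x2 h1 h2 h3 h4 e1.
  have e2 : y1 + y2 = 1 by rewrite -e1.
  have ea : a = a * y1 + a * y2 by rewrite -mulrDr e2 mulr1.
  have eb : b = b * y1 + b * y2 by rewrite -mulrDr e2 mulr1.
  by rewrite {1}ea {1}eb !lerD.
have uS' : S' \in unitmx by rewrite /S' map_unitmx unitmx_tr.
split=> //.
- have d0 : \det S * \det S' != 0 by apply: mulf_neq0; rewrite -unitfE -unitmxE.
  have e1 := congr1 determinant SY; have e2 := congr1 determinant SX.
  rewrite !det_mulmx det1 toC_det in e1; rewrite !det_mulmx toC_det det_diag in e2.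
  apply: (@complexI R); apply: (mulfI d0); rewrite rmorphM rmorph_prod.
  transitivity (\prod_i (toC l) 0 i); first by rewrite -e2; ring.
  rewrite [RHS]mulrCA mulrA; rewrite [_ * _ * _](_ : _ = (\prod_i (l 0 i)%:C%C) * (\det S * (\det Y)%:C%C * \det S')).
    by rewrite e1 mulr1; apply: eq_bigr => i _; rewrite mxE.
  by rewrite -!mulrA; congr (_ * _); ring.
- apply: (@complexI R); rewrite -trace_map_mx map_mxM map_invmx.
  have eY : toC Y = invmx S *m invmx S'.
    have := SY; rewrite -mulmxA => /(congr1 (mulmx (invmx S))).
    by rewrite mulKmx // mulmx1 => /(congr1 (mulmx^~ (invmx S'))); rewrite mulmxK.
  have iY : invmx (toC Y) = S' *m S.
    have KS : toC Y *m (S' *m S) = 1%:M.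
      by rewrite eY -!mulmxA (mulmxA _ S') mulVmx // mul1mx mulVmx.
    have uY : toC Y \in unitmx by rewrite map_unitmx; exact: posdef_unit.
    by rewrite -[RHS](mulKmx uY) KS mulmx1.
  rewrite iY mulmxA mxtrace_mulC mulmxA SX mxtrace_diag rmorph_sum.
  by apply: eq_bigr => i _; rewrite mxE.
Qed.

Lemma det_le X Y (b : R) : posdef Y -> posdef X -> (forall v, qf X v <= b * qf Y v) ->
  \det X <= b ^+ n * \det Y.
Proof.
move=> pY pX hb.
have [|l [hl -> _]] := @relative_eigenvalues X Y 0 b pY (posdef_sym pX).
  by move=> v; rewrite mul0r posdef_ge0 //= hb.
rewrite ler_wpM2r ?(ltW (posdef_det pY)) // -[n in b ^+ n]card_ord -prodr_const.
by apply: ler_prod => i _; exact: hl.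
Qed.

Lemma trace_le X Y (b : R) : posdef Y -> posdef X -> (forall v, qf X v <= b * qf Y v) ->
  `|\tr (X *m invmx Y)| <= n%:R * b.
Proof.
move=> pY pX hb.
have [|l [hl _ ->]] := @relative_eigenvalues X Y 0 b pY (posdef_sym pX).
  by move=> v; rewrite mul0r posdef_ge0 //= hb.
rewrite ger0_norm; last by apply: sumr_ge0 => i _; have /andP[] := hl i.
apply: (@le_trans _ _ (\sum_(i < n) b)); last by rewrite sumr_const card_ord mulr_natl.
by apply: ler_sum => i _; have /andP[] := hl i.
Qed.

Lemma det_entry_bound m (X : 'M[R]_m) (c : R) : (forall i j, `|X i j| <= c) ->
  `|\det X| <= m`!%:R * c ^+ m.
Proof.
move=> h; apply: le_trans (ler_norm_sum _ _ _) _.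
apply: (@le_trans _ _ (\sum_(s : 'S_m) c ^+ m)).
  apply: ler_sum => s _; rewrite normrM normrX normrN1 expr1n mul1r normr_prod.
  rewrite -[m in c ^+ m]card_ord -prodr_const; apply: ler_prod => i _.
  by rewrite normr_ge0 h.
by rewrite sumr_const card_Sn mulr_natl.
Qed.

Lemma adj_entry_bound X (c : R) i j : (forall i j, `|X i j| <= c) ->
  `|\adj X i j| <= n.-1`!%:R * c ^+ n.-1.
Proof.
move=> h; rewrite mxE /cofactor normrM normrX normrN1 expr1n mul1r.
by apply: det_entry_bound => k l; rewrite !mxE.
Qed.

Lemma posdef_entry_bound X (c : R) : posdef X -> (forall i, X i i <= c) -> forall i j, `|X i j| <= c.
Proof.
move=> pX hc i j.
have dd k : qf X (delta_mx 0 k) = X k k by rewrite /qf -rowE trmx_delta -colE !mxE.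
have := @posdef_cauchy X (delta_mx 0 i) (delta_mx 0 j) pX.
rewrite dot_delta -rowE mxE !dd => h.
have p k : 0 <= X k k by rewrite -dd posdef_ge0.
have c0 : 0 <= c by apply: le_trans (p i) (hc i).
rewrite -(ler_pXn2r (_ : 0 < 2)%N) ?nnegrE // -normrX ger0_norm ?sqr_ge0 //.
by apply: le_trans h _; rewrite expr2 ler_pM.
Qed.

(* The cofactor bounds [det M * (M^-1)_ii], so that only one power of [det M]^(1/2) is left. *)
Lemma det_flux_bound M (g : 'rV[R]_n) (K c : R) i : posdef M -> (g *m invmx M *m g^T) 0 0 <= K ->
  (forall j, M j j <= c) ->
  (\det M * (g *m invmx M) 0 i) ^+ 2 <= K * (n.-1`!%:R * c ^+ n.-1) * \det M.
Proof.
move=> pM hK hc; have dM := posdef_det pM; have uM := posdef_unit pM.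
have pI := posdef_inv pM.
have h1 := @posdef_cauchy (invmx M) g (delta_mx 0 i) pI.
rewrite dot_delta in h1.
have dd : qf (invmx M) (delta_mx 0 i) = invmx M i i by rewrite /qf -rowE trmx_delta -colE !mxE.
have ii : \det M * invmx M i i = \adj M i i.
  by rewrite /invmx uM mxE mulrA divff ?mul1r // lt0r_neq0.
have a1 : \adj M i i <= n.-1`!%:R * c ^+ n.-1.
  apply: le_trans (ler_norm _) _; apply: adj_entry_bound; exact: posdef_entry_bound pM hc.
have a0 : 0 <= \adj M i i.
  by rewrite -ii mulr_ge0 ?(ltW dM) // -dd posdef_ge0.
have K0 : 0 <= qf (invmx M) g by exact: posdef_ge0.
rewrite dd in h1; rewrite exprMn expr2 -mulrA.
apply: (@le_trans _ _ (\det M * (\det M * (qf (invmx M) g * invmx M i i)))).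
  by rewrite !ler_wpM2l // ltW.
rewrite [\det M * (qf _ _ * _)]mulrCA ii [leRHS]mulrC ler_wpM2l ?(ltW dM) //.
exact: ler_pM K0 a0 hK a1.
Qed.

(** The difference of the two sides is the defect of [mixed_schur], and it is nonnegative because
    the polynomial of [mixed_poly] has nonnegative coefficients. *)
Lemma mixed_flux_bound A B (a b : 'rV[R]_n) (m : R) : posdef A -> posdef B -> 0 <= m ->
  ((a *m A + m *: (b *m B)) *m invmx (A + m *: B) *m (a *m A + m *: (b *m B))^T) 0 0 <= qf A a + m * qf B b.
Proof.
move=> pA pB m0; have pM := posdefDZ m0 pA pB; set g := _ + _.
have := mixed_schur a b (posdef_sym pA) (posdef_sym pB) (posdef_unit pM).
rewrite /= -/g => e; rewrite -subr_ge0 e.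
have [P [_ hP P0 _ _]] := mixed_poly (a - b) pA pB.
rewrite -(pmulr_rge0 _ (posdef_det pM)) -hP // horner_coef.
by apply: sumr_ge0 => i _; rewrite mulr_ge0 ?exprn_ge0.
Qed.

(** With M the harmonic mean and w = v M, the nonnegative values of A at v - w A^-1 and of B at v -
    w B^-1, averaged with the same weights, add up to the difference of the two sides. *)
Lemma harmonic_le_arithmetic A B (t : R) v : 0 <= t <= 1 -> posdef A -> posdef B ->
  qf (B *m invmx (mid t A B) *m A) v <= t * qf B v + (1 - t) * qf A v.
Proof.
move=> t01 pA pB; have /andP[t0 t1] := t01.
have uA := posdef_unit pA; have uB := posdef_unit pB; have uK := posdef_unit (mid_posdef t01 pA pB).
pose M := B *m invmx (mid t A B) *m A.
have pM : posdef M := mid_harmonic_posdef t01 pA pB.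
pose w := v *m M.
have shift Z : posdef Z -> qf Z (v - w *m invmx Z) = qf Z v - 2 * qf M v + qf (invmx Z) w.
  move=> pZ; have uZ := posdef_unit pZ.
  rewrite /qf mulmxBl mulmxKV // linearB /= trmx_mul trmx_inv (posdef_sym pZ) mulmxBr !mulmxBl.
  rewrite mulmxA mulmxK // !(e00D, e00N).
  have -> : (v *m w^T) 0 0 = (v *m M *m v^T) 0 0.
    by rewrite -/w -[v *m w^T]trmx11 trmx_mul trmxK.
  by rewrite -/w [w *m (_ *m _)]mulmxA; ring.
have hA : 0 <= qf A (v - w *m invmx A) by exact: posdef_ge0.
have hB : 0 <= qf B (v - w *m invmx B) by exact: posdef_ge0.
rewrite (shift A pA) in hA; rewrite (shift B pB) in hB.
have eM : qf M v = t * qf (invmx B) w + (1 - t) * qf (invmx A) w.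
  rewrite -!qfZ -qfD; have -> : t *: invmx B + (1 - t) *: invmx A = invmx M.
    by rewrite [RHS](congr1 _ (mid_harmonic t01 pA pB)) invmxK.
  rewrite /qf /w mulmxK ?posdef_unit //.
  by rewrite -[v *m (v *m M)^T]trmx11 trmx_mul trmxK.
have s0 : 0 <= 1 - t by rewrite subr_ge0.
have := addr_ge0 (mulr_ge0 t0 hB) (mulr_ge0 s0 hA).
have -> : t * (qf B v - 2 * qf M v + qf (invmx B) w) + (1 - t) * (qf A v - 2 * qf M v + qf (invmx A) w)
  = t * qf B v + (1 - t) * qf A v - 2 * qf M v + (t * qf (invmx B) w + (1 - t) * qf (invmx A) w) by ring.
rewrite -eM -/M; move: (qf M v) (t * _ + _) => q s; lra.
Qed.

End MatrixEstimates.

(** * Decaying solutions and the conservation laws they satisfy *)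

Section Fields.
Context {R : realType} {n : nat}.
Local Notation N := (1 + n)%N.
Local Notation D := [set z : 'rV[R]_N | 0 < tm z < 1].
Variables (g0 : 'rV[R]_n -> 'M[R]_n) (ga Cg : R).
Hypotheses (ga0 : 0 < ga) (g0_pd : forall x, posdef (g0 x))
  (g0_det : forall x, \det (g0 x) <= Cg * expR (- (2 * ga * `|x|)))
  (g0_diag : forall x i, g0 x i i <= Cg).

(** All decay is measured against the reference Hessian [g0]. Its determinant decays at rate 2 [ga]
    because the flux estimate keeps only the square root of a determinant, which leaves the rate
    [ga]. *)
Record field (f : 'rV[R]_N -> R) (A : 'rV[R]_N -> 'M[R]_n) (d : 'rV[R]_N -> 'rV[R]_n) : Prop := Field {
  fld_hma : hma D f A d;
  fld_f : continuous f; fld_A : continuous A; fld_d : continuous d;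
  fld_pd : forall z, posdef (A z);
  fld_bd : exists2 C, 0 <= C & forall z, [/\ `|f z| <= C, `|d z| <= C &
    forall v, qf (A z) v <= C * qf (g0 (sp z)) v]
}.

Let Cg0 : 0 <= Cg.
Proof.
have := le_trans (ltW (posdef_det (g0_pd 0))) (g0_det 0).
by rewrite pmulr_lge0 // expR_gt0.
Qed.

Lemma sum_ord_const (a : R) : \sum_(i < n) a = n%:R * a.
Proof. by rewrite sumr_const card_ord mulr_natl. Qed.

Lemma qf_entry_bound (X : 'M[R]_n) (c : R) v : (forall i j, `|X i j| <= c) ->
  `|qf X v| <= n%:R * (n%:R * (`|v| * c) * `|v|).
Proof.
move=> h; rewrite /qf mxE; apply: le_trans (ler_norm_sum _ _ _) _.
apply: (@le_trans _ _ (\sum_(j < n) (n%:R * (`|v| * c) * `|v|))); last by rewrite sum_ord_const.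
apply: ler_sum => j _; rewrite normrM [v^T _ _]mxE; apply: ler_pM => //; last exact: coord_le_norm.
rewrite mxE; apply: le_trans (ler_norm_sum _ _ _) _.
apply: (@le_trans _ _ (\sum_(i < n) (`|v| * c))); last by rewrite sum_ord_const.
by apply: ler_sum => i _; rewrite normrM; apply: ler_pM => //; exact: coord_le_norm.
Qed.

Lemma g0_bound x v C : `|v| <= C -> qf (g0 x) v <= n%:R * (n%:R * (C * Cg) * C).
Proof.
move=> hv; have C0 : 0 <= C := le_trans (normr_ge0 v) hv.
apply: le_trans (ler_norm _) _.
apply: le_trans (qf_entry_bound _ (posdef_entry_bound (g0_pd x) (g0_diag x))) _.
apply: ler_wpM2l => //; apply: ler_pM => //; first by rewrite !mulr_ge0.
by apply: ler_wpM2l => //; apply: ler_wpM2r.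
Qed.

Lemma qf_delta (A : 'M[R]_n) k : qf A (delta_mx 0 k) = A k k.
Proof. by rewrite /qf -rowE trmx_delta -colE !mxE. Qed.

(** The factor 1 + Q avoids a square root, since Q <= (1 + Q)^2. *)
Lemma sqr_decay (x Q e : R) : 0 <= Q -> 0 <= e -> x ^+ 2 <= Q * e ^+ 2 -> `|x| <= (1 + Q) * e.
Proof.
move=> Q0 e0 h; rewrite -(ler_pXn2r (_ : 0 < 2)%N) ?nnegrE //; last by rewrite mulr_ge0 // addr_ge0.
rewrite -normrX ger0_norm ?sqr_ge0 // exprMn; apply: le_trans h _.
rewrite ler_wpM2r ?sqr_ge0 //; nra.
Qed.

Lemma det_decay (M : 'M[R]_n) x C : posdef M -> (forall v, qf M v <= C * qf (g0 x) v) ->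
  \det M <= C ^+ n * Cg * expR (- (ga * `|x|)) ^+ 2.
Proof.
move=> pM hC; apply: le_trans (det_le (g0_pd x) pM hC) _.
have C0 : 0 <= C ^+ n.
  have := det_le (g0_pd x) pM hC => h.
  by have := le_trans (ltW (posdef_det pM)) h; rewrite pmulr_lge0 // posdef_det.
rewrite -mulrA ler_wpM2l // -expRM_natl.
have -> : 2 * - (ga * `|x|) = - (2 * ga * `|x|) by ring.
exact: g0_det.
Qed.

Lemma det_decay1 (M : 'M[R]_n) x C : posdef M -> 0 <= C -> (forall v, qf M v <= C * qf (g0 x) v) ->
  \det M <= C ^+ n * Cg * expR (- (ga * `|x|)).
Proof.
move=> pM C0 hC; apply: le_trans (det_decay pM hC) _.
rewrite ler_wpM2l ?mulr_ge0 ?exprn_ge0 // expr2 ler_piMl ?expR_ge0 //.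
by rewrite -expR0 ler_expR oppr_le0 mulr_ge0 // ltW.
Qed.

(* [det M (g M^-1)_i] decays because its square is at most [g M^-1 g^T] times a cofactor times [det M]. *)
Lemma flux_decay (C K : R) : 0 <= C -> 0 <= K -> exists2 Q, 0 <= Q & forall (M : 'M[R]_n) x (g : 'rV[R]_n) i, posdef M ->
  (forall v, qf M v <= C * qf (g0 x) v) -> (g *m invmx M *m g^T) 0 0 <= K ->
  `|\det M * (g *m invmx M) 0 i| <= Q * expR (- (ga * `|x|)).
Proof.
move=> C0 K0; pose Q := K * (n.-1`!%:R * (C * Cg) ^+ n.-1) * (C ^+ n * Cg).
have Q0 : 0 <= Q by rewrite !mulr_ge0 ?exprn_ge0 ?mulr_ge0.
exists (1 + Q); first by rewrite addr_ge0.
move=> M x g i pM hC hK; apply: (sqr_decay Q0 (expR_ge0 _)).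
apply: le_trans (det_flux_bound i pM hK (_ : forall j, M j j <= C * Cg)) _.
  move=> j; rewrite -qf_delta; apply: le_trans (hC _) _.
  by rewrite ler_wpM2l // qf_delta.
rewrite /Q -!mulrA; do 2 (apply: ler_wpM2l => //); apply: ler_wpM2l; first by rewrite exprn_ge0 ?mulr_ge0.
by rewrite mulrA; exact: det_decay.
Qed.

Lemma continuous_det (T : topologicalType) m (A : T -> 'M[R]_m) (x : T) :
  {for x, continuous A} -> {for x, continuous (fun y : T => \det (A y))}.
Proof. exact: cvg_det. Qed.

Lemma continuous_tr (T : topologicalType) m (A : T -> 'M[R]_m) (x : T) :
  {for x, continuous A} -> {for x, continuous (fun y : T => \tr (A y))}.
Proof. exact: cvg_mxtrace. Qed.

Lemma continuous_trmx (T : topologicalType) m p (A : T -> 'M[R]_(m, p)) (x : T) :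
  {for x, continuous A} -> {for x, continuous (fun y : T => (A y)^T)}.
Proof. exact: cvg_trmx. Qed.

Lemma for_continuous_addZ (T : topologicalType) (A B : T -> 'M[R]_n) (m : R) (x : T) :
  {for x, continuous A} -> {for x, continuous B} -> {for x, continuous (fun y : T => A y + m *: B y)}.
Proof.
move=> cA cB; have cm : {for x, continuous (fun _ : T => m)} by exact: for_continuous_cst.
exact: (continuousD cA (continuousZ cm cB)).
Qed.

Definition mixedT (A0 A1 : 'rV[R]_N -> 'M[R]_n) (d0 d1 : 'rV[R]_N -> 'rV[R]_n) (m : R) z : R :=
  \det (A0 z + m *: A1 z) *
    (m * ((d0 z - d1 z) *m A1 z *m invmx (A0 z + m *: A1 z) *m A0 z *m (d0 z - d1 z)^T) 0 0).

Lemma mixed_law f0 f1 A0 A1 d0 d1 (m : R) : 0 <= m -> field f0 A0 d0 -> field f1 A1 d1 ->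
  claw ga (mixed0 f0 f1 A0 A1 m) (mixedi f0 f1 A0 A1 d0 d1 m) (mixedT A0 A1 d0 d1 m).
Proof.
move=> m0 h0 h1.
have pM z : posdef (A0 z + m *: A1 z) by exact: posdefDZ m0 (fld_pd h0 z) (fld_pd h1 z).
have cM (z : 'rV[R]_N) : {for z, continuous (fun y : 'rV[R]_N => A0 y + m *: A1 y)}.
  have c0 : {for z, continuous A0} := fld_A h0 (x := z).
  have c1 : {for z, continuous A1} := fld_A h1 (x := z).
  exact: (@for_continuous_addZ _ A0 A1 m z c0 c1).
split.
- exact: C1_mixed0 open_slab (fld_hma h0) (fld_hma h1).
- by move=> i; exact: C1_mixedi open_slab m0 (fld_hma h0) (fld_hma h1).
- by move=> z Dz; exact: mixed_divergence open_slab m0 (fld_hma h0) (fld_hma h1) Dz.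
- move=> z; have h : {for z, continuous (fun y : 'rV[R]_N => (f0 y + m * f1 y) * \det (A0 y + m *: A1 y))}.
    apply: continuousM; last exact: (continuous_det (cM z)).
    apply: continuousD; first exact: (fld_f h0 (x := z)).
    by apply: continuousM; [exact: for_continuous_cst|exact: (fld_f h1 (x := z))].
  exact: h.
- move=> z; have h : {for z, continuous (fun y : 'rV[R]_N => \det (A0 y + m *: A1 y) *
      (m * ((d0 y - d1 y) *m A1 y *m invmx (A0 y + m *: A1 y) *m A0 y *m (d0 y - d1 y)^T) 0 0))}; last exact: h.
  apply: continuousM; first exact: (continuous_det (cM z)).
  apply: continuousM; first exact: for_continuous_cst.
  have cd : {for z, continuous (fun y : 'rV[R]_N => d0 y - d1 y)}.
    exact: (continuousB (fld_d h0 (x := z)) (fld_d h1 (x := z))).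
  apply: for_continuous_coord.
  have cI := @for_continuous_invmx R _ _ (fun y : 'rV[R]_N => A0 y + m *: A1 y) z (posdef_unit (pM z)) (cM z).
  exact: (for_continuous_mulmx (for_continuous_mulmx (for_continuous_mulmx (for_continuous_mulmx cd
    (fld_A h1 (x := z))) cI) (fld_A h0 (x := z))) (continuous_trmx cd)).
- have [Ca Ca0 ha] := fld_bd h0; have [Cb Cb0 hb] := fld_bd h1.
  pose q C : R := C * (n%:R * (n%:R * (C * Cg) * C)).
  have q0 C : 0 <= C -> 0 <= q C by move=> C0; rewrite !mulr_ge0.
  have [||Q Q0 hQ] := @flux_decay (Ca + m * Cb) (q Ca + m * q Cb).
  - by rewrite addr_ge0 // mulr_ge0.
  - by rewrite addr_ge0 ?q0 // mulr_ge0 ?q0.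
  exists ((Ca + m * Cb) * Q) => i z _.
  have [fa da Aa] := ha z; have [fb db Ab] := hb z.
  rewrite /mixedi /mixed0 -mulrA normrM -mulrA; apply: ler_pM => //.
    apply: le_trans (ler_normD _ _) _; apply: lerD => //.
    by rewrite normrM ger0_norm // ler_wpM2l.
  apply: hQ => [|v|]; first exact: pM.
    by rewrite qfD qfZ mulrDl -mulrA lerD // ler_wpM2l.
  apply: le_trans (mixed_flux_bound _ _ (fld_pd h0 z) (fld_pd h1 z) m0) _.
  apply: lerD; last (apply: ler_wpM2l => //).
    by apply: le_trans (Aa _) _; apply: ler_wpM2l => //; exact: g0_bound.
  by apply: le_trans (Ab _) _; apply: ler_wpM2l => //; exact: g0_bound.
Qed.

(* Coefficients in m of the polarised law, by interpolation: the flux at a fixed m is only known to be a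
   rational function of m. *)
Definition coef_w f0 f1 A0 A1 (q : nat) z : R :=
  \sum_(k < n.+2) interp_weight q k * @mixed0 R n f0 f1 A0 A1 k%:R z.
Definition coef_i f0 f1 A0 A1 d0 d1 (q : nat) i z : R :=
  \sum_(k < n.+2) interp_weight q k * @mixedi R n f0 f1 A0 A1 d0 d1 k%:R i z.
Definition coef_T A0 A1 d0 d1 (q : nat) z : R :=
  \sum_(k < n.+2) interp_weight q k * mixedT A0 A1 d0 d1 k%:R z.

Lemma coef_law f0 f1 A0 A1 d0 d1 q : field f0 A0 d0 -> field f1 A1 d1 ->
  claw ga (coef_w f0 f1 A0 A1 q) (coef_i f0 f1 A0 A1 d0 d1 q) (coef_T A0 A1 d0 d1 q).
Proof.
move=> h0 h1.
apply: (@claw_sum R n ga 'I_n.+2 (fun k z => interp_weight q k * mixed0 f0 f1 A0 A1 k%:R z)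
  (fun k z => interp_weight q k * mixedT A0 A1 d0 d1 k%:R z)
  (fun k i z => interp_weight q k * mixedi f0 f1 A0 A1 d0 d1 k%:R i z)) => k.
by apply: claw_scale; apply: mixed_law.
Qed.

(** The factor f0 + m f1 raises the degree of the determinant to n + 1, hence the n + 2 nodes. The
    two terms are what will match the scalar equation, multiplied by f0, and a Hessian equation,
    multiplied by f1. *)
Lemma coef_wE f0 f1 A0 A1 q z : (q < n.+1)%N ->
  coef_w f0 f1 A0 A1 q.+1 z = f0 z * (detp (A0 z) (A1 z))`_q.+1 + f1 z * (detp (A0 z) (A1 z))`_q.
Proof.
move=> qn; pose P := f0 z *: detp (A0 z) (A1 z) + f1 z *: ('X * detp (A0 z) (A1 z)).
have sd := size_det_lin (A0 z) (A1 z).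
have sP : (size P <= n.+2)%N.
  apply: leq_trans (size_polyD _ _) _; rewrite geq_max; apply/andP; split.
    by apply: leq_trans (size_scale_leq _ _) _; apply: leqW.
  apply: leq_trans (size_scale_leq _ _) _; apply: leq_trans (size_polyMleq _ _) _.
  by rewrite size_polyX.
have <- : P`_q.+1 = f0 z * (detp (A0 z) (A1 z))`_q.+1 + f1 z * (detp (A0 z) (A1 z))`_q.
  by rewrite /P coefD !coefZ coefXM.
rewrite -(coef_interp sP (_ : (q.+1 < n.+2)%N)) //; apply: eq_bigr => k _; congr (_ * _).
by rewrite /P hornerD !hornerZ hornerM hornerX horner_det_lin /mixed0; ring.
Qed.

Lemma coef_T_poly A0 A1 d0 d1 z : posdef (A0 z) -> posdef (A1 z) -> exists P : {poly R},
  [/\ forall q, (q < n.+2)%N -> coef_T A0 A1 d0 d1 q z = P`_q, forall q, 0 <= P`_q,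
    forall q, (1 <= q <= n)%N -> P`_q = 0 -> d0 z = d1 z &
    P`_1 = \det (A0 z) * qf (A1 z) (d0 z - d1 z)].
Proof.
move=> p0 p1; have [P [sP hP P0 Pz P1]] := mixed_poly (d0 z - d1 z) p0 p1.
exists P; split=> // [q qn|q qn h].
- rewrite -(coef_interp (leqW sP) qn); apply: eq_bigr => k _; congr (_ * _).
  by rewrite hP.
- by apply/eqP; rewrite -subr_eq0; apply/eqP; exact: Pz qn h.
Qed.

Lemma chain_sp (F : 'rV[R]_n -> R) z v : C1on setT F ->
  is_derive z v (fun y => F (sp y)) (\sum_j sp v 0 j * partial j F (sp z)).
Proof. by move=> cF; exact: (C1_chain openT cF I (sp_is_derive z v)). Qed.

Lemma dx_sp (F : 'rV[R]_n -> R) i z : C1on setT F -> dx i (fun y => F (sp y)) z = partial i F (sp z).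
Proof.
move=> cF; rewrite /dx (partial_val (chain_sp z _ cF)) sp_delta_x (bigD1 i) //= mxE !eqxx mul1r big1 ?addr0 //.
by move=> j ji; rewrite mxE eqxx (negbTE ji) mul0r.
Qed.

Lemma dt_sp (F : 'rV[R]_n -> R) z : C1on setT F -> dt (fun y => F (sp y)) z = 0.
Proof.
move=> cF; rewrite /dt (partial_val (chain_sp z _ cF)) sp_delta_t big1 // => j _.
by rewrite mxE mul0r.
Qed.

Lemma C1mx_sp_open (D' : set 'rV[R]_N) : open D' -> C1mx D' (@sp R n).
Proof.
move=> oD i j; apply: (@C1on_eq _ _ D' (fun z => z 0 (xix j))) => [|z _|]; [by []|by rewrite mxE|].
exact: C1on_coord oD.
Qed.

Lemma C1on_sp (D' : set 'rV[R]_N) (F : 'rV[R]_n -> R) : open D' -> C1on setT F -> C1on D' (fun z => F (sp z)).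
Proof.
by move=> oD cF; exact: (@C1on_comp _ _ _ D' setT F _ oD openT (fun _ _ => I) cF (C1mx_sp_open oD)).
Qed.

Lemma hess_third (S : 'rV[R]_n -> R) i j k x : Ck 3 S ->
  partial k (fun y => hess S y i j) x = partial i (fun y => hess S y k j) x.
Proof.
move=> cS; have e a : (fun y => hess S y a j) = partial a (partial j S) by apply/funext => y; rewrite mxE.
rewrite !e; apply: (schwarz openT I).
- exact: Ck_C1on (Ck_partial j cS).
- exact: Ck_C1on (Ck_partial k (Ck_partial j cS)).
- exact: Ck_C1on (Ck_partial i (Ck_partial j cS)).
Qed.

Lemma C1_hess (S : 'rV[R]_n -> R) i j : Ck 3 S -> C1on setT (fun y => hess S y i j).
Proof.
move=> cS; have e : (fun y => hess S y i j) = partial i (partial j S) by apply/funext => y; rewrite mxE.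
by rewrite e; exact: Ck_C1on (Ck_partial i (Ck_partial j cS)).
Qed.

(** A potential independent of time solves the homogeneous equation with zero velocity. Polarised
    against it, a geodesic yields the law for f times the trace of adj A against a fixed Hessian,
    which is how the Ricci term is handled. *)
Lemma static_field (S : 'rV[R]_n -> R) C : Ck 3 S -> (forall x, posdef (hess S x)) -> 0 <= C ->
  (forall x v, qf (hess S x) v <= C * qf (g0 x) v) ->
  field (fun=> 0) (fun z => hess S (sp z)) (fun=> 0).
Proof.
move=> cS pS C0 hC; have oD := @open_slab R n.
have zero k z : partial k (fun _ : 'rV[R]_N => 0 : R) z = 0 by exact: partial_val (is_derive_cst (0 : R) z _).
split.
- split.
  + exact: C1on_cst.
  + by move=> i j; exact: C1on_sp oD (C1_hess i j cS).
  + exact: C1mx_cst.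
  + by move=> z _.
  + by move=> z _; rewrite /dt zero /qf mul0mx mul0mx mxE.
  + by move=> i z _; rewrite /dx zero mul0mx mxE oppr0.
  + by move=> k i j z _; rewrite !(dx_sp _ _ (C1_hess _ _ cS)); exact: hess_third.
  + move=> i j z _; rewrite (dt_sp _ (C1_hess i j cS)).
    have -> : (fun y : 'rV[R]_N => ((0 : 'rV[R]_n) *m hess S (sp y)) 0 j) = (fun=> 0).
      by apply/funext => y; rewrite mul0mx mxE.
    by rewrite /dx zero oppr0.
- by move=> z; exact: for_continuous_cst.
- move=> z; exact: (for_continuous_comp (sp_continuous (x := z)) (Ck_hess_cont (Ck_weak cS))).
- by move=> z; exact: for_continuous_cst.
- by move=> z; exact: pS.
- by exists C => // z; split; rewrite ?normr0.
Qed.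

(** The last field lets the comparison, known at the end points of a displacement, be used at the
    intermediate point. *)
Record tame_pair (u u' : 'rV[R]_n -> R) (C0 C1 ka : R) : Prop := TamePair {
  tp_gp : geodesic_pair u u' C0 C1; tp_ka : 0 <= ka;
  tp_up : forall x v, qf (hess u x) v <= ka * qf (g0 x) v;
  tp_up' : forall x v, qf (hess u' x) v <= ka * qf (g0 x) v;
  tp_lo : forall x v, qf (g0 x) v <= ka * qf (hess u x) v;
  tp_lo' : forall x v, qf (g0 x) v <= ka * qf (hess u' x) v;
  tp_shift : forall x e v, `|e| <= C1 -> qf (g0 (x + e)) v <= ka * qf (g0 x) v
}.

Section GeodesicField.
Variables (u u' : 'rV[R]_n -> R) (C0 C1 ka : R).
Hypothesis tp : tame_pair u u' C0 C1 ka.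
Let gp := tp_gp tp.
Let ka0 := tp_ka tp.
Let up := tp_up tp.
Let up' := tp_up' tp.
Let lo := tp_lo tp.
Let lo' := tp_lo' tp.
Let shift := tp_shift tp.
Local Notation gd := (gd u u').
Local Notation apt := (apt u u').
Local Notation bpt := (bpt u u').
Local Notation gA := (gA u u').
Local Notation gB := (gB u u').
Local Notation gK := (gK u u').
Local Notation gE := (gE u u').
Local Notation gM := (gM u u').
Local Notation gf := (gf u u').

Let C10 : 0 <= C1 := le_trans (normr_ge0 _) (gd_bound gp 0).

(** The tangent inequality for u at a and that for u' at b place the velocity between (u' - u)(b)
    and (u' - u)(a). *)
Lemma gf_bound z : `|gf z| <= C0.
Proof.
have su : strictly_convex u := conj (Ck_weak (gp_l gp)) (gp_pl gp).
have su' : strictly_convex u' := conj (Ck_weak (gp_r gp)) (gp_pr gp).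
have dE : bpt z - apt z = gd z by exact: row_segment_diff.
have h1 := convex_tangent (apt z) (bpt z) su; have h2 := convex_tangent (bpt z) (apt z) su'.
rewrite dE in h1; rewrite -opprB dE dotNl (gdP gp) in h2.
have := gp_bound gp (bpt z); have := gp_bound gp (apt z).
rewrite /Submission.gf /Submission.gpm dotC !ler_norml => /andP[_ h3] /andP[h4 _].
move: h1 h2 h3 h4; move: (dot _ _) => p h1 h2 h3 h4.
by apply/andP; split; lra.
Qed.

Lemma small_shift (z : 'rV[R]_N) c : 0 <= c <= 1 -> `|c *: gd z| <= C1.
Proof.
move=> /andP[c0 c1]; rewrite normrZ ger0_norm // -[C1]mul1r.
by apply: ler_pM => //; exact: gd_bound gp z.
Qed.

Let t01' (z : 'rV[R]_N) : 0 <= 1 - clamp (tm z) <= 1.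
Proof. by have /andP[h1 h2] := clamp_itv (tm z : R); rewrite subr_ge0 h2 gerBl. Qed.

Lemma gA_up z v : qf (gA z) v <= ka * ka * qf (g0 (sp z)) v.
Proof.
apply: le_trans (up _ _) _; rewrite -mulrA ler_wpM2l //.
rewrite /Submission.apt -scaleNr; apply: shift; rewrite scaleNr normrN; exact: small_shift (clamp_itv _).
Qed.

Lemma gB_up z v : qf (gB z) v <= ka * ka * qf (g0 (sp z)) v.
Proof.
apply: le_trans (up' _ _) _; rewrite -mulrA ler_wpM2l //.
by rewrite /Submission.bpt; apply: shift; exact: small_shift (t01' z).
Qed.

Lemma gA_lo z v : qf (g0 (sp z)) v <= ka * ka * qf (gA z) v.
Proof.
have -> : sp z = apt z + clamp (tm z) *: gd z by rewrite /Submission.apt subrK.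
apply: le_trans (shift _ _ (small_shift z (clamp_itv _))) _.
by rewrite -mulrA; apply: (ler_wpM2l ka0); exact: (lo (apt z) v).
Qed.

Lemma gB_lo z v : qf (g0 (sp z)) v <= ka * ka * qf (gB z) v.
Proof.
have -> : sp z = bpt z + - ((1 - clamp (tm z)) *: gd z) by rewrite /Submission.bpt addrK.
apply: le_trans (shift _ _ _) _; first by rewrite normrN; exact: small_shift (t01' z).
by rewrite -mulrA; apply: (ler_wpM2l ka0); exact: (lo' (bpt z) v).
Qed.

Lemma mid_qf t (A B : 'M[R]_n) v : qf (mid t A B) v = (1 - t) * qf B v + t * qf A v.
Proof. by rewrite /mid qfD !qfZ. Qed.

Lemma convex_le (t a b c : R) : 0 <= t <= 1 -> a <= c -> b <= c -> t * a + (1 - t) * b <= c.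
Proof.
move=> /andP[t0 t1] ha hb; have s0 : 0 <= 1 - t by rewrite subr_ge0.
have := lerD (ler_wpM2l t0 ha) (ler_wpM2l s0 hb); rewrite -mulrDl.
have -> : t + (1 - t) = 1 by rewrite addrC subrK.
by rewrite mul1r.
Qed.

Lemma convex_ge (t a b c k : R) : 0 <= t <= 1 -> c <= k * a -> c <= k * b -> c <= k * ((1 - t) * b + t * a).
Proof.
move=> /andP[t0 t1] ha hb; have s0 : 0 <= 1 - t by rewrite subr_ge0.
have := lerD (ler_wpM2l s0 hb) (ler_wpM2l t0 ha); rewrite -mulrDl subrK.
by rewrite mul1r mulrCA [X in _ <= _ + X -> _]mulrCA -mulrDr.
Qed.

Lemma gK_lo z v : qf (g0 (sp z)) v <= ka * ka * qf (gK z) v.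
Proof.
have -> : qf (gK z) v = (1 - clamp (tm z)) * qf (gB z) v + clamp (tm z) * qf (gA z) v := mid_qf _ _ _ _.
exact: (convex_ge (clamp_itv (tm z)) (gA_lo z v) (gB_lo z v)).
Qed.

Lemma gM_up z v : qf (gM z) v <= ka * ka * qf (g0 (sp z)) v.
Proof.
apply: le_trans (harmonic_le_arithmetic v (clamp_itv _) (gA_posdef gp z) (gB_posdef gp z)) _.
exact: convex_le (clamp_itv _) (gB_up z v) (gA_up z v).
Qed.

Lemma gE_trace_bound z : `|\tr (gE z)| <= 2 * (n%:R * (ka * ka * (ka * ka))).
Proof.
rewrite /Submission.gE mulmxBl raddfB /=; apply: le_trans (ler_normB _ _) _.
rewrite mulr_natl mulr2n; have k2 : 0 <= ka * ka by rewrite mulr_ge0.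
apply: lerD; apply: trace_le; try exact: gK_posdef gp z.
- exact: gA_posdef gp z.
- by move=> v; apply: le_trans (gA_up z v) _; rewrite -[leRHS]mulrA ler_wpM2l //; exact: gK_lo.
- exact: gB_posdef gp z.
- by move=> v; apply: le_trans (gB_up z v) _; rewrite -[leRHS]mulrA ler_wpM2l //; exact: gK_lo.
Qed.

Lemma geodesic_field : field gf gM gd.
Proof.
split; [exact: geodesic_hma gp|exact: gf_continuous gp|exact: gM_continuous gp|exact: gd_continuous gp|exact: gM_posdef gp|].
have C00 : 0 <= C0 := le_trans (normr_ge0 _) (gf_bound 0).
exists (C0 + C1 + ka * ka); first by rewrite !addr_ge0 ?mulr_ge0.
have k2 : 0 <= ka * ka by rewrite mulr_ge0.
move=> z; split.
- apply: le_trans (gf_bound z) _; rewrite -addrA lerDl addr_ge0 //.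
- by apply: le_trans (gd_bound gp z) _; rewrite addrAC lerDr addr_ge0.
- move=> v; apply: le_trans (gM_up z v) _; rewrite ler_wpM2r ?posdef_ge0 //.
  by rewrite lerDr addr_ge0.
Qed.

Variables (r : 'rV[R]_n -> R) (Cr : R).
Hypotheses (cr : Ck 3 r) (rbd : forall x, `|grad r x| <= Cr).

(** The material derivative of log det A - r. When r is the logarithm of the initial determinant,
    its product with det A is the density of the time derivative of the relative entropy. *)
Definition ksource z : R := - (\tr (gE z) + dot (gd z) (grad r (sp z))).

Lemma ksource_bound z : `|ksource z| <= 2 * (n%:R * (ka * ka * (ka * ka))) + n%:R * (C1 * Cr).
Proof.
rewrite normrN; apply: le_trans (ler_normD _ _) _; apply: lerD; first exact: gE_trace_bound.
apply: le_trans (dot_norm_le _ _) _; rewrite ler_wpM2l //.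
by apply: ler_pM => //; exact: gd_bound gp z.
Qed.

Lemma C1_grad_sp (D' : set 'rV[R]_N) : open D' -> C1mx D' (fun z => grad r (sp z)).
Proof.
move=> oD i j.
have -> : (fun z => grad r (sp z) i j) = (fun z : 'rV[R]_N => partial j r (sp z)) by apply/funext => z; rewrite mxE.
by apply: (C1on_sp oD); exact: Ck_C1on (Ck_partial j cr).
Qed.

Lemma C1_ksource : C1on D ksource.
Proof.
have oD := @open_slab R n.
exact: (C1on_opp oD (C1on_add oD (C1on_mxtrace oD (C1mx_gE gp))
  (C1mx_mul oD (C1mx_gd gp) (C1mx_tr oD (C1_grad_sp oD)) 0 0))).
Qed.

(** The second derivative of the entropy: the trace evolves by [trace_transport], and since d is
    constant along the motion, the derivative of d . grad r is the Hessian of r at d. *)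
Lemma ksource_transport z : D z ->
  dt ksource z + \sum_l gd z 0 l * dx l ksource z = \tr (gE z *m gE z) - qf (hess r (sp z)) (gd z).
Proof.
move=> Dz; have oD := @open_slab R n.
have ctr := C1on_mxtrace oD (C1mx_gE gp).
have dj k j : partial k (fun y => gd y 0 j * partial j r (sp y)) z =
   partial k (fun y => gd y 0 j) z * partial j r (sp z) + gd z 0 j * partial k (fun y => partial j r (sp y)) z.
  apply: partial_val; apply: is_deriveMp; first exact: C1on_partial (C1mx_gd gp 0 j) Dz.
  exact: C1on_partial (C1on_sp oD (Ck_C1on (Ck_partial j cr))) Dz.
have dk k : partial k ksource z = - (partial k (fun y => \tr (gE y)) z +
   \sum_j (partial k (fun y => gd y 0 j) z * partial j r (sp z) + gd z 0 j * partial k (fun y => partial j r (sp y)) z)).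
  apply: partial_val; apply: is_deriveNp; apply: is_deriveDp; first exact: C1on_partial ctr Dz.
  have h : is_derive z (delta_mx 0 k) (fun y => \sum_j gd y 0 j * partial j r (sp y))
     (\sum_j (partial k (fun y => gd y 0 j) z * partial j r (sp z) + gd z 0 j * partial k (fun y => partial j r (sp y)) z)).
    apply: is_derive_suml => j _; rewrite -dj; apply: C1on_partial Dz.
    exact: C1on_mul oD (C1mx_gd gp 0 j) (C1on_sp oD (Ck_C1on (Ck_partial j cr))).
  apply: is_derive_eqfun h => // y.
  by rewrite dotE; apply: eq_bigr => j _; rewrite [grad _ _ _ _]mxE.
have := trace_transport gp Dz; rewrite /dt /dx => tt.
rewrite /dt /dx !dk.
under [X in _ + X]eq_bigr do rewrite dk.
have e1 j : partial tix (fun y => partial j r (sp y)) z = 0 by exact: dt_sp (Ck_C1on (Ck_partial j cr)).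
have e2 l j : partial (xix l) (fun y => partial j r (sp y)) z = partial l (partial j r) (sp z).
  exact: dx_sp (Ck_C1on (Ck_partial j cr)).
have e3 j : partial tix (fun y => gd y 0 j) z = - (gd z *m gE z) 0 j := gd_dt gp j Dz.
have e4 l j : partial (xix l) (fun y => gd y 0 j) z = gE z l j := gd_dx gp z l j.
pose a j := partial j r (sp z); pose S := \sum_j (gd z *m gE z) 0 j * a j.
have s1 : \sum_j (partial tix (fun y => gd y 0 j) z * partial j r (sp z)
   + gd z 0 j * partial tix (fun y => partial j r (sp y)) z) = - S.
  by rewrite /S -sumrN; apply: eq_bigr => j _; rewrite e1 e3 mulr0 addr0 mulNr.
have s2 : \sum_i gd z 0 i * \sum_j gE z i j * a j = S.
  under eq_bigr do rewrite mulr_sumr.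
  rewrite exchange_big; apply: eq_bigr => j _; rewrite mxE mulr_suml.
  by apply: eq_bigr => i _; rewrite mulrA.
have s3 : \sum_i gd z 0 i * \sum_j gd z 0 j * partial i (partial j r) (sp z) = qf (hess r (sp z)) (gd z).
  rewrite /qf mxE; under [RHS]eq_bigr do rewrite mxE mulr_suml.
  rewrite exchange_big; apply: eq_bigr => i _; rewrite mulr_sumr; apply: eq_bigr => j _.
  by rewrite [hess _ _ _ _]mxE [_^T _ _]mxE; ring.
have s4 : \sum_i gd z 0 i * - (partial (xix i) (fun y => \tr (gE y)) z +
   \sum_j (partial (xix i) (fun y => gd y 0 j) z * partial j r (sp z) +
     gd z 0 j * partial (xix i) (fun y => partial j r (sp y)) z)) =
  - (\sum_i gd z 0 i * partial (xix i) (fun y => \tr (gE y)) z) - S - qf (hess r (sp z)) (gd z).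
  rewrite -s2 -s3 -!sumrN -!big_split; apply: eq_bigr => i _ /=.
  rewrite (eq_bigr (fun j => gE z i j * a j + gd z 0 j * partial i (partial j r) (sp z))).
    by rewrite big_split /=; ring.
  by move=> j _; rewrite e2 e4.
have fin (p q s T Q : R) : p + q = - T -> - (p + - s) + (- q - s - Q) = T - Q.
  by move=> h; rewrite -[T]opprK -h; ring.
refine (etrans (congr2 +%R (congr1 (fun x => - (_ + x)) s1) s4) (fin _ _ _ _ _ tt)).
Qed.

End GeodesicField.
End Fields.

(** * Energy and dissipation along the geodesics *)

Lemma dot_posdef_inv (R : realType) n (X : 'M[R]_n) (d w : 'rV[R]_n) : posdef X ->
  dot (d *m X) (w *m invmx X) = dot d w.
Proof.
move=> pX; have uX := posdef_unit pX; rewrite /dot trmx_mul trmx_inv (posdef_sym pX).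
by rewrite mulmxA mulmxK.
Qed.

Section Energy.
Context {R : realType} {n : nat}.
Local Notation N := (1 + n)%N.
Local Notation D := [set z : 'rV[R]_N | 0 < tm z < 1].
Variables (g0 : 'rV[R]_n -> 'M[R]_n) (ga Cg : R).
Hypotheses (ga0 : 0 < ga) (g0_pd : forall x, posdef (g0 x))
  (g0_det : forall x, \det (g0 x) <= Cg * expR (- (2 * ga * `|x|)))
  (g0_diag : forall x i, g0 x i i <= Cg).

Lemma C1on_det_hess (v : 'rV[R]_n -> R) : Ck 3 v -> C1on setT (fun x => \det (hess v x)).
Proof. by move=> cv; apply: (C1on_det openT) => i j; exact: C1_hess. Qed.

Definition time_free (F : 'rV[R]_N -> R) := forall y y', sp y = sp y' -> F y = F y'.

Lemma dt_time_free F z : time_free F -> dt F z = 0.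
Proof.
move=> tf; apply: partial_val; apply: is_derive_affine; near=> h.
rewrite [h *: (0 : R)]mulr0 add0r; apply: tf.
by rewrite spD spZ sp_delta_t scaler0 add0r.
Unshelve. all: by end_near.
Qed.

Lemma at_time_sp c (y y' : 'rV[R]_N) : sp y = sp y' -> at_time c y = at_time c y'.
Proof. by rewrite /at_time => ->. Qed.

Section Pair.
Variables (u u' : 'rV[R]_n -> R) (C0 C1 ka : R).
Hypothesis tp : tame_pair g0 u u' C0 C1 ka.
Let gp := tp_gp tp.
Local Notation gd := (gd u u').
Local Notation gA := (gA u u').
Local Notation gB := (gB u u').
Local Notation gK := (gK u u').
Local Notation gE := (gE u u').
Local Notation gM := (gM u u').
Local Notation gf := (gf u u').

Let C10 : 0 <= C1 := le_trans (normr_ge0 _) (gd_bound gp 0).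
Let Cg0 : 0 <= Cg.
Proof.
have := le_trans (ltW (posdef_det (g0_pd 0))) (g0_det 0).
by rewrite pmulr_lge0 // expR_gt0.
Qed.

Variables (r : 'rV[R]_n -> R) (Cr : R).
Hypotheses (cr : Ck 3 r) (rbd : forall x, `|grad r x| <= Cr).

Local Notation ks := (ksource u u' r).

Lemma grad_sp_continuous : continuous (fun z : 'rV[R]_N => grad r (sp z)).
Proof.
move=> z; exact: (for_continuous_comp (sp_continuous (x := z)) (Ck_grad_cont (Ck_weak (Ck_weak cr)))).
Qed.

Lemma ksource_continuous : continuous ks.
Proof.
move=> z; have h : {for z, continuous (fun y : 'rV[R]_N => - (\tr (gE y) + dot (gd y) (grad r (sp y))))}; last exact: h.
apply: continuousN; apply: continuousD; first exact: (continuous_tr (gE_continuous gp (x := z))).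
exact: (norm_continuous_dot (gd_continuous gp (x := z)) (grad_sp_continuous (x := z))).
Qed.

Lemma kenergy_law : claw ga (fun z => \det (gM z) * ks z) (fun i z => \det (gM z) * gd z 0 i * ks z)
  (fun z => \det (gM z) * (\tr (gE z *m gE z) - qf (hess r (sp z)) (gd z))).
Proof.
have oD := @open_slab R n; have cs := C1_ksource tp cr.
have cJ : C1on D (fun z => \det (gM z)) := C1on_det oD (C1mx_gM gp).
have cd (z : 'rV[R]_N) : {for z, continuous (fun y : 'rV[R]_N => \det (gM y))}.
  exact: (continuous_det (gM_continuous gp (x := z))).
split.
- exact: C1on_mul oD cJ cs.
- by move=> i; exact: C1on_mul oD (C1on_mul oD cJ (C1mx_gd gp 0 i)) cs.
- move=> z Dz; rewrite -(ksource_transport tp cr Dz).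
  exact: (mass_transport oD (geodesic_hma gp) cs Dz).
- move=> z; have h : {for z, continuous ks} := ksource_continuous (x := z).
  exact: (continuousM (cd z) h).
- move=> z; have h : {for z, continuous (fun y : 'rV[R]_N => \tr (gE y *m gE y) - qf (hess r (sp y)) (gd y))}; last exact: (continuousM (cd z) h).
  apply: continuousB.
    exact: (continuous_tr (for_continuous_mulmx (gE_continuous gp (x := z)) (gE_continuous gp (x := z)))).
  have c1 : {for z, continuous (fun y : 'rV[R]_N => hess r (sp y))}.
    exact: (for_continuous_comp (sp_continuous (x := z)) (Ck_hess_cont (Ck_weak cr))).
  have c2 := gd_continuous gp (x := z).
  apply: for_continuous_coord.
  exact: (for_continuous_mulmx (for_continuous_mulmx c2 c1) (continuous_trmx c2)).
- pose K := 2 * (n%:R * (ka * ka * (ka * ka))) + n%:R * (C1 * Cr).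
  exists ((ka * ka) ^+ n * Cg * (C1 * K)) => i z _.
  have k2 : 0 <= ka * ka by rewrite mulr_ge0 // (tp_ka tp).
  have d1 := det_decay1 ga0 g0_pd g0_det (gM_posdef gp z) k2 (gM_up tp z).
  rewrite normrM normrM -mulrA [leRHS]mulrAC; apply: ler_pM => //.
    by rewrite gtr0_norm // posdef_det //; exact: gM_posdef gp z.
  apply: ler_pM => //; first by apply: le_trans (coord_le_norm _ _) (gd_bound gp z).
  have hk := ksource_bound tp rbd z.
  exact: hk.
Qed.

Section Slice.
Variables (c : R) (v s : 'rV[R]_n -> R) (Cv Ks : R).
Hypotheses (c01 : 0 <= c <= 1) (cv : Ck 3 v) (pv : forall x, posdef (hess v x)) (cs : Ck 3 s)
  (gMv : forall z, gM (at_time c z) = hess v (sp z))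
  (dv : forall x i, partial i (fun y => \det (hess v y)) x = \det (hess v x) * (partial i r x + partial i s x))
  (Cv0 : 0 <= Cv) (vup : forall x w, qf (hess v x) w <= Cv * qf (g0 x) w)
  (Ks0 : 0 <= Ks) (sbd : forall x w, dot w (grad s x) ^+ 2 <= Ks * qf (hess v x) w).

(** The flux of an integration by parts on one end slice. By [dv], log det of the Hessian of v has
    gradient grad (r + s), so the first term has divergence det (tr E + d . grad (r + s)); the
    second removes d . grad s and brings in f times the trace against the Hessian of s. Thus
    [slice_div] has no gradient of s, and its first term is minus the entropy density of
    [kenergy_law]. *)
Definition slice_flux i (z : 'rV[R]_N) : R := \det (hess v (sp z)) * gd (at_time c z) 0 i +
  gf (at_time c z) * (\det (hess v (sp z)) * (grad s (sp z) *m invmx (hess v (sp z))) 0 i).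

Definition slice_div (z : 'rV[R]_N) : R :=
  \det (hess v (sp z)) * (\tr (gE (at_time c z)) + dot (gd (at_time c z)) (grad r (sp z))) +
  gf (at_time c z) * (\det (hess v (sp z)) * \tr (invmx (hess v (sp z)) *m hess s (sp z))).

Let C1mx_hess_sp (f : 'rV[R]_n -> R) : Ck 3 f -> C1mx setT (fun z : 'rV[R]_N => hess f (sp z)).
Proof. by move=> cf; exact: C1mx_hess_comp openT cf (C1mx_sp_open openT). Qed.

Let C1mx_inv_sp : C1mx setT (fun z : 'rV[R]_N => invmx (hess v (sp z))).
Proof. by apply: (C1mx_inv openT) (C1mx_hess_sp cv) => z _; exact: posdef_unit. Qed.

Let C1on_det_sp : C1on setT (fun z : 'rV[R]_N => \det (hess v (sp z))).
Proof. exact: C1on_det openT (C1mx_hess_sp cv). Qed.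

Lemma C1_slice_cofactor i : C1on setT (fun z : 'rV[R]_N =>
  gf (at_time c z) * (\det (hess v (sp z)) * (grad s (sp z) *m invmx (hess v (sp z))) 0 i)).
Proof.
have cg : C1mx setT (fun z : 'rV[R]_N => grad s (sp z)) := C1_grad_sp cs openT.
have c2 : C1on setT (fun z : 'rV[R]_N => (grad s (sp z) *m invmx (hess v (sp z))) 0 i).
  exact: (C1mx_mul openT cg C1mx_inv_sp 0 i).
have c4 : C1on setT (fun z : 'rV[R]_N => gf (at_time c z)) := C1on_gf_slice gp c01.
exact: (C1on_mul openT c4 (C1on_mul openT C1on_det_sp c2)).
Qed.

Lemma C1_slice_flux i : C1on setT (slice_flux i).
Proof.
have c1 : C1on setT (fun z : 'rV[R]_N => gd (at_time c z) 0 i) := C1mx_gd_slice gp c 0 i.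
exact: (C1on_add openT (C1on_mul openT C1on_det_sp c1) (C1_slice_cofactor i)).
Qed.

Lemma C1_slice_div : C1on setT slice_div.
Proof.
have c1 : C1on setT (fun z : 'rV[R]_N => \tr (gE (at_time c z))) := C1on_mxtrace openT (C1mx_gE_slice gp c01).
have cg : C1mx setT (fun z : 'rV[R]_N => grad r (sp z)) := C1_grad_sp cr openT.
have c2 : C1on setT (fun z : 'rV[R]_N => dot (gd (at_time c z)) (grad r (sp z))).
  exact: (C1mx_mul openT (C1mx_gd_slice gp c) (C1mx_tr openT cg) 0 0).
have c3 : C1on setT (fun z : 'rV[R]_N => \tr (invmx (hess v (sp z)) *m hess s (sp z))).
  exact: (C1on_mxtrace openT (C1mx_mul openT C1mx_inv_sp (C1mx_hess_sp cs))).
have c4 : C1on setT (fun z : 'rV[R]_N => gf (at_time c z)) := C1on_gf_slice gp c01.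
exact: (C1on_add openT (C1on_mul openT C1on_det_sp (C1on_add openT c1 c2))
  (C1on_mul openT c4 (C1on_mul openT C1on_det_sp c3))).
Qed.

Lemma slice_mass i z : dx i (fun y => \det (hess v (sp y)) * gd (at_time c y) 0 i) z =
  \det (hess v (sp z)) * (partial i r (sp z) + partial i s (sp z)) * gd (at_time c z) 0 i
  + \det (hess v (sp z)) * gE (at_time c z) i i.
Proof.
have c1 : C1on setT (fun y : 'rV[R]_N => gd (at_time c y) 0 i) := C1mx_gd_slice gp c 0 i.
have e1 : partial (xix i) (fun y : 'rV[R]_N => \det (hess v (sp y))) z =
  \det (hess v (sp z)) * (partial i r (sp z) + partial i s (sp z)).
  exact: etrans (dx_sp i z (C1on_det_hess cv)) (dv (sp z) i).
have e2 : partial (xix i) (fun y : 'rV[R]_N => gd (at_time c y) 0 i) z = gE (at_time c z) i i := gd_dx_slice gp c z i i.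
have h := is_deriveMp (C1on_partial (xix i) C1on_det_sp (I : setT z)) (C1on_partial (xix i) c1 (I : setT z)).
by have := partial_val h; rewrite e1 e2.
Qed.

(** [cofactor_divergence] is applied to the artificial family Hess v + t Hess s at t = 0. Its time
    derivative is Hess s, as required with g = grad s, so the static cofactor identity is read off
    from the space-time one. *)
Lemma slice_cofactor z :
  \sum_i dx i (fun y => gf (at_time c y) * (\det (hess v (sp y)) * (grad s (sp y) *m invmx (hess v (sp y))) 0 i)) z
  = gf (at_time c z) * (\det (hess v (sp z)) * \tr (invmx (hess v (sp z)) *m hess s (sp z)))
    - \det (hess v (sp z)) * dot (gd (at_time c z)) (grad s (sp z)).
Proof.
pose z0 := at_time 0 z; have sz0 : sp z0 = sp z by exact: sp_at.
have tz0 : tm z0 = 0 by exact: tm_at.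
have az0 : at_time c z0 = at_time c z by exact: at_time_sp.
(* F is the velocity on the slice c, extended independently of time; [tm y] is the parameter of the
   artificial family and has nothing to do with c. *)
pose F y := gf (at_time c y); pose M (y : 'rV[R]_N) := hess v (sp y) + tm y *: hess s (sp y).
pose g (y : 'rV[R]_N) := grad s (sp y).
have ctm : C1on setT (@tm R n) by exact: C1on_coord openT.
have cF : C1on setT F := C1on_gf_slice gp c01.
have cM : C1mx setT M := C1mx_add openT (C1mx_hess_sp cv) (C1mx_scale openT ctm (C1mx_hess_sp cs)).
have cg : C1mx setT g := C1_grad_sp cs openT.
have Mz0 : M z0 = hess v (sp z) by rewrite /M tz0 scale0r addr0 sz0.
have uM : M z0 \in unitmx by rewrite Mz0; exact: posdef_unit.
have dM k i j : partial k (fun y => M y i j) z0 =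
   partial k (fun y => hess v (sp y) i j) z0 + tm (delta_mx 0 k : 'rV[R]_N) * hess s (sp z) i j.
  apply: partial_val.
  have h1 := C1on_partial k (C1mx_hess_sp cv i j) (I : setT z0).
  have ht : is_derive z0 (delta_mx 0 k) (@tm R n) (tm (delta_mx 0 k : 'rV[R]_N)).
    by apply: is_derive_affine; near=> t; rewrite tmD tmZ.
  have h2 := is_deriveMp ht (C1on_partial k (C1mx_hess_sp cs i j) (I : setT z0)).
  have h3 := is_deriveDp h1 h2; rewrite tz0 mul0r addr0 sz0 in h3.
  apply: is_derive_eqfun h3 => // y; rewrite /M; move: (hess v _) (hess s _) (tm y) => X Y a.
  by rewrite !mxE.
have dMt : partial_mx tix M z0 = hess s (sp z).
  apply/matrixP => i j; rewrite mxE dM tm_delta_t mul1r.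
  by rewrite -[partial tix _ z0]/(dt (fun y => hess v (sp y) i j) z0) (dt_sp _ (C1_hess i j cv)) add0r.
have dMx k i j : dx k (fun y => M y i j) z0 = partial k (fun x => hess v x i j) (sp z).
  by rewrite /dx dM tm_delta_x mul0r addr0 -[LHS]/(dx k (fun y => hess v (sp y) i j) z0) (dx_sp _ _ (C1_hess i j cv)) sz0.
have main := @cofactor_divergence R n setT F M g z0 openT cF cM cg I uM.
have hMt i j : dt (fun y => M y i j) z0 = dx i (fun y => g y 0 j) z0.
  transitivity (partial_mx tix M z0 i j); first by rewrite mxE.
  rewrite dMt mxE -sz0 -(dx_sp _ _ (Ck_C1on (Ck_partial j cs))).
  by congr (dx i _ z0); apply/funext => y; rewrite [RHS]mxE.
have {}main := main hMt.
have hT k i j : dx k (fun y => M y i j) z0 = dx i (fun y => M y k j) z0 by rewrite !dMx; exact: hess_third.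
have {}main := main hT.
pose H i y := F y * \det (M y) * (g y *m invmx (M y)) 0 i.
have cH i : partial (xix i) (fun y => - H i y) z0 = - partial (xix i) (H i) z0.
  apply: partial_val; apply: is_deriveNp.
  have uMn : \forall y \near z0, M y \in unitmx.
    have c1 : {for z0, continuous (fun y : 'rV[R]_N => \det (M y))} := continuous_det (C1mx_cvg cM (I : setT z0)).
    have : \forall y \near z0, \det (M y) != 0.
      by apply: (cvgr_neq0 _ c1); rewrite -unitfE -unitmxE.
    by apply: filterS => y; rewrite unitmxE unitfE.
  have d1 := C1mx_is_derive (xix i) cM (I : setT z0).
  have d2 := is_derive_mulmx (C1mx_is_derive (xix i) cg (I : setT z0)) (is_derive_invmx uM d1).
  have d3 := is_deriveMp (is_deriveMp (C1on_partial (xix i) cF (I : setT z0)) (is_derive_det uM d1)) ((is_derive_mxP _ _ _ _).1 d2 0 i).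
  by rewrite -[H i]/(fun y => F y * \det (M y) * (g y *m invmx (M y)) 0 i) (partial_val d3).
have dHz i : dx i (fun y => gf (at_time c y) * (\det (hess v (sp y)) * (grad s (sp y) *m invmx (hess v (sp y))) 0 i)) z
    = partial (xix i) (H i) z0.
  have -> : (fun y => gf (at_time c y) * (\det (hess v (sp y)) * (grad s (sp y) *m invmx (hess v (sp y))) 0 i)) =
     (fun y => H i (at_time 0 y)).
    apply/funext => y; have sy : sp (at_time 0 y) = sp y := sp_at 0 y.
    by rewrite /H /F /M /g sy tm_at scale0r addr0 (at_time_sp c sy) mulrA.
  apply: partial_val; apply: at_time_is_derive; rewrite at_time_delta.
  have d1 := C1mx_is_derive (xix i) cM (I : setT z0).
  have d2 := is_derive_mulmx (C1mx_is_derive (xix i) cg (I : setT z0)) (is_derive_invmx uM d1).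
  have d3 := is_deriveMp (is_deriveMp (C1on_partial (xix i) cF (I : setT z0)) (is_derive_det uM d1)) ((is_derive_mxP _ _ _ _).1 d2 0 i).
  by rewrite -[H i]/(fun y => F y * \det (M y) * (g y *m invmx (M y)) 0 i) (partial_val d3).
under eq_bigr do rewrite dHz.
have dtF : dt F z0 = 0.
  by apply: dt_time_free => y y' e; rewrite /F (at_time_sp c e).
have dF0 : dt (fun y => F y * \det (M y)) z0 = F z0 * (\det (M z0) * \tr (invmx (M z0) *m hess s (sp z))).
  have d := is_deriveMp (C1on_partial tix cF (I : setT z0)) (is_derive_det uM (C1mx_is_derive tix cM (I : setT z0))).
  rewrite -[partial tix F z0]/(dt F z0) dtF mul0r add0r dMt in d.
  exact: partial_val d.
rewrite /spacetime_div dF0 dtF sub0r in main.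
rewrite (eq_bigr (fun i => - partial (xix i) (H i) z0)) in main; last by move=> i _; exact: cH.
have Fz0 : F z0 = gf (at_time c z) by rewrite /F az0.
rewrite sumrN Mz0 Fz0 in main.
have dFx i : dx i F z0 = - (gd (at_time c z) *m hess v (sp z)) 0 i.
  by rewrite /F (gf_dx_slice gp c z0 i) az0 gMv.
have e2 : - \sum_i dx i F z0 * (g z0 *m invmx (hess v (sp z))) 0 i = dot (gd (at_time c z)) (grad s (sp z)).
  rewrite -sumrN (eq_bigr (fun i => (gd (at_time c z) *m hess v (sp z)) 0 i * (g z0 *m invmx (hess v (sp z))) 0 i)); last first.
    by move=> i _; rewrite dFx mulNr opprK.
  rewrite -dotE /g sz0; exact: dot_posdef_inv (pv _).
rewrite e2 in main.
by apply/eqP; rewrite -subr_eq0 -main; apply/eqP; ring.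
Unshelve. all: by end_near.
Qed.

Lemma slice_divergence z : \sum_i dx i (slice_flux i) z = slice_div z.
Proof.
have c1 i : C1on setT (fun y : 'rV[R]_N => \det (hess v (sp y)) * gd (at_time c y) 0 i).
  exact: (C1on_mul openT C1on_det_sp (C1mx_gd_slice gp c 0 i)).
have dd i : dx i (slice_flux i) z = dx i (fun y => \det (hess v (sp y)) * gd (at_time c y) 0 i) z +
  dx i (fun y => gf (at_time c y) * (\det (hess v (sp y)) * (grad s (sp y) *m invmx (hess v (sp y))) 0 i)) z.
  exact: partial_val (is_deriveDp (C1on_partial (xix i) (c1 i) (I : setT z)) (C1on_partial (xix i) (C1_slice_cofactor i) (I : setT z))).
have e (f : 'rV[R]_n -> R) (d : 'rV[R]_n) x : dot d (grad f x) = \sum_i partial i f x * d 0 i.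
  by rewrite dotE; apply: eq_bigr => i _; rewrite [grad _ _ _ _]mxE mulrC.
transitivity (\sum_i (\det (hess v (sp z)) * (partial i r (sp z) + partial i s (sp z)) * gd (at_time c z) 0 i
  + \det (hess v (sp z)) * gE (at_time c z) i i) + 
  (gf (at_time c z) * (\det (hess v (sp z)) * \tr (invmx (hess v (sp z)) *m hess s (sp z)))
    - \det (hess v (sp z)) * dot (gd (at_time c z)) (grad s (sp z)))).
  rewrite -slice_cofactor -big_split; apply: eq_bigr => i _.
  by rewrite dd slice_mass.
rewrite /slice_div !e big_split /= -mulr_sumr -/(\tr _).
have fin (J S fq a b s1 : R) : s1 = J * a + J * b -> s1 + J * S + (fq - J * b) = J * (S + a) + fq.
  by move=> ->; ring.
apply: fin.
rewrite -mulrDr -big_split mulr_sumr; apply: eq_bigr => i _ /=.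
by rewrite -mulrA -mulrDl.
Qed.

(** The time derivative of the affine weight is b, and it is balanced by the flux with factor - b.
    So a spatial divergence, with any affine weight, can be added to an energy at no cost in
    dissipation. *)
Lemma slice_law (a b : R) :
  claw ga (fun z => (a + b * tm z) * slice_div z) (fun i z => - b * slice_flux i z) (fun=> 0).
Proof.
have oD := @open_slab R n.
have cdiv : C1on D slice_div := C1on_sub (@subsetT _ _) C1_slice_div.
have cflux i : C1on D (slice_flux i) := C1on_sub (@subsetT _ _) (C1_slice_flux i).
have cab : C1on D (fun z => a + b * tm z) := C1on_add oD (C1on_cst a oD) (C1on_mul oD (C1on_cst b oD) (@C1on_tm R n)).
split.
- exact: C1on_mul oD cab cdiv.
- by move=> i; exact: C1on_mul oD (C1on_cst _ oD) (cflux i).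
- move=> z Dz; rewrite /spacetime_div.
  have ht : is_derive z (delta_mx 0 tix) (@tm R n) 1.
    by apply: is_derive_affine; near=> t; rewrite tmD tmZ tm_delta_t.
  have d0 : dt (fun y => (a + b * tm y) * slice_div y) z = b * slice_div z.
    have h1 := is_deriveDp (is_derive_cst a z (delta_mx 0 tix)) (is_deriveMp (is_derive_cst b z _) ht).
    have h2 := is_deriveMp h1 (C1on_partial tix cdiv Dz).
    have := partial_val h2; rewrite /dt => ->.
    have -> : partial tix slice_div z = 0.
      by apply: dt_time_free => y y' e; rewrite /slice_div e (at_time_sp c e).
    by rewrite mulr0 addr0 mul0r add0r add0r mulr1.
  rewrite d0 (eq_bigr (fun i => - b * dx i (slice_flux i) z)).
    by rewrite -mulr_sumr slice_divergence mulNr subrr.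
  move=> i _; apply: partial_val.
  apply: is_derive_eqfun (is_deriveMp (is_derive_cst (- b) z _) (C1on_partial (xix i) (cflux i) Dz)) => //.
  by rewrite mul0r add0r.
- move=> z; have h1 : {for z, continuous (fun y : 'rV[R]_N => a + b * tm y)}.
    apply: continuousD; first exact: for_continuous_cst.
    by apply: continuousM; [exact: for_continuous_cst|exact: tm_continuous].
  have h2 : {for z, continuous slice_div} by have [] := C1_slice_div (I : setT z).
  exact: (continuousM h1 h2).
- by move=> z; exact: for_continuous_cst.
- have Ksq0 : 0 <= Ks by [].
  have [Q Q0 hQ] := flux_decay g0_pd g0_det g0_diag Cv0 Ks0.
  have C00 : 0 <= C0 := le_trans (normr_ge0 _) (gf_bound tp 0).
  exists (`|b| * (Cv ^+ n * Cg * C1 + C0 * Q)) => i z _.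
  rewrite normrM normrN -[leRHS]mulrA; apply: ler_wpM2l; first exact: normr_ge0.
  rewrite /slice_flux; apply: le_trans (ler_normD _ _) _; rewrite [leRHS]mulrDl; apply: lerD.
    rewrite normrM [leRHS]mulrAC; apply: ler_pM => //.
      rewrite gtr0_norm ?posdef_det //; exact: (det_decay1 ga0 g0_pd g0_det).
    by apply: le_trans (coord_le_norm _ _) (gd_bound gp _).
  rewrite normrM -[leRHS]mulrA; apply: ler_pM => //; first exact: gf_bound tp _.
  apply: hQ => //; set X := hess v (sp z); set g := grad s (sp z).
  have pX : posdef X by exact: pv.
  have q0 : 0 <= (g *m invmx X *m g^T) 0 0 by exact: posdef_ge0 (posdef_inv pX).
  (* The bound on grad s is tested on w = grad s . X^-1, where both sides contain the same quantity
     q, and one factor q is cancelled. *)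
  have := sbd (sp z) (g *m invmx X); rewrite -/g -/X /dot.
  have -> : qf X (g *m invmx X) = (g *m invmx X *m g^T) 0 0.
    by rewrite /qf mulmxKV ?posdef_unit // trmx_mul trmx_inv (posdef_sym pX) mulmxA.
  move: q0; set q := (_ *m _ *m _) 0 0; rewrite le_eqVlt => /orP[/eqP <- //|q0].
  by rewrite expr2 ler_pM2r.
Unshelve. all: by end_near.
Qed.

End Slice.
End Pair.
End Energy.

Section LinearCombinations.
Context {R : realType} {n : nat}.
Implicit Types (f g : 'rV[R]_n -> R).

Lemma partialDZ m j f g a y : Ck m.+1 f -> Ck m.+1 g ->
  partial j (fun y => f y + a * g y) y = partial j f y + a * partial j g y.
Proof.
move=> c1 c2; apply: partial_val; apply: is_deriveDp; first exact: Ck_is_derive c1.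
apply: is_derive_eqfun (is_deriveMp (is_derive_cst a y _) (Ck_is_derive y j c2)) => //.
by rewrite mul0r add0r.
Qed.

Lemma hessDZ f g a x : Ck 2 f -> Ck 2 g ->
  hess (fun y => f y + a * g y) x = hess f x + a *: hess g x.
Proof.
move=> cf cg; apply/matrixP => i j; rewrite !mxE.
have -> : partial j (fun y => f y + a * g y) = (fun y => partial j f y + a * partial j g y).
  by apply/funext => y; exact: (@partialDZ 1).
exact: (@partialDZ 0 _ _ _ _ _ (Ck_partial j cf) (Ck_partial j cg)).
Qed.

Lemma CkDZ m f g a : Ck m f -> Ck m g -> Ck m (fun y => f y + a * g y).
Proof.
elim: m f g => [|m IH] f g cf cg; have c : continuous (fun y => f y + a * g y).
- move=> x; have h : {for x, continuous (fun y : 'rV[R]_n => f y + a * g y)}; last exact: h.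
  apply: continuousD; first exact: (Ck_cont cf (x := x)).
  by apply: continuousM; [exact: for_continuous_cst|exact: (Ck_cont cg (x := x))].
- by split.
- move=> x; have h : {for x, continuous (fun y : 'rV[R]_n => f y + a * g y)}; last exact: h.
  apply: continuousD; first exact: (Ck_cont cf (x := x)).
  by apply: continuousM; [exact: for_continuous_cst|exact: (Ck_cont cg (x := x))].
split=> // j; split.
  move=> z; have h : is_derive z (delta_mx 0 j) (fun y => f y + a * g y) (partial j f z + (0 * g z + a * partial j g z)).
    exact: (is_deriveDp (Ck_is_derive z j cf) (is_deriveMp (is_derive_cst a z _) (Ck_is_derive z j cg))).
  by case: h.
have -> : partial j (fun y => f y + a * g y) = (fun y => partial j f y + a * partial j g y).
  by apply/funext => y; exact: (@partialDZ m).
exact: IH (Ck_partial j cf) (Ck_partial j cg).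
Qed.

Lemma partial_cst j (a : R) (x : 'rV[R]_n) : partial j (fun=> a) x = 0.
Proof. exact: partial_val (is_derive_cst a x _). Qed.

Lemma Ck_cst m (a : R) : Ck m (fun _ : 'rV[R]_n => a).
Proof.
elim: m a => [|m IH] a; first by split=> // x; exact: for_continuous_cst.
split=> [x|j]; first exact: for_continuous_cst.
split; first by move=> z; have h := is_derive_cst a z (delta_mx 0 j : 'rV[R]_n); case: h.
by have -> : partial j (fun _ : 'rV[R]_n => a) = (fun=> 0); [apply/funext => y; exact: partial_cst|exact: IH].
Qed.

End LinearCombinations.

Section InterpolationEnds.
Context {R : realType} {n : nat}.
Implicit Types (A B X : 'M[R]_n).

Lemma mid0 A B : mid 0 A B = B.
Proof. by rewrite /mid subr0 scale1r scale0r addr0. Qed.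

Lemma mid1 A B : mid 1 A B = A.
Proof. by rewrite /mid subrr scale0r scale1r add0r. Qed.

Lemma posdef_dominated A B X (c : R) : posdef A -> 0 <= c -> X^T = X -> X = A + c *: A + B ->
  (forall v, `|qf B v| <= c * qf A v) -> posdef X.
Proof.
move=> pA c0 sX eX hB; split=> // v v0; rewrite eX !qfD qfZ.
have := hB v; rewrite ler_norml => /andP[h _].
have := pA.2 _ v0; move: h; move: (qf _ _) (qf _ _) => a b h a0.
by rewrite -addrA ltr_pwDl // addrC -lerBlDr sub0r.
Qed.

Lemma eq_le (a b : R) : a = b -> a <= b.
Proof. by move=> ->. Qed.

Lemma qf_perturb A B X (v : 'rV[R]_n) (c a q : R) : X = A + B -> qf A v = c * q -> `|qf B v| <= a * q ->
  qf X v <= (c + a) * q.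
Proof.
by move=> -> e h; rewrite qfD e mulrDl lerD2l; exact: le_trans (ler_norm _) h.
Qed.

Lemma sum_mul_add {m} (F S S' : 'I_m -> R) (f : R) : (forall j, F j = f * S j + S' j) ->
  \sum_j F j = f * (\sum_j S j) + \sum_j S' j.
Proof. by move=> h; rewrite mulr_sumr -big_split; apply: eq_bigr. Qed.

Lemma det_trace_inv A X : posdef A -> \det A * \tr (invmx A *m X) = \tr (\adj A *m X).
Proof.
move=> pA; rewrite -mxtraceZ scalemxAl; congr (\tr (_ *m _)).
by rewrite /invmx (posdef_unit pA) scalerA divff ?scale1r // lt0r_neq0 // posdef_det.
Qed.

Lemma apt_at0 (u u' : 'rV[R]_n -> R) z : apt u u' (at_time 0 z) = sp z.
Proof. by rewrite /apt tm_at clamp_id ?lexx ?ler01 // scale0r subr0 sp_at. Qed.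

Lemma bpt_at1 (u u' : 'rV[R]_n -> R) z : bpt u u' (at_time 1 z) = sp z.
Proof. by rewrite /bpt tm_at clamp_id ?lexx ?ler01 // subrr scale0r addr0 sp_at. Qed.

Lemma gK_at0 (u u' : 'rV[R]_n -> R) z : gK u u' (at_time 0 z) = gB u u' (at_time 0 z).
Proof. by rewrite /gK tm_at clamp_id ?mid0 // lexx ler01. Qed.

Lemma gK_at1 (u u' : 'rV[R]_n -> R) z : gK u u' (at_time 1 z) = gA u u' (at_time 1 z).
Proof. by rewrite /gK tm_at clamp_id ?mid1 // lexx ler01. Qed.

Lemma gM_at0 (u u' : 'rV[R]_n -> R) (C0 C1 : R) z : geodesic_pair u u' C0 C1 ->
  gM u u' (at_time 0 z) = hess u (sp z).
Proof.
move=> gp; have uB := posdef_unit (gB_posdef gp (at_time 0 z)).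
by rewrite /gM gK_at0 (mulmxV uB) mul1mx /gA apt_at0.
Qed.

Lemma gM_at1 (u u' : 'rV[R]_n -> R) (C0 C1 : R) z : geodesic_pair u u' C0 C1 ->
  gM u u' (at_time 1 z) = hess u' (sp z).
Proof.
move=> gp; have uA := posdef_unit (gA_posdef gp (at_time 1 z)).
by rewrite /gM gK_at1 (mulmxKV uA) /gB bpt_at1.
Qed.

End InterpolationEnds.

(** * The combined energy and its dissipation *)

Section Rigidity.
Context {R : realType} {n k : nat}.
Local Notation N := (1 + n)%N.
Local Notation D := [set z : 'rV[R]_N | 0 < tm z < 1].
Variables (u u' : 'I_k.+1 -> 'rV[R]_n -> R) (p : 'I_k -> nat) (cc : 'I_k.+1 -> R).
Local Notation g0 := (hess (u ord0)).
Local Notation g1 := (hess (u' ord0)).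
Local Notation nx j := (lift ord0 j).
Variables (ga Cg ka Cr : R) (C0 C1 : 'I_k.+1 -> R) (r s : 'rV[R]_n -> R).

(* r and r + s are the logarithms of the determinants of the Hessians of [u ord0] and [u' ord0]; [rd_e0] to
   [rd_e1'] are the equations of the two systems. *)
Record rigid_data : Prop := RigidData {
  rd_ga : 0 < ga;
  rd_tp : forall i, tame_pair g0 (u i) (u' i) (C0 i) (C1 i) ka;
  rd_det : forall x, \det (g0 x) <= Cg * expR (- (2 * ga * `|x|));
  rd_diag : forall x i, g0 x i i <= Cg;
  rd_r : Ck 3 r; rd_s : Ck 3 s;
  rd_dr : forall x i, partial i (fun y => \det (g0 y)) x = \det (g0 x) * partial i r x;
  rd_ds : forall x i, partial i (fun y => \det (g1 y)) x = \det (g1 x) * (partial i r x + partial i s x);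
  rd_grad : forall x, `|grad r x| <= Cr;
  rd_hess : forall x v, `|qf (hess r x) v| <= ka * qf (g0 x) v;
  rd_gs : forall x w, dot w (grad s x) ^+ 2 <= ka * qf (g1 x) w;
  rd_p : forall j, (p j < n)%N;
  rd_e0 : forall x, \sum_j (detp (g0 x) (hess (u (nx j)) x))`_(p j).+1 + (detp (g0 x) (hess r x))`_1
     = cc ord0 * \det (g0 x);
  rd_e0' : forall x, \sum_j (detp (g1 x) (hess (u' (nx j)) x))`_(p j).+1 + (detp (g1 x) (hess r x))`_1
     + (detp (g1 x) (hess s x))`_1 = cc ord0 * \det (g1 x);
  rd_e1 : forall j x, (detp (g0 x) (hess (u (nx j)) x))`_(p j) = cc (nx j) * \det (hess (u (nx j)) x);
  rd_e1' : forall j x, (detp (g1 x) (hess (u' (nx j)) x))`_(p j) = cc (nx j) * \det (hess (u' (nx j)) x)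
}.

Hypothesis rd : rigid_data.
Let ga0 := rd_ga rd.
Let tp i := rd_tp rd i.
Let gp i := tp_gp (tp i).
Let g0_pd x : posdef (g0 x) := gp_pl (gp ord0) x.
Let g1_pd x : posdef (g1 x) := gp_pr (gp ord0) x.
Let det0 := rd_det rd.
Let diag0 := rd_diag rd.
Let ka0 : 0 <= ka := tp_ka (tp ord0).

Local Notation ff i := (gf (u i) (u' i)).
Local Notation dd i := (gd (u i) (u' i)).
Local Notation MM i := (gM (u i) (u' i)).
Local Notation EE := (gE (u ord0) (u' ord0)).

Let fld i : field g0 (ff i) (MM i) (dd i) := geodesic_field g0_pd (tp i).

Let cu0 : Ck 3 (u ord0) := gp_l (gp ord0).
Definition ref2 y := u ord0 y + ka * u ord0 y.
(* The Hessian of r need not be positive, so it is written as a difference of two positive ones. *)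
Definition ref1 y := ref2 y + 1 * r y.

Lemma Ck_ref2 : Ck 3 ref2. Proof. exact: CkDZ ka cu0 cu0. Qed.
Lemma Ck_ref1 : Ck 3 ref1. Proof. exact: CkDZ 1 Ck_ref2 (rd_r rd). Qed.

Lemma hess_ref2 x : hess ref2 x = g0 x + ka *: g0 x.
Proof. exact: hessDZ (Ck_weak cu0) (Ck_weak cu0). Qed.

Lemma hess_ref1 x : hess ref1 x = hess ref2 x + hess r x.
Proof. by rewrite (hessDZ 1 x (Ck_weak Ck_ref2) (Ck_weak (rd_r rd))) scale1r. Qed.

Local Opaque ref1 ref2.

Lemma ref2_posdef x : posdef (hess ref2 x).
Proof. by rewrite hess_ref2; exact: posdefDZ. Qed.

Lemma ref2_qf x v : qf (hess ref2 x) v = (1 + ka) * qf (g0 x) v.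
Proof. by rewrite hess_ref2 qfD qfZ mulrDl mul1r. Qed.

Lemma ref1_posdef x : posdef (hess ref1 x).
Proof.
have e : hess ref1 x = g0 x + ka *: g0 x + hess r x by rewrite -hess_ref2; exact: hess_ref1.
exact: (posdef_dominated (g0_pd x) ka0 (hess_sym x (Ck_weak Ck_ref1)) e (rd_hess rd x)).
Qed.

Lemma ref2_field : field g0 (fun=> 0) (fun z => hess ref2 (sp z)) (fun=> 0).
Proof.
have c0 : 0 <= 1 + ka by rewrite addr_ge0.
have h := @static_field R n g0 ref2 (1 + ka) Ck_ref2 ref2_posdef c0; apply: h.
by move=> x v; exact: eq_le (ref2_qf x v).
Qed.

Lemma ref1_field : field g0 (fun=> 0) (fun z => hess ref1 (sp z)) (fun=> 0).
Proof.
have c0 : 0 <= 1 + ka + ka by rewrite !addr_ge0.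
have h := @static_field R n g0 ref1 (1 + ka + ka) Ck_ref1 ref1_posdef c0; apply: h.
move=> x v; exact: qf_perturb (hess_ref1 x) (ref2_qf x v) (rd_hess rd x v).
Qed.

Lemma slice_divE c v t z : slice_div (u ord0) (u' ord0) r c v t z =
  \det (hess v (sp z)) * (\tr (EE (at_time c z)) + dot (dd ord0 (at_time c z)) (grad r (sp z))) +
  ff ord0 (at_time c z) * (\det (hess v (sp z)) * \tr (invmx (hess v (sp z)) *m hess t (sp z))).
Proof. by []. Qed.

Lemma ksourceE z : ksource (u ord0) (u' ord0) r z = - (\tr (EE z) + dot (dd ord0 z) (grad r (sp z))).
Proof. by []. Qed.

Lemma mixed0_same f A (z : 'rV[R]_N) : mixed0 f f A A 0 z = f z * \det (A z).
Proof. by rewrite /mixed0 mul0r addr0 scale0r addr0. Qed.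

Lemma mixedT_same A d (z : 'rV[R]_N) : mixedT A A d d 0 z = 0.
Proof. by rewrite /mixedT mul0r mulr0. Qed.

(** Coefficient p_j + 1 of the polarised law for phi_0 and phi_j meets the scalar equation and the
    j-th Hessian equation at once. In [en2] and [en3] a field is paired with itself at m = 0, which
    leaves the conserved density f det A and carries the constants of the system. *)
Definition en1 z := \sum_j coef_w (ff ord0) (ff (nx j)) (MM ord0) (MM (nx j)) (p j).+1 z.
Definition en2 z := - cc ord0 * mixed0 (ff ord0) (ff ord0) (MM ord0) (MM ord0) 0 z.
Definition en3 z := \sum_j - cc (nx j) * mixed0 (ff (nx j)) (ff (nx j)) (MM (nx j)) (MM (nx j)) 0 z.
Definition en4 z := \det (MM ord0 z) * ksource (u ord0) (u' ord0) r z.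
Definition en5 z := coef_w (ff ord0) (fun=> 0) (MM ord0) (fun z => hess ref1 (sp z)) 1 z.
Definition en6 z := -1 * coef_w (ff ord0) (fun=> 0) (MM ord0) (fun z => hess ref2 (sp z)) 1 z.
(* en7 and en8 are spatial divergences, which do not change the total flux; they are weighted so that the energy
   vanishes at both ends. *)
Definition en7 z := (1 + -1 * tm z) * slice_div (u ord0) (u' ord0) r 0 (u ord0) (fun=> 0) z.
Definition en8 z := (0 + 1 * tm z) * slice_div (u ord0) (u' ord0) r 1 (u' ord0) s z.
Definition energy z := en1 z + en2 z + en3 z + en4 z + en5 z + en6 z + en7 z + en8 z.

Definition ds1 z := \sum_j coef_T (MM ord0) (MM (nx j)) (dd ord0) (dd (nx j)) (p j).+1 z.
Definition ds2 z := - cc ord0 * mixedT (MM ord0) (MM ord0) (dd ord0) (dd ord0) 0 z.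
Definition ds3 z := \sum_j - cc (nx j) * mixedT (MM (nx j)) (MM (nx j)) (dd (nx j)) (dd (nx j)) 0 z.
Definition ds4 z := \det (MM ord0 z) * (\tr (EE z *m EE z) - qf (hess r (sp z)) (dd ord0 z)).
Definition ds5 z := coef_T (MM ord0) (fun z => hess ref1 (sp z)) (dd ord0) (fun=> 0) 1 z.
Definition ds6 z := -1 * coef_T (MM ord0) (fun z => hess ref2 (sp z)) (dd ord0) (fun=> 0) 1 z.
Definition dissipation z := ds1 z + ds2 z + ds3 z + ds4 z + ds5 z + ds6 z + 0 + 0.

Lemma law1 : exists W, claw ga en1 W ds1.
Proof. by eexists; exact: (claw_sum (fun j => coef_law g0_pd det0 diag0 (p j).+1 (fld ord0) (fld (nx j)))). Qed.

Lemma law2 : exists W, claw ga en2 W ds2.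
Proof. by eexists; exact: (claw_scale (- cc ord0) (mixed_law g0_pd det0 diag0 (lexx 0) (fld ord0) (fld ord0))). Qed.

Lemma law3 : exists W, claw ga en3 W ds3.
Proof.
by eexists; exact: (claw_sum (fun j => claw_scale (- cc (nx j)) (mixed_law g0_pd det0 diag0 (lexx 0) (fld (nx j)) (fld (nx j))))).
Qed.

Lemma law4 : exists W, claw ga en4 W ds4.
Proof. by eexists; exact: (kenergy_law ga0 g0_pd det0 (tp ord0) (rd_r rd) (rd_grad rd)). Qed.

Lemma law5 : exists W, claw ga en5 W ds5.
Proof. by eexists; exact: (coef_law g0_pd det0 diag0 1 (fld ord0) ref1_field). Qed.

Lemma law6 : exists W, claw ga en6 W ds6.
Proof. by eexists; exact: (claw_scale (-1) (coef_law g0_pd det0 diag0 1 (fld ord0) ref2_field)). Qed.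

Lemma law7 : exists W, claw ga en7 W (fun=> 0).
Proof.
eexists; apply: (@slice_law R n g0 ga Cg ga0 g0_pd det0 diag0 (u ord0) (u' ord0) _ _ _ (tp ord0) r (rd_r rd)
  0 (u ord0) (fun=> 0) 1 0 _ cu0 g0_pd (Ck_cst 3 0) (fun z => gM_at0 z (gp ord0))).
- by rewrite lexx ler01.
- by move=> x i; rewrite partial_cst addr0; exact: rd_dr rd x i.
- exact: ler01.
- by move=> x w; rewrite mul1r.
- exact: lexx.
- move=> x w; have -> : grad (fun=> 0 : R) x = 0 by apply/rowP => i; rewrite !mxE partial_cst.
  by rewrite /dot trmx0 mulmx0 mxE expr0n mul0r.
Qed.

Lemma law8 : exists W, claw ga en8 W (fun=> 0).
Proof.
eexists; apply: (@slice_law R n g0 ga Cg ga0 g0_pd det0 diag0 (u ord0) (u' ord0) _ _ _ (tp ord0) r (rd_r rd)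
  1 (u' ord0) s ka ka _ (gp_r (gp ord0)) g1_pd (rd_s rd) (fun z => gM_at1 z (gp ord0)) (rd_ds rd) ka0 (tp_up' (tp ord0)) ka0 (rd_gs rd)).
by rewrite lexx ler01.
Qed.

Lemma energy_law : exists W, claw ga energy W dissipation.
Proof.
have [? h1] := law1; have [? h2] := law2; have [? h3] := law3; have [? h4] := law4.
have [? h5] := law5; have [? h6] := law6; have [? h7] := law7; have [? h8] := law8.
eexists; exact: (claw_add (claw_add (claw_add (claw_add (claw_add (claw_add (claw_add h1 h2) h3) h4) h5) h6) h7) h8).
Qed.

Lemma en1E z : en1 z = ff ord0 z * (\sum_j (detp (MM ord0 z) (MM (nx j) z))`_(p j).+1)
  + \sum_j ff (nx j) z * (detp (MM ord0 z) (MM (nx j) z))`_(p j).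
Proof.
have h j : coef_w (ff ord0) (ff (nx j)) (MM ord0) (MM (nx j)) (p j).+1 z =
  ff ord0 z * (detp (MM ord0 z) (MM (nx j) z))`_(p j).+1 + ff (nx j) z * (detp (MM ord0 z) (MM (nx j) z))`_(p j).
  by apply: coef_wE; apply: leqW; exact: rd_p.
exact: sum_mul_add h.
Qed.

Lemma en2E z : en2 z = - cc ord0 * (ff ord0 z * \det (MM ord0 z)).
Proof. by rewrite /en2 mixed0_same. Qed.

Lemma en3E z : en3 z = \sum_j - cc (nx j) * (ff (nx j) z * \det (MM (nx j) z)).
Proof. by apply: eq_bigr => j _; rewrite mixed0_same. Qed.

Lemma en5E z : en5 z = ff ord0 z * (detp (MM ord0 z) (hess ref1 (sp z)))`_1.
Proof. by rewrite /en5 coef_wE // mul0r addr0. Qed.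

Lemma en6E z : en6 z = -1 * (ff ord0 z * (detp (MM ord0 z) (hess ref2 (sp z)))`_1).
Proof. by rewrite /en6 coef_wE // mul0r addr0. Qed.

Lemma slice_boundary c v t z : tm z = c -> MM ord0 z = hess v (sp z) -> posdef (hess v (sp z)) ->
  slice_div (u ord0) (u' ord0) r c v t z =
  - en4 z + ff ord0 z * (detp (MM ord0 z) (hess t (sp z)))`_1.
Proof.
move=> tc eM pv; have e : at_time c z = z by rewrite -tc at_timeK.
rewrite slice_divE e /en4 ksourceE mulrN opprK detp_coef1 -eM; congr (_ + _ * _).
by apply: det_trace_inv; rewrite eM.
Qed.

Local Opaque en1 en2 en3 en4 en5 en6.

(** The factor of f_0 is the scalar equation and that of f_j is the j-th Hessian equation. The
    entropy cancels against the slice term, which leaves a trace against the Hessian of t: t = 0 at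
    the initial end and t = s at the final one, so that r + t is the logarithm of the determinant
    there. *)
Lemma energy_balance (t : 'rV[R]_n -> R) z a :
  (forall j, (detp (MM ord0 z) (MM (nx j) z))`_(p j) = cc (nx j) * \det (MM (nx j) z)) ->
  \sum_j (detp (MM ord0 z) (MM (nx j) z))`_(p j).+1 + (detp (MM ord0 z) (hess r (sp z)))`_1
     + (detp (MM ord0 z) (hess t (sp z)))`_1 = cc ord0 * \det (MM ord0 z) ->
  a = - en4 z + ff ord0 z * (detp (MM ord0 z) (hess t (sp z)))`_1 ->
  en1 z + en2 z + en3 z + en4 z + en5 z + en6 z + a = 0.
Proof.
move=> e1 e0 ->.
have dR : (detp (MM ord0 z) (hess ref1 (sp z)))`_1 - (detp (MM ord0 z) (hess ref2 (sp z)))`_1 =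
   (detp (MM ord0 z) (hess r (sp z)))`_1.
  by rewrite -detp_coef1B hess_ref1 addrC addKr.
have fin (f S S' c J K q1 q2 qr qt : R) : S + qr + qt = c * J -> q1 - q2 = qr ->
   f * S + S' + - c * (f * J) + - S' + K + f * q1 + -1 * (f * q2) + (- K + f * qt) = 0.
  move=> h0 h1; transitivity (f * (S + (q1 - q2) + qt - c * J)); first by ring.
  by rewrite h1 h0 subrr mulr0.
have e3 : en3 z = - \sum_j ff (nx j) z * (detp (MM ord0 z) (MM (nx j) z))`_(p j).
  rewrite en3E -sumrN; apply: eq_bigr => j _; rewrite (e1 j).
  by rewrite mulNr [cc _ * (_ * _)]mulrCA.
rewrite en1E en2E e3 en5E en6E.
exact: fin e0 dR.
Qed.

Lemma hess_zero x : hess (fun=> 0 : R) x = 0 :> 'M[R]_n.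
Proof.
apply/matrixP => i j; rewrite !mxE.
have -> : partial j (fun _ : 'rV[R]_n => 0 : R) = (fun=> 0) by apply/funext => y; exact: partial_cst.
exact: partial_cst.
Qed.

Lemma energy_boundary z : tm z = 0 \/ tm z = 1 -> energy z = 0.
Proof.
case=> hz.
  have zE i : MM i z = hess (u i) (sp z) by rewrite -(gM_at0 z (gp i)) -hz at_timeK.
  have e7 (a b : R) : (1 + -1 * 0) * a = a /\ (0 + 1 * 0) * b = 0 by split; ring.
  rewrite /energy /en7 /en8 hz (e7 _ 0).1 (e7 0 _).2 addr0.
  apply: (@energy_balance (fun=> 0)).
  - by move=> j; rewrite !zE; exact: rd_e1 rd j _.
  - rewrite hess_zero [X in _ + X]detp_coef1 mulmx0 linear0 addr0 (zE ord0).
    apply: etrans (rd_e0 rd (sp z)); congr (_ + _).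
    by apply: eq_bigr => j _; rewrite (zE (nx j)).
  - exact: (slice_boundary _ hz (zE ord0) (g0_pd _)).
have zE i : MM i z = hess (u' i) (sp z) by rewrite -(gM_at1 z (gp i)) -hz at_timeK.
have e8 (e a b : R) : e + (1 + -1 * 1) * a + (0 + 1 * 1) * b = e + b by ring.
rewrite /energy /en7 /en8 hz e8.
apply: (@energy_balance s).
- by move=> j; rewrite !zE; exact: rd_e1' rd j _.
- rewrite (zE ord0); apply: etrans (rd_e0' rd (sp z)); congr (_ + _ + _).
  by apply: eq_bigr => j _; rewrite (zE (nx j)).
- exact: (slice_boundary _ hz (zE ord0) (g1_pd _)).
Qed.

Lemma trace_gE_square z : 0 <= \tr (EE z *m EE z) /\ (\tr (EE z *m EE z) = 0 -> EE z = 0).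
Proof.
have pA := gA_posdef (gp ord0) z; have pB := gB_posdef (gp ord0) z; have pK := gK_posdef (gp ord0) z.
rewrite /gE; move: (gA _ _ _) (gB _ _ _) (gK _ _ _) pA pB pK => A B K pA pB pK.
have sN : (A - B)^T = A - B by rewrite linearB /= (posdef_sym pA) (posdef_sym pB).
have [h1 h2] := trace_square pK sN.
have -> : \tr ((A - B) *m invmx K *m ((A - B) *m invmx K)) = \tr (invmx K *m (A - B) *m (invmx K *m (A - B))).
  by rewrite -!mulmxA mxtrace_mulC !mulmxA mxtrace_mulC !mulmxA.
by split=> // /h2 ->; rewrite mul0mx.
Qed.

(** The Hessian of r at d, which has no sign, appears with opposite signs in the entropy law and in
    the difference of the two laws with static references, and cancels. *)
Lemma dissipationE z : dissipation z = ds1 z + \det (MM ord0 z) * \tr (EE z *m EE z).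
Proof.
have pM i : posdef (MM i z) := gM_posdef (gp i) z.
have [P1 [h1 _ _ e1]] := @coef_T_poly R n (MM ord0) (fun y => hess ref1 (sp y)) (dd ord0) (fun=> 0) z (pM ord0) (ref1_posdef (sp z)).
have [P2 [h2 _ _ e2]] := @coef_T_poly R n (MM ord0) (fun y => hess ref2 (sp y)) (dd ord0) (fun=> 0) z (pM ord0) (ref2_posdef (sp z)).
have nn : (1 < n.+2)%N by [].
have d5 : ds5 z = \det (MM ord0 z) * (qf (hess ref2 (sp z)) (dd ord0 z) + qf (hess r (sp z)) (dd ord0 z)).
  by rewrite /ds5 (h1 1%N nn) e1 hess_ref1 qfD subr0.
have d6 : ds6 z = -1 * (\det (MM ord0 z) * qf (hess ref2 (sp z)) (dd ord0 z)).
  apply: (congr1 (fun y => -1 * y)); apply: (etrans (h2 1%N nn)); apply: (etrans e2).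
  by rewrite subr0.
have d2 : ds2 z = 0 by rewrite /ds2 mixedT_same mulr0.
have d3 : ds3 z = 0 by apply: big1 => j _; rewrite mixedT_same mulr0.
have fin (S J t q a : R) : S + 0 + 0 + J * (t - q) + J * (a + q) + -1 * (J * a) + 0 + 0 = S + J * t by ring.
by rewrite /dissipation d2 d3 d5 d6; exact: fin.
Qed.

(** The index p_j + 1 lies in the range 1, ..., n in which [mixed_poly] detects a difference of
    displacements; this is the role of the bound on p_j. *)
Lemma coef_T_sign j z : 0 <= coef_T (MM ord0) (MM (nx j)) (dd ord0) (dd (nx j)) (p j).+1 z /\
  (coef_T (MM ord0) (MM (nx j)) (dd ord0) (dd (nx j)) (p j).+1 z = 0 -> dd ord0 z = dd (nx j) z).
Proof.
have pM i : posdef (MM i z) := gM_posdef (gp i) z.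
have [P [h P0 Pz _]] := coef_T_poly (dd ord0) (dd (nx j)) (pM ord0) (pM (nx j)).
have q1 : ((p j).+1 <= n)%N by exact: rd_p.
have q2 : ((p j).+1 < n.+2)%N by rewrite ltnS leqW.
by rewrite (h _ q2); split; [exact: P0|exact: Pz].
Qed.

Lemma dissipation_ge0 z : 0 <= dissipation z /\
  (dissipation z = 0 -> EE z = 0 /\ forall j, dd (nx j) z = dd ord0 z).
Proof.
have [pE nE] := trace_gE_square z.
have J0 : 0 < \det (MM ord0 z) := posdef_det (gM_posdef (gp ord0) z).
have S0 : 0 <= ds1 z by apply: sumr_ge0 => j _; case: (coef_T_sign j z).
rewrite dissipationE.
have t0 : 0 <= \det (MM ord0 z) * \tr (EE z *m EE z) := mulr_ge0 (ltW J0) pE.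
split; first exact: addr_ge0.
move/eqP; rewrite (paddr_eq0 S0 t0) mulf_eq0 (negbTE (lt0r_neq0 J0)) /= => /andP[sz /eqP tz]; split.
  exact: nE.
move=> j; apply/esym; apply: (coef_T_sign j z).2; apply/eqP.
move: sz; rewrite /ds1 psumr_eq0; last by move=> i _; case: (coef_T_sign i z).
by move/allP/(_ j); rewrite mem_index_enum; apply.
Qed.

Local Opaque energy dissipation.

(** At time 1/2 the dissipation vanishes. Then the spatial derivative of d_0 is zero on this slice,
    so d_0 is a constant a there, and all d_j equal it. *)
Theorem rigidity : exists a, forall i x, grad (u' i) (x + a) = grad (u i) x.
Proof.
have [W hW] := energy_law.
have half z : tm z = 1 / 2 -> EE z = 0 /\ forall j, dd (nx j) z = dd ord0 z.
  move=> hz; apply: (dissipation_ge0 z).2.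
  by apply: (claw_vanish ga0 hW energy_boundary _ hz) => y _; exact: (dissipation_ge0 y).1.
have h01 : 0 <= (1 / 2 : R) <= 1 by apply/andP; split; lra.
pose z0 : 'rV[R]_N := at_time (1 / 2) 0; pose a := dd ord0 z0; exists a => i x.
have da z : tm z = 1 / 2 -> dd i z = a.
  move=> hz; have -> : dd i z = dd ord0 z.
    have [j ->|->] := unliftP ord0 i; [exact: (half z hz).2|by []].
  rewrite /a; apply/rowP => j; apply/eqP; rewrite -subr_eq0; apply/eqP.
  have tw : tm (z - z0) = 0 by rewrite tmD -scaleN1r tmZ hz tm_at mulN1r subrr.
  have der (t : R) : 0 <= t <= 1 -> is_derive (t *: (z - z0) + z0) (z - z0) (fun y => dd ord0 y 0 j) 0.
    move=> _; have tt : tm (t *: (z - z0) + z0) = 1 / 2 by rewrite tmD tmZ tw mulr0 add0r tm_at.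
    have := (is_derive_mxP _ _ _ _).1 (gd_is_derive (gp ord0) (clamp_linear_slice (t *: (z - z0) + z0) tw)) 0 j.
    by rewrite (half _ tt).1 mulmx0 [X in is_derive _ _ _ X]mxE.
  have [t _] := @line_MVT R _ (fun y => dd ord0 y 0 j) (fun=> 0) z0 (z - z0) der.
  by rewrite subrK.
(* The midpoint x + a/2 is reached from x and leads to x + a, so the equality of momenta is the
   claim at x. *)
pose z := at_time (1 / 2) (row_mx 0 (x + (1 / 2) *: a) : 'rV[R]_N).
have tz : tm z = 1 / 2 by exact: tm_at.
have sz : sp z = x + (1 / 2) *: a.
  by rewrite sp_at; apply/rowP => j; rewrite [LHS]mxE /xix row_mxEr.
have ha : apt (u i) (u' i) z = x + (1 / 2) *: a - (1 / 2) *: a by rewrite /apt tz (clamp_id h01) (da z tz) sz.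
have hb : bpt (u i) (u' i) z = x + (1 / 2) *: a + (1 - 1 / 2) *: a by rewrite /bpt tz (clamp_id h01) (da z tz) sz.
have := gdP (gp i) z; rewrite ha hb.
have -> : x + (1 / 2) *: a + (1 - 1 / 2) *: a = x + a.
  by apply/rowP => j; rewrite !mxE; field.
by rewrite addrK.
Qed.

End Rigidity.

(** * The displacement bound *)

Lemma convex_comb_ge {R : realType} (t a b c : R) : 0 <= t <= 1 -> a <= b -> a <= c -> a <= (1 - t) * b + t * c.
Proof.
move=> /andP[t0 t1] ab ac; have -> : a = (1 - t) * a + t * a by rewrite -mulrDl subrK mul1r.
by apply: lerD; apply: ler_wpM2l; rewrite ?subr_ge0.
Qed.

Lemma mid_row_diff {R : realType} {n : nat} (t : R) (a b a0 b0 : 'rV[R]_n) :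
  (1 - t) *: (a - a0) + t *: (b - b0) = (1 - t) *: a + t *: b - ((1 - t) *: a0 + t *: b0).
Proof. by rewrite !scalerBr addrACA -opprD. Qed.

Lemma mid_time_diff {R : realType} {n : nat} (s t : R) (a b : 'rV[R]_n) :
  (1 - s) *: a + s *: b - ((1 - t) *: a + t *: b) = (s - t) *: (b - a).
Proof. by apply/rowP => i; rewrite !mxE; ring. Qed.

Lemma chain_arith {R : realType} (p1 p2 a1 a2 y1 y2 t C0 K k : R) :
  a1 + - ((1 - t) * p2 + t * p1) + K - k <= y1 -> t * C0 <= C0 -> t * a2 <= t * (a1 + C0) ->
  t * (y1 - C0) <= t * y2 -> t * (y2 + p1) <= t * a2 -> (1 - t) * (y1 + p2) <= (1 - t) * a1 -> K <= k + C0 + C0.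
Proof. by rewrite !(mulrDr, mulrBr, mulrDl, mulrBl, mul1r, mulr1); lra. Qed.

Section Displacement.
Context {R : realType} {n : nat}.
Variables (u u' : 'rV[R]_n -> R) (C0 C1 : R).
Hypotheses (n0 : (0 < n)%N) (cu : Ck 2 u) (cu' : Ck 2 u').
Hypotheses (pu : forall x, posdef (hess u x)) (pu' : forall x, posdef (hess u' x)).
Hypothesis bnd : forall y, `|u' y - u y| <= C0.
Hypothesis vel : forall x t, 0 <= t <= 1 ->
  exists2 w, w *m mid t (hess u' x) (hess u x) = grad u' x - grad u x & `|w| <= C1.

Let su : strictly_convex u := conj cu pu.
Let su' : strictly_convex u' := conj cu' pu'.

Lemma Ck_dot (q : 'rV[R]_n) : Ck 1 (fun y => dot y q).
Proof.
apply: C1on_Ck1; have -> : (fun y => dot y q) = (fun y => \sum_i y 0 i * q 0 i) by apply/funext => y; rewrite dotE.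
apply: C1on_sum; first exact: openT.
by move=> i _; apply: C1on_mul; [exact: openT|exact: C1on_coord openT|exact: C1on_cst openT].
Qed.

Lemma partial_dot (q y : 'rV[R]_n) j : partial j (fun y => dot y q) y = q 0 j.
Proof.
apply: partial_val; have -> : (fun y => dot y q) = (fun y => \sum_i y 0 i * q 0 i) by apply/funext => z; rewrite dotE.
have := @is_derive_suml R _ _ (index_enum 'I_n) xpredT _ _ y (delta_mx 0 j) (fun i _ => is_deriveMp
  ((is_derive_mxP _ _ _ _).1 (is_derive_id y (delta_mx 0 j)) 0 i) (is_derive_cst (q 0 i) y (delta_mx 0 j))).
apply: is_derive_eqfun => //.
rewrite (bigD1 j) //= !mxE !eqxx mul1r mulr0 addr0 big1 ?addr0 // => i ij.
by rewrite !mxE eqxx (negbTE ij) mul0r mulr0 addr0.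
Qed.

(* The displacement is estimated by following the point with fixed momentum along the linear path from u to u'. *)
Lemma chain_point a t : 0 <= t <= 1 ->
  exists y, (1 - t) *: grad u y + t *: grad u' y = grad u a.
Proof.
move=> /andP[t0 t1]; pose q := grad u a.
have [k k0 hk] := linear_growth a n0 su.
pose f y := u' y + -1 * u y; pose ut y := u y + t * f y; pose F y := ut y + -1 * dot y q.
have cf : Ck 2 f := CkDZ (-1) cu' cu.
have cut : Ck 1 ut := Ck_weak (CkDZ t cu cf).
have cF : Ck 1 F := CkDZ (-1) cut (Ck_dot q).
have [|y hy] := @coercive_critical R n F k (- (u a - dot a q - k - k * `|a| - C0)) k0 cF.
  move=> d; rewrite opprK; have := hk (d - a); rewrite subrK dotBl.
  have h1 : k * `|d| <= k * `|d - a| + k * `|a|.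
    by rewrite -mulrDr ler_wpM2l ?(ltW k0) // -{1}(subrK a d) ler_normD.
  have h2 : - C0 <= t * f d.
    have := bnd d; rewrite /f mulN1r => h; apply: (@le_trans _ _ (- (t * `|u' d - u d|))).
      rewrite lerN2; apply: le_trans h; rewrite -[leRHS]mul1r; exact: ler_wpM2r.
    by rewrite -mulrN ler_wpM2l // lerNl ler_normr lexx orbT.
  by rewrite /F /ut mulN1r -/q; move: h1 h2; move: (dot d q) (dot a q) (t * f d) (k * _) (k * _) (k * _) => *; lra.
exists y; apply/rowP => j; have := congr1 (fun M : 'rV[R]_n => M 0 j) hy; rewrite !mxE.
rewrite /F (@partialDZ _ _ 0 _ _ _ _ _ cut (Ck_dot q)) /ut (@partialDZ _ _ 0 _ _ _ _ _ (Ck_weak cu) (Ck_weak cf)).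
rewrite /f (@partialDZ _ _ 0 _ _ _ _ _ (Ck_weak cu') (Ck_weak cu)) partial_dot [q 0 j]mxE.
move: (partial j u y) (partial j u' y) (partial j u a) => b b' c; lra.
Qed.

(** The linear growth of u at a is set against the tangent inequalities of u and u' at y, weighted
    by 1 - t and t; the momentum terms cancel and k |y - a| <= k + 2 C0 remains. *)
Lemma chain_bounded a : exists r, forall t y, 0 <= t <= 1 ->
  (1 - t) *: grad u y + t *: grad u' y = grad u a -> `|y - a| <= r.
Proof.
have [k k0 hk] := linear_growth a n0 su.
exists ((k + C0 + C0) / k) => t y /andP[t0 t1] hy; rewrite ler_pdivlMr //.
have h1 := convex_tangent y a su; have h2 := convex_tangent y a su'.
have h3 := hk (y - a); rewrite subrK in h3.
have h4 : dot (a - y) (grad u a) = (1 - t) * dot (a - y) (grad u y) + t * dot (a - y) (grad u' y).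
  by rewrite -hy dotDr !dotZr.
have h5 : dot (y - a) (grad u a) = - dot (a - y) (grad u a) by rewrite -dotNl opprB.
have b1 := bnd y; have b2 := bnd a; rewrite ler_distl in b1; rewrite ler_distl in b2.
move: b1 b2 => /andP[b1 _] /andP[_ b2].
rewrite h5 h4 in h3.
have s0 : 0 <= 1 - t by rewrite subr_ge0.
have C00 : 0 <= C0 by apply: le_trans (bnd a).
have tC : t * C0 <= C0 by rewrite ler_piMl.
rewrite mulrC; exact: (chain_arith h3 tC (ler_wpM2l t0 b2) (ler_wpM2l t0 b1) (ler_wpM2l t0 h2) (ler_wpM2l s0 h1)).
Qed.

Lemma monotone_lower (v : 'rV[R]_n -> R) x (r : R) : strictly_convex v -> 0 <= r -> exists2 c, 0 < c & forall y z,
  `|y - x| <= r -> `|z - x| <= r -> c * dot (y - z) (y - z) <= dot (y - z) (grad v y - grad v z).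
Proof.
move=> sv r0; have [c c0 hc] := hess_lower x sv r0; exists c => // y z hy hz.
have [s hs e] := grad_MVT z (y - z) (y - z) sv.1; rewrite subrK -dotBr in e; rewrite e.
apply: hc; have -> : s *: (y - z) + z - x = s *: (y - x) + (1 - s) *: (z - x).
  by apply/rowP => i; rewrite !mxE; ring.
exact: norm_convex hs hy hz.
Qed.

(** The difference of the two momentum equations, paired with y - y0, is at least m |y - y0|^2 by
    uniform convexity and at most a multiple of |t - t0| |y - y0|. *)
Lemma chain_lipschitz a t0 y0 : 0 <= t0 <= 1 -> (1 - t0) *: grad u y0 + t0 *: grad u' y0 = grad u a ->
  exists K, forall t y, 0 <= t <= 1 -> (1 - t) *: grad u y + t *: grad u' y = grad u a ->
  `|y - y0| <= K * `|t - t0|.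
Proof.
move=> ht0 hy0; have [r hr] := chain_bounded a.
have ry0 := hr _ _ ht0 hy0; have r0 : 0 <= r := le_trans (normr_ge0 _) ry0.
have [c c0 hc] := monotone_lower a su r0; have [c' c0' hc'] := monotone_lower a su' r0.
pose m := Num.min c c'; have m0 : 0 < m by rewrite lt_min c0.
pose g := grad u' y0 - grad u y0; exists (n%:R * `|g| / m) => t y ht hy.
have [->|yn] := eqVneq y y0; first by rewrite subrr normr0 !mulr_ge0 // invr_ge0 ltW.
have dn : 0 < `|y - y0| by rewrite normr_gt0 subr_eq0.
have ry := hr _ _ ht hy; have /andP[t1 t2] := ht.
have h1 := hc _ _ ry ry0; have h2 := hc' _ _ ry ry0.
have q0 := dot_ge0 (y - y0).
have {}h1 : m * dot (y - y0) (y - y0) <= dot (y - y0) (grad u y - grad u y0).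
  by apply: le_trans h1; apply: ler_wpM2r => //; rewrite ge_min lexx.
have {}h2 : m * dot (y - y0) (y - y0) <= dot (y - y0) (grad u' y - grad u' y0).
  by apply: le_trans h2; apply: ler_wpM2r => //; rewrite ge_min lexx orbT.
have s0 : 0 <= 1 - t by rewrite subr_ge0.
have e : (1 - t) * dot (y - y0) (grad u y - grad u y0) + t * dot (y - y0) (grad u' y - grad u' y0) =
  (t0 - t) * dot (y - y0) g.
  rewrite -!dotZr -dotDr; congr dot.
  transitivity ((1 - t) *: grad u y + t *: grad u' y - ((1 - t) *: grad u y0 + t *: grad u' y0)).
    exact: mid_row_diff.
  by rewrite hy -hy0; exact: mid_time_diff.
have key : m * `|y - y0| ^+ 2 <= `|t - t0| * (n%:R * (`|y - y0| * `|g|)).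
  apply: (@le_trans _ _ (m * dot (y - y0) (y - y0))).
    by apply: ler_wpM2l (norm_sq_le_dot _); exact: ltW.
  apply: (@le_trans _ _ ((t0 - t) * dot (y - y0) g)).
    rewrite -e; exact: convex_comb_ge ht h1 h2.
  apply: le_trans (ler_norm _) _; rewrite normrM distrC; apply: ler_wpM2l => //.
  exact: dot_norm_le.
rewrite mulrAC ler_pdivlMr // -(ler_pM2r dn).
have -> : `|y - y0| * m * `|y - y0| = m * `|y - y0| ^+ 2 by ring.
by apply: le_trans key _; rewrite le_eqVlt; apply/orP; left; apply/eqP; ring.
Qed.

(** The point y(t) whose momentum for (1-t) u + t u' equals grad u(a) runs from a to b, and its
    velocity is minus the vector w provided by [vel]. The mean value theorem in each coordinate and
    the sup norm give the bound without loss. *)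
Theorem displacement_bound a b : grad u a = grad u' b -> `|b - a| <= C1.
Proof.
move=> hab.
have /choice[y hy'] : forall t : R, exists y : 'rV[R]_n,
    (1 - clamp t) *: grad u y + clamp t *: grad u' y = grad u a.
  by move=> t; exact: chain_point (clamp_itv t).
have hy t : 0 <= t <= 1 -> (1 - t) *: grad u (y t) + t *: grad u' (y t) = grad u a.
  by move=> ht; have := hy' t; rewrite (clamp_id ht).
have cy (t : R) : y s @[s --> t] --> y t.
  have [K hK] := chain_lipschitz (clamp_itv t) (hy' t).
  apply/cvgrPdist_le => e e0; have K0 : 0 < `|K| + 1 by rewrite ltr_wpDl.
  have : \forall s \near t, `|clamp t - clamp s| <= e / (`|K| + 1).
    by have /cvgrPdist_le /(_ (e / (`|K| + 1))) := @clamp_continuous R t; apply; rewrite divr_gt0.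
  apply: filterS => s hts; rewrite distrC.
  apply: le_trans (hK _ _ (clamp_itv s) (hy' s)) _; rewrite distrC.
  apply: (@le_trans _ _ ((`|K| + 1) * `|clamp t - clamp s|)).
    by apply: ler_wpM2r => //; apply: le_trans (ler_norm _) _; rewrite lerDl.
  by rewrite mulrC -ler_pdivlMr.
have i0 : 0 <= (0 : R) <= 1 by rewrite lexx ler01.
have i1 : 0 <= (1 : R) <= 1 by rewrite lexx ler01.
have y0 : y 0 = a.
  by have := hy _ i0; rewrite subr0 scale1r scale0r addr0 => /(grad_inj su).
have y1 : y 1 = b.
  by have := hy _ i1; rewrite subrr scale1r scale0r add0r hab => /(grad_inj su').
have der (t : R) : 0 < t < 1 -> exists2 w : 'rV[R]_n, is_derive t 1 y (- w) & `|w| <= C1.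
  move=> /andP[t0 t1]; have ht : 0 <= t <= 1 by rewrite !ltW.
  have [w ew hw] := vel (y t) ht; exists w => //.
  have [HA [eA cA]] := caratheodory (y t) cu; have [HB [eB cB]] := caratheodory (y t) cu'.
  have near01 : \forall s \near t, 0 <= s <= 1.
    near=> s; apply/andP; split; [apply: ltW; near: s; exact: lt_nbhsr|apply: ltW; near: s; exact: lt_nbhsl].
  have cXA : HA (y s) @[s --> t] --> hess u (y t) := cvg_comp_at (cy t) cA.
  have cXB : HB (y s) @[s --> t] --> hess u' (y t) := cvg_comp_at (cy t) cB.
  have cid : s @[s --> t] --> t by exact: cvg_id.
  have pK := mid_posdef ht (pu' (y t)) (pu (y t)).
  have uK := posdef_unit pK.
  have nK := near_mid_unit (FF := nbhs_filter t) cXB cXA cid uK.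
  pose g := grad u' (y t) - grad u (y t).
  have cq : (- g *m invmx (mid s (HB (y s)) (HA (y s)))) @[s --> t] --> - g *m invmx (mid t (hess u' (y t)) (hess u (y t))).
    apply: cvg_mulmx; first exact: cvg_cst.
    by have c1 := cvg_mid (FF := nbhs_filter t) cXB cXA cid; exact: (cvg_invmx (FF := nbhs_filter t) uK c1).
  have wE : - g *m invmx (mid t (hess u' (y t)) (hess u (y t))) = - w.
    by rewrite /g -ew mulNmx mulmxK.
  (* Caratheodory's form again: the increment of y solves a linear system with invertible matrix, so
     the difference quotient is explicit and its limit is - w. *)
  have eq1 : \forall s \near t, y s - y t = (s - t) *: (- g *m invmx (mid s (HB (y s)) (HA (y s)))).
    near=> s; have hs : 0 <= s <= 1 by near: s.
    have us : mid s (HB (y s)) (HA (y s)) \in unitmx by near: s.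
    have e : (y s - y t) *m mid s (HB (y s)) (HA (y s)) = (s - t) *: - g.
      rewrite /mid mulmxDr -!scalemxAr -eA -eB.
      transitivity ((1 - s) *: grad u (y s) + s *: grad u' (y s) - ((1 - s) *: grad u (y t) + s *: grad u' (y t))).
        exact: mid_row_diff.
      by rewrite (hy _ hs) -(hy _ ht) mid_time_diff -opprB scaleNr scalerN.
    by rewrite scalemxAl -e mulmxK.
  rewrite wE in cq.
  have l0 : (h *: (1 : R) + t) @[h --> (0 : R)] --> t.
    have c : {for 0, continuous (fun h : R => h *: (1 : R) + t)}.
      by apply: continuousD; [apply: for_continuous_scalel|exact: for_continuous_cst].
    by move: c; rewrite /prop_for /continuous_at scale0r add0r.
  have eq2 : \forall h \near (0 : R), y (h *: (1 : R) + t) - y t =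
      h *: (- g *m invmx (mid (h *: (1 : R) + t) (HB (y (h *: (1 : R) + t))) (HA (y (h *: (1 : R) + t))))).
    have h0 := l0 _ eq1; near=> h.
    have : y (h *: (1 : R) + t) - y t = (h *: (1 : R) + t - t) *: (- g *m invmx (mid (h *: (1 : R) + t) (HB (y (h *: (1 : R) + t))) (HA (y (h *: (1 : R) + t))))).
      by near: h.
    by have -> : h *: (1 : R) + t - t = h; [rewrite addrK; exact: mulr1|].
  have cq2 : (- g *m invmx (mid (h *: (1 : R) + t) (HB (y (h *: (1 : R) + t))) (HA (y (h *: (1 : R) + t))))) @[h --> (0 : R)] --> - w.
    exact: (cvg_comp_at l0 cq).
  have key : (fun h => h^-1 *: (y (h *: (1 : R) + t) - y t)) @ 0^' --> - w.
    have cq' := cvg_trans (cvg_app _ (@nbhs_dnbhs _ (0 : R))) cq2.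
    apply: cvg_trans cq'; apply: near_eq_cvg.
    have n1 : \forall h \near (0:R)^', h != 0 by exact: nbhs_dnbhs_neq.
    have n2 := @nbhs_dnbhs _ (0 : R) _ eq2.
    apply: filterS2 n1 n2 => h h0 ->.
    by rewrite scalerA mulVf // scale1r.
  have key' : (fun h => h^-1 *: (y (h *: (1 : R) + t) - y t)) @ 0^' --> - w := key.
  split; first by apply/cvg_ex; eexists; exact: key'.
  exact: cvg_lim key'.
have /choice[w hw] : forall t : R, exists w : 'rV[R]_n, 0 < t < 1 -> is_derive t (1 : R) y (- w) /\ `|w| <= C1.
  move=> t; have [ht|ht] := boolP (0 < t < 1); last by exists 0.
  by have [w h1 h2] := der t ht; exists w.
have C10 : 0 <= C1 by have [w0 _] := vel a i0; apply: le_trans.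
apply: (row_norm_le _ C10).2 => j; rewrite -y0 -y1.
have [||t ht] := @MVT R (fun t => y t 0 j) (fun t => (- w t) 0 j) 0 1 ltr01.
- move=> t; rewrite in_itv /= => ht; exact: (is_derive_mxP _ _ _ _).1 (hw t ht).1 0 j.
- by apply: continuous_subspaceT => t; apply: for_continuous_coord; exact: cy.
rewrite in_itv /= in ht; rewrite subr0 mulr1 !mxE => ->; rewrite normrN.
exact: le_trans (coord_le_norm _ _) (hw t ht).2.
Unshelve. all: by end_near.
Qed.

End Displacement.

(** * Calculus on toric charts *)

Section CkClosure.
Context {R : realType} {N : nat}.
Implicit Types (f g : 'rV[R]_N -> R).

Lemma CkI m f (df : 'I_N -> 'rV[R]_N -> R) : continuous f ->
  (forall x j, is_derive x (delta_mx 0 j) f (df j x)) -> (forall j, Ck m (df j)) -> Ck m.+1 f.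
Proof.
move=> cf hf hdf; split=> // j; split; first by move=> x; case: (hf x j).
by have -> : partial j f = df j by apply/funext => x; exact: partial_val (hf x j).
Qed.

Lemma Ck0 m f : Ck m f -> continuous f. Proof. by case: m => [|m] []. Qed.

Lemma CkD m f g : Ck m f -> Ck m g -> Ck m (fun x => f x + g x).
Proof.
move=> cf cg; have -> : (fun x => f x + g x) = (fun x => f x + 1 * g x) by apply/funext => x; rewrite mul1r.
exact: CkDZ.
Qed.

Lemma CkM m f g : Ck m f -> Ck m g -> Ck m (fun x => f x * g x).
Proof.
elim: m f g => [|m IH] f g cf cg; have c : continuous (fun x => f x * g x).
- by move=> x; exact: (continuousM (Ck0 cf (x := x)) (Ck0 cg (x := x))).
- by split.
- by move=> x; exact: (continuousM (Ck0 cf (x := x)) (Ck0 cg (x := x))).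
apply: CkI c (fun x j => is_deriveMp (Ck_is_derive x j cf) (Ck_is_derive x j cg)) _ => j.
by apply: CkD; apply: IH; [exact: Ck_partial|exact: Ck_weak|exact: Ck_weak|exact: Ck_partial].
Qed.

Lemma CkZ m a f : Ck m f -> Ck m (fun x => a * f x).
Proof. by move=> cf; apply: CkM => //; exact: Ck_cst. Qed.

Lemma CkN m f : Ck m f -> Ck m (fun x => - f x).
Proof.
move=> cf; have -> : (fun x => - f x) = (fun x => -1 * f x) by apply/funext => x; rewrite mulN1r.
exact: CkZ.
Qed.

Lemma CkB m f g : Ck m f -> Ck m g -> Ck m (fun x => f x - g x).
Proof. by move=> cf cg; apply: CkD => //; exact: CkN. Qed.

Lemma Ck_sum (I : Type) (r : seq I) (P : pred I) m (F : I -> 'rV[R]_N -> R) :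
  (forall i, P i -> Ck m (F i)) -> Ck m (fun x => \sum_(i <- r | P i) F i x).
Proof.
move=> h; elim: r => [|a r IH].
  have -> : (fun x => \sum_(i <- [::] | P i) F i x) = (fun=> 0) by apply/funext => x; rewrite big_nil.
  exact: Ck_cst.
have [Pa|Pa] := boolP (P a).
  have -> : (fun x => \sum_(i <- a :: r | P i) F i x) = (fun x => F a x + \sum_(i <- r | P i) F i x).
    by apply/funext => x; rewrite big_cons Pa.
  by apply: CkD => //; exact: h.
have -> // : (fun x => \sum_(i <- a :: r | P i) F i x) = (fun x => \sum_(i <- r | P i) F i x).
by apply/funext => x; rewrite big_cons (negbTE Pa).
Qed.

Lemma Ck_coord m k : Ck m (fun x : 'rV[R]_N => x 0 k).
Proof.
have c : continuous (fun x : 'rV[R]_N => x 0 k) by exact: coord_continuous.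
case: m => [|m]; first by split.
apply: (CkI c (df := fun j _ => (delta_mx 0 j : 'rV[R]_N) 0 k)) => [x j|j]; last exact: Ck_cst.
exact: (is_derive_mxP _ _ _ _).1 (is_derive_id x _) 0 k.
Qed.

Lemma is_derive_outer (phi : R -> R) f x v df dphi : is_derive x v f df -> is_derive (f x) 1 phi dphi ->
  is_derive x v (fun y => phi (f y)) (dphi * df).
Proof.
move=> hf hphi; apply/is_derive1P; have {}hf : is_derive (0 : R) 1 (fun t : R => f (t *: v + x)) df by apply/is_derive1P.
have := @is_derive1_comp R phi (fun t : R => f (t *: v + x)) 0 _ _ _ hf; apply.
by rewrite scale0r add0r.
Qed.

Lemma for_continuous_outer (phi : R -> R) f x dphi : {for x, continuous f} -> is_derive (f x) 1 phi dphi ->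
  {for x, continuous (fun y => phi (f y))}.
Proof.
move=> cf hphi; have c : {for f x, continuous phi}.
  by apply: differentiable_continuous; apply/derivable1_diffP; case: hphi.
exact: for_continuous_comp cf c.
Qed.

Lemma Ck_expR m f : Ck m f -> Ck m (fun x => expR (f x)).
Proof.
elim: m f => [|m IH] f cf; have c : continuous (fun x => expR (f x)).
- by move=> x; exact: for_continuous_outer (Ck0 cf (x := x)) (is_derive_expR (f x)).
- by split.
- by move=> x; exact: for_continuous_outer (Ck0 cf (x := x)) (is_derive_expR (f x)).
apply: CkI c (fun x j => is_derive_outer (Ck_is_derive x j cf) (is_derive_expR (f x))) _ => j.
by apply: CkM; [apply: IH; exact: Ck_weak|exact: Ck_partial].
Qed.

Lemma is_derive_invr (a : R) : a != 0 -> is_derive a 1 (fun y : R => y^-1) (- (a^-1 * a^-1)).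
Proof.
move=> a0; have := @is_deriveV R (fun y : R => y) a 1 1 a0 (is_derive_id a (1 : R)).
by apply: is_derive_eqfun => //; rewrite /GRing.scale /= mulr1 -expr2 exprVn.
Qed.

Lemma Ck_inv m f : (forall x, f x != 0) -> Ck m f -> Ck m (fun x => (f x)^-1).
Proof.
move=> f0; elim: m f f0 => [|m IH] f f0 cf; have c : continuous (fun x => (f x)^-1).
- by move=> x; exact: for_continuous_outer (Ck0 cf (x := x)) (is_derive_invr (f0 x)).
- by split.
- by move=> x; exact: for_continuous_outer (Ck0 cf (x := x)) (is_derive_invr (f0 x)).
apply: CkI c (fun x j => is_derive_outer (Ck_is_derive x j cf) (is_derive_invr (f0 x))) _ => j.
have ci := IH _ f0 (Ck_weak cf).
by apply: CkM; [apply: CkN; exact: CkM|exact: Ck_partial].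
Qed.

Lemma Ck_ln m f : (forall x, 0 < f x) -> Ck m f -> Ck m (fun x => ln (f x)).
Proof.
move=> f0 cf; have c : continuous (fun x => ln (f x)).
  by move=> x; exact: for_continuous_outer (Ck0 cf (x := x)) (is_derive1_ln (f0 x)).
case: m cf => [|m] cf; first by split.
apply: CkI c (fun x j => is_derive_outer (Ck_is_derive x j cf) (is_derive1_ln (f0 x))) _ => j.
by apply: CkM; [apply: Ck_inv (Ck_weak cf) => x; exact: lt0r_neq0|exact: Ck_partial].
Qed.

End CkClosure.

Section CkComposition.
Context {R : realType} {M N : nat}.
Implicit Types (f : 'rV[R]_N -> R) (Phi : 'rV[R]_M -> 'rV[R]_N).

Lemma is_derive_row m Phi x j : (forall k, Ck m.+1 (fun x => Phi x 0 k)) ->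
  is_derive x (delta_mx 0 j) Phi (\row_k partial j (fun x => Phi x 0 k) x).
Proof.
move=> h; apply/is_derive_mxP => i k; rewrite ord1 mxE; exact: Ck_is_derive (h k).
Qed.

Lemma comp_is_derive m f Phi x j : Ck 1 f -> (forall k, Ck m.+1 (fun x => Phi x 0 k)) ->
  is_derive x (delta_mx 0 j) (fun x => f (Phi x))
    (\sum_k partial j (fun x => Phi x 0 k) x * partial k f (Phi x)).
Proof.
move=> cf h; have := C1_chain openT (Ck_C1on cf) I (is_derive_row x j h).
by apply: is_derive_eqfun => //; apply: eq_bigr => k _; rewrite mxE.
Qed.

Lemma Ck_comp m f Phi : Ck m f -> (forall k, Ck m (fun x => Phi x 0 k)) -> Ck m (fun x => f (Phi x)).
Proof.
move=> + h; have cP : continuous Phi.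
  by move=> x; apply: for_continuous_mx => i k; rewrite ord1; exact: Ck0 (h k) x.
elim: m f h => [|m IH] f h cf; have c : continuous (fun x => f (Phi x)).
- by move=> x; exact: for_continuous_comp (cP x) (Ck0 cf (x := _)).
- by split.
- by move=> x; exact: for_continuous_comp (cP x) (Ck0 cf (x := _)).
apply: CkI c (fun x j => comp_is_derive x j (Ck_le (ltn0Sn m) cf) h) _ => j.
apply: Ck_sum => k _; apply: CkM; first exact: Ck_partial (h k).
by apply: IH; [move=> l; exact: Ck_weak|exact: Ck_partial].
Qed.

End CkComposition.

Lemma is_derive_cmul {R : realType} {V : normedModType R} (a : R) (f : V -> R) x v df :
  is_derive x v f df -> is_derive x v (fun y => a * f y) (a * df).
Proof. by move=> h; have := is_deriveZ a h. Qed.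

Section AffineChange.
Context {R : realType} {n : nat}.
Implicit Types (V : 'rV[R]_n -> R) (Q : 'M[R]_n).

Lemma hessE V y i j : hess V y i j = partial i (partial j V) y.
Proof. by rewrite mxE. Qed.

Lemma Ck_linear m Q k : Ck m (fun y : 'rV[R]_n => (y *m Q) 0 k).
Proof.
have -> : (fun y : 'rV[R]_n => (y *m Q) 0 k) = (fun y => \sum_j y 0 j * Q j k) by apply/funext => y; rewrite mxE.
by apply: Ck_sum => j _; apply: CkM; [exact: Ck_coord|exact: Ck_cst].
Qed.

Lemma partial_linear Q j k (y : 'rV[R]_n) : partial j (fun y => (y *m Q) 0 k) y = Q j k.
Proof.
have := partial_dot (\row_j Q j k) y j; rewrite mxE => <-.
by congr partial; apply/funext => z; rewrite dotE mxE; apply: eq_bigr => i _; rewrite mxE.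
Qed.

Lemma partial_linear_comp V Q j y : Ck 1 V ->
  partial j (fun y => V (y *m Q)) y = \sum_k Q j k * partial k V (y *m Q).
Proof.
move=> cV; apply: partial_val.
have := @comp_is_derive R n n 0 V (fun y => y *m Q) y j cV (fun k => Ck_linear 1 Q k).
by apply: is_derive_eqfun => //; apply: eq_bigr => k _; rewrite partial_linear.
Qed.

Lemma grad_linear_comp V Q y : Ck 1 V -> grad (fun y => V (y *m Q)) y = grad V (y *m Q) *m Q^T.
Proof.
move=> cV; apply/rowP => j; rewrite !mxE partial_linear_comp //.
by apply: eq_bigr => k _; rewrite !mxE mulrC.
Qed.

Lemma hess_linear_comp V Q y : Ck 2 V -> hess (fun y => V (y *m Q)) y = Q *m hess V (y *m Q) *m Q^T.
Proof.
move=> cV; apply/matrixP => i j; rewrite [LHS]hessE mxE.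
have -> : partial j (fun y => V (y *m Q)) = (fun y => \sum_k Q j k * partial k V (y *m Q)).
  by apply/funext => z; exact: partial_linear_comp (Ck_weak cV).
have h k : is_derive y (delta_mx 0 i) (fun y => Q j k * partial k V (y *m Q))
    (Q j k * \sum_l Q i l * partial l (partial k V) (y *m Q)).
  have c1 : Ck 1 (fun y => partial k V (y *m Q)).
    by apply: Ck_comp; [exact: Ck_partial|move=> l; exact: Ck_linear].
  have e := partial_linear_comp Q i y (Ck_partial k cV).
  have := is_derive_cmul (Q j k) (Ck_is_derive y i c1).
  by rewrite e.
rewrite (partial_val (@is_derive_suml R _ _ (index_enum 'I_n) xpredT _ _ y (delta_mx 0 i) (fun k _ => h k))).
apply: eq_bigr => k _; rewrite !mxE mulrC; congr (_ * _).
by apply: eq_bigr => l _; rewrite mxE.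
Qed.

Lemma partial_dot_add V (l : 'rV[R]_n) (c : R) j y : Ck 1 V ->
  partial j (fun y => V y + (dot y l + c)) y = partial j V y + l 0 j.
Proof.
move=> cV; apply: partial_val; apply: is_deriveDp; first exact: Ck_is_derive cV.
have := is_deriveDp (Ck_is_derive y j (Ck_dot l)) (is_derive_cst c y _).
by apply: is_derive_eqfun => //; rewrite partial_dot addr0.
Qed.

Lemma grad_affine_add V (l : 'rV[R]_n) (c : R) y : Ck 1 V -> grad (fun y => V y + (dot y l + c)) y = grad V y + l.
Proof. by move=> cV; apply/rowP => j; rewrite !mxE partial_dot_add. Qed.

Lemma hess_affine_add V (l : 'rV[R]_n) (c : R) y : Ck 2 V -> hess (fun y => V y + (dot y l + c)) y = hess V y.
Proof.
move=> cV; apply/matrixP => i j; rewrite [LHS]hessE [RHS]hessE.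
have -> : partial j (fun y => V y + (dot y l + c)) = (fun y => partial j V y + l 0 j).
  by apply/funext => z; apply: partial_dot_add; exact: Ck_weak.
apply: partial_val; have := is_deriveDp (Ck_is_derive y i (Ck_partial j cV)) (is_derive_cst (l 0 j) y _).
by apply: is_derive_eqfun => //; rewrite addr0.
Qed.

End AffineChange.

Local Open Scope complex_scope.

(** * Consequences of invariance at the real points *)

Section TorusSymmetry.
Context {R : realType} {n : nat}.
Local Notation dx j := (@partial R (n + n) (lshift n j)).
Local Notation dy j := (@partial R (n + n) (rshift n j)).
Implicit Types (F : cpt R n -> R).

Definition scale (w : 'I_n -> R[i]) (z : cpt R n) : cpt R n := of_zc (fun j => w j * zc z j).

Definition rot_inv F := forall w, (forall j, `|w j| = 1) -> forall z, F (scale w z) = F z.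

Lemma scale_l w (z : cpt R n) k : scale w z 0 (lshift n k) =
  complex.Re (w k) * z 0 (lshift n k) - complex.Im (w k) * z 0 (rshift n k).
Proof. by rewrite /scale /of_zc row_mxEl mxE /zc; case: (w k). Qed.

Lemma scale_r w (z : cpt R n) k : scale w z 0 (rshift n k) =
  complex.Re (w k) * z 0 (rshift n k) + complex.Im (w k) * z 0 (lshift n k).
Proof. by rewrite /scale /of_zc row_mxEr mxE /zc; case: (w k) => a b /=; rewrite [b * _]mulrC. Qed.

Lemma cpt_split (P : 'I_(n + n) -> Prop) : (forall k, P (lshift n k)) -> (forall k, P (rshift n k)) -> forall i, P i.
Proof. by move=> hl hr i; case: (split_ordP i) => k ->. Qed.

Lemma cptP (z z' : cpt R n) : (forall k, z 0 (lshift n k) = z' 0 (lshift n k)) ->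
  (forall k, z 0 (rshift n k) = z' 0 (rshift n k)) -> z = z'.
Proof. by move=> hl hr; apply/rowP; exact: cpt_split. Qed.

Lemma partial_coord N (i k : 'I_N) (z : 'rV[R]_N) : partial i (fun z => z 0 k) z = (k == i)%:R.
Proof.
have := (is_derive_mxP _ _ _ _).1 (is_derive_id z (delta_mx 0 i)) 0 k.
by rewrite !mxE eqxx => /partial_val.
Qed.

Lemma partial_coordM N (i k : 'I_N) (g : 'rV[R]_N -> R) z : Ck 1 g ->
  partial i (fun z => z 0 k * g z) z = (k == i)%:R * g z + z 0 k * partial i g z.
Proof.
move=> cg; rewrite -(partial_coord i k z).
exact: partial_val (is_deriveMp (Ck_is_derive z i (Ck_coord 1 k)) (Ck_is_derive z i cg)).
Qed.

Lemma partialD1 N (i : 'I_N) (f g : 'rV[R]_N -> R) z : Ck 1 f -> Ck 1 g ->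
  partial i (fun z => f z + g z) z = partial i f z + partial i g z.
Proof. by move=> cf cg; exact: partial_val (is_deriveDp (Ck_is_derive z i cf) (Ck_is_derive z i cg)). Qed.

Lemma partial_identity N (i a b : 'I_N) (f g h : 'rV[R]_N -> R) : Ck 1 f -> Ck 1 g -> Ck 1 h ->
  (forall z : 'rV[R]_N, z 0 a * f z = h z + z 0 b * g z) -> forall z,
  (a == i)%:R * f z + z 0 a * partial i f z = partial i h z + ((b == i)%:R * g z + z 0 b * partial i g z).
Proof.
move=> cf cg ch e z.
rewrite -(partial_coordM i a z cf) -(partial_coordM i b z cg) -(partialD1 i z ch (CkM (Ck_coord 1 b) cg)).
by have -> : (fun z : 'rV[R]_N => z 0 a * f z) = (fun z => h z + z 0 b * g z) by apply/funext.
Qed.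

Lemma sum_two j (a b : R) (G : 'I_(n + n) -> R) :
  \sum_i (row_mx (\row_k (if k == j then a else 0)) (\row_k (if k == j then b else 0)) : 'rV[R]_(n + n)) 0 i * G i
  = a * G (lshift n j) + b * G (rshift n j).
Proof.
rewrite big_split_ord /=; congr (_ + _); rewrite (bigD1 j) //= big1 ?addr0.
- by rewrite row_mxEl mxE eqxx.
- by move=> k kj; rewrite row_mxEl mxE (negbTE kj) mul0r.
- by rewrite row_mxEr mxE eqxx.
- by move=> k kj; rewrite row_mxEr mxE (negbTE kj) mul0r.
Qed.

Implicit Types z : cpt R n.

(* The invariance under rotation of z_j, differentiated at the identity. *)
Lemma rotation_field F : smooth F -> rot_inv F -> forall j z,
  z 0 (lshift n j) * dy j F z = z 0 (rshift n j) * dx j F z.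
Proof.
move=> sF rF j z.
pose w (t : R) k : R[i] := if k == j then cos t +i* sin t else 1.
have nw t k : `|w t k| = 1.
  rewrite /w; case: eqP => _; last exact: normr1.
  by rewrite normc_def /= cos2Dsin2 sqrtr1.
pose dw : 'rV[R]_(n + n) := row_mx (\row_k (if k == j then - z 0 (rshift n j) else 0))
   (\row_k (if k == j then z 0 (lshift n j) else 0)).
have hd : is_derive (0 : R) 1 (fun t => scale (w t) z : 'rV[R]_(n + n)) dw.
  apply/is_derive_mxP => i; rewrite ord1; apply: cpt_split => k.
    have hl : (fun t => scale (w t) z 0 (lshift n k)) =
       (fun t => complex.Re (w t k) * z 0 (lshift n k) - complex.Im (w t k) * z 0 (rshift n k)).
      by apply/funext => t; rewrite scale_l.
    rewrite hl row_mxEl mxE /w; case: eqP => [->|_] /=.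
      have := is_deriveBp (is_deriveMp (is_derive_cos (0 : R)) (is_derive_cst (z 0 (lshift n j)) (0 : R) 1))
         (is_deriveMp (is_derive_sin (0 : R)) (is_derive_cst (z 0 (rshift n j)) (0 : R) 1)).
      by apply: is_derive_eqfun => //; rewrite sin0 cos0 oppr0 !mul0r !mulr0 !addr0 mul1r sub0r.
    exact: is_derive_cst.
  have hl : (fun t => scale (w t) z 0 (rshift n k)) =
     (fun t => complex.Re (w t k) * z 0 (rshift n k) + complex.Im (w t k) * z 0 (lshift n k)).
    by apply/funext => t; rewrite scale_r.
  rewrite hl row_mxEr mxE /w; case: eqP => [->|_] /=.
    have := is_deriveDp (is_deriveMp (is_derive_cos (0 : R)) (is_derive_cst (z 0 (rshift n j)) (0 : R) 1))
       (is_deriveMp (is_derive_sin (0 : R)) (is_derive_cst (z 0 (lshift n j)) (0 : R) 1)).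
    by apply: is_derive_eqfun => //; rewrite sin0 cos0 oppr0 !mul0r !mulr0 !addr0 mul1r add0r.
  exact: is_derive_cst.
have w0 : scale (w 0) z = z.
  by apply: cptP => k; rewrite ?scale_l ?scale_r /w; case: eqP => [->|_] /=;
    rewrite ?cos0 ?sin0 mul1r mul0r ?subr0 ?addr0.
have c1 : Ck 1 (F : 'rV[R]_(n + n) -> R) := sF 1%N.
have h := C1_chain openT (Ck_C1on c1) I hd.
have hc : is_derive (0 : R) 1 (fun t => F (scale (w t) z)) 0.
  by apply: is_derive_eqfun (is_derive_cst (F z) (0 : R) 1) => // t; rewrite rF.
have e : \sum_i dw 0 i * partial i F z = 0.
  by move: h; rewrite w0 => -[_ <-]; case: hc.
rewrite sum_two mulNr addrC in e; move/eqP: e.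
by rewrite subr_eq0 => /eqP.
Qed.

Definition real_pt (z : cpt R n) :=  forall j, z 0 (rshift n j) = 0.

Lemma smooth_partial i F : smooth F -> smooth (partial i F : cpt R n -> R).
Proof. by move=> sF m; exact: Ck_partial (sF m.+1). Qed.

Lemma partialC i j F z : smooth F -> partial i (partial j F) z = partial j (partial i F) z.
Proof.
move=> sF; apply: (@schwarz _ _ setT) => //; first exact: openT.
- exact: Ck_C1on (sF 1%N).
- exact: Ck_C1on (smooth_partial i sF 1%N).
- exact: Ck_C1on (smooth_partial j sF 1%N).
Qed.

Section Invariant.
Variable F : cpt R n -> R.
Hypotheses (sF : smooth F) (rF : rot_inv F).
Let rot j z := rotation_field sF rF j z.

Lemma rot_partial i j z :
  (lshift n j == i)%:R * dy j F z + z 0 (lshift n j) * partial i (dy j F) z =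
  (rshift n j == i)%:R * dx j F z + z 0 (rshift n j) * partial i (dx j F) z.
Proof.
have c1 := smooth_partial (rshift n j) sF 1%N; have c2 := smooth_partial (lshift n j) sF 1%N.
rewrite (partial_identity i c1 c2 (Ck_cst 1 0) (b := rshift n j)); first by rewrite partial_cst add0r.
by move=> y; rewrite add0r; exact: rot.
Qed.

(** Where x_j is nonzero this is the rotation identity itself; where x_j = 0 it is that identity
    differentiated in x_j. *)
Lemma dy_real j z : real_pt z -> dy j F z = 0.
Proof.
move=> hz; have [x0|x0] := eqVneq (z 0 (lshift n j)) 0.
  have := rot_partial (lshift n j) j z; rewrite eqxx eq_rlshift x0 (hz j).
  by move: (dy j F z) (partial _ _ _) (dx j F z) (partial _ _ _) => a b c d; rewrite mul1r !mul0r !addr0.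
by apply: (mulfI x0); rewrite rot hz mul0r mulr0.
Qed.

Lemma dydy_real j k z : real_pt z -> z 0 (lshift n j) * dy k (dy j F) z = (j == k)%:R * dx j F z.
Proof.
move=> hz; have := rot_partial (rshift n k) j z; rewrite eq_lrshift (hz j) eq_rshift.
by move: (dy j F z) (partial _ _ _) (dx j F z) (partial _ _ _) => a b c d; rewrite !mul0r add0r addr0.
Qed.

Lemma dxdy_real j k z : real_pt z -> dx k (dy j F) z = 0.
Proof.
move=> hz; apply: partial_val.
have h := Ck_is_derive z (lshift n k) (smooth_partial (rshift n j) sF 1%N).
apply/is_derive1P; apply: is_derive_eqfun (is_derive_cst (0 : R) (0 : R) 1) => // t.
apply/esym/dy_real => l; rewrite !mxE eqxx hz addr0.
by rewrite eq_rlshift mulr0.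
Qed.

Lemma dydx_real j k z : real_pt z -> dy k (dx j F) z = 0.
Proof. by move=> hz; rewrite (partialC _ _ _ sF); exact: dxdy_real. Qed.

(** The rotation identity is differentiated in y_j and then in x_k, at a point where y_j = 0. It
    extracts a factor x_j from the mixed derivative. *)
Lemma dxdx_real j k z : real_pt z -> k != j ->
  dx k (dx j F) z = z 0 (lshift n j) * dx k (dy j (dy j F)) z.
Proof.
move=> hz kj.
have e (y : cpt R n) : y 0 (lshift n j) * dy j (dy j F) y = dx j F y + y 0 (rshift n j) * dy j (dx j F) y.
  have := rot_partial (rshift n j) j y; rewrite eqxx eq_lrshift.
  by move: (dy j F y) (partial _ _ _) (dx j F y) (partial _ _ _) => a b c d; rewrite mul0r add0r mul1r.
have s1 := smooth_partial (rshift n j) (smooth_partial (rshift n j) sF).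
have s2 := smooth_partial (lshift n j) sF.
have s3 := smooth_partial (rshift n j) s2.
have fin (a b c f g x : R) : 0 * f + x * a = b + (0 * g + 0 * c) -> b = x * a.
  by rewrite !mul0r add0r !addr0.
have := partial_identity (lshift n k) (s1 1%N) (s3 1%N) (s2 1%N) e z.
rewrite eq_lshift eq_rlshift [j == k]eq_sym (negbTE kj) (hz j); exact: fin.
Qed.

Definition rform (z : cpt R n) : 'M[R]_n := \matrix_(j, k) ((dx j (dx k F) z + dy j (dy k F) z) / 4).

Lemma ddbar_real z : real_pt z -> ddbar F z = map_mx (real_complex R) (rform z).
Proof.
move=> hz; apply/matrixP => j k; rewrite !mxE; congr (_ +i* _).
by rewrite (dxdy_real _ _ hz) (dydx_real _ _ hz) subrr mul0r.
Qed.

(** Off-diagonal entries vanish with z_j, with a smooth quotient. This is what later permits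
    division by z_j near the toric divisors. *)
Lemma rform_off j k z : real_pt z -> k != j -> rform z k j = z 0 (lshift n j) / 4 * dx k (dy j (dy j F)) z.
Proof.
move=> hz kj.
have fin (x a b c : R) : a = x * c -> b = 0 -> (a + b) / 4 = x / 4 * c by move=> -> ->; rewrite addr0 mulrAC.
rewrite mxE; apply: (fin _ _ _ _ (dxdx_real hz kj)).
have [x0|x0] := eqVneq (z 0 (lshift n j)) 0; last first.
  by apply: (mulfI x0); rewrite (dydy_real _ _ hz) eq_sym (negbTE kj) mul0r mulr0.
have e (y : cpt R n) : y 0 (lshift n j) * dy k (dy j F) y = 0 + y 0 (rshift n j) * dy k (dx j F) y.
  rewrite add0r; have := rot_partial (rshift n k) j y.
  rewrite eq_lrshift eq_rshift eq_sym (negbTE kj).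
  by move: (dy j F y) (partial _ _ _) (dx j F y) (partial _ _ _) => a b c d; rewrite !mul0r !add0r.
have s1 := smooth_partial (rshift n k) (smooth_partial (rshift n j) sF).
have s2 := smooth_partial (rshift n k) (smooth_partial (lshift n j) sF).
have := partial_identity (lshift n j) (s1 1%N) (s2 1%N) (Ck_cst 1 0) e z.
rewrite partial_cst eqxx eq_rlshift (hz j) x0.
have fin2 (a b c d : R) : 1 * a + 0 * b = 0 + (0 * c + 0 * d) -> a = 0 by rewrite mul1r !mul0r !addr0.
exact: fin2.
Qed.

End Invariant.

Lemma rform_sym F z : smooth F -> (rform F z)^T = rform F z.
Proof.
move=> sF; apply/matrixP => j k; rewrite !mxE.
have e1 := partialC (lshift n k) (lshift n j) z sF; have e2 := partialC (rshift n k) (rshift n j) z sF.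
by rewrite e1 e2.
Qed.

(** On real vectors the Hermitian form takes the value of its real part. Positivity holds at every
    point, not only at real ones, which makes compactness arguments on polydiscs possible. *)
Lemma rform_posdef F z : smooth F -> positive_form (ddbar F z) -> posdef (rform F z).
Proof.
move=> sF pF; split; first exact: rform_sym.
move=> v v0; have := pF (map_mx (real_complex R) v).
have h : map_mx (real_complex R) v != 0.
  apply: contra v0 => /eqP/matrixP e; apply/eqP/matrixP => i j; have := e i j.
  by rewrite !mxE => -[].
move=> /(_ h); rewrite ltcE => /andP[_]; rewrite /qf.
set a := complex.Re (fun_of_matrix _ _ _) => h0; have -> : (v *m rform F z *m v^T) 0 0 = a; last exact: h0.
apply/esym; rewrite /a !mxE raddf_sum; apply: eq_bigr => k _; rewrite !mxE.
rewrite (_ : (v 0 k)%:C^* = (v 0 k)%:C); last by rewrite /= oppr0.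
have reM (x : R[i]) (t : R) : complex.Re (x * t%:C) = complex.Re x * t.
  by case: x => p q; rewrite /= mulr0 subr0.
rewrite [LHS]reM; congr (_ * _); rewrite raddf_sum; apply: eq_bigr => l _; rewrite !mxE /=.
by rewrite mul0r subr0.
Qed.

End TorusSymmetry.

Section ScalePullback.
Context {R : realType} {n : nat}.
Local Notation dx j := (@partial R (n + n) (lshift n j)).
Local Notation dy j := (@partial R (n + n) (rshift n j)).
Implicit Types (F : cpt R n -> R) (z : cpt R n) (w : 'I_n -> R[i]).

Definition scale_mx w : 'M[R]_(n + n) := \matrix_i (scale w (delta_mx 0 i) : 'rV[R]_(n + n)).

Lemma scale_mx_l w j : row (lshift n j) (scale_mx w) =
  row_mx (\row_k (if k == j then complex.Re (w j) else 0)) (\row_k (if k == j then complex.Im (w j) else 0)).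
Proof.
rewrite rowK; apply: cptP => k; rewrite ?scale_l ?scale_r ?row_mxEl ?row_mxEr !mxE !eqxx ?eq_lshift ?eq_rlshift mulr0 ?subr0 ?add0r.
  by case: eqP => [->|_]; rewrite ?mulr1 ?mulr0.
by case: eqP => [->|_]; rewrite ?mulr1 ?mulr0.
Qed.

Lemma scale_mx_r w j : row (rshift n j) (scale_mx w) =
  row_mx (\row_k (if k == j then - complex.Im (w j) else 0)) (\row_k (if k == j then complex.Re (w j) else 0)).
Proof.
rewrite rowK; apply: cptP => k; rewrite ?scale_l ?scale_r ?row_mxEl ?row_mxEr !mxE !eqxx ?eq_rshift ?eq_lrshift mulr0 ?sub0r ?addr0.
  by case: eqP => [->|_]; rewrite ?mulr1 // mulr0 oppr0.
by case: eqP => [->|_]; rewrite ?mulr1 // mulr0.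
Qed.

Lemma scaleE w z : scale w z = z *m scale_mx w.
Proof.
have e i k : scale_mx w i k = row i (scale_mx w) 0 k by rewrite [RHS]mxE.
have sg (c : R) (x : 'I_n -> R) k : \sum_j x j * (if k == j then c else 0) = c * x k.
  rewrite (bigD1 k) //= eqxx big1 ?addr0 ?[x k * c]mulrC // => j; rewrite eq_sym => /negbTE ->.
  by rewrite mulr0.
have sg' (c : 'I_n -> R) (x : 'I_n -> R) k : \sum_j x j * (if k == j then c j else 0) = c k * x k.
  by rewrite -(sg (c k)); apply: eq_bigr => j _; case: eqP => // ->.
apply: cptP => k; rewrite ?scale_l ?scale_r mxE big_split_ord /=; apply/esym; last rewrite [RHS]addrC; congr (_ + _).
- rewrite -(sg' (fun k => complex.Re (w k)) (fun k => z 0 (lshift n k))).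
  by apply: eq_bigr => j _; rewrite e scale_mx_l row_mxEl mxE.
- rewrite -mulNr -(sg' (fun k => - complex.Im (w k)) (fun k => z 0 (rshift n k))).
  by apply: eq_bigr => j _; rewrite e scale_mx_r row_mxEl mxE.
- rewrite -(sg' (fun k => complex.Im (w k)) (fun k => z 0 (lshift n k))).
  by apply: eq_bigr => j _; rewrite e scale_mx_l row_mxEr mxE.
- rewrite -(sg' (fun k => complex.Re (w k)) (fun k => z 0 (rshift n k))).
  by apply: eq_bigr => j _; rewrite e scale_mx_r row_mxEr mxE.
Qed.

Lemma smooth_scale F w : smooth F -> smooth (fun z => F (scale w z)).
Proof.
move=> sF m; have -> : (fun z => F (scale w z)) = (fun z : 'rV[R]_(n + n) => F (z *m scale_mx w)).
  by apply/funext => z; rewrite scaleE.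
by apply: Ck_comp (sF m) _ => k; exact: Ck_linear.
Qed.

Lemma partial_scale F w i z : smooth F ->
  partial i (fun z => F (scale w z)) z = \sum_k row i (scale_mx w) 0 k * partial k F (scale w z).
Proof.
move=> sF; have -> : (fun z => F (scale w z)) = (fun z : 'rV[R]_(n + n) => F (z *m scale_mx w)).
  by apply/funext => y; rewrite scaleE.
rewrite (partial_linear_comp _ _ _ (sF 1%N)) -scaleE; apply: eq_bigr => k _; congr (_ * _).
by rewrite [RHS]mxE.
Qed.

Lemma dx_scale F w j : smooth F -> dx j (fun z => F (scale w z)) =
  fun z => complex.Re (w j) * dx j F (scale w z) + complex.Im (w j) * dy j F (scale w z).
Proof. by move=> sF; apply/funext => z; rewrite (partial_scale _ _ _ sF) scale_mx_l sum_two. Qed.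

Lemma dy_scale F w j : smooth F -> dy j (fun z => F (scale w z)) =
  fun z => - complex.Im (w j) * dx j F (scale w z) + complex.Re (w j) * dy j F (scale w z).
Proof. by move=> sF; apply/funext => z; rewrite (partial_scale _ _ _ sF) scale_mx_r sum_two. Qed.

Lemma partial_lin2 N (i : 'I_N) (a b : R) (f g : 'rV[R]_N -> R) y : Ck 1 f -> Ck 1 g ->
  partial i (fun y => a * f y + b * g y) y = a * partial i f y + b * partial i g y.
Proof.
move=> cf cg; exact: partial_val (is_deriveDp (is_derive_cmul a (Ck_is_derive y i cf)) (is_derive_cmul b (Ck_is_derive y i cg))).
Qed.

Lemma scale_algebra (a b : R[i]) (X Y Z T P Q U V : R) :
  P = complex.Re a * X + complex.Im a * Z -> Q = complex.Re a * Y + complex.Im a * T ->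
  U = - complex.Im a * X + complex.Re a * Z -> V = - complex.Im a * Y + complex.Re a * T ->
  (complex.Re b * P + complex.Im b * Q + (- complex.Im b * U + complex.Re b * V)) / 4
  +i* ((- complex.Im b * P + complex.Re b * Q - (complex.Re b * U + complex.Im b * V)) / 4)
  = a * (((X + T) / 4) +i* ((Y - Z) / 4)) * b^*.
Proof.
move=> -> -> -> ->; case: a => a1 a2; case: b => b1 b2.
apply/eqP; rewrite eq_complex /=; by apply/andP; split; apply/eqP; field.
Qed.

Lemma ddbar_scale F w z : smooth F ->
  ddbar (fun z => F (scale w z)) z = \matrix_(j, k) (w j * ddbar F (scale w z) j k * (w k)^*).
Proof.
move=> sF; apply/matrixP => j k; rewrite [LHS]mxE [RHS]mxE [ddbar F _ _ _]mxE.
have c i : Ck 1 (fun z : 'rV[R]_(n + n) => partial i F (scale w z)).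
  exact: (smooth_scale w (smooth_partial i sF)) 1%N.
have sX := smooth_partial (lshift n k) sF; have sY := smooth_partial (rshift n k) sF.
rewrite (dx_scale w k sF) (dy_scale w k sF) !(partial_lin2 _ _ _ _ (c _) (c _)).
exact: scale_algebra (congr1 (fun f => f z) (dx_scale w j sX)) (congr1 (fun f => f z) (dx_scale w j sY))
  (congr1 (fun f => f z) (dy_scale w j sX)) (congr1 (fun f => f z) (dy_scale w j sY)).
Qed.

Lemma rot_inv_ddbar F w z : smooth F -> rot_inv F -> (forall j, `|w j| = 1) ->
  ddbar F z = diag_mx (\row_j w j) *m ddbar F (scale w z) *m diag_mx (\row_j (w j)^*).
Proof.
move=> sF rF hw; have e : (fun z => F (scale w z)) = F by apply/funext => y; exact: rF.
have := ddbar_scale w z sF; rewrite e => ->; apply/matrixP => j k.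
by rewrite mul_diag_mx mul_mx_diag !mxE.
Qed.

Lemma rot_inv_det F w z : smooth F -> rot_inv F -> (forall j, `|w j| = 1) ->
  \det (ddbar F z) = \det (ddbar F (scale w z)).
Proof.
move=> sF rF hw; rewrite (rot_inv_ddbar z sF rF hw) !det_mulmx !det_diag mulrAC -big_split /= big1 ?mul1r // => j _.
by rewrite !mxE -sqr_normc hw expr1n.
Qed.

Lemma to_real_pt z : exists w, [/\ forall j, `|w j| = 1, real_pt (scale w z)
  & forall j, 0 <= scale w z 0 (lshift n j)].
Proof.
pose w j : R[i] := if zc z j == 0 then 1 else (zc z j)^-1 * `|zc z j|.
have e j : w j * zc z j = `|zc z j|.
  rewrite /w; case: eqP => [->|/eqP h]; first by rewrite mulr0 normr0.
  by rewrite mulrAC mulVf // mul1r.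
exists w; split=> j.
- rewrite /w; case: eqP => [_|/eqP h]; first exact: normr1.
  by rewrite normrM normfV normr_id mulVf // normr_eq0.
- by rewrite /scale /of_zc row_mxEr mxE e normc_def.
- by rewrite /scale /of_zc row_mxEl mxE e normc_def /= sqrtr_ge0.
Qed.

Lemma det_ddbar_real F z : smooth F -> rot_inv F -> real_pt z ->
  complex.Re (\det (ddbar F z)) = \det (rform F z).
Proof. by move=> sF rF hz; rewrite (ddbar_real sF rF hz) det_map_mx. Qed.

Lemma det_ddbar_gt0 F z : smooth F -> rot_inv F -> (forall z, positive_form (ddbar F z)) ->
  0 < complex.Re (\det (ddbar F z)).
Proof.
move=> sF rF pF; have [w [hw hz _]] := to_real_pt z.
rewrite (rot_inv_det z sF rF hw) det_ddbar_real //; apply: posdef_det.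
exact: rform_posdef.
Qed.

Definition csmooth (f : cpt R n -> R[i]) :=
  smooth (fun z => complex.Re (f z)) /\ smooth (fun z => complex.Im (f z)).

Lemma csmooth_cst c : csmooth (fun=> c).
Proof. by split=> m; exact: Ck_cst. Qed.

Lemma csmoothD f g : csmooth f -> csmooth g -> csmooth (fun z => f z + g z).
Proof.
move=> [f1 f2] [g1 g2]; split=> m.
  have -> : (fun z => complex.Re (f z + g z)) = (fun z => complex.Re (f z) + complex.Re (g z)).
    by apply/funext => z; case: (f z) => a b; case: (g z).
  exact: CkD (f1 m) (g1 m).
have -> : (fun z => complex.Im (f z + g z)) = (fun z => complex.Im (f z) + complex.Im (g z)).
  by apply/funext => z; case: (f z) => a b; case: (g z).
exact: CkD (f2 m) (g2 m).
Qed.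

Lemma csmoothM f g : csmooth f -> csmooth g -> csmooth (fun z => f z * g z).
Proof.
move=> [f1 f2] [g1 g2]; split=> m.
  have -> : (fun z => complex.Re (f z * g z)) =
     (fun z => complex.Re (f z) * complex.Re (g z) - complex.Im (f z) * complex.Im (g z)).
    by apply/funext => z; case: (f z) => a b; case: (g z).
  exact: CkB (CkM (f1 m) (g1 m)) (CkM (f2 m) (g2 m)).
have -> : (fun z => complex.Im (f z * g z)) =
   (fun z => complex.Re (f z) * complex.Im (g z) + complex.Im (f z) * complex.Re (g z)).
  by apply/funext => z; case: (f z) => a b; case: (g z).
exact: CkD (CkM (f1 m) (g2 m)) (CkM (f2 m) (g1 m)).
Qed.

Lemma csmooth_big (op : R[i] -> R[i] -> R[i]) (x0 : R[i]) (I : Type) (r : seq I) (G : I -> cpt R n -> R[i]) :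
  (forall f g, csmooth f -> csmooth g -> csmooth (fun z => op (f z) (g z))) ->
  (forall i, csmooth (G i)) -> csmooth (fun z => \big[op/x0]_(i <- r) G i z).
Proof.
move=> hop hG; elim: r => [|a r IH].
  have -> : (fun z => \big[op/x0]_(i <- [::]) G i z) = (fun=> x0) by apply/funext => z; rewrite big_nil.
  exact: csmooth_cst.
have -> : (fun z => \big[op/x0]_(i <- a :: r) G i z) = (fun z => op (G a z) (\big[op/x0]_(i <- r) G i z)).
  by apply/funext => z; rewrite big_cons.
exact: hop.
Qed.

Lemma csmooth_ddbar F j k : smooth F -> csmooth (fun z => ddbar F z j k).
Proof.
move=> sF.
have s i l := smooth_partial i (smooth_partial l sF).
split=> m.
  have -> : (fun z => complex.Re (ddbar F z j k)) = (fun z => 4^-1 * (dx j (dx k F) z + dy j (dy k F) z)).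
    by apply/funext => z; rewrite mxE /= mulrC.
  exact: CkZ (CkD (s _ _ m) (s _ _ m)).
have -> : (fun z => complex.Im (ddbar F z j k)) = (fun z => 4^-1 * (dx j (dy k F) z - dy j (dx k F) z)).
  by apply/funext => z; rewrite mxE /= mulrC.
exact: CkZ (CkB (s _ _ m) (s _ _ m)).
Qed.

(* [ricci F] is [- ddbar (vol F)]. *)
Definition vol F z := ln (complex.Re (\det (ddbar F z))).

Lemma smooth_vol F : smooth F -> rot_inv F -> (forall z, positive_form (ddbar F z)) -> smooth (vol F).
Proof.
move=> sF rF pF; have [h _] : csmooth (fun z => \det (ddbar F z)).
  apply: csmooth_big => [f g|s]; first exact: csmoothD.
  apply: csmoothM; first exact: csmooth_cst.
  by apply: csmooth_big => [f g|i]; [exact: csmoothM|exact: csmooth_ddbar].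
by move=> m; apply: Ck_ln (h m) => z; exact: det_ddbar_gt0.
Qed.

Lemma rot_inv_vol F : smooth F -> rot_inv F -> rot_inv (vol F).
Proof. move=> sF rF w hw z; exact: (congr1 (fun d => ln (complex.Re d)) (esym (rot_inv_det z sF rF hw))). Qed.

End ScalePullback.

(** * Logarithmic coordinates on a chart *)

Section ExpChart.
Context {R : realType} {n : nat}.
Local Notation dx j := (@partial R (n + n) (lshift n j)).
Local Notation dy j := (@partial R (n + n) (rshift n j)).
Implicit Types (F : cpt R n -> R) (y v : 'rV[R]_n).

Definition Exp y : cpt R n := row_mx (\row_j expR (y 0 j)) 0.

Lemma Exp_l y j : Exp y 0 (lshift n j) = expR (y 0 j). Proof. by rewrite /Exp row_mxEl mxE. Qed.
Lemma Exp_r y j : Exp y 0 (rshift n j) = 0. Proof. by rewrite /Exp row_mxEr mxE. Qed.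
Lemma Exp_real y : real_pt (Exp y). Proof. exact: Exp_r. Qed.

Lemma Exp_zc y j : zc (Exp y) j = (expR (y 0 j))%:C.
Proof. by rewrite /zc Exp_l Exp_r. Qed.

Lemma Ck_Exp m k : Ck m (fun y => Exp y 0 k).
Proof.
move: k; apply: cpt_split => k.
  have -> : (fun y => Exp y 0 (lshift n k)) = (fun y => expR (y 0 k)) by apply/funext => y; exact: Exp_l.
  by apply: Ck_expR; exact: Ck_coord.
have -> : (fun y => Exp y 0 (rshift n k)) = (fun=> 0) by apply/funext => y; exact: Exp_r.
exact: Ck_cst.
Qed.

Lemma Ck_comp_Exp m F : smooth F -> Ck m (fun y => F (Exp y)).
Proof. by move=> sF; apply: Ck_comp (sF m) _ => k; exact: Ck_Exp. Qed.

Lemma partial_expR k j y : partial j (fun y : 'rV[R]_n => expR (y 0 k)) y = (k == j)%:R * expR (y 0 k).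
Proof.
have := is_derive_outer (Ck_is_derive y j (Ck_coord 1 k)) (is_derive_expR (y 0 k)).
by rewrite partial_coord mulrC => /partial_val.
Qed.

Lemma partial_Exp F j y : smooth F -> partial j (fun y => F (Exp y)) y = expR (y 0 j) * dx j F (Exp y).
Proof.
move=> sF; rewrite (partial_val (comp_is_derive y j (sF 1%N) (Ck_Exp 1))) big_split_ord /=.
rewrite [X in _ + X]big1 ?addr0 => [|k _]; last first.
  have -> : (fun y => Exp y 0 (rshift n k)) = (fun=> 0) by apply/funext => x; exact: Exp_r.
  by rewrite partial_cst mul0r.
have e k : partial j (fun y => Exp y 0 (lshift n k)) y = (k == j)%:R * expR (y 0 k).
  have -> : (fun y => Exp y 0 (lshift n k)) = (fun y => expR (y 0 k)) by apply/funext => x; exact: Exp_l.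
  exact: partial_expR.
rewrite (bigD1 j) //= big1 ?addr0 => [|k kj]; first by rewrite e eqxx mul1r.
by rewrite e (negbTE kj) !mul0r.
Qed.

Definition zmx y : 'M[R]_n := diag_mx (\row_j expR (y 0 j)).

Lemma grad_Exp F y : smooth F -> grad (fun y => F (Exp y)) y = (\row_j dx j F (Exp y)) *m zmx y.
Proof.
move=> sF; apply/rowP => j; rewrite mxE (partial_Exp _ _ sF) mul_mx_diag !mxE mulrC.
by [].
Qed.

(** Differentiating F(e^y) twice yields an extra first derivative on the diagonal; by [dydy_real] it
    is the contribution of the second derivatives in the imaginary directions. *)
Lemma hess_Exp F y : smooth F -> rot_inv F ->
  hess (fun y => F (Exp y)) y = 4 *: (zmx y *m rform F (Exp y) *m zmx y).
Proof.
move=> sF rF; apply/matrixP => i j; rewrite hessE.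
have -> : partial j (fun y => F (Exp y)) = (fun y => expR (y 0 j) * dx j F (Exp y)).
  by apply/funext => x; exact: partial_Exp.
have sj := smooth_partial (lshift n j) sF.
have h := is_deriveMp (Ck_is_derive y i (Ck_expR (Ck_coord 1 j))) (Ck_is_derive y i (Ck_comp_Exp 1 sj)).
rewrite (partial_val h) partial_expR (partial_Exp _ _ sj).
rewrite mxE mul_mx_diag mul_diag_mx !mxE.
have d := dydy_real sF rF j i (Exp_real y); rewrite Exp_l in d.
have fin (x z X Y D s : R) : z * Y = s * D -> (s = 1 -> x = z) -> (s = 0 \/ s = 1) -> z != 0 ->
   s * z * D + z * (x * X) = 4 * (x * ((X + Y) / 4) * z).
  move=> e1 e2 [s0|s1] z0.
    have -> : Y = 0 by apply: (mulfI z0); rewrite e1 s0 mul0r mulr0.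
    by rewrite s0; field.
  have {}e1 : z * Y = D by rewrite e1 s1 mul1r.
  by rewrite s1 mul1r -e1 (e2 s1); field.
apply: fin d _ _ _; last exact: lt0r_neq0 (expR_gt0 _).
- by case: eqP => [->|_] // /eqP; rewrite eq_sym oner_eq0.
- by case: eqP; [right|left].
Qed.

End ExpChart.

Section FiniteBounds.
Context {R : realType}.

(** There are finitely many charts, so bounds that persist when the constant grows can be made
    uniform over them. *)
Lemma fin_sup (I : finType) (P : I -> R -> Prop) :
  (forall i C C', C <= C' -> P i C -> P i C') -> (forall i, exists C, P i C) ->
  exists2 C, 0 <= C & forall i, P i C.
Proof.
move=> mono /choice[C hC]; exists (\sum_i `|C i|); first exact: sumr_ge0.
move=> i; apply: mono (hC i); apply: le_trans (ler_norm _) _.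
by rewrite (bigD1 i) //= lerDl sumr_ge0.
Qed.

End FiniteBounds.

(** * Estimates on polydiscs, uniform up to the toric divisors *)

Section ChartBounds.
Context {R : realType} {n : nat}.
Local Notation dx j := (@partial R (n + n) (lshift n j)).
Local Notation dy j := (@partial R (n + n) (rshift n j)).
Implicit Types (F : cpt R n -> R) (y v : 'rV[R]_n) (L : R).

Definition below L y := forall j, y 0 j <= L.

(** The points e^y stay in a compact set that contains the toric divisors, although these are
    reached only as y_j tends to minus infinity. *)
Lemma Exp_bounded (G : cpt R n -> R) L : continuous (G : 'rV[R]_(n + n) -> R) ->
  exists C, forall y, below L y -> `|G (Exp y)| <= C.
Proof.
move=> cG; have cN : continuous (fun z : 'rV[R]_(n + n) => `|G z|).
  by move=> z; apply: (for_continuous_comp (cG z)); exact: norm_continuous.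
have [|z0 _ hmax] := @EVT_max_rV R (n + n) _ [set z | `|z - 0| <= expR L] _ (@ball_row_compact _ _ 0 _) (continuous_subspaceT cN).
  by exists 0; rewrite /= subrr normr0 expR_ge0.
exists `|G z0| => y hy; apply: hmax; rewrite inE /= subr0.
apply/row_norm_le; first exact: expR_ge0.
apply: cpt_split => k; rewrite ?Exp_l ?Exp_r ?normr0 ?expR_ge0 //.
by rewrite ger0_norm ?expR_ge0 // ler_expR.
Qed.

Lemma Exp_bounded2 (I J : finType) (G : I -> J -> cpt R n -> R) L :
  (forall i j, continuous (G i j : 'rV[R]_(n + n) -> R)) ->
  exists2 C, 0 <= C & forall i j y, below L y -> `|G i j (Exp y)| <= C.
Proof.
move=> cG.
have [|[i j]|C C0 hC] := @fin_sup R (I * J)%type (fun ij C => forall y, below L y -> `|G ij.1 ij.2 (Exp y)| <= C).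
- by move=> i C C' h hC y hy; apply: le_trans (hC y hy) h.
- exact: Exp_bounded.
by exists C => // i j; exact: hC (i, j).
Qed.

(** The flat metric of the chart in logarithmic coordinates, the common yardstick for all Hessians:
    the sum of the squares of v_j e^(y_j). *)
Definition wt y v : R := dot (v *m zmx y) (v *m zmx y).

Lemma wt_ge0 y v : 0 <= wt y v. Proof. exact: dot_ge0. Qed.

Lemma qf_congr (A Z : 'M[R]_n) v : Z^T = Z -> qf (Z *m A *m Z) v = qf A (v *m Z).
Proof. by move=> sZ; rewrite /qf trmx_mul sZ !mulmxA. Qed.

Lemma zmxT y : (zmx y)^T = zmx y. Proof. exact: tr_diag_mx. Qed.

Lemma qf_hess_Exp F y v : smooth F -> rot_inv F ->
  qf (hess (fun y => F (Exp y)) y) v = 4 * qf (rform F (Exp y)) (v *m zmx y).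
Proof. by move=> sF rF; rewrite (hess_Exp y sF rF) qfZ qf_congr // zmxT. Qed.

Lemma rform_continuous F i j : smooth F -> continuous (fun z : 'rV[R]_(n + n) => rform F z i j).
Proof.
move=> sF; have c : continuous (fun z : 'rV[R]_(n + n) => 4^-1 * (dx i (dx j F) z + dy i (dy j F) z)).
  by have h := CkZ 4^-1 (CkD (smooth_partial (lshift n i) (smooth_partial (lshift n j) sF) 0%N)
    (smooth_partial (rshift n i) (smooth_partial (rshift n j) sF) 0%N)); exact: Ck0 h.
have -> // : (fun z : 'rV[R]_(n + n) => rform F z i j) = (fun z => 4^-1 * (dx i (dx j F) z + dy i (dy j F) z)).
by apply/funext => z; rewrite mxE mulrC.
Qed.

(** Stated with an absolute value and for F without sign, because it also serves for the logarithm
    of the volume. *)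
Lemma hess_Exp_upper F L : smooth F -> rot_inv F -> exists2 C, 0 <= C & forall y v, below L y ->
  `|qf (hess (fun y => F (Exp y)) y) v| <= C * wt y v.
Proof.
move=> sF rF; have [C C0 hC] := @Exp_bounded2 _ _ (fun i j z => rform F z i j) L (fun i j => @rform_continuous F i j sF).
exists (4 * (n%:R * n%:R * C)) => [|y v hy]; first by rewrite !mulr_ge0.
rewrite (qf_hess_Exp _ _ sF rF) normrM ger0_norm // -mulrA ler_wpM2l //.
apply: le_trans (qf_entry_bound _ (fun i j => hC i j y hy)) _.
have -> : n%:R * (n%:R * (`|v *m zmx y| * C) * `|v *m zmx y|) = n%:R * n%:R * C * `|v *m zmx y| ^+ 2 by ring.
by apply: ler_wpM2l (norm_sq_le_dot _); rewrite !mulr_ge0.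
Qed.

Lemma rform_lower F L : smooth F -> (forall z, posdef (rform F z)) -> exists2 c, 0 < c & forall y v, below L y ->
  c * dot v v <= qf (rform F (Exp y)) v.
Proof.
move=> sF pF.
have ci i j : continuous (fun z : 'rV[R]_(n + n) => invmx (rform F z) i j).
  move=> z; have h : {for z, continuous (fun z : 'rV[R]_(n + n) => invmx (rform F z))}.
    apply: for_continuous_invmx; first exact: posdef_unit.
    by apply: for_continuous_mx => a b; exact: rform_continuous.
  exact: for_continuous_coord h.
have [C C0 hC] := @Exp_bounded2 _ _ (fun i j z => invmx (rform F z) i j) L ci.
have C1 : 0 < C + 1 by rewrite ltr_wpDl.
have p0 : 0 < n.+1%:R * (C + 1) by rewrite mulr_gt0.
exists (n.+1%:R * (C + 1))^-1; first by rewrite invr_gt0.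
move=> y v hy; rewrite ler_pdivrMl //.
have hM i j : `|invmx (rform F (Exp y)) i j| <= C + 1 by apply: le_trans (hC i j y hy) _; rewrite lerDl.
apply: le_trans (posdef_lower v (pF _) C1 hM) _.
by rewrite ler_wpM2r ?posdef_ge0 // ler_wpM2r ?(ltW C1) // ler_nat.
Qed.

Lemma hess_Exp_lower F L : smooth F -> rot_inv F -> (forall z, posdef (rform F z)) ->
  exists2 c, 0 < c & forall y v, below L y -> c * wt y v <= qf (hess (fun y => F (Exp y)) y) v.
Proof.
move=> sF rF pF; have [c c0 hc] := rform_lower L sF pF; exists (4 * c); first by rewrite mulr_gt0.
move=> y v hy; rewrite (qf_hess_Exp _ _ sF rF) -mulrA ler_wpM2l //; exact: hc.
Qed.

Lemma dot_mulmx v (g : 'rV[R]_n) (A : 'M[R]_n) : dot v (g *m A) = dot (v *m A^T) g.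
Proof. by rewrite /dot trmx_mul mulmxA. Qed.

Lemma grad_Exp_bound F L : smooth F -> exists2 C, 0 <= C & forall y, below L y ->
  `|grad (fun y => F (Exp y)) y| <= C /\ forall v, dot v (grad (fun y => F (Exp y)) y) ^+ 2 <= C * wt y v.
Proof.
move=> sF; have [C C0 hC] := @Exp_bounded2 'I_1 'I_n (fun _ j z => dx j F z) L
  (fun _ j => Ck0 (smooth_partial (lshift n j) sF 0%N)).
have eL := expR_ge0 L.
exists (C * expR L + (n%:R * C) ^+ 2) => [|y hy]; first by rewrite addr_ge0 ?mulr_ge0 ?sqr_ge0.
have hg : `|\row_j dx j F (Exp y)| <= C by apply/row_norm_le => // j; rewrite mxE; exact: hC ord0 j y hy.
rewrite (grad_Exp _ sF); split.
  apply: (@le_trans _ _ (C * expR L)); last by rewrite lerDl sqr_ge0.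
  apply/row_norm_le; first exact: mulr_ge0.
  move=> j; rewrite mul_mx_diag !mxE normrM; apply: ler_pM => //; first exact: hC ord0 j y hy.
  by rewrite ger0_norm ?expR_ge0 // ler_expR.
move=> v; rewrite dot_mulmx zmxT /wt; set a := v *m zmx y.
have h := dot_norm_le a (\row_j dx j F (Exp y)).
rewrite -[X in X <= _]real_normK ?num_real //.
apply: (@le_trans _ _ ((n%:R * (`|a| * C)) ^+ 2)).
  rewrite ler_sqr ?nnegrE ?mulr_ge0 //; apply: le_trans h _.
  by rewrite ler_wpM2l // ler_wpM2l.
have -> : (n%:R * (`|a| * C)) ^+ 2 = (n%:R * C) ^+ 2 * `|a| ^+ 2 by ring.
apply: le_trans (ler_wpM2l (sqr_ge0 _) (norm_sq_le_dot a)) _.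
by rewrite ler_wpM2r ?dot_ge0 // lerDr mulr_ge0.
Qed.

Lemma det_hess_Exp F y : smooth F -> rot_inv F -> (forall z, positive_form (ddbar F z)) ->
  \det (hess (fun y => F (Exp y)) y) = expR (vol F (Exp y) + \sum_j y 0 j *+ 2 + ln (4 ^+ n)).
Proof.
move=> sF rF pF; rewrite (hess_Exp y sF rF) detZ !det_mulmx det_diag.
have -> : \prod_i (\row_j expR (y 0 j)) 0 i = expR (\sum_j y 0 j).
  by rewrite expR_sum; apply: eq_bigr => i _; rewrite mxE.
have hd := det_ddbar_gt0 (Exp y) sF rF pF.
rewrite !expRD lnK ?posrE ?exprn_gt0 // /vol lnK ?posrE // (det_ddbar_real sF rF (Exp_real y)).
have -> : expR (\sum_j y 0 j *+ 2) = expR (\sum_j y 0 j) * expR (\sum_j y 0 j).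
  by rewrite -expRD -big_split; congr expR; apply: eq_bigr => j _; rewrite mulr2n.
by move: (expR _) (4 ^+ n) (\det _) => a b c; ring.
Qed.

Lemma convex_norm_le (t a b c : R) : 0 <= t <= 1 -> `|a| <= c -> `|b| <= c -> `|(1 - t) * a + t * b| <= c.
Proof.
move=> /andP[t0 t1] ha hb; have s0 : 0 <= 1 - t by rewrite subr_ge0.
apply: le_trans (ler_normD _ _) _; rewrite !normrM (ger0_norm t0) (ger0_norm s0).
have -> : c = (1 - t) * c + t * c by rewrite -mulrDl subrK mul1r.
by apply: lerD; apply: ler_wpM2l.
Qed.

Lemma mid_entry_le t (A B : 'M[R]_n) i j (x K p q : R) : 0 <= t <= 1 -> 0 <= x ->
  A i j = x / 4 * p -> B i j = x / 4 * q -> `|4^-1 * p| <= K -> `|4^-1 * q| <= K -> `|mid t A B i j| <= x * K.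
Proof.
move=> ht x0 eA eB hp hq.
have -> : mid t A B i j = x * ((1 - t) * (4^-1 * q) + t * (4^-1 * p)) by rewrite /mid !mxE eA eB; ring.
by rewrite normrM (ger0_norm x0); apply: ler_wpM2l => //; exact: convex_norm_le.
Qed.

Lemma mid_lower t (A B : 'M[R]_n) v (c : R) : 0 <= t <= 1 -> c <= qf A v -> c <= qf B v -> c <= qf (mid t A B) v.
Proof. by move=> ht hA hB; rewrite /mid qfD !qfZ; exact: convex_comb_ge. Qed.

Lemma mid_congr t (A B Z : 'M[R]_n) (a : R) :
  mid t (a *: (Z *m A *m Z)) (a *: (Z *m B *m Z)) = a *: (Z *m mid t A B *m Z).
Proof.
by rewrite /mid mulmxDr mulmxDl -!scalemxAr -!scalemxAl scalerDr !scalerA ![_ * a]mulrC.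
Qed.

Lemma congr_solution (e eta g : 'rV[R]_n) (A Z : 'M[R]_n) (a : R) : a *: (e *m Z) = eta -> eta *m A = g ->
  e *m (a *: (Z *m A *m Z)) = g *m Z.
Proof. by move=> <- <-; rewrite -scalemxAr !mulmxA !scalemxAl. Qed.

Section Velocity.
Variables F F' : cpt R n -> R.
Hypotheses (sF : smooth F) (rF : rot_inv F) (pF : forall z, posdef (rform F z)).
Hypotheses (sF' : smooth F') (rF' : rot_inv F') (pF' : forall z, posdef (rform F' z)).

(* The off-diagonal entries of the form in a column j vanish with z_j, and so does the right-hand side; hence so does
   the j-th entry of the solution of the linear system, by its j-th equation. *)
Lemma column_solution (A : 'M[R]_n) (eta g : 'rV[R]_n) (c C E B x : R) j : 0 < c -> 0 <= E -> 0 <= B -> 0 <= x ->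
  eta *m A = g -> (forall v, c * dot v v <= qf A v) -> `|g 0 j| <= x * C -> `|eta| <= E ->
  (forall k, k != j -> `|A k j| <= x * B) -> `|eta 0 j| <= x * ((C + n%:R * (E * B)) / c).
Proof.
move=> c0 E0 B0 x0 eg lo hg he hA.
have Aj : c <= A j j.
  have := lo (delta_mx 0 j); rewrite qf_delta dot_delta mxE !eqxx mulr1; exact.
have ej : eta 0 j * A j j = g 0 j - \sum_(k | k != j) eta 0 k * A k j.
  by rewrite -eg mxE (bigD1 j) //= addrK.
have S : `|\sum_(k | k != j) eta 0 k * A k j| <= x * (n%:R * (E * B)).
  apply: le_trans (ler_norm_sum _ _ _) _.
  apply: (@le_trans _ _ (\sum_(k < n) x * (E * B))); last by rewrite sum_ord_const mulrCA.
  apply: (@le_trans _ _ (\sum_(k < n | k != j) x * (E * B))).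
    apply: ler_sum => k kj; rewrite normrM mulrCA; apply: ler_pM => //; last exact: hA.
    exact: le_trans (coord_le_norm _ _) he.
  by rewrite [leRHS](bigID (fun k => k != j)) /= lerDl sumr_ge0 // => k _; rewrite !mulr_ge0.
rewrite mulrA ler_pdivlMr //; apply: (@le_trans _ _ `|eta 0 j * A j j|).
  rewrite normrM ler_wpM2l // ; apply: le_trans Aj (ler_norm _).
rewrite ej; apply: le_trans (ler_normB _ _) _; rewrite mulrDr.
exact: lerD hg S.
Qed.

(** In the coordinates z the system is eta A = g with A uniformly positive, so eta is bounded. The
    velocity in logarithmic coordinates is eta_j / (4 z_j), hence eta_j must be of order z_j: this
    is what [column_solution] gives from [rform_off] for the entries and from [dydy_real] for the
    right-hand side. *)
Lemma velocity_bound L : exists2 C, 0 <= C & forall y t, below L y -> 0 <= t <= 1 ->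
  exists2 e, e *m mid t (hess (fun y => F' (Exp y)) y) (hess (fun y => F (Exp y)) y)
    = grad (fun y => F' (Exp y)) y - grad (fun y => F (Exp y)) y & `|e| <= C.
Proof.
have [c c0 hc] := rform_lower L sF pF; have [c' c0' hc'] := rform_lower L sF' pF'.
pose m := Num.min c c'; have m0 : 0 < m by rewrite lt_min c0.
have bnd G : smooth G -> exists2 C, 0 <= C & [/\ forall j y, below L y -> `|dx j G (Exp y)| <= C,
    forall j y, below L y -> `|dy j (dy j G) (Exp y)| <= C &
    forall k j y, below L y -> `|4^-1 * dx k (dy j (dy j G)) (Exp y)| <= C].
  move=> sG.
  have [C1 C10 h1] := @Exp_bounded2 'I_1 'I_n (fun _ j z => dx j G z) L (fun _ j => Ck0 (smooth_partial (lshift n j) sG 0%N)).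
  have s2 j := smooth_partial (rshift n j) (smooth_partial (rshift n j) sG).
  have [C2 C20 h2] := @Exp_bounded2 'I_1 'I_n (fun _ j z => dy j (dy j G) z) L (fun _ j => Ck0 (s2 j 0%N)).
  have [C3 C30 h3] := @Exp_bounded2 'I_n 'I_n (fun k j z => 4^-1 * dx k (dy j (dy j G)) z) L
    (fun k j => Ck0 (CkZ 4^-1 (smooth_partial (lshift n k) (s2 j) 0%N))).
  exists (C1 + C2 + C3); first by rewrite !addr_ge0.
  split=> [j y hy|j y hy|k j y hy].
  - by apply: le_trans (h1 ord0 j y hy) _; rewrite -addrA lerDl addr_ge0.
  - by apply: le_trans (h2 ord0 j y hy) _; rewrite addrAC lerDr addr_ge0.
  - by apply: le_trans (h3 k j y hy) _; rewrite lerDr addr_ge0.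
have [B B0 [b1 b2 b3]] := bnd F sF; have [B' B0' [b1' b2' b3']] := bnd F' sF'.
pose K := B + B'; have K0 : 0 <= K by rewrite addr_ge0.
have KB a : a <= B -> a <= K by move=> h; apply: le_trans h _; rewrite lerDl.
have KB' a : a <= B' -> a <= K by move=> h; apply: le_trans h _; rewrite lerDr.
pose E := n%:R * (K + K) / m; have E0 : 0 <= E by rewrite divr_ge0 ?mulr_ge0 ?addr_ge0 // ltW.
pose C := (K + K + n%:R * (E * K)) / m; have C0 : 0 <= C by rewrite divr_ge0 ?(ltW m0) // !addr_ge0 // mulr_ge0 // mulr_ge0.
exists C => // y t hy ht.
pose A := mid t (rform F' (Exp y)) (rform F (Exp y)).
have pA : posdef A by apply: mid_posdef.
have lo v : m * dot v v <= qf A v.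
  apply: mid_lower ht _ _.
    by apply: le_trans (hc' y v hy); rewrite ler_wpM2r ?dot_ge0 // ge_min lexx orbT.
  by apply: le_trans (hc y v hy); rewrite ler_wpM2r ?dot_ge0 // ge_min lexx.
pose g : 'rV[R]_n := \row_j (dx j F' (Exp y) - dx j F (Exp y)).
pose eta := g *m invmx A.
have eg : eta *m A = g by rewrite /eta mulmxKV // posdef_unit.
have hg : `|g| <= K + K.
  apply/row_norm_le; first exact: addr_ge0.
  move=> j; rewrite mxE; apply: le_trans (ler_normB _ _) (lerD _ _); [exact/KB'/b1'|exact/KB/b1].
have heta : `|eta| <= E.
  have [->|e0] := eqVneq eta 0; first by rewrite normr0.
  have ep : 0 < `|eta| by rewrite normr_gt0.
  rewrite ler_pdivlMr // -(ler_pM2r ep).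
  have -> : `|eta| * m * `|eta| = m * `|eta| ^+ 2 by ring.
  apply: le_trans (ler_wpM2l (ltW m0) (norm_sq_le_dot eta)) _; apply: le_trans (lo eta) _.
  have -> : qf A eta = dot g eta by rewrite /qf eg.
  apply: le_trans (ler_norm _) _; apply: le_trans (dot_norm_le _ _) _; rewrite -mulrA ler_wpM2l //.
  by rewrite ler_wpM2r.
have xj j : 0 < expR (y 0 j) := expR_gt0 _.
have hj j : `|eta 0 j| <= expR (y 0 j) * C.
  apply: (column_solution m0 E0 K0 (ltW (xj j)) eg lo _ heta).
    have d1 := dydy_real sF rF j j (Exp_real y); have d2 := dydy_real sF' rF' j j (Exp_real y).
    rewrite eqxx mul1r Exp_l in d1; rewrite eqxx mul1r Exp_l in d2.
    rewrite mxE -d1 -d2 -mulrBr normrM (gtr0_norm (xj j)); apply: ler_wpM2l; first exact: ltW.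
    apply: le_trans (ler_normB _ _) (lerD _ _); [exact/KB'/b2'|exact/KB/b2].
  move=> k kj; have o1 := rform_off sF rF (Exp_real y) kj; have o2 := rform_off sF' rF' (Exp_real y) kj.
  rewrite Exp_l in o1; rewrite Exp_l in o2.
  exact: mid_entry_le ht (ltW (xj j)) o2 o1 (KB' _ (b3' k j y hy)) (KB _ (b3 k j y hy)).
pose e : 'rV[R]_n := \row_j (eta 0 j / expR (y 0 j) / 4).
have ez : 4 *: (e *m zmx y) = eta.
  apply/rowP => j; rewrite mxE mul_mx_diag !mxE.
  have := lt0r_neq0 (xj j); move: (eta 0 j) (expR _) => a x x0; by field.
exists e.
  rewrite (hess_Exp y sF rF) (hess_Exp y sF' rF') (grad_Exp y sF) (grad_Exp y sF').
  rewrite mid_congr; apply: etrans (congr_solution ez eg) _.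
  by rewrite -mulmxBl; congr (_ *m _); apply/rowP => j; rewrite !mxE.
apply/row_norm_le => // j; rewrite mxE !normrM.
rewrite normfV (gtr0_norm (xj j)) [`|4^-1|]ger0_norm //.
apply: (@le_trans _ _ (`|eta 0 j| / expR (y 0 j))); last by rewrite ler_pdivrMr // mulrC.
by rewrite ler_piMr ?divr_ge0 ?(ltW (xj j)) // invf_le1 // ler1n.
Qed.

End Velocity.

End ChartBounds.

(** * Wedge products and mixed discriminants *)

Section MixedDiscriminants.
Context {n : nat}.

Lemma perm_set (S : {set 'I_n}) : exists p : 'S_n, forall i, (p i \in S) = (i < #|S|)%N.
Proof.
pose s := enum S ++ enum (~: S).
have szs : size s = n by rewrite size_cat -!cardE cardsC card_ord.
have us : uniq s.
  rewrite cat_uniq !enum_uniq andbT /=; apply/hasPn => x; rewrite !mem_enum inE.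
  by [].
pose f (i : 'I_n) := nth i s i.
have injf : injective f.
  move=> i j; rewrite /f (set_nth_default i) ?szs // => /eqP.
  by rewrite nth_uniq ?szs // => /eqP/val_inj.
exists (perm injf) => i; rewrite permE /f nth_cat -cardE.
case: ltnP => h; first by rewrite -mem_enum mem_nth // -cardE.
apply/negbTE; rewrite -finset.in_setC -mem_enum mem_nth // -cardE.
by rewrite -(ltn_add2r #|S|) subnK // addnC cardsC card_ord.
Qed.

Lemma perm_sets (S T : {set 'I_n}) : #|S| = #|T| -> exists p : 'S_n, forall i, (p i \in S) = (i \in T).
Proof.
move=> e; have [a ha] := perm_set S; have [b hb] := perm_set T.
by exists (b^-1 * a)%g => i; rewrite permM ha e -hb permKV.
Qed.

Section Ring.
Context {K : comNzRingType}.
Implicit Types (A B : 'M[K]_n) (M : 'I_n -> 'M[K]_n).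

Definition wedge M : K := \sum_(u : 'S_n) \sum_(v : 'S_n) (-1) ^+ u * (-1) ^+ v * \prod_(i < n) M i (u i) (v i).

Lemma sgnM (p u : 'S_n) : (-1) ^+ (p * u)%g = (-1) ^+ p * (-1) ^+ u :> K.
Proof. by rewrite odd_permM (signr_addb _ (odd_perm p)). Qed.

Lemma sgn2 (p : 'S_n) : (-1) ^+ p * (-1) ^+ p = 1 :> K.
Proof. by rewrite -expr2 sqrr_sign. Qed.

Lemma wedge_perm M (p : 'S_n) : wedge (fun i => M (p i)) = wedge M.
Proof.
rewrite /wedge [RHS](reindex_inj (mulgI p^-1%g)); apply: eq_bigr => u _.
rewrite [RHS](reindex_inj (mulgI p^-1%g)); apply: eq_bigr => v _.
rewrite !sgnM mulrACA sgn2 mul1r; congr (_ * _).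
rewrite [RHS](reindex_inj (@perm_inj _ p)); apply: eq_bigr => i _.
by rewrite !permM permK.
Qed.

Lemma wedge_cst A : wedge (fun=> A) = \det A *+ n`!.
Proof.
rewrite /wedge -(card_Sn n) -sumr_const; apply: eq_bigr => u _.
rewrite (reindex_inj (mulgI u)) /=; apply: eq_bigr => v _.
rewrite sgnM mulrA sgn2 mul1r; congr (_ * _).
rewrite [RHS](reindex_inj (@perm_inj _ u)); apply: eq_bigr => i _.
by rewrite permM.
Qed.

End Ring.

(** Wedge products of (1,1)-forms commute, so only the number of factors B matters. *)
Lemma wedge_subset {K : comNzRingType} (A B : 'M[K]_n) (S T : {set 'I_n}) : #|S| = #|T| ->
  wedge (fun i => if i \in S then B else A) = wedge (fun i => if i \in T then B else A).
Proof.
move=> /perm_sets[p hp]; rewrite -(wedge_perm (fun i => if i \in S then B else A) p); congr wedge.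
by apply/funext => i; rewrite hp.
Qed.

Lemma wedge_poly {K : comNzRingType} (A B : 'M[K]_n) :
  wedge (fun=> map_mx polyC A + 'X *: map_mx polyC B) =
  \sum_(S : {set 'I_n}) (wedge (fun i => if i \in S then B else A)) *: 'X^#|S|.
Proof.
rewrite /wedge.
transitivity (\sum_(u : 'S_n) \sum_(v : 'S_n) \sum_(S : {set 'I_n})
   ((-1) ^+ u * (-1) ^+ v * \prod_(i < n) (if i \in S then B else A) (u i) (v i)) *: 'X^#|S| : {poly K}).
  apply: eq_bigr => u _; apply: eq_bigr => v _.
  rewrite (eq_bigr (fun i => 'X * (B (u i) (v i))%:P + (A (u i) (v i))%:P)); last first.
    by move=> i _; rewrite !mxE addrC.
  rewrite bigA_distr mulr_sumr; apply: eq_bigr => S _.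
  have -> : \prod_i (if i \in S then 'X * (B (u i) (v i))%:P else (A (u i) (v i))%:P) =
     (\prod_(i < n) (if i \in S then B else A) (u i) (v i))%:P * 'X^#|S|.
    rewrite rmorph_prod (eq_bigr (fun i => (if i \in S then 'X else 1) * ((if i \in S then B else A) (u i) (v i))%:P)); last first.
      by move=> i _; case: ifP; rewrite ?mul1r.
    rewrite big_split mulrC /=; congr (_ * _).
    by rewrite -big_mkcond prodr_const.
  rewrite mulrA -mul_polyC; congr (_ * _).
  by rewrite !rmorphM !rmorphXn !rmorphN1.
rewrite (eq_bigr (fun u : 'S_n => \sum_(S : {set 'I_n}) \sum_(v : 'S_n)
   ((-1) ^+ u * (-1) ^+ v * \prod_(i < n) (if i \in S then B else A) (u i) (v i)) *: 'X^#|S|)).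
  by rewrite exchange_big; apply: eq_bigr => S _; rewrite scaler_suml; apply: eq_bigr => u _; rewrite scaler_suml.
by move=> u _; rewrite exchange_big.
Qed.

Definition det_pencil {K : comNzRingType} (A B : 'M[K]_n) : {poly K} := \det (map_mx polyC A + 'X *: map_mx polyC B).

(** Expanding n! det (A + X B) over the sets of positions occupied by B, the coefficient of degree b
    is a sum of 'C(n, b) equal terms. *)
Lemma wedge_coef {K : numFieldType} (A B : 'M[K]_n) (T : {set 'I_n}) :
  wedge (fun i => if i \in T then B else A) = (det_pencil A B)`_#|T| * ((#|T|)`! * (n - #|T|)`!)%:R.
Proof.
set b := #|T|; have bn : (b <= n)%N by rewrite /b -[X in (_ <= X)%N]card_ord max_card.
have := wedge_poly A B; rewrite wedge_cst => /(congr1 (fun q : {poly K} => q`_b)).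
rewrite -/(det_pencil A B) coefMn; move: (det_pencil A B)`_b => d; rewrite coef_sum.
rewrite (eq_bigr (fun S : {set 'I_n} => if #|S| == b then wedge (fun i => if i \in T then B else A) else 0)); last first.
  move=> S _; rewrite coefZ coefXn eq_sym; case: eqP => [e|_]; last by rewrite mulr0.
  by rewrite mulr1; exact: wedge_subset.
rewrite -big_mkcond sumr_const /=.
have -> : #|[pred S : {set 'I_n} | #|S| == b]| = 'C(n, b).
  by rewrite -[X in 'C(X, b)]card_ord -card_draws cardsE.
rewrite -(bin_fact bn) => e.
have c0 : 'C(n, b)%:R != 0 :> K by rewrite pnatr_eq0 -lt0n bin_gt0.
move: e; set W := wedge _ => e.
have {}e : d * ('C(n, b) * (b`! * (n - b)`!))%:R = W * 'C(n, b)%:R by rewrite !mulr_natr; exact: e.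
by apply: (mulIf c0); rewrite -e -mulrA -natrM mulnC.
Qed.

End MixedDiscriminants.

Section TopWedge.
Context {R : realType} {n : nat}.
Implicit Types (A B : 'M[R[i]]_n).

Lemma top_wedge_wedge (s : seq 'M[R[i]]_n) : top_wedge s = wedge (fun i : 'I_n => nth 0 s i).
Proof. by []. Qed.

Lemma card_ltn b : (b <= n)%N -> #|[set i : 'I_n | (i < b)%N]%SET| = b.
Proof.
move=> bn; have -> : [set i : 'I_n | (i < b)%N]%SET = widen_ord bn @: [set: 'I_b]%SET.
  apply/setP => i; rewrite inE; apply/idP/imsetP => [h|[j _ ->]]; last exact: (ltn_ord j).
  by exists (Ordinal h) => //; exact: val_inj.
by rewrite card_imset ?cardsT ?card_ord // => i j /(congr1 val) /= /val_inj.
Qed.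

Lemma wedge_coefE A B (T : {set 'I_n}) b : #|T| = b ->
  wedge (fun i => if i \in T then B else A) = (det_pencil A B)`_b * (b`! * (n - b)`!)%:R.
Proof. by move=> <-; exact: wedge_coef. Qed.

Lemma top_wedge_lt A B b : (b <= n)%N ->
  top_wedge (nseq b B ++ nseq (n - b) A) = (det_pencil A B)`_b * (b`! * (n - b)`!)%:R.
Proof.
move=> bn; rewrite top_wedge_wedge -(wedge_coefE A B (card_ltn bn)); congr wedge; apply/funext => i.
rewrite inE nth_cat size_nseq !nth_nseq; case: ltnP => // h.
by rewrite ltn_sub2r // (leq_ltn_trans h).
Qed.

Lemma top_wedge_ge A B b : (b <= n)%N ->
  top_wedge (nseq (n - b) A ++ nseq b B) = (det_pencil A B)`_b * (b`! * (n - b)`!)%:R.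
Proof.
move=> bn; pose T := ~: [set i : 'I_n | (i < n - b)%N]%SET.
have cT : #|T| = b.
  by rewrite cardsCs finset.setCK card_ord card_ltn ?leq_subr // subKn.
rewrite top_wedge_wedge -(wedge_coefE A B cT); congr wedge; apply/funext => i.
rewrite !inE nth_cat size_nseq !nth_nseq; case: ltnP => //= h.
by rewrite -(ltn_add2r (n - b)) subnK // addnC subnK // ltn_ord.
Qed.

Lemma top_wedge_all A : top_wedge (nseq n A) = \det A * n`!%:R.
Proof.
rewrite top_wedge_wedge mulr_natr -wedge_cst; congr wedge; apply/funext => i.
by rewrite nth_nseq ltn_ord.
Qed.

Lemma det_pencil_map (A B : 'M[R]_n) b :
  (det_pencil (map_mx (real_complex R) A) (map_mx (real_complex R) B))`_b = ((detp A B)`_b)%:C.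
Proof.
have -> : det_pencil (map_mx (real_complex R) A) (map_mx (real_complex R) B) = map_poly (real_complex R) (detp A B).
  rewrite /det_pencil /detp -det_map_mx; congr (\det _).
  by apply/matrixP => i j; rewrite !mxE rmorphD rmorphM /= map_polyX !map_polyC.
exact: coef_map.
Qed.

Lemma detp_congr (Z A B : 'M[R]_n) (a : R) b :
  (detp (a *: (Z *m A *m Z)) (a *: (Z *m B *m Z)))`_b = a ^+ n * (\det Z * \det Z) * (detp A B)`_b.
Proof.
have e : map_mx polyC (a *: (Z *m A *m Z)) + 'X *: map_mx polyC (a *: (Z *m B *m Z)) =
  a%:P *: (map_mx polyC Z *m (map_mx polyC A + 'X *: map_mx polyC B) *m map_mx polyC Z).
  rewrite !map_mxZ !map_mxM /= mulmxDr mulmxDl scalerDr -scalemxAr -scalemxAl !scalerA.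
  by rewrite ['X * _]mulrC.
rewrite /detp e detZ !det_mulmx !det_map_mx.
set q := \det (_ + _); have -> : a%:P ^+ n * ((\det Z)%:P * q * (\det Z)%:P) = (a ^+ n * (\det Z * \det Z))%:P * q.
  by rewrite !polyCM polyC_exp; ring.
by rewrite coefCM.
Qed.

End TopWedge.

(** * Toric geometry *)

Section Exponents.
Context {R : realType} {n : nat}.

Lemma expR_exprz (a : R) (m : int) : (expR a)%:C ^ m = (expR (a * m%:~R))%:C :> R[i].
Proof.
case: m => k.
  by rewrite -exprnP -rmorphXn -expRM_natl mulrC.
by rewrite NegzE -exprnN -rmorphXn -fmorphV -expRM_natl -expRN mulrNz mulrN mulrC.
Qed.

Lemma prod_expR_exprz (x : 'I_n -> R) (m : 'I_n -> int) :
  \prod_i (expR (x i))%:C ^ m i = (expR (\sum_i x i * (m i)%:~R))%:C :> R[i].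
Proof.
by rewrite expR_sum rmorph_prod; apply: eq_bigr => i _; exact: expR_exprz.
Qed.

Lemma prod_exprz (K : fieldType) (w : 'I_n -> K) (A B : 'M[int]_n) j : (forall k, w k != 0) ->
  \prod_i (\prod_k w k ^ A k i) ^ B i j = \prod_k w k ^ (A *m B) k j.
Proof.
move=> w0; transitivity (\prod_i \prod_k w k ^ (A k i * B i j)).
  apply: eq_bigr => i _; rewrite (big_morph (fun x : K => x ^ B i j) (id1 := 1) (op1 := *%R)).
  - by apply: eq_bigr => k _; rewrite exprz_exp.
  - by move=> x y; exact: expfzMl.
  - exact: exp1rz.
rewrite exchange_big; apply: eq_bigr => k _; rewrite mxE.
rewrite (big_morph (fun m : int => w k ^ m) (id1 := 1) (op1 := *%R)) //.
by move=> a b; rewrite expfzDr.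
Qed.

End Exponents.

Lemma norm_exprz1 (K : numFieldType) (x : K) (m : int) : `|x| = 1 -> `|x ^ m| = 1.
Proof.
by move=> hx; case: m => k; rewrite ?NegzE -?exprnN -?exprnP ?normfV normrX hx expr1n ?invr1.
Qed.

Section Charts.
Context {R : realType} {n : nat} (X : toric_manifold R n).
Implicit Types (s t : chart X) (y : 'rV[R]_n).

(** The change of logarithmic coordinates from the chart s to the chart t, which is linear on the
    real torus. *)
Definition chg s t : 'M[R]_n := map_mx intr (gens s *m invmx (gens t)).

Lemma chg_comp s t r : chg s t *m chg t r = chg s r.
Proof. by rewrite -map_mxM /= mulmxA mulmxKV // gens_basis. Qed.

Lemma chg_id s : chg s s = 1%:M.
Proof. by rewrite /chg mulmxV ?gens_basis // map_mx1. Qed.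

Lemma character_Exp (m : 'rV[int]_n) s y :
  character m s (Exp y) = (expR (dot y (map_mx intr (gens s *m m^T))^T))%:C.
Proof.
rewrite /character (eq_bigr (fun i => (expR (y 0 i))%:C ^ (gens s *m m^T) i 0)); last by move=> i _; rewrite Exp_zc.
rewrite prod_expR_exprz dotE; congr (expR _)%:C; apply: eq_bigr => i _.
by rewrite [X in _ = _ * X]mxE [X in _ = _ * X]mxE.
Qed.

Lemma transition_Exp s t y : transition s t (Exp y) = Exp (y *m chg s t).
Proof.
apply: cptP => k; rewrite ?Exp_l ?Exp_r /transition /of_zc ?row_mxEl ?row_mxEr mxE character_Exp //=.
congr expR; rewrite dotE mxE; apply: eq_bigr => i _; congr (_ * _).
rewrite trmxK [LHS]mxE [LHS]mxE [RHS]mxE !mxE; congr (_%:~R).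
by apply: eq_bigr => l _; rewrite mxE.
Qed.

Lemma overlap_Exp s t y : overlap s t (Exp y).
Proof. by move=> i _; rewrite Exp_zc; apply/eqP => -[/eqP]; rewrite gt_eqF // expR_gt0. Qed.

(** The factor 2 comes from the squared norm in the gluing rule of the metric. The slope depends on
    the line bundle only, so two solutions in the same class share it. *)
Definition slope (L : toric_line_bundle X) s t : 'rV[R]_n :=
  2 *: (map_mx intr (gens s *m (lb_char L t - lb_char L s)^T))^T.

Lemma potential_chart (L : toric_line_bundle X) (h : hermitian_metric L) (phi : smooth_fun X) s t y :
  potential h phi s (Exp y) = potential h phi t (Exp (y *m chg s t)) + (dot y (slope L s t) + 0).
Proof.
rewrite /potential -transition_Exp (sf_glue phi (@overlap_Exp s t y)) addr0.
have := hm_glue h (@overlap_Exp s t y); rewrite character_Exp.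
set d := dot y _; rewrite normc_def /= expr0n addr0 sqrtr_sqr ger0_norm ?expR_ge0 //.
rewrite -rmorphXn -rmorphM => -[]; rewrite -expRM_natl -expRD => /expR_inj e.
have -> : dot y (slope L s t) = 2 * d by rewrite /slope dotZr.
by move: e; move: (h t _) (h s _) (phi s _) => a b c e; lra.
Qed.

(** Completeness of the fan: the opposite of the vector with coordinates y lies in some cone t, and
    its nonnegative coordinates there are the opposites of the logarithmic coordinates in the chart
    t. *)
Lemma chart_below s y : exists t, below 0 (y *m chg s t).
Proof.
have [t [a [a0 e]]] := cones_cover X (- (y *m map_mx intr (gens s))); exists t => j.
have -> : y *m chg s t = - a.
  rewrite /chg map_mxM mulmxA -[y *m _]opprK e mulNmx -mulmxA -map_mxM mulmxV ?gens_basis //.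
  by rewrite map_mx1 mulmx1.
by rewrite mxE oppr_le0.
Qed.

Lemma torus_of_weight s (w : 'I_n -> R[i]) : (forall j, w j != 0) ->
  exists g : torus R n, (forall i, g i = \prod_k w k ^ gens s k i) /\ forall j, torus_weight g s j = w j.
Proof.
move=> w0.
have g0 i : \prod_k w k ^ gens s k i != 0 by apply/prodf_neq0 => k _; rewrite expfz_neq0.
exists (Torus g0); split=> // j; rewrite /torus_weight /= prod_exprz // mulmxV ?gens_basis //.
rewrite (bigD1 j) //= big1 ?mulr1 => [|k kj]; rewrite mxE ?eqxx ?expr1z // (negbTE kj) expr0z //.
Qed.

(** The generators of a cone form a basis of the lattice, so independent rotations of the chart
    coordinates all come from the compact torus. *)
Lemma rot_inv_chart (f : chart X -> cpt R n -> R) s : torus_invariant f -> rot_inv (f s).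
Proof.
move=> inv w hw z.
have w0 j : w j != 0 by rewrite -normr_gt0 hw ltr01.
have [g [gE wE]] := torus_of_weight s w0.
have cg : in_compact_torus g.
  move=> i; rewrite gE normr_prod big1 // => k _.
  exact: norm_exprz1.
rewrite -[RHS](inv g cg s z); congr (f s _); rewrite /scale /torus_act; congr of_zc.
by apply/funext => j; rewrite wE.
Qed.

Lemma potential_smooth (L : toric_line_bundle X) (h : hermitian_metric L) (phi : smooth_fun X) s :
  smooth (potential h phi s).
Proof. by move=> m; exact: CkD (hm_smooth h s m) (sf_smooth phi s m). Qed.

Lemma potential_rot_inv (L : toric_line_bundle X) (h : hermitian_metric L) (phi : smooth_fun X) s :
  torus_invariant h -> torus_invariant phi -> rot_inv (potential h phi s).
Proof.
move=> ih iphi w hw z; rewrite /potential.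
exact: congr2 (rot_inv_chart s ih hw z) (rot_inv_chart s iphi hw z).
Qed.

End Charts.

Section ChartRelation.
Context {R : realType} {n : nat}.
Implicit Types (Q : 'M[R]_n) (F : cpt R n -> R) (u : 'rV[R]_n -> R) (l y v : 'rV[R]_n) (c : R).

Definition chart_rel u F Q l c := forall y, u y = F (Exp (y *m Q)) + (dot y l + c).

Lemma chart_hess u F Q l c y : smooth F -> chart_rel u F Q l c ->
  hess u y = Q *m hess (fun y => F (Exp y)) (y *m Q) *m Q^T.
Proof.
move=> sF hu; have cV := Ck_comp_Exp 2 sF.
have cQ : Ck 2 (fun y => F (Exp (y *m Q))).
  by apply: (@Ck_comp _ n n 2 (fun y => F (Exp y)) (fun y => y *m Q) cV) => k; exact: Ck_linear.
have -> : u = (fun y => (fun y => F (Exp (y *m Q))) y + (dot y l + c)) by apply/funext => x; rewrite hu.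
rewrite hess_affine_add //; exact: (hess_linear_comp Q y cV).
Qed.

Lemma chart_grad u F Q l c y : smooth F -> chart_rel u F Q l c ->
  grad u y = grad (fun y => F (Exp y)) (y *m Q) *m Q^T + l.
Proof.
move=> sF hu; have cV := Ck_comp_Exp 1 sF.
have cQ : Ck 1 (fun y => F (Exp (y *m Q))).
  by apply: (@Ck_comp _ n n 1 (fun y => F (Exp y)) (fun y => y *m Q) cV) => k; exact: Ck_linear.
have -> : u = (fun y => (fun y => F (Exp (y *m Q))) y + (dot y l + c)) by apply/funext => x; rewrite hu.
rewrite grad_affine_add //; congr (_ + _); exact: (grad_linear_comp Q y cV).
Qed.

Lemma chart_qf u F Q l c y v : smooth F -> chart_rel u F Q l c ->
  qf (hess u y) v = qf (hess (fun y => F (Exp y)) (y *m Q)) (v *m Q).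
Proof. by move=> sF hu; rewrite (chart_hess y sF hu) /qf trmx_mul !mulmxA. Qed.

Lemma norm_mulmx_le v Q (q : R) : (forall i j, `|Q i j| <= q) -> 0 <= q -> `|v *m Q| <= n%:R * (`|v| * q).
Proof.
move=> hQ q0; apply/row_norm_le; first by rewrite !mulr_ge0.
move=> j; rewrite mxE; apply: le_trans (ler_norm_sum _ _ _) _.
rewrite -sum_ord_const; apply: ler_sum => i _; rewrite normrM; apply: ler_pM => //.
exact: coord_le_norm.
Qed.

Lemma wt_shift (L : R) y (e : 'rV[R]_n) v : (forall j, `|e 0 j| <= L) -> wt (y + e) v <= expR L ^+ 2 * wt y v.
Proof.
move=> he; rewrite /wt !dotE mulr_sumr; apply: ler_sum => j _.
rewrite !mul_mx_diag !mxE -!expr2 expRD.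
have -> : (v 0 j * (expR (y 0 j) * expR (e 0 j))) ^+ 2 = expR (e 0 j) ^+ 2 * (v 0 j * expR (y 0 j)) ^+ 2 by ring.
rewrite ler_wpM2r ?sqr_ge0 // ler_sqr ?nnegrE ?expR_ge0 // ler_expR.
exact: le_trans (ler_norm _) (he j).
Qed.

Lemma wt_le y v (c : R) : below 0 y -> (forall j, `|v 0 j| <= c) -> wt y v <= n%:R * c ^+ 2.
Proof.
move=> hy hv; rewrite /wt dotE -sum_ord_const; apply: ler_sum => j _.
rewrite mul_mx_diag !mxE -expr2 exprMn -[leRHS]mulr1; apply: ler_pM; rewrite ?sqr_ge0 //.
  rewrite -[X in X <= _]real_normK ?num_real // ler_sqr ?nnegrE //; exact: le_trans (hv j).
rewrite expr_le1 // ?expR_ge0 //; by rewrite -expR0 ler_expR.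
Qed.

End ChartRelation.

Section Congruence.
Context {R : realType} {n : nat}.
Implicit Types (A Z : 'M[R]_n) (v g a l : 'rV[R]_n).

Lemma posdef_scaled_congr A Z (a : R) : 0 < a -> posdef A -> Z \in unitmx -> posdef (a *: (Z *m A *m Z^T)).
Proof.
move=> a0 pA uZ; split.
  by rewrite linearZ /= !trmx_mul trmxK (posdef_sym pA) !mulmxA.
move=> v v0; rewrite qfZ; apply: mulr_gt0 => //.
have -> : qf (Z *m A *m Z^T) v = qf A (v *m Z) by rewrite /qf !trmx_mul !mulmxA.
apply: pA.2; apply: contra v0 => /eqP e; apply/eqP.
by rewrite -(mulmxK uZ v) e mul0mx.
Qed.

Lemma le_chain (a b c A B k : R) : 0 <= c -> 0 <= A -> a <= A * b -> b <= B * c -> A * B <= k -> a <= k * c.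
Proof.
move=> c0 A0 h1 h2 h3; apply: le_trans h1 _; apply: (@le_trans _ _ (A * (B * c))); first exact: ler_wpM2l.
by rewrite mulrA ler_wpM2r.
Qed.

Lemma le_sum5 (a b c d e : R) : 0 <= a -> 0 <= b -> 0 <= c -> 0 <= d -> 0 <= e ->
  let k := a + b + c + d + e in [/\ 0 <= k, a <= k, b <= k & [/\ c <= k, d <= k & e <= k]].
Proof. by move=> a0 b0 c0 d0 e0 k; rewrite /k; split; [|..|split]; lra. Qed.

Lemma sqr_subr_le (a b A B : R) : a ^+ 2 <= A -> b ^+ 2 <= B -> (a - b) ^+ 2 <= 2 * (A + B).
Proof.
move=> h1 h2; have h3 := sqr_ge0 (a + b).
have -> : (a - b) ^+ 2 = 2 * (a ^+ 2 + b ^+ 2) - (a + b) ^+ 2 by ring.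
lra.
Qed.

Lemma dot_affine_sub v g g' a a' l (P : 'M[R]_n) : a = g *m P^T + l -> a' = g' *m P^T + l ->
  dot v (a' - a) = dot (v *m P) (g' - g).
Proof. by move=> -> ->; rewrite opprD addrACA subrr addr0 -mulmxBl dot_mulmx trmxK. Qed.

End Congruence.

(** * From local potentials to the uniform estimates on real space *)

Section Atlas.
Context {R : realType} {n : nat} {I : finType}.
Variables (Q Qi : I -> 'M[R]_n) (s0 : I).
Hypotheses (n0 : (0 < n)%N) (QQi : forall s, Q s *m Qi s = 1%:M) (cover : forall y, exists s, below 0 (y *m Q s)).
Implicit Types (u r : 'rV[R]_n -> R) (F : I -> cpt R n -> R) (l : I -> 'rV[R]_n) (y v : 'rV[R]_n).

(* [F s] is a local potential in the chart s; on the real points all charts give the same convex function u, up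
   to linear terms. *)
Record polarized u F l : Prop := Polarized {
  pol_smooth : forall s, smooth (F s);
  pol_rot : forall s, rot_inv (F s);
  pol_pos : forall s z, positive_form (ddbar (F s) z);
  pol_rel : forall s, chart_rel u (F s) (Q s) (l s) 0
}.

Lemma pol_posdef u F l s z : polarized u F l -> posdef (rform (F s) z).
Proof. by move=> h; apply: rform_posdef; [exact: pol_smooth h s|exact: pol_pos h s z]. Qed.

Lemma entry_bound : exists2 q, 0 <= q & forall s, (forall i j, `|Q s i j| <= q) /\ (forall i j, `|Qi s i j| <= q).
Proof.
have [|[[s i] j]|q q0 hq] := @fin_sup R (I * 'I_n * 'I_n)%type
  (fun a C => `|Q a.1.1 a.1.2 a.2| <= C /\ `|Qi a.1.1 a.1.2 a.2| <= C).
- by move=> a C C' h [h1 h2]; split; apply: le_trans h.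
- exists (`|Q s i j| + `|Qi s i j|); by split; [rewrite lerDl|rewrite lerDr].
exists q => // s; split=> i j; have [h1 h2] := hq (s, i, j); [exact: h1|exact: h2].
Qed.

Lemma mulQ_unit y s : y *m Q s *m Qi s = y.
Proof. by rewrite -mulmxA QQi mulmx1. Qed.

Lemma chart_bound (P : I -> 'rV[R]_n -> 'rV[R]_n -> R -> Prop) L :
  (forall s y v C C', C <= C' -> P s y v C -> P s y v C') ->
  (forall s, exists C, forall y v, below L y -> P s y v C) ->
  exists2 C, 0 <= C & forall s y v, below L (y *m Q s) -> P s (y *m Q s) v C.
Proof.
move=> mono h.
have [|s|C C0 hC] := @fin_sup R I (fun s C => forall y v, below L y -> P s y v C).
- by move=> s C C' CC' hs y v hy; apply: mono CC' (hs y v hy).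
- exact: h.
by exists C => // s y v; exact: hC.
Qed.

(** Both bounds refer to a chart in which y Q is below L. A level L above 0 is allowed, so that the
    chart of x can still be used for a shifted point. *)
Lemma hess_compare u F l L : polarized u F l -> exists2 C, 0 <= C & forall s y v, below L (y *m Q s) ->
  qf (hess u y) v <= C * wt (y *m Q s) (v *m Q s) /\ wt (y *m Q s) (v *m Q s) <= C * qf (hess u y) v.
Proof.
move=> pu.
have [|s|C C0 hC] := @chart_bound (fun s y v C => forall q, q = qf (hess (fun y => F s (Exp y)) y) v ->
   q <= C * wt y v /\ wt y v <= C * q) L.
- move=> s y v C C' CC' h q eq; have [h1 h2] := h q eq.
  have C0 : 0 <= q by rewrite eq (qf_hess_Exp _ _ (pol_smooth pu s) (pol_rot pu s)) mulr_ge0 // posdef_ge0 //; exact: pol_posdef pu.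
  by split; [apply: le_trans h1 _; rewrite ler_wpM2r ?wt_ge0|apply: le_trans h2 _; rewrite ler_wpM2r].
- have [C C0 hC] := hess_Exp_upper L (pol_smooth pu s) (pol_rot pu s).
  have [c c0 hc] := hess_Exp_lower L (pol_smooth pu s) (pol_rot pu s) (fun z => pol_posdef s z pu).
  exists (C + c^-1) => y v hy q ->; have h1 := hC y v hy; have h2 := hc y v hy; split.
    apply: le_trans (ler_norm _) _; apply: le_trans h1 _.
    by rewrite ler_wpM2r ?wt_ge0 // lerDl invr_ge0 ltW.
  have q0 : 0 <= qf (hess (fun y => F s (Exp y)) y) v.
    by apply: le_trans h2; rewrite mulr_ge0 ?wt_ge0 // ltW.
  apply: (@le_trans _ _ (c^-1 * qf (hess (fun y => F s (Exp y)) y) v)); first by rewrite ler_pdivlMl.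
  by rewrite ler_wpM2r // lerDr.
exists C => // s y v hy; rewrite (chart_qf y v (pol_smooth pu s) (pol_rel pu s)).
exact: hC s y (v *m Q s) hy _ erefl.
Qed.

Lemma pol_hess_posdef u F l y : polarized u F l -> posdef (hess u y).
Proof.
move=> pu; have [s hs] := cover y.
have sF := pol_smooth pu s; have rF := pol_rot pu s.
rewrite (chart_hess y sF (pol_rel pu s)) (hess_Exp _ sF rF).
have pd := pol_posdef s (Exp (y *m Q s)) pu.
pose Z := Q s *m zmx (y *m Q s).
have uZ : Z \in unitmx.
  rewrite unitmx_mul; apply/andP; split; first by have [] := mulmx1_unit (QQi s).
  rewrite unitmxE det_diag unitfE; apply/prodf_neq0 => i _; rewrite mxE; exact: lt0r_neq0 (expR_gt0 _).
have -> : Q s *m (4 *: (zmx (y *m Q s) *m rform (F s) (Exp (y *m Q s)) *m zmx (y *m Q s))) *m (Q s)^T =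
   4 *: (Z *m rform (F s) (Exp (y *m Q s)) *m Z^T).
  by rewrite -scalemxAr -scalemxAl /Z trmx_mul zmxT !mulmxA.
exact: posdef_scaled_congr.
Qed.

Lemma pol_Ck u F l m : polarized u F l -> Ck m u.
Proof.
move=> pu; have -> : u = (fun y => F s0 (Exp (y *m Q s0)) + (dot y (l s0) + 0)).
  by apply/funext => y; exact: pol_rel pu s0 y.
apply: CkD.
  apply: (@Ck_comp _ n n m (fun y => F s0 (Exp y)) (fun y => y *m Q s0)); first exact: Ck_comp_Exp (pol_smooth pu s0).
  by move=> k; exact: Ck_linear.
apply: CkD; last exact: Ck_cst.
have -> : (fun y => dot y (l s0)) = (fun y => \sum_i y 0 i * l s0 0 i) by apply/funext => y; rewrite dotE.
by apply: Ck_sum => i _; apply: CkM; [exact: Ck_coord|exact: Ck_cst].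
Qed.

Section Pair.
Variables (u u' : 'rV[R]_n -> R) (F F' : I -> cpt R n -> R) (l : I -> 'rV[R]_n).
Hypotheses (pu : polarized u F l) (pu' : polarized u' F' l).

(** The linear terms of u and u' are the same, so the difference is a function that is continuous on
    each closed polydisc. *)
Lemma pol_bounded : exists C, forall y, `|u' y - u y| <= C.
Proof.
have [|s|C C0 hC] := @chart_bound (fun s y _ C => `|F' s (Exp y) - F s (Exp y)| <= C) 0.
- by move=> s y v C C' CC' h; apply: le_trans h CC'.
- have [C hC] := @Exp_bounded R n (fun z => F' s z - F s z) 0 (Ck0 (CkB (pol_smooth pu' s 0%N) (pol_smooth pu s 0%N))).
  by exists C => y v; exact: hC.
exists C => y; have [s hs] := cover y; have := hC s y 0 hs.
rewrite (pol_rel pu s) (pol_rel pu' s); congr (`|_| <= _).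
by move: (F' s _) (F s _) (dot _ _) => a b c; ring.
Qed.

Lemma pol_velocity : exists C, forall y t, 0 <= t <= 1 ->
  exists2 w, w *m mid t (hess u' y) (hess u y) = grad u' y - grad u y & `|w| <= C.
Proof.
have [q q0 hq] := entry_bound.
have [|s|C C0 hC] := @chart_bound (fun s y _ C => forall t, 0 <= t <= 1 ->
   exists2 e, e *m mid t (hess (fun y => F' s (Exp y)) y) (hess (fun y => F s (Exp y)) y)
    = grad (fun y => F' s (Exp y)) y - grad (fun y => F s (Exp y)) y & `|e| <= C) 0.
- by move=> s y v C C' CC' h t /h[e e1 e2]; exists e => //; apply: le_trans CC'.
- have [C C0 hC] := velocity_bound (pol_smooth pu s) (pol_rot pu s) (fun z => pol_posdef s z pu)
    (pol_smooth pu' s) (pol_rot pu' s) (fun z => pol_posdef s z pu') 0.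
  by exists C => y v hy t; exact: hC.
exists (n%:R * (C * q)) => y t ht; have [s hs] := cover y.
have [e e1 e2] := hC s y 0 hs t ht.
exists (e *m Qi s); last first.
  apply: le_trans (norm_mulmx_le e (hq s).2 q0) _.
  by rewrite ler_wpM2l // ler_wpM2r.
rewrite (chart_hess y (pol_smooth pu s) (pol_rel pu s)) (chart_hess y (pol_smooth pu' s) (pol_rel pu' s)).
rewrite (chart_grad y (pol_smooth pu s) (pol_rel pu s)) (chart_grad y (pol_smooth pu' s) (pol_rel pu' s)).
have QiQ : Qi s *m Q s = 1%:M := mulmx1C (QQi s).
have fin (A B : 'M[R]_n) (g g' m : 'rV[R]_n) : e *m mid t A B = g' - g ->
  e *m Qi s *m mid t (Q s *m A *m (Q s)^T) (Q s *m B *m (Q s)^T) = g' *m (Q s)^T + m - (g *m (Q s)^T + m).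
  move=> h; have -> : mid t (Q s *m A *m (Q s)^T) (Q s *m B *m (Q s)^T) = Q s *m mid t A B *m (Q s)^T.
    by rewrite /mid mulmxDr mulmxDl -!scalemxAr -!scalemxAl.
  rewrite opprD addrACA subrr addr0 -mulmxBl -h !mulmxA -[e *m Qi s *m Q s]mulmxA QiQ mulmx1.
  by [].
exact: fin e1.
Qed.

Lemma pol_geodesic_pair : exists C0 C1, geodesic_pair u u' C0 C1.
Proof.
have [C0 h0] := pol_bounded; have [C1 h1] := pol_velocity; exists C0, C1.
have p y := pol_hess_posdef y pu; have p' y := pol_hess_posdef y pu'.
split=> //; [exact: pol_Ck pu|exact: pol_Ck pu'|].
move=> a b; exact: displacement_bound n0 (pol_Ck 2 pu) (pol_Ck 2 pu') p p' h0 h1 a b.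
Qed.

Lemma pol_tame w G m C0 C1 : polarized w G m -> geodesic_pair u u' C0 C1 ->
  exists ka, tame_pair (hess w) u u' C0 C1 ka.
Proof.
move=> pw gp; have [q q0 hq] := entry_bound.
have [Kw Kw0 hw] := hess_compare 0 pw; have [Ku Ku0 hu] := hess_compare 0 pu.
have [Ku' Ku'0 hu'] := hess_compare 0 pu'.
(* A shift by at most C1 changes the logarithmic coordinates in any chart by at most L. *)
pose L := n%:R * (C1 * q); have [KL KL0 hL] := hess_compare L pw.
have C10 : 0 <= C1 := le_trans (normr_ge0 _) (gp_disp gp (esym (gdP gp 0))).
pose ka := Ku * Kw + Ku' * Kw + Kw * Ku + Kw * Ku' + KL * (expR L ^+ 2 * Kw).
have e0 := sqr_ge0 (expR L).
have [ka0 k1 k2 [k3 k4 k5]] := le_sum5 (mulr_ge0 Ku0 Kw0) (mulr_ge0 Ku'0 Kw0) (mulr_ge0 Kw0 Ku0) (mulr_ge0 Kw0 Ku'0)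
  (mulr_ge0 KL0 (mulr_ge0 e0 Kw0)).
have pq A f x v : polarized A f x -> forall y, 0 <= qf (hess A y) v.
  by move=> pA y; exact: posdef_ge0 (pol_hess_posdef y pA).
exists ka; split=> // x.
- move=> v; have [s hs] := cover x; have [h1 _] := hu s x v hs; have [_ h2] := hw s x v hs.
  exact: le_chain (pq _ _ _ v pw x) Ku0 h1 h2 k1.
- move=> v; have [s hs] := cover x; have [h1 _] := hu' s x v hs; have [_ h2] := hw s x v hs.
  exact: le_chain (pq _ _ _ v pw x) Ku'0 h1 h2 k2.
- move=> v; have [s hs] := cover x; have [_ h1] := hu s x v hs; have [h2 _] := hw s x v hs.
  exact: le_chain (pq _ _ _ v pu x) Kw0 h2 h1 k3.
- move=> v; have [s hs] := cover x; have [_ h1] := hu' s x v hs; have [h2 _] := hw s x v hs.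
  exact: le_chain (pq _ _ _ v pu' x) Kw0 h2 h1 k4.
move=> e v he; have [s hs] := cover x; have [_ h2] := hw s x v hs.
have hL' : `|e *m Q s| <= L.
  apply: le_trans (norm_mulmx_le e (hq s).1 q0) _; rewrite /L ler_wpM2l // ler_wpM2r //.
have he' j : `|(e *m Q s) 0 j| <= L := le_trans (coord_le_norm _ _) hL'.
have hb : below L ((x + e) *m Q s).
  move=> j; rewrite mulmxDl mxE -[L]add0r; apply: lerD; first exact: hs.
  exact: le_trans (ler_norm _) (he' j).
have [h1 _] := hL s (x + e) v hb.
have h3 : wt ((x + e) *m Q s) (v *m Q s) <= expR L ^+ 2 * wt (x *m Q s) (v *m Q s).
  by rewrite mulmxDl; exact: wt_shift.
have h4 := ler_wpM2l e0 h2; rewrite mulrA in h4.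
have h5 := le_trans h3 h4.
exact: le_chain (pq _ _ _ v pw x) KL0 h1 h5 k5.
Qed.

End Pair.

Definition ldet u y := ln (\det (hess u y)).
Definition lslope s : 'rV[R]_n := const_mx 2 *m (Q s)^T.
Lemma dot_lslope y s : dot y (lslope s) = 2 * \sum_j (y *m Q s) 0 j.
Proof.
rewrite /lslope dot_mulmx trmxK dotE mulr_sumr; apply: eq_bigr => j _.
by rewrite [X in _ * X]mxE mulrC.
Qed.

Definition lcst s : R := ln (4 ^+ n) + ln (\det (Q s) ^+ 2).

Lemma detQ s : \det (Q s) != 0.
Proof. by have [h _] := mulmx1_unit (QQi s); rewrite -unitfE -unitmxE. Qed.

(** The logarithm of the determinant has local weights just as a potential has, those of a metric on
    the canonical or anticanonical bundle; the estimates for potentials that need no positivity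
    therefore apply to it. *)
Lemma ldet_rel u F l s : polarized u F l -> chart_rel (ldet u) (vol (F s)) (Q s) (lslope s) (lcst s).
Proof.
move=> pu y; have sF := pol_smooth pu s; have rF := pol_rot pu s.
rewrite /ldet (chart_hess y sF (pol_rel pu s)) !det_mulmx det_tr (det_hess_Exp _ sF rF (pol_pos pu s)).
have d2 : 0 < \det (Q s) ^+ 2 by rewrite lt_def sqr_ge0 sqrf_eq0 detQ.
have e : dot y (lslope s) = \sum_j (y *m Q s) 0 j *+ 2.
  by rewrite dot_lslope mulr_sumr; apply: eq_bigr => j _; rewrite mulr_natl.
have fin (d a b c k : R) : 0 < d ^+ 2 -> b = c -> ln (d * expR (a + c + k) * d) = a + (b + (k + ln (d ^+ 2))).
  move=> d0 ->; rewrite mulrAC -expr2 lnM ?posrE ?expR_gt0 // expRK addrC !addrA.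
  by rewrite -!addrA; congr (_ + _); rewrite !addrA [c + k]addrC.
exact: fin d2 e.
Qed.

Lemma ldetK u F l y : polarized u F l -> expR (ldet u y) = \det (hess u y).
Proof. by move=> pu; rewrite lnK // posrE; exact: posdef_det (pol_hess_posdef y pu). Qed.

Local Opaque ldet vol.

Lemma smooth_pol_vol u F l s : polarized u F l -> smooth (vol (F s)).
Proof. by move=> pu; exact: smooth_vol (pol_smooth pu s) (pol_rot pu s) (pol_pos pu s). Qed.

Lemma rot_pol_vol u F l s : polarized u F l -> rot_inv (vol (F s)).
Proof. by move=> pu; exact: rot_inv_vol (pol_smooth pu s) (pol_rot pu s). Qed.

Lemma ldet_Ck u F l m : polarized u F l -> Ck m (ldet u).
Proof.
move=> pu; have -> : ldet u = (fun y => vol (F s0) (Exp (y *m Q s0)) + (dot y (lslope s0) + lcst s0)).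
  by apply/funext => y; exact: ldet_rel s0 pu y.
apply: CkD.
  apply: (@Ck_comp _ n n m (fun y => vol (F s0) (Exp y)) (fun y => y *m Q s0)).
    exact: Ck_comp_Exp (smooth_pol_vol s0 pu).
  by move=> k; exact: Ck_linear.
apply: CkD; last exact: Ck_cst.
have -> : (fun y => dot y (lslope s0)) = (fun y => \sum_i y 0 i * lslope s0 0 i) by apply/funext => y; rewrite dotE.
by apply: Ck_sum => i _; apply: CkM; [exact: Ck_coord|exact: Ck_cst].
Qed.

Lemma ldet_grad u F l : polarized u F l -> exists C, forall y, `|grad (ldet u) y| <= C.
Proof.
move=> pu; have [q q0 hq] := entry_bound.
have [|s|C C0 hC] := @chart_bound (fun s y _ C => `|grad (fun y => vol (F s) (Exp y)) y| <= C) 0.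
- by move=> s y v C C' CC' h; apply: le_trans h CC'.
- have [C C0 hC] := grad_Exp_bound 0 (smooth_pol_vol s pu).
  by exists C => y v hy; have [] := hC y hy.
exists (n%:R * (C * q) + \sum_s `|lslope s|) => y; have [s hs] := cover y.
have e := chart_grad y (smooth_pol_vol s pu) (ldet_rel s pu); rewrite e.
apply: le_trans (ler_normD _ _) (lerD _ _).
  have hqT i j : `|(Q s)^T i j| <= q by rewrite mxE; exact: (hq s).1.
  apply: le_trans (norm_mulmx_le _ hqT q0) _.
  by rewrite ler_wpM2l // ler_wpM2r //; exact: hC s y 0 hs.
by rewrite (bigD1 s) //= lerDl sumr_ge0.
Qed.

Lemma ldet_hess u F l : polarized u F l -> exists2 C, 0 <= C & forall y v,
  `|qf (hess (ldet u) y) v| <= C * qf (hess u y) v.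
Proof.
move=> pu; have [K K0 hK] := hess_compare 0 pu.
have [|s|C C0 hC] := @chart_bound (fun s y v C => `|qf (hess (fun y => vol (F s) (Exp y)) y) v| <= C * wt y v) 0.
- by move=> s y v C C' CC' h; apply: le_trans h _; rewrite ler_wpM2r ?wt_ge0.
- by have [C C0 hC] := hess_Exp_upper 0 (smooth_pol_vol s pu) (rot_pol_vol s pu); exists C.
exists (C * K) => [|y v]; first exact: mulr_ge0.
have [s hs] := cover y; have e := chart_qf y v (smooth_pol_vol s pu) (ldet_rel s pu).
have h1 := hC s y (v *m Q s) hs; have [_ h2] := hK s y v hs.
have q0 := posdef_ge0 v (pol_hess_posdef y pu).
have fin (a b c : R) : a = b -> `|b| <= c -> `|a| <= c by move=> ->.
exact: fin e (le_chain q0 C0 h1 h2 (lexx (C * K))).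
Qed.

(** The gradient of [ldet] alone tends to nonzero slopes at infinity and is not controlled by the
    metric. In the difference the slopes cancel, and what is left is bounded by the degenerating
    metric. *)
Lemma ldet_diff_grad u F l u' F' l' : polarized u F l -> polarized u' F' l' ->
  exists2 C, 0 <= C & forall y v, dot v (grad (fun y => ldet u' y + -1 * ldet u y) y) ^+ 2 <= C * qf (hess u' y) v.
Proof.
move=> pu pu'; have [K K0 hK] := hess_compare 0 pu'.
have bound w G m (pw : polarized w G m) s : exists2 C, 0 <= C & forall y, below 0 y ->
   forall v, dot v (grad (fun y => vol (G s) (Exp y)) y) ^+ 2 <= C * wt y v.
  by have [C C0 hC] := grad_Exp_bound 0 (smooth_pol_vol s pw); exists C => // y hy; have [] := hC y hy.
have [|s|C C0 hC] := @chart_bound (fun s y v C =>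
   dot v (grad (fun y => vol (F' s) (Exp y)) y - grad (fun y => vol (F s) (Exp y)) y) ^+ 2 <= C * wt y v) 0.
- by move=> s y v C C' CC' h; apply: le_trans h _; rewrite ler_wpM2r ?wt_ge0.
- have [C C0 hC] := bound _ _ _ pu s; have [C' C0' hC'] := bound _ _ _ pu' s.
  exists (2 * (C' + C)) => y v hy; rewrite dotBr.
  have -> : 2 * (C' + C) * wt y v = 2 * (C' * wt y v + C * wt y v) by ring.
  exact: sqr_subr_le (hC' y hy v) (hC y hy v).
exists (C * K) => [|y v]; first exact: mulr_ge0.
have [s hs] := cover y.
have -> : grad (fun y => ldet u' y + -1 * ldet u y) y = grad (ldet u') y - grad (ldet u) y.
  apply/rowP => j; have h := partialDZ j (-1) y (ldet_Ck 1 pu') (ldet_Ck 1 pu).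
  by rewrite [LHS]mxE h !mxE mulN1r.
have e := chart_grad y (smooth_pol_vol s pu) (ldet_rel s pu); have e' := chart_grad y (smooth_pol_vol s pu') (ldet_rel s pu').
have h1 := hC s y (v *m Q s) hs; have [_ h2] := hK s y v hs.
have q0 := posdef_ge0 v (pol_hess_posdef y pu').
have fin (a b c : R) : a = b -> b ^+ 2 <= c -> a ^+ 2 <= c by move=> ->.
exact: fin (dot_affine_sub v e e') (le_chain q0 C0 h1 h2 (lexx (C * K))).
Qed.

(** In a chart where all logarithmic coordinates are nonpositive the determinant is comparable to
    the exponential of twice their sum, and minus this sum dominates the norm of y Q, hence that of
    y up to the factor n q + 1. *)
Lemma pol_decay u F l : polarized u F l -> exists2 ga, 0 < ga & exists Cg,
  (forall y, \det (hess u y) <= Cg * expR (- (2 * ga * `|y|))) /\ forall y i, hess u y i i <= Cg.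
Proof.
move=> pu; have [q q0 hq] := entry_bound; have [K K0 hK] := hess_compare 0 pu.
have [|s|C C0 hC] := @chart_bound (fun s y _ C => `|vol (F s) (Exp y)| <= C) 0.
- by move=> s y v C C' CC' h; apply: le_trans h CC'.
- by have [C hC] := @Exp_bounded R n (vol (F s)) 0 (Ck0 (smooth_pol_vol s pu 0%N)); exists C => y v; exact: hC.
have nq : 0 < n%:R * q + 1 by rewrite ltr_wpDl // mulr_ge0.
pose D := C + \sum_s `|lcst s|; pose B := K * (n%:R * q ^+ 2).
have B0 : 0 <= B by rewrite !mulr_ge0 ?sqr_ge0.
exists (n%:R * q + 1)^-1; first by rewrite invr_gt0.
exists (expR D + B); split=> [y|y i]; have [s hs] := cover y.
  apply: (@le_trans _ _ (expR D * expR (- (2 * (n%:R * q + 1)^-1 * `|y|)))); last first.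
    by rewrite ler_wpM2r ?expR_ge0 // lerDl.
  rewrite -(ldetK y pu) -expRD ler_expR (ldet_rel s pu) addrCA addrC.
  have h1 : `|y *m Q s| <= - \sum_j (y *m Q s) 0 j.
    have nn j : 0 <= - (y *m Q s) 0 j by rewrite oppr_ge0; exact: hs.
    rewrite -sumrN; apply/row_norm_le; first exact: sumr_ge0.
    by move=> j; rewrite -normrN ger0_norm // (bigD1 j) //= lerDl sumr_ge0.
  have h2 : `|y| <= `|y *m Q s| * (n%:R * q + 1).
    rewrite -{1}(mulQ_unit y s); apply: le_trans (norm_mulmx_le _ (hq s).2 q0) _.
    by rewrite mulrCA ler_wpM2l // lerDl.
  have h3 : (n%:R * q + 1)^-1 * `|y| <= `|y *m Q s| by rewrite ler_pdivrMl // mulrC.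
  have h4 := le_trans (ler_norm _) (hC s y 0 hs).
  have h5 : lcst s <= \sum_s `|lcst s|.
    by apply: le_trans (ler_norm _) _; rewrite (bigD1 s) //= lerDl sumr_ge0.
  rewrite dot_lslope -mulrA /D; move: h1 h3 h4 h5.
  by move: (\sum_j _) (_^-1 * _) (vol _ _) (lcst _) (\sum_s _) `|_ *m _| => S T V l' SL M; lra.
have [h1 _] := hK s y (delta_mx 0 i) hs; rewrite qf_delta in h1.
apply: le_trans h1 _; apply: (@le_trans _ _ B); last by rewrite lerDr expR_ge0.
rewrite /B ler_wpM2l //; apply: wt_le => // j.
by rewrite -rowE mxE; exact: (hq s).1.
Qed.

End Atlas.

(** * Rigidity for solutions given in an atlas *)

Section AtlasRigidity.
Context {R : realType} {n k : nat} {I : finType}.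
Variables (Q Qi : I -> 'M[R]_n) (s0 : I).
Hypotheses (n0 : (0 < n)%N) (QQi : forall s, Q s *m Qi s = 1%:M) (cover : forall y, exists s, below 0 (y *m Q s)).
Variables (p : 'I_k -> nat) (cc : 'I_k.+1 -> R) (p_lt : forall j, (p j < n)%N).
Local Notation nx j := (lift ord0 j).

Record solves (u : 'I_k.+1 -> 'rV[R]_n -> R) : Prop := Solves {
  slv_scal : forall x, \sum_j (detp (hess (u ord0) x) (hess (u (nx j)) x))`_(p j).+1 +
    (detp (hess (u ord0) x) (hess (ldet (u ord0)) x))`_1 = cc ord0 * \det (hess (u ord0) x);
  slv_hess : forall j x, (detp (hess (u ord0) x) (hess (u (nx j)) x))`_(p j) = cc (nx j) * \det (hess (u (nx j)) x)
}.

Lemma tame_le (g0 : 'rV[R]_n -> 'M[R]_n) u u' C0 C1 (a b : R) : (forall x, posdef (g0 x)) ->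
  a <= b -> tame_pair g0 u u' C0 C1 a -> tame_pair g0 u u' C0 C1 b.
Proof.
move=> pg ab [gp a0 h1 h2 h3 h4 h5].
have le_q (q x : R) : 0 <= q -> x <= a * q -> x <= b * q.
  by move=> q0 h; apply: le_trans h _; rewrite ler_wpM2r.
have qg x v : 0 <= qf (g0 x) v := posdef_ge0 v (pg x).
have qu x v : 0 <= qf (hess u x) v := posdef_ge0 v (gp_pl gp x).
have qu' x v : 0 <= qf (hess u' x) v := posdef_ge0 v (gp_pr gp x).
exact: (TamePair gp (le_trans a0 ab) (fun x v => le_q _ _ (qg x v) (h1 x v)) (fun x v => le_q _ _ (qg x v) (h2 x v))
  (fun x v => le_q _ _ (qu x v) (h3 x v)) (fun x v => le_q _ _ (qu' x v) (h4 x v))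
  (fun x e v he => le_q _ _ (qg x v) (h5 x e v he))).
Qed.

Lemma partial_expR_comp (r D : 'rV[R]_n -> R) i x : Ck 1 r -> (forall y, expR (r y) = D y) ->
  partial i D x = D x * partial i r x.
Proof.
move=> cr e; have -> : D = (fun y => expR (r y)) by apply/funext.
exact: partial_val (is_derive_outer (Ck_is_derive x i cr) (is_derive_expR (r x))).
Qed.

Variables (u u' : 'I_k.+1 -> 'rV[R]_n -> R) (F F' : 'I_k.+1 -> I -> cpt R n -> R) (l : 'I_k.+1 -> I -> 'rV[R]_n).
Hypotheses (pu : forall i, polarized Q (u i) (F i) (l i)) (pu' : forall i, polarized Q (u' i) (F' i) (l i)).
Hypotheses (su : solves u) (su' : solves u').

Local Opaque ldet.

Theorem atlas_rigidity : exists a, forall i x, grad (u' i) (x + a) = grad (u i) x.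
Proof.
have /choice[C0 /choice[C1 gp]] := fun i => pol_geodesic_pair s0 n0 QQi cover (pu i) (pu' i).
have /choice[kt tp] := fun i => pol_tame QQi cover (pu i) (pu' i) (pu ord0) (gp i).
have [ga ga0 [Cg [hdet hdiag]]] := pol_decay QQi cover (pu ord0).
have [Cr hr] := ldet_grad QQi cover (pu ord0).
have [Ch Ch0 hh] := ldet_hess QQi cover (pu ord0).
have [Cs Cs0 hs] := ldet_diff_grad s0 QQi cover (pu ord0) (pu' ord0).
(* s is the difference of the two logarithmic determinants, so that r + s belongs to the final end
   and only grad s has to be small relative to the metric. *)
pose r := ldet (u ord0); pose s y := ldet (u' ord0) y + -1 * ldet (u ord0) y.
pose ka := Ch + Cs + \sum_i `|kt i|.
have S0 : 0 <= \sum_i `|kt i| by exact: sumr_ge0.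
have k1 : Ch <= ka by rewrite /ka -addrA lerDl addr_ge0.
have k2 : Cs <= ka by rewrite /ka addrAC lerDr addr_ge0.
have k3 i : kt i <= ka.
  apply: le_trans (ler_norm _) _; apply: (@le_trans _ _ (\sum_i `|kt i|)); last by rewrite /ka lerDr addr_ge0.
  by rewrite (bigD1 i) //= lerDl sumr_ge0.
have g0 x : posdef (hess (u ord0) x) := pol_hess_posdef QQi cover x (pu ord0).
have g1 x : posdef (hess (u' ord0) x) := pol_hess_posdef QQi cover x (pu' ord0).
have cr m : Ck m r := ldet_Ck s0 QQi m (pu ord0).
have cr' m : Ck m (ldet (u' ord0)) := ldet_Ck s0 QQi m (pu' ord0).
have cs m : Ck m s := CkDZ (-1) (cr' m) (cr m).
have hs2 x : hess s x = hess (ldet (u' ord0)) x - hess r x.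
  by rewrite (hessDZ (-1) x (cr' 2) (cr 2)) scaleN1r.
have ps x i : partial i r x + partial i s x = partial i (ldet (u' ord0)) x.
  by rewrite (partialDZ i (-1) x (cr' 1%N) (cr 1%N)) mulN1r addrC subrK.
have d0 x i : partial i (fun y => \det (hess (u ord0) y)) x = \det (hess (u ord0) x) * partial i r x.
  by apply: partial_expR_comp (cr 1%N) _ => y; exact: (ldetK QQi cover y (pu ord0)).
have d1 x i : partial i (fun y => \det (hess (u' ord0) y)) x =
    \det (hess (u' ord0) x) * (partial i r x + partial i s x).
  rewrite ps; apply: partial_expR_comp (cr' 1%N) _ => y; exact: (ldetK QQi cover y (pu' ord0)).
have hk x v : `|qf (hess r x) v| <= ka * qf (hess (u ord0) x) v.
  apply: le_trans (hh x v) _; apply: ler_wpM2r k1; exact: posdef_ge0.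
have sk x w : dot w (grad s x) ^+ 2 <= ka * qf (hess (u' ord0) x) w.
  apply: le_trans (hs x w) _; apply: ler_wpM2r k2; exact: posdef_ge0.
have e1 x : \sum_j (detp (hess (u' ord0) x) (hess (u' (nx j)) x))`_(p j).+1 +
    (detp (hess (u' ord0) x) (hess r x))`_1 + (detp (hess (u' ord0) x) (hess s x))`_1 = cc ord0 * \det (hess (u' ord0) x).
  rewrite hs2 detp_coef1B -addrA [X in _ + X]addrC subrK; exact: slv_scal su' x.
exact: (rigidity (RigidData ga0 (fun i => tame_le g0 (k3 i) (tp i)) hdet hdiag (cr 3) (cs 3) d0 d1 hr hk sk p_lt
  (slv_scal su) e1 (slv_hess su) (slv_hess su'))).
Qed.

End AtlasRigidity.

Section ChartEquations.
Context {R : realType} {n : nat}.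
Variables (F0 F1 : cpt R n -> R) (y : 'rV[R]_n).
Hypotheses (s0 : smooth F0) (r0 : rot_inv F0) (s1 : smooth F1) (r1 : rot_inv F1).

Definition jac : R := 4 ^+ n * (\det (zmx y) * \det (zmx y)).

Lemma detp_Exp b : (detp (hess (fun y => F0 (Exp y)) y) (hess (fun y => F1 (Exp y)) y))`_b =
  jac * (detp (rform F0 (Exp y)) (rform F1 (Exp y)))`_b.
Proof.
have e0 := hess_Exp y s0 r0; have e1 := hess_Exp y s1 r1; rewrite e0 e1.
exact: detp_congr.
Qed.

Lemma det_rform_Exp : \det (hess (fun y => F0 (Exp y)) y) = jac * \det (rform F0 (Exp y)).
Proof. by have e0 := hess_Exp y s0 r0; rewrite e0 detZ !det_mulmx /jac; ring. Qed.

End ChartEquations.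

(** * From the system of forms to equations between Hessians *)

Section ToricSolution.
Context {R : realType} {n k : nat} {X : toric_manifold R n} {L : 'I_k.+1 -> toric_line_bundle X}.
Variables (h : forall i : 'I_k.+1, hermitian_metric (L i)) (p : 'I_k -> nat) (c : 'I_k.+1 -> R).
Hypotheses (n_gt0 : (0 < n)%N) (h_invariant : forall i, torus_invariant (h i)) (p_le : forall i, (p i <= n - 1)%N).
Variable s0 : chart X.
Local Notation Q := (chg (R := R) s0).
Local Notation nx j := (lift ord0 j).

Definition real_potential (phi : 'I_k.+1 -> smooth_fun X) i y := potential (h i) (phi i) s0 (Exp y).

Lemma p_lt j : (p j < n)%N.
Proof. by apply: leq_ltn_trans (p_le j) _; rewrite subn1 prednK. Qed.

Section OneSolution.
Variable phi : 'I_k.+1 -> smooth_fun X.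
Hypothesis sol : invariant_solution h p c phi.
Local Notation P i s := (potential (h i) (phi i) s).

Lemma solution_smooth i s : smooth (P i s). Proof. exact: potential_smooth. Qed.

Lemma solution_rot_inv i s : rot_inv (P i s).
Proof. exact: potential_rot_inv (h_invariant i) (sol_invariant sol i). Qed.

Lemma solution_polarized i : polarized Q (real_potential phi i) (fun s => P i s) (slope (L i) s0).
Proof.
split=> s; [exact: solution_smooth|exact: solution_rot_inv|exact: sol_kahler sol i s|].
by move=> y; exact: potential_chart.
Qed.

Lemma vol_smooth s : smooth (vol (P ord0 s)).
Proof. exact: smooth_vol (solution_smooth _ _) (solution_rot_inv _ _) (sol_kahler sol ord0 s). Qed.

Lemma vol_rot_inv s : rot_inv (vol (P ord0 s)).
Proof. exact: rot_inv_vol (solution_smooth _ _) (solution_rot_inv _ _). Qed.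

Lemma hess_ldet y : hess (ldet (real_potential phi ord0)) y = hess (fun y => vol (P ord0 s0) (Exp y)) y.
Proof.
have QQ s : Q s *m chg s s0 = 1%:M by rewrite chg_comp chg_id.
have e := chart_hess y (vol_smooth s0) (ldet_rel QQ s0 (solution_polarized ord0)).
by rewrite e chg_id trmx1 !mulmx1 mul1mx.
Qed.

Lemma detp_coef1N (A B : 'M[R]_n) : (detp A (- B))`_1 = - (detp A B)`_1.
Proof. by rewrite !detp_coef1 mulmxN raddfN. Qed.

(** At the real points of one chart all the forms are real matrices, and the wedge products divided
    by their factorials are coefficients of determinants. Passing to logarithmic coordinates
    multiplies every term by the same Jacobian. *)
Lemma solution_solves : solves p c (real_potential phi).
Proof.
pose A i y := rform (P i s0) (Exp y); pose V y := rform (vol (P ord0 s0)) (Exp y).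
have sm i := solution_smooth i s0; have rm i := solution_rot_inv i s0.
have wE i y : omega (h i) (phi i) s0 (Exp y) = map_mx (real_complex R) (A i y).
  by have e := ddbar_real (sm i) (rm i) (Exp_real y); rewrite /omega e.
have ricE y : ricci (P ord0 s0) (Exp y) = map_mx (real_complex R) (- V y).
  have e := ddbar_real (vol_smooth s0) (vol_rot_inv s0) (Exp_real y).
  by rewrite map_mxN -e.
have nat0 m : (m`!)%:R != 0 :> R[i] by rewrite pnatr_eq0 -lt0n fact_gt0.
have nat00 m m' : (m`! * m'`!)%:R != 0 :> R[i] by rewrite pnatr_eq0 -lt0n muln_gt0 !fact_gt0.
(* The Ricci form is minus the form of the logarithmic volume, which turns the minus sign of the
   scalar equation into a plus. *)
have scalE (S d c0 J : R) : S%:C - (- d)%:C - c0%:C * J%:C = 0 -> S + d = c0 * J.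
  by rewrite -rmorphM -!rmorphB opprK => -[] /eqP; rewrite subr_eq0 => /eqP.
have realE (a b : R) : a%:C - b%:C = 0 -> a = b by move/eqP; rewrite subr_eq0 => /eqP[].
split=> [y|j y].
  have eq : \sum_j (detp (A ord0 y) (A (nx j) y))`_(p j).+1 + (detp (A ord0 y) (V y))`_1 = c ord0 * \det (A ord0 y).
    have := sol_scal sol s0 (Exp y); rewrite /scal_equation /= ricE.
    have -> : top_wedge (map_mx (real_complex R) (- V y) :: nseq (n - 1) (omega (h ord0) (phi ord0) s0 (Exp y)))
        / (n - 1)`!%:R = (- (detp (A ord0 y) (V y))`_1)%:C.
      have := top_wedge_lt (map_mx (real_complex R) (A ord0 y)) (map_mx (real_complex R) (- V y)) n_gt0.
      rewrite wE /= => ->; rewrite mul1n mulfK // det_pencil_map detp_coef1N.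
      by [].
    have -> : top_wedge (nseq n (omega (h ord0) (phi ord0) s0 (Exp y))) / n`!%:R = (\det (A ord0 y))%:C.
      by rewrite top_wedge_all mulfK // wE det_map_mx.
    rewrite (eq_bigr (fun j => ((detp (A ord0 y) (A (nx j) y))`_(p j).+1)%:C)); last first.
      move=> j _; have e : (n - p j - 1 = n - (p j).+1)%N by rewrite subn1 subnS.
      by rewrite e (top_wedge_lt _ _ (p_lt j)) mulfK // !wE det_pencil_map.
    rewrite -(rmorph_sum (real_complex R)); exact: scalE.
  rewrite hess_ldet.
  have e1 j : (detp (hess (real_potential phi ord0) y) (hess (real_potential phi (nx j)) y))`_(p j).+1 =
     jac y * (detp (A ord0 y) (A (nx j) y))`_(p j).+1 := detp_Exp y (sm _) (rm _) (sm _) (rm _) _.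
  have e2 : (detp (hess (real_potential phi ord0) y) (hess (fun y => vol (P ord0 s0) (Exp y)) y))`_1 =
     jac y * (detp (A ord0 y) (V y))`_1 := detp_Exp y (sm _) (rm _) (vol_smooth s0) (vol_rot_inv s0) _.
  have e3 : \det (hess (real_potential phi ord0) y) = jac y * \det (A ord0 y) := det_rform_Exp y (sm _) (rm _).
  have eS : \sum_j (detp (hess (real_potential phi ord0) y) (hess (real_potential phi (nx j)) y))`_(p j).+1 =
      jac y * \sum_j (detp (A ord0 y) (A (nx j) y))`_(p j).+1.
    by apply: etrans (esym (mulr_sumr _ _ _ _)); apply: eq_bigr => j _; exact: e1.
  have fin (S T D S' T' D' J c0 : R) : S = J * S' -> T = J * T' -> D = J * D' -> S' + T' = c0 * D' -> S + T = c0 * D.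
    by move=> -> -> -> e; rewrite -mulrDr e mulrCA.
  exact: fin eS e2 e3 eq.
have eq : (detp (A ord0 y) (A (nx j) y))`_(p j) = c (nx j) * \det (A (nx j) y).
  have := sol_hessian sol j s0 (Exp y); rewrite /hessian_equation /=.
  have -> : top_wedge (nseq n (omega (h (nx j)) (phi (nx j)) s0 (Exp y))) / n`!%:R = (\det (A (nx j) y))%:C.
    by rewrite top_wedge_all mulfK // wE det_map_mx.
  rewrite (top_wedge_ge _ _ (ltnW (p_lt j))) mulnC mulfK // !wE det_pencil_map -rmorphM; exact: realE.
have e1 : (detp (hess (real_potential phi ord0) y) (hess (real_potential phi (nx j)) y))`_(p j) =
  jac y * (detp (A ord0 y) (A (nx j) y))`_(p j) := detp_Exp y (sm _) (rm _) (sm _) (rm _) _.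
have e3 : \det (hess (real_potential phi (nx j)) y) = jac y * \det (A (nx j) y) := det_rform_Exp y (sm _) (rm _).
by rewrite e1 e3 eq mulrCA.
Qed.

End OneSolution.

Variables phi psi : 'I_k.+1 -> smooth_fun X.
Hypotheses (phi_sol : invariant_solution h p c phi) (psi_sol : invariant_solution h p c psi).

Lemma solution_translation : exists a, forall i x, grad (real_potential psi i) (x + a) = grad (real_potential phi i) x.
Proof.
have QQ s : Q s *m chg s s0 = 1%:M by rewrite chg_comp chg_id.
exact: (atlas_rigidity s0 n_gt0 QQ (chart_below s0) p_lt (solution_polarized phi_sol) (solution_polarized psi_sol)
  (solution_solves phi_sol) (solution_solves psi_sol)).
Qed.

End ToricSolution.

(** * From the real points of the torus to the whole manifold *)

Section Extension.
Context {R : realType} {n : nat}.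
Implicit Types (F : cpt R n -> R) (z : cpt R n) (w : 'I_n -> R[i]).

Lemma translation_cst (u u' : 'rV[R]_n -> R) a : Ck 1 u -> Ck 1 u' ->
  (forall x, grad u' (x + a) = grad u x) -> forall x, u' (x + a) = u x + (u' a - u 0).
Proof.
move=> cu cu' e x.
have d (y : 'rV[R]_n) : is_derive y x (fun y => u' (a + y) - u y) 0.
  have h1 := is_derive_shiftV (c := a) (grad_is_derive (a + y) x cu').
  have := is_deriveBp h1 (grad_is_derive y x cu).
  by apply: is_derive_eqfun => //; rewrite [a + y]addrC e subrr.
have [t _] := @line_MVT R _ (fun y => u' (a + y) - u y) (fun=> 0) 0 x (fun t _ => d _).
have fin (A B C D : R) : A - B - (C - D) = 0 -> A = B + (C - D) by move/eqP; rewrite subr_eq0 => /eqP <-; rewrite addrC subrK.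
by rewrite !addr0 [a + x]addrC; exact: fin.
Qed.

Lemma zc_scale w z j : zc (scale w z) j = w j * zc z j.
Proof. by rewrite /zc /scale /of_zc row_mxEl row_mxEr !mxE; case: (_ * _). Qed.

Lemma scale_comm w w' z : scale w (scale w' z) = scale w' (scale w z).
Proof. by rewrite /scale; congr of_zc; apply/funext => j; rewrite !zc_scale mulrCA. Qed.

Lemma scale_Exp (b y : 'rV[R]_n) : scale (fun j => (expR (b 0 j))%:C) (Exp y) = Exp (y + b).
Proof.
apply: cptP => j; rewrite ?scale_l ?scale_r ?Exp_l ?Exp_r /= ?mul0r ?mulr0 ?subr0 ?addr0 //.
by rewrite mxE expRD mulrC.
Qed.

(** A rotation takes z to a point with nonnegative real coordinates. Adding a small positive number
    to each coordinate makes it a point [Exp y], so continuity extends the vanishing across the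
    toric divisors. *)
Lemma rot_inv_zero F : smooth F -> rot_inv F -> (forall y, F (Exp y) = 0) -> forall z, F z = 0.
Proof.
move=> sF rF F0 z; have [w [hw hr hpos]] := to_real_pt z; rewrite -(rF w hw); move: (scale w z) hr hpos => {w hw}x hr hpos.
apply/eqP; apply: contraT => nz.
pose one : cpt R n := row_mx (const_mx 1) 0.
have c : {for (0 : R), continuous (fun t : R => F (t *: (one : 'rV[R]_(n + n)) + x))}.
  have cl : {for (0 : R), continuous (fun t : R => t *: (one : 'rV[R]_(n + n)) + x)}.
    by apply: continuousD; [exact: for_continuous_scalel|exact: for_continuous_cst].
  exact: (for_continuous_comp cl (Ck0 (sF 0%N) (x := _))).
have : \forall t \near (0 : R), F (t *: (one : 'rV[R]_(n + n)) + x) != 0.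
  by apply: (cvgr_neq0 _ c); rewrite scale0r add0r.
move=> /nbhs_ballP[d /= d0 hd]; have d2 : 0 < d / 2 by rewrite divr_gt0.
have : F (d / 2 *: (one : 'rV[R]_(n + n)) + x) != 0.
  apply: hd; rewrite /ball /= sub0r normrN gtr0_norm // ltr_pdivrMr // mulr_natr mulr2n ltrDl //.
have -> : d / 2 *: (one : 'rV[R]_(n + n)) + x = Exp (\row_j ln (d / 2 + x 0 (lshift n j))).
  apply: cptP => j; rewrite ?Exp_l ?Exp_r [LHS]mxE [X in X + _]mxE.
    by rewrite /one row_mxEl !mxE mulr1 lnK // posrE ltr_wpDr.
  by rewrite /one row_mxEr mxE mulr0 hr addr0.
by rewrite F0 eqxx.
Qed.

Lemma ddbar_addc F (a : R) z : smooth F -> ddbar (fun z => F z + a) z = ddbar F z.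
Proof.
move=> sF; have e i : partial i (fun z : 'rV[R]_(n + n) => F z + a) = partial i F.
  apply/funext => y; rewrite (partialD1 i y (sF 1%N) (Ck_cst 1 a)) partial_cst addr0.
  by [].
by rewrite /ddbar; apply/matrixP => i j; rewrite [LHS]mxE [RHS]mxE !e.
Qed.

End Extension.

(** Equal gradients give equality up to a constant in the chart s0; in another chart the translation
    shifts the common linear term, which only changes that constant. *)
Lemma chart_translation (R : realType) (n k : nat) (X : toric_manifold R n) (L : 'I_k.+1 -> toric_line_bundle X)
    (h : forall i : 'I_k.+1, hermitian_metric (L i)) (phi psi : 'I_k.+1 -> smooth_fun X) s0 i s (a : 'rV[R]_n) :
  (forall x, grad (real_potential h s0 psi i) (x + a) = grad (real_potential h s0 phi i) x) ->
  exists C, forall y, potential (h i) (psi i) s (Exp y) = potential (h i) (phi i) s (Exp (y + - a *m chg s0 s)) + C.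
Proof.
move=> ha.
have c1 f : Ck 1 (real_potential h s0 f i) by apply: Ck_comp_Exp; exact: potential_smooth.
have tr := translation_cst (c1 phi) (c1 psi) ha.
set K := real_potential h s0 psi i a - _ in tr.
exists (K - dot a (slope (L i) s0 s)) => y; pose x := y *m chg s s0.
have xy : x *m chg s0 s = y by rewrite /x -mulmxA chg_comp chg_id mulmx1.
have := tr (x - a); rewrite subrK /real_potential !(potential_chart _ _ s0 s) mulmxBl xy dotBl mulNmx.
move: (potential _ _ _ _) (potential _ _ _ _) (dot _ _) (dot _ _) => p q d e; lra.
Qed.

Theorem corollary4p10 (R : realType) (n k : nat) (X : toric_manifold R n)
    (L : 'I_k.+1 -> toric_line_bundle X)
    (h : forall i : 'I_k.+1, hermitian_metric (L i))
    (p : 'I_k -> nat) (c : 'I_k.+1 -> R)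
    (n_gt0 : (0 < n)%N)
    (h_invariant : forall i, torus_invariant (h i))
    (h_positive : forall i s z, positive_form (curvature (h i) s z))
    (p_le : forall i, (p i <= n - 1)%N)
    (phi psi : 'I_k.+1 -> smooth_fun X)
    (phi_sol : invariant_solution h p c phi)
    (psi_sol : invariant_solution h p c psi) :
  same_solution h phi psi.
Proof.
(* The cones cover the space, so there is at least one chart to start from. *)
have [s0 _] := cones_cover X 0.
have [a ha] := solution_translation n_gt0 h_invariant p_le s0 phi_sol psi_sol.
(* The potential of psi at x is that of phi at x - a, up to a constant, so the torus element acts by
   e^(-a). *)
pose w0 j := (expR ((- a) 0 j))%:C.
have w0n j : w0 j != 0 by rewrite /w0; apply/eqP => -[/eqP]; rewrite gt_eqF // expR_gt0.
have [g [gE _]] := torus_of_weight s0 w0n.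
exists g => i s z; pose b := - a *m chg s0 s.
have WE : torus_weight g s = (fun j => (expR (b 0 j))%:C).
  apply/funext => j; rewrite /torus_weight (eq_bigr _ (fun i _ => congr1 (fun x => x ^ _) (gE i))) prod_exprz //.
  rewrite prod_expR_exprz /b mxE; congr (expR _)%:C; apply: eq_bigr => l _.
  by rewrite [X in _ = _ * X]mxE.
have [C hC] := chart_translation s (ha i).
pose P := potential (h i) (phi i) s; pose P' := potential (h i) (psi i) s.
have sP : smooth P by exact: potential_smooth.
have sP' : smooth P' by exact: potential_smooth.
have sPg := smooth_scale (torus_weight g s) sP.
(* The relation holds on the real points of the torus; G is smooth and invariant, hence zero on the
   whole chart, and the constant C does not change the form. *)
pose G z := P' z - P (scale (torus_weight g s) z) - C.
have G0 : forall z, G z = 0.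
  apply: rot_inv_zero.
  - by move=> m; exact: CkB (CkB (sP' m) (sPg m)) (Ck_cst m C).
  - move=> w hw y; rewrite /G scale_comm.
    have rP := potential_rot_inv s (h_invariant i) (sol_invariant phi_sol i).
    have rP' := potential_rot_inv s (h_invariant i) (sol_invariant psi_sol i).
    by rewrite /P /P' (rP w hw) (rP' w hw).
  - by move=> y; rewrite /G WE scale_Exp /P' hC /P [_ + C]addrC addrK subrr.
have e : P' = fun z => P (scale (torus_weight g s) z) + C.
  by apply/funext => y; have := G0 y; rewrite /G => /eqP; rewrite subr_eq0 => /eqP <-; rewrite addrC subrK.
rewrite /omega -/P' e (ddbar_addc _ _ sPg) (ddbar_scale _ _ sP).
by [].
Qed.
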